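(* Let $a\in\mathbb{Q}\setminus\{-1,0,1\}$. Unconditionally, \[ \liminf_{x\to\infty} \sum_{n=0}^\infty nD_a^{\omega/}(n;x)\ge\frac{dF^{\omega/}_a}{dz}(1) + \frac{dH^{\omega/}_a}{dz}(1)+\sum_q\frac{1}{q(q-1)}. \]
   Context: $p,q$ denote primes; $\nu_p(a)$ is the $p$-adic valuation; $\mathrm{ord}_p(a)$ the multiplicative order of $a$ mod $p$; $\omega(n)$ the number of distinct prime factors. The numbers $D_a^{\omega/}(n;x)$ are defined by $\sum_{n\ge0} D_a^{\omega/}(n;x)z^n=\frac1{\pi(x)}\sum_{p\le x,\ \nu_p(a)=0} z^{\omega((p-1)/\mathrm{ord}_p(a))}$. Write $a=\pm a_0^h$ with $a_0>0$ rational not a perfect power ($h$ maximal), $a_0=b_0c_0^2$ with $b_0$ squarefree integer, and \[ H^{\omega/}_a(z) = \prod_{\substack{q\mid h\\ q\neq 2}} \frac{q(q+z-2)}{q^2-q+z-1},\quad f_a^{\omega/}(z) = \prod_{\substack{q\mid 2b_0 \\ q \nmid h}} \frac{z-1}{q^2-q+z-1} \prod_{q\mid (b_0,h)} \frac{z-1}{q+z-2}, \] $F^{\omega/}_a(z)=1$ if $2\nmid h$ and $\mathrm{sgn}(a)b_0\not\equiv1\pmod4$; $=1+f_a^{\omega/}(z)$ if $2\nmid h$ and $\mathrm{sgn}(a)b_0\equiv1\pmod4$; $=2z/(z+1)$ if $2\mid h$, $a>0$; $=1$ if $2\mid h$, $a<0$. *)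

(* Defs.v *)
From HB Require Import structures.
From mathcomp Require Import all_boot all_order all_algebra all_fingroup.
From mathcomp Require Import all_classical all_reals all_analysis.
Set Implicit Arguments. Unset Strict Implicit. Unset Printing Implicit Defensive.
Import Order.TTheory GRing.Theory Num.Theory.
Import numFieldNormedType.Exports.
Local Open Scope ring_scope.

Definition nu (p : nat) (a : rat) : int :=
  (logn p `|numq a|%N)%:Z - (logn p `|denq a|%N)%:Z.

Definition modp_rat (p : nat) (a : rat) : 'F_p :=
  (numq a)%:~R / (denq a)%:~R.

(* multiplicative order of a mod p (meaningful when nu p a = 0, i.e. a is a
   unit mod p); it is the order of the element a mod p in the unit group
   of F_p *)
Definition ordp (p : nat) (a : rat) : nat :=
  #[insubd (1%g : {unit 'F_p}) (modp_rat p a)]%g.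

Definition omega (n : nat) : nat := size (primes n).

Definition omega_index (a : rat) (p : nat) : nat := omega (p.-1 %/ ordp p a).

Definition primepi {R : realType} (x : R) : nat :=
  #|[set p : 'I_(Num.truncn x).+1 | prime p && (p%:R <= x)]|.

(* D_a^{omega/}(n;x) : coefficient of z^n in the generating function *)
Definition Dom {R : realType} (a : rat) (n : nat) (x : R) : R :=
  (#|[set p : 'I_(Num.truncn x).+1 |
       [&& prime p, (p%:R <= x), nu p a == 0 & omega_index a p == n]]|)%:R
  / (primepi x)%:R.

Definition squarefree_int (b : int) : Prop :=
  b != 0 /\ forall p : nat, prime p -> ~~ (p ^ 2 %| `|b|)%N.

Definition not_perfect_power (a0 : rat) : Prop :=
  forall (b : rat) (k : nat), (1 < k)%N -> b ^+ k != a0.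

Section Fns.
Variable R : realType.

Definition H_om (h : nat) (z : R) : R :=
  \prod_(q <- primes h | q != 2%N) ((q%:R * (q%:R + z - 2)) / (q%:R ^+ 2 - q%:R + z - 1)).

Definition f_om (h : nat) (b0 : int) (z : R) : R :=
  (\prod_(q <- primes (2 * `|b0|) | ~~ (q %| h)%N) ((z - 1) / (q%:R ^+ 2 - q%:R + z - 1)))
  * (\prod_(q <- primes (gcdn `|b0| h)) ((z - 1) / (q%:R + z - 2))).

Definition F_om (a : rat) (h : nat) (b0 : int) (z : R) : R :=
  if odd h then
    (if (((if (a < 0)%R then - b0 else b0) %% 4)%Z == 1) then 1 + f_om h b0 z else 1)
  else (if 0 < a then 2 * z / (z + 1) else 1).

End Fns.

Definition sum_primes_recip (R : realType) : R :=
  \big[+%R/0%R]_(0 <= q <oo) (if prime q then ((q * q.-1)%:R : R)^-1 else 0).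

Definition mean_Dom (R : realType) (a : rat) (x : R) : R :=
  \big[+%R/0%R]_(0 <= n <oo) (n%:R * Dom a n x).

(* Main.v *)
(** For a prime [q], [q] divides the index of [a] modulo [p] exactly when [p = 1] modulo [q] and
    [a] is a [q]-th power modulo [p]. These primes have density [1 / (q (q - 1))], or
    [1 / (q - 1)] when [a] is a [q]-th power in [rat]. Counting only the [q] below a bound
    minorizes [omega], hence the mean, and the two derivatives at [1] are the total excess
    of the second density over the first: [1 / q] for the odd [q] dividing [h], [1 / 2] for [q = 2]
    when [a] is a positive even power, while [f_om] has a zero of order at least two at [1].

    The densities come from root counts: for [f] irreducible over the rationals, the number of roots
    of [f] modulo [p] is on average at least [1]. Indeed it bounds the number of ideals of index [p]
    in [O = Z[X] / f], and for the ideals [M] whose index is prime to an integer [D] of the ideal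
    [(f, f')] one has unique factorization into maximal ideals. If the number of such [M] of
    index at most [N] is [c N + O (N ^ s)] with [c > 0] and [s < 1], Selberg's elementary argument gives the
    prime ideal theorem. With [f = 'X], ['Phi_q] and ['X^q - A] one counts the primes [p], those
    with [p = 1] modulo [q], and the roots of [x^q = a] modulo [p], which number [q], [0] or [1].

    The count of ideals avoids units and class groups. By the pigeonhole principle each [M] of
    index [m] contains some [x = 1] modulo [D] with [|x|^n <= C m], so [M] is recovered from
    [x] and the ideal [J] with [M J = (x)], whose index is bounded. A sum over [M] thus becomes a sum
    over the finitely many [J] of a sum over lattice points [x], weighted to undo the
    multiplicity; comparing the scales [y] and [k y] shows convergence with a power saving. *)

Require Import Defs.
From HB Require Import structures.
From mathcomp Require Import all_boot all_order all_algebra all_fingroup.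
From mathcomp Require Import all_classical all_reals all_analysis.
From mathcomp Require Import cyclic algC cyclotomic finfield.
From mathcomp Require Import ring lra zify.
Import Order.TTheory GRing.Theory Num.Theory.
Import numFieldNormedType.Exports.
Local Open Scope ring_scope.
Set Implicit Arguments. Unset Strict Implicit. Unset Printing Implicit Defensive.

(** * The prime number theorem for a sequence with regular sums *)

(** Root counts are only ever bounded below on average, and the single upper bound, for the number
    of all primes, comes from ['X]. If [a] is not a [q]-th power and [p] is large, [x^q = a] has at
    most [q [hit] + (1 - [q | p-1])] roots modulo [p]. This is at least 1 on average; subtracting
    the count of all primes and adding that of the primes 1 modulo [q] leaves [1/(q-1)] for [q
    [hit]].

    The order [Z[X] / f] need not be integrally closed, so a general ideal has no inverse. At a
    prime [p] not dividing [D] the reduction of [f] is separable, which gives an explicit cofactor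
    for each maximal ideal over [p]; ideals containing an integer prime to [D] then factor.

    The saving [s < 1] is essential: it makes the counting error divided by [n] summable and leaves
    room to absorb logarithms. As the main term of the ideal count is found by comparing scales, its
    constant is not identified, and its positivity is proved separately from lattice points near
    integers. *)

Section DirichletConvolution.
Variable R : realType.
Implicit Types (f g h u v : nat -> R) (N : nat) (x : R).

Definition sumN f N : R := \sum_(1 <= n < N.+1) f n.
Definition sumR f x : R := sumN f (Num.truncn x).
Definition dconv u v n : R := \sum_(1 <= d < n.+1 | (d %| n)%N) u d * v (n %/ d)%N.
Definition dunit n : R := (n == 1%N)%:R.

Lemma sumN0 f : sumN f 0 = 0.
Proof. by rewrite /sumN big_nil. Qed.

Lemma sumNS f N : sumN f N.+1 = sumN f N + f N.+1.
Proof. by rewrite /sumN big_nat_recr. Qed.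

Lemma eq_sumN f g N : (forall n, (0 < n <= N)%N -> f n = g n) -> sumN f N = sumN g N.
Proof. by move=> e; apply: eq_big_nat => n /andP[? ?]; apply: e; apply/andP. Qed.

Lemma le_sumN f g N : (forall n, (0 < n <= N)%N -> f n <= g n) -> sumN f N <= sumN g N.
Proof. by move=> e; apply: ler_sum_nat => n /andP[? ?]; apply: e; apply/andP. Qed.

Lemma sumN_ge0 f N : (forall n, (0 < n <= N)%N -> 0 <= f n) -> 0 <= sumN f N.
Proof. by move=> e; rewrite /sumN big_nat_cond sumr_ge0 // => n /andP[/andP[? ?] _]; apply: e; apply/andP. Qed.

Lemma sumND f g N : sumN (fun n => f n + g n) N = sumN f N + sumN g N.
Proof. exact: big_split. Qed.

Lemma sumNB f g N : sumN (fun n => f n - g n) N = sumN f N - sumN g N.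
Proof. by rewrite /sumN sumrB. Qed.

Lemma sumNZ c f N : sumN (fun n => c * f n) N = c * sumN f N.
Proof. by rewrite /sumN mulr_sumr. Qed.

Lemma sumNZr c f N : sumN (fun n => f n * c) N = sumN f N * c.
Proof. by rewrite /sumN mulr_suml. Qed.

Lemma ler_norm_sumN f N : `|sumN f N| <= sumN (fun n => `|f n|) N.
Proof. exact: ler_norm_sum. Qed.

Lemma le_sumNr f N M : (forall n, (N < n <= M)%N -> 0 <= f n) -> (N <= M)%N -> sumN f N <= sumN f M.
Proof.
move=> f0 NM; rewrite /sumN (@big_cat_nat _ _ _ N.+1 1 M.+1) //=.
rewrite lerDl big_nat_cond sumr_ge0 // => n /andP[/andP[? ?] _]; apply: f0; apply/andP; by [].
Qed.

Lemma sumN_const (c : R) N : sumN (fun=> c) N = c * N%:R.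
Proof. by elim: N => [|N IH]; rewrite ?sumN0 ?mulr0 // sumNS IH -natr1 mulrDr mulr1. Qed.

Lemma truncn_divn x m : 0 <= x -> (0 < m)%N -> Num.truncn (x / m%:R) = (Num.truncn x %/ m)%N.
Proof.
move=> x0 m0; have m0' : (0 : R) < m%:R by rewrite ltr0n.
apply/eqP; rewrite truncn_eq ?divr_ge0 ?ler0n //.
rewrite ler_pdivlMr // ltr_pdivrMr // -!natrM -truncn_ge_nat // -truncn_lt_nat //.
by rewrite leq_divM /= ltn_ceil.
Qed.

(** Induction on [N]: the quotient [N.+1 %/ m] exceeds [N %/ m] exactly when [m] divides [N.+1], so
    the new terms are the factorizations of [N.+1]. *)
Lemma hyperbola (h : nat -> nat -> R) N :
  sumN (fun m => sumN (h m) (N %/ m)) N =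
  sumN (fun k => \sum_(1 <= d < k.+1 | (d %| k)%N) h d (k %/ d)%N) N.
Proof.
elim: N => [|N IH]; first by rewrite !sumN0.
rewrite [RHS]sumNS -IH.
have -> : sumN (fun m => sumN (h m) (N.+1 %/ m)) N.+1 =
   sumN (fun m => sumN (h m) (N %/ m)) N.+1 + sumN (fun m => if (m %| N.+1)%N then h m (N.+1 %/ m)%N else 0) N.+1.
  rewrite -sumND; apply: eq_sumN => m /andP[m0 _].
  rewrite divnS //; case: (m %| N.+1)%N; last by rewrite add0n addr0.
  by rewrite add1n sumNS.
rewrite [in LHS]sumNS divn_small // sumN0 addr0; congr (_ + _).
by rewrite /sumN -big_mkcond.
Qed.

(** Summing over all pairs below a common cutoff makes the two factors symmetric, so commutativity
    and associativity become exchanges of finite sums. *)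
Lemma dconvE u v n M : (0 < n < M)%N ->
  dconv u v n = \sum_(1 <= d < M) \sum_(1 <= e < M) (d * e == n)%N%:R * (u d * v e).
Proof.
move=> /andP[n0 nM].
rewrite /dconv [RHS](@big_cat_nat _ _ _ n.+1) //= [X in _ = _ + X]big1_seq ?addr0; last first.
  move=> d /andP[_]; rewrite mem_index_iota => /andP[dn _].
  rewrite big1_seq // => e /andP[_]; rewrite mem_index_iota => /andP[e0 _].
  case: eqP => [E|_]; last by rewrite mul0r.
  by move: (leq_pmulr d e0); rewrite E leqNgt dn.
rewrite big_mkcond /=; apply: eq_big_nat => d /andP[d0 dn].
case: ifPn => [/dvdnP[e E]|nd].
  have e0 : (0 < e)%N by move: n0; rewrite E muln_gt0 => /andP[].
  have eM : (e < M)%N by apply: leq_ltn_trans nM; rewrite E leq_pmulr.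
  rewrite (bigD1_seq e) ?mem_index_iota ?e0 ?iota_uniq //= E mulnC eqxx mul1r mulKn //.
  rewrite big1 ?addr0 // => i ie; rewrite eqn_pmul2l // (negbTE ie) mul0r //.
rewrite big1 // => e _; case: eqP => [E|_]; last by rewrite mul0r.
by move: nd; rewrite -E dvdn_mulr.
Qed.

Lemma dconvC u v n : (0 < n)%N -> dconv u v n = dconv v u n.
Proof.
move=> n0; rewrite (@dconvE u v n n.+1) ?n0 ?ltnSn // (@dconvE v u n n.+1) ?n0 ?ltnSn //.
by rewrite exchange_big /=; apply: eq_bigr => d _; apply: eq_bigr => e _; rewrite mulnC [u e * _]mulrC.
Qed.

Lemma eq_dconv u v u' v' n : (forall d, (0 < d <= n)%N -> u d = u' d) ->
  (forall d, (0 < d <= n)%N -> v d = v' d) -> dconv u v n = dconv u' v' n.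
Proof.
move=> hu hv; rewrite /dconv big_nat_cond [RHS]big_nat_cond; apply: eq_bigr => d /andP[/andP[d0 dn] dvd].
rewrite hu ?d0 // hv // leq_div andbT divn_gt0 //.
Qed.

Lemma dconvA3 u v w n : (0 < n)%N ->
  dconv u (dconv v w) n = \sum_(1 <= d < n.+1) \sum_(1 <= e < n.+1) \sum_(1 <= f < n.+1)
     (d * e * f == n)%N%:R * (u d * v e * w f).
Proof.
move=> n0; rewrite (@dconvE _ _ n n.+1) ?n0 ?ltnSn //; apply: eq_big_nat => d /andP[d0 dn].
transitivity (\sum_(1 <= k < n.+1) \sum_(1 <= e < n.+1) \sum_(1 <= f < n.+1)
    (d * k == n)%N%:R * ((e * f == k)%N%:R * (u d * v e * w f))).
  apply: eq_big_nat => k /andP[k0 kn]; rewrite (@dconvE _ _ k n.+1) ?k0 ?kn //.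
  rewrite mulrA mulr_sumr; apply: eq_bigr => e _; rewrite mulr_sumr; apply: eq_bigr => f _; ring.
rewrite exchange_big /=; apply: eq_bigr => e _; rewrite exchange_big /=; apply: eq_bigr => f _.
case: (boolP (d * e * f == n)%N) => [/eqP E|ne].
  have k0 : (0 < e * f)%N by move: n0; rewrite -E -mulnA muln_gt0 => /andP[].
  rewrite (bigD1_seq (e * f)%N) ?mem_index_iota ?iota_uniq //=; last first.
    by rewrite k0 /= ltnS -E -mulnA leq_pmull.
  rewrite mulnA E !eqxx !mul1r big1 ?addr0 // => k ke.
  by rewrite [(e * f == k)%N]eq_sym (negbTE ke) mul0r mulr0.
rewrite mul0r big1 // => k _; case: (boolP (e * f == k)%N) => [/eqP <-|_]; last by rewrite mul0r mulr0.
by rewrite mulnA (negbTE ne) mul0r.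
Qed.

Lemma dconvA u v w n : (0 < n)%N -> dconv u (dconv v w) n = dconv (dconv u v) w n.
Proof.
move=> n0; rewrite [RHS]dconvC // !dconvA3 //.
rewrite [RHS]exchange_big; apply: eq_bigr => d _ /=; rewrite [RHS]exchange_big.
apply: eq_bigr => e _ /=; apply: eq_bigr => f _.
by rewrite (_ : f * d * e = d * e * f)%N; [congr (_ * _); ring|lia].
Qed.

Lemma dconv1u u n : (0 < n)%N -> dconv dunit u n = u n.
Proof.
move=> n0; rewrite /dconv big_mkcond (bigD1_seq 1%N) ?mem_index_iota ?iota_uniq //= dvd1n /dunit eqxx mul1r divn1.
by rewrite big1 ?addr0 // => d /negbTE ->; rewrite mul0r if_same.
Qed.

Lemma sumN_dconv u v f N :
  sumN (fun m => u m * sumN (fun n => v n * f (m * n)%N) (N %/ m)) N = sumN (fun k => dconv u v k * f k) N.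
Proof.
under eq_sumN => m _ do rewrite -sumNZ.
rewrite hyperbola; apply: eq_sumN => k _; rewrite /dconv mulr_suml.
by apply: eq_bigr => d dk; rewrite mulrA mulnC divnK.
Qed.

(** Course-of-values recursion: [Phi n] reads only values below [n], so iterating from the zero
    sequence fixes the value at [n] after [n + 1] rounds. *)
Lemma rec_exists (Phi : nat -> (nat -> R) -> R) :
  (forall n u v, (forall m, (m < n)%N -> u m = v m) -> Phi n u = Phi n v) ->
  exists u : nat -> R, forall n, u n = Phi n u.
Proof.
move=> H; pose T (u : nat -> R) := fun n => Phi n u.
pose it k := iter k T (fun=> 0).
have st : forall n k l, (n < k)%N -> (n < l)%N -> it k n = it l n.
  elim/ltn_ind => n IH [//|k] [//|l] nk nl.
  by rewrite /it !iterS; apply: H => m mn; apply: IH; rewrite // (leq_trans mn).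
exists (fun n => it n.+1 n) => n.
by rewrite {1}/it iterS; apply: H => m mn; apply: st.
Qed.

End DirichletConvolution.

(** * Abel summation and elementary bounds for powers and logarithms *)

Section AbelSummation.
Variable R : realType.
Implicit Types (f g h u v e : nat -> R) (N : nat) (x y s K : R).

(** The limit is the supremum of the lower ends [u t - e t], which lie below every upper end. It
    serves as a convergence criterion that keeps the error [e] explicit. *)
Lemma squeeze_limit (T : Type) (t0 : T) (u e : T -> R) :
  (forall a b, u a - e a <= u b + e b) -> exists l, forall t, `|u t - l| <= e t.
Proof.
move=> H; pose A := [set u t - e t | t in [set: T]]%classic.
have ub : ubound A (u t0 + e t0) by move=> _ [t _ <-]; apply: H.
have hs : has_sup A by split; [exists (u t0 - e t0); exists t0 | exists (u t0 + e t0)].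
exists (sup A) => t.
have h1 : u t - e t <= sup A by apply: sup_upper_bound => //; exists t.
have h2 : sup A <= u t + e t by apply: ge_sup; [exact: hs.1|move=> _ [t' _ <-]; apply: H].
by rewrite ler_norml; apply/andP; split; lra.
Qed.

Lemma abel_sumN e (phi : nat -> R) N :
  sumN (fun n => e n * phi n) N =
  sumN e N * phi N.+1 + sumN (fun n => sumN e n * (phi n - phi n.+1)) N.
Proof.
elim: N => [|N IH]; first by rewrite !sumN0 mul0r addr0.
by rewrite sumNS IH [sumN _ N.+1 in RHS]sumNS [sumN (fun=> _) N.+1]sumNS [sumN e N.+1]sumNS; ring.
Qed.

(** Concavity of the power, in the form of Young's inequality for [t ^ s] and 1 with conjugate
    exponents [1/s] and [1/(1-s)]. *)
Lemma powR_le_tangent (t s : R) : 0 <= t -> 0 < s -> s < 1 -> t `^ s <= 1 + s * (t - 1).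
Proof.
move=> t0 s0 s1.
have q0 : 0 < (1 - s)^-1 by rewrite invr_gt0 subr_gt0.
have := @conjugate_powR _ (t `^ s) 1 s^-1 (1 - s)^-1 (powR_ge0 _ _) ler01.
rewrite invr_gt0 => /(_ s0 q0); rewrite !invrK => /(_ _)/wrap[]; first by lra.
rewrite mulr1 -powRrM mulfV ?gt_eqF // powRr1 // powR1 mul1r; lra.
Qed.

Lemma ln_le_powR y s : 0 < s -> 1 <= y -> ln y <= y `^ s / s.
Proof.
move=> s0 y1; have y0 : 0 < y by lra.
rewrite ler_pdivlMr // mulrC -ln_powR.
have p0 : 0 < y `^ s by rewrite powR_gt0.
have := @le_ln1Dx R (y `^ s - 1); rewrite [1 + _]addrC subrK => H.
have: ln (y `^ s) <= y `^ s - 1 by apply: H; lra.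
lra.
Qed.

Lemma powRD_gt0 x r s : 0 < x -> x `^ (r + s) = x `^ r * x `^ s.
Proof. by move=> x0; rewrite powRD //; apply/implyP => _; rewrite gt_eqF. Qed.

Lemma powRB1_gt0 x s : 0 < x -> x `^ (s - 1) = x `^ s / x.
Proof. by move=> x0; rewrite powRD_gt0 // powR_inv1 ?ltW. Qed.

Lemma natr1_ge1 N : (1 : R) <= N.+1%:R. Proof. by rewrite ler1n. Qed.

(** The tangent inequality at [N / N.+1]; it makes sums of [n ^ (s-1)] telescope. *)
Lemma powR_increment (s : R) N : 0 < s -> s < 1 ->
  N.+1%:R `^ (s - 1) <= (N.+1%:R `^ s - N%:R `^ s) / s.
Proof.
move=> s0 s1; have n0 : (0 : R) < N.+1%:R by rewrite ltr0n.
rewrite ler_pdivlMr //.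
have -> : (N%:R : R) `^ s = N.+1%:R `^ s * (N%:R / N.+1%:R) `^ s.
  rewrite -powRM ?divr_ge0 ?ler0n // mulrC divfK ?gt_eqF //.
have := @powR_le_tangent (N%:R / N.+1%:R) s (divr_ge0 (ler0n _ _) (ltW n0)) s0 s1.
have -> : (N%:R : R) / N.+1%:R - 1 = - N.+1%:R^-1.
  by rewrite -[N.+1%:R]natr1; move: (ler0n R N); move: (N%:R : R) => b b0; field; lra.
have -> : (N.+1%:R : R) `^ (s - 1) = N.+1%:R `^ s * N.+1%:R^-1.
  by rewrite powRB1_gt0.
move=> H; have p0 : 0 < (N.+1%:R : R) `^ s by rewrite powR_gt0.
rewrite -mulrA -[X in _ <= X - _]mulr1 -mulrBr ler_pM2l //.
by move: H; set t := (N%:R / _) `^ s; set i := N.+1%:R^-1; rewrite mulrN [s * i]mulrC => H; lra.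
Qed.

(** The tangent inequality with exponent [1 - s] at [N.+1 / N.+2]; it makes the terms left by Abel
    summation of [e n / n] telescope. *)
Lemma powR_decrement (s : R) N : 0 < s -> s < 1 ->
  N.+1%:R `^ s * (N.+1%:R^-1 - N.+2%:R^-1) <= (N.+1%:R `^ (s - 1) - N.+2%:R `^ (s - 1)) / (1 - s).
Proof.
move=> s0 s1; have n0 : (0 : R) < N.+1%:R by rewrite ltr0n.
have n2 : (0 : R) < N.+2%:R by rewrite ltr0n.
rewrite ler_pdivlMr; last by lra.
have -> : (N.+2%:R : R) `^ (s - 1) = N.+1%:R `^ (s - 1) * (N.+1%:R / N.+2%:R) `^ (1 - s).
  rewrite powRM ?invr_ge0 ?ler0n // -[N.+2%:R^-1]powR_inv1 ?ler0n // -powRrM mulN1r opprB mulrA.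
  by rewrite -powRD_gt0 // (_ : s - 1 + (1 - s) = 0) ?powRr0 ?mul1r //; ring.
have := @powR_le_tangent (N.+1%:R / N.+2%:R) (1 - s) (divr_ge0 (ler0n _ _) (ltW n2)).
move=> /(_ _ _)/wrap[]; [lra|lra|move=> H].
have E1 : (N.+1%:R : R) / N.+2%:R - 1 = - N.+2%:R^-1.
  by rewrite -[N.+2%:R]natr1; move: n0; move: (N.+1%:R : R) => b b0; field; lra.
have E2 : N.+1%:R `^ s = N.+1%:R `^ (s - 1) * N.+1%:R.
  by rewrite powRB1_gt0 // divfK // gt_eqF.
have E3 : (N.+1%:R : R) * (N.+1%:R^-1 - N.+2%:R^-1) = N.+2%:R^-1.
  by rewrite -[N.+2%:R]natr1; move: n0; move: (N.+1%:R : R) => b b0; field; lra.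
have p0 : 0 < (N.+1%:R : R) `^ (s - 1) by rewrite powR_gt0.
rewrite E2 -!mulrA [N.+1%:R * (_ * _)]mulrA E3 -[X in _ <= X - _]mulr1 -mulrBr ler_pM2l //.
by move: H; rewrite E1; set t := (_ / _) `^ _; set i := N.+2%:R^-1; rewrite mulrN [(1 - s) * i]mulrC => H; lra.
Qed.

Lemma sumN_powR (s : R) N : 0 < s -> s < 1 -> sumN (fun n => n%:R `^ (s - 1)) N <= N%:R `^ s / s.
Proof.
move=> s0 s1; elim: N => [|N IH]; first by rewrite sumN0 divr_ge0 ?powR_ge0 ?ltW.
rewrite sumNS; have := powR_increment N s0 s1; lra.
Qed.

(** Abel summation of both sides, the right one as the constant sequence [K]: the weights
    [phi n - phi n.+1] are nonnegative, so partial sums may be compared termwise. *)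
Lemma le_sumN_antitone h (phi : nat -> R) K N :
  (forall n, 0 <= phi n) -> (forall n, (0 < n)%N -> phi n.+1 <= phi n) ->
  (forall n, (n <= N)%N -> sumN h n <= K * n%:R) ->
  sumN (fun n => h n * phi n) N <= K * sumN phi N.
Proof.
move=> p0 pd H.
have -> : K * sumN phi N = sumN (fun n => K * phi n) N by rewrite sumNZ.
rewrite abel_sumN [X in _ <= X](@abel_sumN (fun=> K)).
apply: lerD; first by rewrite ler_wpM2r // sumN_const; apply: H.
apply: le_sumN => n /andP[n0 nN]; rewrite ler_wpM2r ?subr_ge0 ?pd //.
by rewrite sumN_const; apply: H.
Qed.

(** Because [s < 1], linear growth of the partial sums of [h] suffices and no logarithm is lost.
    This turns bounds by [(x / n)^s] inside a Dirichlet sum into [O(x)]. *)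
Lemma sumR_powR_weight h s K x : 0 < s -> s < 1 -> 0 <= K -> 1 <= x ->
  (forall n, sumN h n <= K * n%:R) ->
  sumR (fun n => h n * (x / n%:R) `^ s) x <= K / (1 - s) * x.
Proof.
move=> s0 s1 K0 x1 H; have x0 : 0 < x by lra.
have -> : sumR (fun n => h n * (x / n%:R) `^ s) x = x `^ s * sumR (fun n => h n * n%:R `^ (- s)) x.
  rewrite /sumR -sumNZ; apply: eq_sumN => n /andP[n0 _].
  by rewrite powRM ?invr_ge0 ?ler0n ?ltW // -[_^-1]powR_inv1 ?ler0n // -powRrM mulN1r; ring.
have h2 : sumR (fun n => h n * n%:R `^ (- s)) x <= K * (x `^ (1 - s) / (1 - s)).
  apply: le_trans (_ : K * sumN (fun n => n%:R `^ (- s)) (Num.truncn x) <= _).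
    apply: le_sumN_antitone => // n n0; rewrite ?powR_ge0 // !powRN lef_pV2 ?posrE ?powR_gt0 ?ltr0n //.
    by rewrite ge0_ler_powR ?ltW // ?nnegrE ?ler0n // ltr_nat.
  rewrite ler_wpM2l //.
  have := @sumN_powR (1 - s) (Num.truncn x); rewrite (_ : 1 - s - 1 = - s); last by ring.
  move=> /(_ _ _)/wrap[]; [lra|lra|]; move=> /le_trans; apply.
  rewrite ler_pM2r ?invr_gt0; last by lra.
  by rewrite ge0_ler_powR ?nnegrE ?ler0n ?(ltW x0) ?truncn_le ?ltW //; lra.
apply: le_trans (ler_wpM2l (powR_ge0 _ _) h2) _.
have -> : x `^ s * (K * (x `^ (1 - s) / (1 - s))) = K / (1 - s) * (x `^ s * x `^ (1 - s)) by ring.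
rewrite -powRD_gt0 //.
have -> : s + (1 - s) = 1 by ring.
by rewrite powRr1 // ltW.
Qed.

Lemma lnV_le (N : nat) : (0 < N)%N -> ln (N.+1%:R / N%:R : R) <= N%:R^-1.
Proof.
move=> N0; have n0 : (0 : R) < N%:R by rewrite ltr0n.
have -> : (N.+1%:R / N%:R : R) = 1 + N%:R^-1 by rewrite -natr1 mulrDl divff ?gt_eqF ?mul1r.
have i0 : (0 : R) < N%:R^-1 by rewrite invr_gt0.
by apply: le_ln1Dx; lra.
Qed.

Lemma ln_natS (N : nat) : (0 < N)%N ->
  0 <= ln (N.+1%:R : R) - ln (N%:R) <= (N%:R^-1 : R).
Proof.
move=> N0; have n0 : (0 : R) < N%:R by rewrite ltr0n.
have := lnV_le N0; rewrite ln_div ?posrE ?ltr0n // => ->; rewrite andbT subr_ge0.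
by rewrite ler_ln ?posrE ?ltr0n // ler_nat.
Qed.

Lemma ln_sub_le (x y : R) : 0 < x -> x <= y -> 0 <= ln y - ln x <= (y - x) / x.
Proof.
move=> x0 xy; have y0 : 0 < y by lra.
rewrite subr_ge0 ler_ln ?posrE // xy /= -ln_div ?posrE //.
have -> : y / x = 1 + (y - x) / x by field; lra.
have : 0 <= (y - x) / x by rewrite divr_ge0 //; lra.
by move=> h; apply: le_ln1Dx; lra.
Qed.

(* Lower bound for ln from the tangent inequality applied at [x / y]. *)
Lemma ln_sub_ge (x y : R) : 0 < x -> x <= y -> (y - x) / y <= ln y - ln x.
Proof.
move=> x0 xy; have y0 : 0 < y by lra.
have := @le_ln1Dx R ((x - y) / y); have -> : 1 + (x - y) / y = x / y by field; lra.
rewrite ln_div ?posrE // => H.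
have : ln x - ln y <= (x - y) / y.
  apply: H; rewrite ltr_pdivlMr //; lra.
rewrite -[x - y]opprB mulNr; lra.
Qed.

Lemma truncn_bounds x : 1 <= x ->
  [/\ (0 < Num.truncn x)%N, (Num.truncn x)%:R <= x & x < (Num.truncn x)%:R + 1].
Proof.
by move=> x1; rewrite truncn_gt0 x1 natr1 truncnS_gt truncn_le; split => //; lra.
Qed.

Lemma harmonic_sum : exists gam : R, forall x, 1 <= x ->
  `|sumR (fun n => n%:R^-1) x - ln x - gam| <= 4 / x.
Proof.
pose u (n : nat) : R := sumN (fun n => n%:R^-1) n.+1 - ln n.+1%:R.
(* [u] decreases while [u n - 1/(n+1)] increases, which is the input of [squeeze_limit]. *)
have mono (m n : nat) : (m <= n)%N -> - m.+1%:R^-1 + n.+1%:R^-1 <= u n - u m <= 0.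
  elim: n => [|n IH].
    by rewrite leqn0 => /eqP ->; rewrite !subrr addNr lexx.
  rewrite leq_eqVlt => /orP[/eqP ->|]; first by rewrite !subrr addNr lexx.
  rewrite ltnS => /IH /andP[h1 h2].
  have -> : u n.+1 = u n + n.+2%:R^-1 - (ln n.+2%:R - ln n.+1%:R) by rewrite /u [in LHS]sumNS; ring.
  have /andP[l1 l2] := ln_natS (ltn0Sn n).
  have l3 : n.+2%:R^-1 <= ln n.+2%:R - ln (n.+1%:R : R).
    apply: le_trans (ln_sub_ge _ _); rewrite ?ltr0n ?ler_nat //.
    by rewrite -{2}[n.+2%:R]natr1 [_ + 1]addrC addrK mul1r.
  move: h1 h2 l2 l3; move: (u n) (u m) (ln n.+2%:R) (ln n.+1%:R) => a b c d.
  by move: (n.+1%:R^-1) (n.+2%:R^-1) (m.+1%:R^-1) => i j k *; apply/andP; split; lra.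
have [|gam Hg] := @squeeze_limit nat 0%N u (fun n => n.+1%:R^-1).
  move=> a b; have p (n : nat) : (0 : R) < n.+1%:R^-1 by rewrite invr_gt0 ltr0n.
  have := p a; have := p b; case/orP: (leq_total a b) => /mono/andP[];
    move: (u a) (u b) (a.+1%:R^-1) (b.+1%:R^-1) => *; lra.
exists gam => x x1; have [N0 Nx xN] := truncn_bounds x1.
move: N0 Nx xN; rewrite /sumR; case: (Num.truncn x) => // N _ Nx xN.
have x0 : 0 < x by lra.
have n0 : (0 : R) < N.+1%:R by rewrite ltr0n.
have h1 := Hg N.
have h2 : N.+1%:R^-1 <= 2 / x :> R.
  have n1 := natr1_ge1 N.
  by rewrite -[_^-1]mul1r ler_pdivrMr // mulrAC ler_pdivlMr // mul1r; lra.
have /andP[h3 h4] := ln_sub_le n0 Nx.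
have h5 := ln_sub_ge n0 Nx.
have h6 : (x - N.+1%:R) / N.+1%:R <= N.+1%:R^-1 by rewrite ler_pdivrMr // mulVf ?gt_eqF //; lra.
move: h1; rewrite /u !ler_norml => /andP[h7 h8].
have : 0 < x^-1 by rewrite invr_gt0.
move: h2 h3 h4 h6 h7 h8; move: (sumN _ _) (ln N.+1%:R) (ln x) (x^-1) (N.+1%:R^-1) => S l lx i j.
by move=> *; apply/andP; split; lra.
Qed.

End AbelSummation.

(** * Sums of logarithms and sequences with a power saving *)

Section LogSums.
Variable R : realType.
Implicit Types (e : nat -> R) (N : nat) (x y s K : R).

Lemma sum_ln_nat N : `|sumN (fun n => ln (n%:R : R)) N - (N%:R * ln N%:R - N%:R)| <= sumN (fun n => n%:R^-1) N.
Proof.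
elim: N => [|[|N] IH]; first by rewrite !sumN0 mul0r !subr0 normr0.
  by rewrite !sumNS !sumN0 ln1 mulr0 !add0r invr1 opprK normr1.
rewrite [sumN _ N.+2]sumNS [sumN (fun _ => _^-1) N.+2]sumNS.
have n0 : (0 : R) < N.+1%:R by rewrite ltr0n.
have /andP[l1 l2] := @ln_natS R N.+1 (ltn0Sn N).
have l3 : N.+2%:R^-1 <= ln N.+2%:R - ln (N.+1%:R : R).
  apply: le_trans (ln_sub_ge _ _); rewrite ?ltr0n ?ler_nat //.
  by rewrite -{2}[N.+2%:R]natr1 [_ + 1]addrC addrK mul1r.
have l4 : 1 - N.+2%:R^-1 <= N.+1%:R * (ln N.+2%:R - ln (N.+1%:R : R)).
  apply: le_trans (ler_wpM2l (ltW n0) l3); rewrite -[N.+2%:R]natr1.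
  by rewrite [X in X <= _](_ : _ = N.+1%:R / (N.+1%:R + 1)) //; move: n0; move: (N.+1%:R : R) => b b0; field; lra.
have l5 : N.+1%:R * (ln N.+2%:R - ln (N.+1%:R : R)) <= 1.
  by apply: le_trans (ler_wpM2l (ltW n0) l2) _; rewrite divff ?gt_eqF.
have E : N.+2%:R = N.+1%:R + 1 :> R by rewrite natr1.
move: IH; rewrite !ler_norml => /andP[].
move: l4 l5; move: (sumN _ _) (sumN _ _) (ln N.+2%:R) (ln N.+1%:R) (N.+2%:R^-1 : R); rewrite E.
by move: (N.+1%:R : R) => b S T l l' i *; apply/andP; split; lra.
Qed.

Lemma sum_ln x : 1 <= x ->
  `|sumR (fun n => ln (n%:R : R)) x - (x * ln x - x)| <= 2 * ln x + 10.
Proof.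
move=> x1; have x0 : 0 < x by lra.
have [N0 Nx xN] := truncn_bounds x1.
have h1 := sum_ln_nat (Num.truncn x).
have [gam Hg] := harmonic_sum R.
have := Hg x x1; rewrite /sumR.
(* Origin of the 10: the harmonic sum is at most [ln x + 9], by [gam <= 5] and [4 / x <= 4], and
   passing from the integer part to [x] costs at most [ln x + 1]. *)
have g1 : gam <= 5.
  have := Hg 1 (lexx _); rewrite /sumR truncn1 sumNS sumN0 ln1 add0r !invr1 subr0 mulr1 ler_norml => /andP[]; lra.
have i1 : x^-1 <= 1 by rewrite invf_le1.
have n0 : (0 : R) < (Num.truncn x)%:R by rewrite ltr0n.
have /andP[l1 l2] := ln_sub_le n0 Nx.
have l3 : 0 <= (Num.truncn x)%:R * (ln x - ln (Num.truncn x)%:R) by rewrite mulr_ge0 // ltW.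
have l4 : (Num.truncn x)%:R * (ln x - ln (Num.truncn x)%:R) <= x - (Num.truncn x)%:R.
  by rewrite mulrC -ler_pdivlMr.
have lx : 0 <= ln x by rewrite ln_ge0.
have l5 : (x - (Num.truncn x)%:R) * ln x <= ln x by rewrite ler_piMl //; lra.
have l6 : 0 <= (x - (Num.truncn x)%:R) * ln x by rewrite mulr_ge0 //; lra.
move: h1; rewrite !ler_norml => /andP[h1 h2] /andP[h3 h4].
move: h1 h2 h3 h4 l3 l4 l5 l6; move: (sumN _ _) (sumN _ _) (ln (_%:R)) => S T l *.
by apply/andP; split; lra.
Qed.

Lemma powR_truncn_le x s : 1 <= x -> 0 <= s -> (Num.truncn x)%:R `^ s <= x `^ s.
Proof.
move=> x1 s0; have [N0 Nx xN] := truncn_bounds x1.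
by rewrite ge0_ler_powR ?nnegrE ?ler0n //; lra.
Qed.

Lemma powR_truncn_ge x s : 1 <= x -> 0 < s -> s < 1 -> (Num.truncn x)%:R `^ (s - 1) <= 2 * x `^ (s - 1).
Proof.
move=> x1 s0 s1; have [N0 Nx xN] := truncn_bounds x1; have x0 : 0 < x by lra.
have n1 : (1 : R) <= (Num.truncn x)%:R by rewrite ler1n.
move: n1 Nx xN; move: ((Num.truncn x)%:R : R) => b b1 bx xb; have b0 : 0 < b by lra.
rewrite !powRB1_gt0 // ler_pdivrMr // -mulrA -mulrA.
rewrite (_ : 2 * _ = x `^ s * (2 * b / x)); last by ring.
apply: le_trans (_ : x `^ s <= _); first by rewrite ge0_ler_powR ?nnegrE //; lra.
by rewrite ler_peMr ?powR_ge0 // ler_pdivlMr //; lra.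
Qed.

Section PowerSaving.
Variables (e : nat -> R) (s K : R).
Hypotheses (s0 : 0 < s) (s1 : s < 1) (K0 : 0 <= K).
Hypothesis He : forall N, `|sumN e N| <= K * N%:R `^ s.

(** After Abel summation both the edge term and the tail between two cutoffs are of order [n^(s-1)],
    the tail by [powR_decrement]; this is where [s < 1] gives convergence. *)
Lemma sum_inv_power_saving : exists l K', 0 <= K' /\ forall x, 1 <= x ->
  `|sumR (fun n => e n / n%:R) x - l| <= K' * x `^ (s - 1).
Proof.
have s1' : 0 < 1 - s by rewrite subr_gt0.
pose u n := sumN (fun n => e n / n%:R) n.+1.
pose w (n : nat) : R := n.+1%:R `^ (s - 1).
have w0 n : 0 < w n by rewrite powR_gt0 // ltr0n.
have edge n : `|sumN e n.+1 / n.+2%:R| <= K * w n.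
  rewrite normrM [`|_^-1|]ger0_norm ?invr_ge0 ?ler0n // ler_pdivrMr ?ltr0n //.
  apply: le_trans (He _) _; rewrite -mulrA ler_wpM2l // /w powRB1_gt0 ?ltr0n //.
  rewrite -mulrA ler_peMr ?powR_ge0 // mulrC ler_pdivlMr ?ltr0n // mul1r ler_nat //.
have wd n : w n.+1 <= w n.
  rewrite /w -[s - 1]opprB !powRN lef_pV2 ?posrE ?powR_gt0 ?ltr0n //.
  by rewrite ge0_ler_powR ?nnegrE ?ler0n ?ler_nat // ltW.
have mid m n : (m <= n)%N -> `|sumN (fun n => sumN e n * (n%:R^-1 - n.+1%:R^-1)) n.+1
      - sumN (fun n => sumN e n * (n%:R^-1 - n.+1%:R^-1)) m.+1| <= K / (1 - s) * (w m.+1 - w n.+1).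
  elim: n => [|n IH]; first by rewrite leqn0 => /eqP ->; rewrite !subrr normr0 mulr0.
  rewrite leq_eqVlt => /orP[/eqP ->|]; first by rewrite !subrr normr0 mulr0.
  rewrite ltnS => /IH; rewrite [sumN _ n.+2]sumNS.
  set a := sumN _ n.+1; set b := sumN _ m.+1; set c := sumN e _ * _ => H.
  have hc : `|c| <= K / (1 - s) * (w n.+1 - w n.+2).
    rewrite /c normrM [`|_ - _|]ger0_norm; last first.
      by rewrite subr_ge0 lef_pV2 ?posrE ?ltr0n // ler_nat.
    apply: le_trans (ler_wpM2r _ (He _)) _.
      by rewrite subr_ge0 lef_pV2 ?posrE ?ltr0n // ler_nat.
    have := ler_wpM2l K0 (powR_decrement n.+1 s0 s1).
    by rewrite mulrA [K * (_ / _)]mulrA [_ * _ / (1 - s)]mulrAC.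
  rewrite (_ : _ - b = (a - b) + c); last by ring.
  apply: le_trans (ler_normD _ _) _; apply: le_trans (lerD H hc) _.
  by rewrite -mulrDr (_ : w m.+1 - w n.+1 + _ = w m.+1 - w n.+2) //; ring.
pose C := K + K / (1 - s).
have C0 : 0 <= K / (1 - s) by rewrite divr_ge0 // ltW.
have diff m n : (m <= n)%N -> `|u n - u m| <= C * w m + C * w n.
  move=> mn; rewrite /u !(abel_sumN e); have := mid _ _ mn; have := edge m; have := edge n.
  set a := _ / _; set b := _ / _; set c := sumN _ _; set d := sumN _ _ => h1 h2 h3.
  rewrite (_ : _ - _ = a - b + (c - d)); last by ring.
  apply: le_trans (ler_normD _ _) _; apply: le_trans (lerD (ler_normB _ _) h3) _.
  have := mulr_ge0 C0 (ltW (w0 n)); have := mulr_ge0 C0 (ltW (w0 n.+1)); have := ler_wpM2l C0 (wd m); move: h1 h2; rewrite /C !mulrDl mulrBr; lra.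
have [|l Hl] := @squeeze_limit _ nat 0%N u (fun n => C * w n).
  by move=> a b; case/orP: (leq_total a b) => /diff; rewrite ler_norml => /andP[]; lra.
exists l, (2 * C); split; first by rewrite mulr_ge0 // addr_ge0.
move=> x x1; have [N0 Nx xN] := truncn_bounds x1.
have := powR_truncn_ge x1 s0 s1; move: N0; rewrite /sumR; case: (Num.truncn x) => // N _ h.
apply: le_trans (Hl N) _; rewrite -mulrA [2 * (_ * _)]mulrCA ler_wpM2l // addr_ge0 //.
Qed.

Lemma sum_ln_power_saving x : 1 <= x ->
  `|sumR (fun n => e n * ln n%:R) x| <= K * x `^ s * (1 + s^-1 + ln x).
Proof.
move=> x1; have x0 : 0 < x by lra.
have [N0 Nx xN] := truncn_bounds x1; have n0 : (0 : R) < (Num.truncn x)%:R by rewrite ltr0n.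
have pl : (Num.truncn x)%:R `^ s <= x `^ s by rewrite powR_truncn_le // ltW.
have lx : 0 <= ln x by rewrite ln_ge0.
rewrite /sumR abel_sumN (le_trans (ler_normD _ _)) //.
have h1 : `|sumN e (Num.truncn x) * ln (Num.truncn x).+1%:R| <= K * x `^ s * (1 + ln x).
  rewrite normrM; apply: ler_pM => //.
    by apply: le_trans (He _) _; rewrite ler_wpM2l.
  have /andP[l1 l2] := @ln_natS R _ N0.
  have l3 : (Num.truncn x)%:R^-1 <= 1 :> R by rewrite invf_le1 // ler1n.
  have l4 : ln (Num.truncn x)%:R <= ln x by rewrite ler_ln ?posrE.
  have l5 : 0 <= ln ((Num.truncn x)%:R : R) by rewrite ln_ge0 // ler1n.
  rewrite ger0_norm; last by lra.
  by move: l2 l3 l4; move: (ln (Num.truncn x).+1%:R) (ln (Num.truncn x)%:R) ((Num.truncn x)%:R^-1 : R) => *; lra.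
have h2 : `|sumN (fun n => sumN e n * (ln n%:R - ln n.+1%:R)) (Num.truncn x)| <= K * x `^ s / s.
  apply: le_trans (ler_norm_sumN _ _) _.
  apply: le_trans (_ : sumN (fun n => K * n%:R `^ (s - 1)) (Num.truncn x) <= _).
    apply: le_sumN => n /andP[n1 _]; have /andP[l1 l2] := @ln_natS R _ n1.
    rewrite normrM distrC [`|_ - _|]ger0_norm // powRB1_gt0 ?ltr0n // mulrA.
    by apply: ler_pM.
  rewrite sumNZ -mulrA ler_wpM2l //; apply: le_trans (sumN_powR _ s0 s1) _.
  by rewrite ler_pM2r // invr_gt0.
by apply: le_trans (lerD h1 h2) _; rewrite -mulrDr (_ : 1 + ln x + s^-1 = 1 + s^-1 + ln x) //; ring.
Qed.

End PowerSaving.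
End LogSums.

Lemma sumR_dconv (R : realType) (u v : nat -> R) (f : nat -> R) (x : R) : 0 <= x ->
  sumR (fun m => u m * sumR (fun n => v n * f (m * n)%N) (x / m%:R)) x = sumR (fun k => dconv u v k * f k) x.
Proof.
move=> x0; rewrite /sumR -sumN_dconv; apply: eq_sumN => m /andP[m0 _].
by rewrite truncn_divn.
Qed.

Section SumR.
Variable R : realType.
Implicit Types (f g : nat -> R) (x : R).

Lemma sumR_range x n : (0 < n <= Num.truncn x)%N -> [/\ (0 : R) < n%:R, n%:R <= x & 1 <= x / n%:R].
Proof.
move=> /andP[n0 nx].
have x1 : 1 <= x by rewrite -truncn_gt0 (leq_trans n0).
have n0' : (0 : R) < n%:R by rewrite ltr0n.
have h : n%:R <= x by rewrite -truncn_ge_nat //; lra.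
by split => //; rewrite ler_pdivlMr // mul1r.
Qed.

Lemma eq_sumR f g x :
  (forall n, (0 < n)%N -> (0 : R) < n%:R -> 1 <= x / n%:R -> f n = g n) -> sumR f x = sumR g x.
Proof. by move=> H; apply: eq_sumN => n h; have [n0 _ xn] := sumR_range h; case/andP: h => ? _; apply: H. Qed.

Lemma le_sumR f g x :
  (forall n, (0 < n)%N -> (0 : R) < n%:R -> 1 <= x / n%:R -> f n <= g n) -> sumR f x <= sumR g x.
Proof. by move=> H; apply: le_sumN => n h; have [n0 _ xn] := sumR_range h; case/andP: h => ? _; apply: H. Qed.

Lemma ler_norm_sumR f x : `|sumR f x| <= sumR (fun n => `|f n|) x.
Proof. exact: ler_norm_sumN. Qed.
Lemma sumRD f g x : sumR (fun n => f n + g n) x = sumR f x + sumR g x.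
Proof. exact: sumND. Qed.
Lemma sumRB f g x : sumR (fun n => f n - g n) x = sumR f x - sumR g x.
Proof. exact: sumNB. Qed.
Lemma sumRZ k f x : sumR (fun n => k * f n) x = k * sumR f x.
Proof. exact: sumNZ. Qed.
Lemma sumRZr k f x : sumR (fun n => f n * k) x = sumR f x * k.
Proof. exact: sumNZr. Qed.

Lemma sumR_dunit f x : 1 <= x -> sumR (fun k => dunit R k * f k) x = f 1%N.
Proof.
move=> x1; rewrite /sumR; have : (0 < Num.truncn x)%N by rewrite truncn_gt0.
elim: (Num.truncn x) => // -[_ _|N IH _]; rewrite sumNS /dunit ?sumN0 ?add0r ?mul1r //.
by rewrite IH // mul0r addr0.
Qed.

End SumR.

(** * The inverse of [a] for Dirichlet convolution *)

Section Mobius.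
Variable R : realType.
Variables (Lam a : nat -> R).
Hypothesis Lam_ge0 : forall n, 0 <= Lam n.
Hypothesis a1 : a 1%N = 1.
(** In terms of Dirichlet series, that of [Lam] is minus the logarithmic derivative of that of
    [a]. *)
Hypothesis a_ln : forall n, (0 < n)%N -> a n * ln n%:R = dconv Lam a n.

Lemma Lam1 : Lam 1%N = 0.
Proof.
have := a_ln (ltn0Sn 0); rewrite ln1 mulr0 /dconv big_mkcond big_nat1 dvdnn divn1 a1 mulr1.
by [].
Qed.

(** The logarithm is additive on [n = d (n / d)], so multiplying by it is a derivation of the
    convolution algebra. *)
Lemma dconv_ln_der (u v : nat -> R) n : (0 < n)%N ->
  dconv u v n * ln n%:R = dconv (fun d => u d * ln d%:R) v n + dconv u (fun d => v d * ln d%:R) n.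
Proof.
move=> n0; rewrite /dconv mulr_suml -big_split /= big_nat_cond [RHS]big_nat_cond; apply: eq_bigr => d /andP[/andP[d0 dn] dv].
have q0 : (0 < n %/ d)%N by rewrite divn_gt0 // dvdn_leq.
have -> : ln (n%:R : R) = ln d%:R + ln (n %/ d)%:R.
  by rewrite -lnM ?posrE ?ltr0n // -natrM mulnC divnK.
ring.
Qed.

(** The inverse has to satisfy [mu ln = - (Lam conv mu)]. Taken as a recursion this defines [mu];
    the derivation rule then makes [ln] times the convolution of [mu] and [a] vanish, so that
    convolution is the unit. Up to sign [a] obeys the same recursion, with [Lam >= 0], whence
    [|mu| <= a], which does the work of the bound 1 for the Moebius function. *)
Lemma dirichlet_inverse : exists mu : nat -> R,
  (forall n, (0 < n)%N -> dconv mu a n = dunit R n) /\ (forall n, (0 < n)%N -> `|mu n| <= a n).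
Proof.
pose Phi n (u : nat -> R) := if (n <= 1)%N then 1 else
   - (\sum_(1 <= d < n.+1 | (d %| n)%N && (1 < d)%N) Lam d * u (n %/ d)%N) / ln n%:R.
have [|mu Hmu] := @rec_exists R Phi.
  move=> n u v H; rewrite /Phi; case: ifP => // n1; congr (- _ / _).
  rewrite big_nat_cond [RHS]big_nat_cond; apply: eq_bigr => d /andP[/andP[d0 dn] /andP[dv d1]].
  by rewrite H // ltn_Pdiv // ltnW // ltnNge n1.
have mu1 : mu 1%N = 1 by rewrite Hmu.
have lnp n : (1 < n)%N -> 0 < ln (n%:R : R) by move=> n1; rewrite ln_gt0 // ltr1n.
have E n : (0 < n)%N -> mu n * ln n%:R = - dconv Lam mu n.
  case: n => // -[_|n _].
    by rewrite ln1 mulr0 /dconv big_mkcond big_nat1 dvdnn Lam1 mul0r oppr0.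
  rewrite Hmu /Phi /= divfK ?gt_eqF ?lnp //; congr (- _).
  rewrite /dconv big_mkcondr /=; apply: eq_bigr => -[|[|d]] // _.
  by rewrite /= Lam1 mul0r.
exists mu; split.
  move=> [|[|n]] // _.
    by rewrite /dconv big_mkcond big_nat1 dvdnn divn1 mu1 a1 mulr1.
  apply: (mulIf (lt0r_neq0 (lnp n.+2 isT))); rewrite /dunit /= mul0r dconv_ln_der //.
  rewrite (@eq_dconv R mu (fun d => a d * ln d%:R) mu (dconv Lam a)) //; last first.
    by move=> d /andP[d0 _]; apply: a_ln.
  rewrite dconvA //.
  rewrite (@eq_dconv R (fun d => mu d * ln d%:R) a (fun d => - dconv Lam mu d) a) //; last first.
    by move=> d /andP[d0 _]; apply: E.
  rewrite (@eq_dconv R (dconv mu Lam) a (dconv Lam mu) a) //; last first.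
    by move=> d /andP[d0 _]; apply: dconvC.
  rewrite /dconv -big_split /= big1 // => d _; ring.
elim/ltn_ind => -[|[|n]] IH // _; first by rewrite mu1 a1 normr1.
have ln0 := lnp n.+2 isT.
rewrite -(ler_pM2r ln0) -{1}(gtr0_norm ln0) -normrM E // a_ln // normrN.
rewrite /dconv; apply: le_trans (ler_norm_sum _ _ _) _.
rewrite big_nat_cond [X in _ <= X]big_nat_cond; apply: ler_sum => -[|[|d]] /andP[/andP[d0 dn] dv] //.
  by rewrite Lam1 !mul0r normr0.
rewrite normrM ger0_norm // ler_wpM2l // IH // ?ltn_Pdiv // divn_gt0 //.
Qed.

End Mobius.

(** * Chebyshev's bound and Selberg's formula by convolution inversion *)

Section SelbergFormula.
Variable R : realType.
Variables (Lam a : nat -> R) (c s K : R).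
Hypothesis Lam_ge0 : forall n, 0 <= Lam n.
Hypothesis a1 : a 1%N = 1.
Hypothesis a_ln : forall n, (0 < n)%N -> a n * ln n%:R = dconv Lam a n.
Hypotheses (c0 : 0 < c) (s0 : 0 < s) (s1 : s < 1) (K0 : 0 <= K).
Hypothesis count : forall N, `|sumN a N - c * N%:R| <= K * N%:R `^ s.

Definition psi (x : R) : R := sumR Lam x.

Let s1' : 0 < 1 - s. Proof. by rewrite subr_gt0. Qed.
(** An exponent strictly between [s] and 1; the gap above [s] absorbs factors [ln x]. *)
Let t : R := (1 + s) / 2.
Let t0 : 0 < t. Proof. rewrite /t; move: s0; lra. Qed.
Let t1 : t < 1. Proof. rewrite /t; move: s1; lra. Qed.
Let st : s < t. Proof. rewrite /t; move: s1; lra. Qed.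

Lemma powR_ge1 (x r : R) : 1 <= x -> 0 <= r -> 1 <= x `^ r.
Proof. move=> x1 r0; have : 1 `^ r <= x `^ r by rewrite ge0_ler_powR ?nnegrE //; lra.
by rewrite powR1. Qed.

Lemma sumN_a_le N : sumN a N <= (c + K) * N%:R.
Proof.
have := count N; rewrite ler_norml => /andP[_ h].
case: N h => [|N] h; first by rewrite sumN0 mulr0.
have : N.+1%:R `^ s <= (N.+1%:R : R).
  rewrite -[X in _ <= X]powRr1 ?ler0n //; apply: ler_powR; rewrite ?ler1n //; exact: ltW.
move=> /(ler_wpM2l K0); rewrite mulrDl; lra.
Qed.

(* The constant [C] is chosen so that the main terms of the three sums cancel. *)
Lemma sum_a_psi : exists C K1, 0 <= K1 /\ forall x, 1 <= x ->
  `|sumR (fun m => a m * (psi (x / m%:R) - x / m%:R - C)) x| <= K1 * x `^ t.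
Proof.
pose e n := a n - c.
have He N : `|sumN e N| <= K * N%:R `^ s by rewrite /e sumNB sumN_const.
have [l [K' [K'0 Hl]]] := sum_inv_power_saving s0 s1 K0 He.
have Hln := sum_ln_power_saving s0 s1 K0 He.
have [gam Hgam] := harmonic_sum R.
pose C := -1 - gam - l / c; exists C.
pose d := t - s; have d0 : 0 < d by rewrite subr_gt0.
pose K1 := c * (2 / d + 10) + K * (1 + s^-1 + d^-1) + 4 * c + K' + `|C| * (K + c).
have sv : 0 < s^-1 by rewrite invr_gt0. have dv : 0 < d^-1 by rewrite invr_gt0.
have c0' := ltW c0.
exists K1; split.
  have q1 : 0 <= c * (2 / d + 10) by rewrite mulr_ge0 //; lra.
  have q2 : 0 <= K * (1 + s^-1 + d^-1) by rewrite mulr_ge0 //; lra.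
  have q3 : 0 <= `|C| * (K + c) by rewrite mulr_ge0 // addr_ge0.
  by rewrite /K1; lra.
move=> x x1; have x0 : 0 < x by lra.
have E : sumR (fun m => a m * (psi (x / m%:R) - x / m%:R - C)) x =
   (c * sumR (fun n => ln n%:R) x + sumR (fun n => e n * ln n%:R) x)
   - x * (c * sumR (fun n => n%:R^-1) x + sumR (fun n => e n / n%:R) x) - C * (c * (Num.truncn x)%:R + sumR e x).
  rewrite -!sumRZ -(sumN_const c) -!sumRD.
  have -> : sumR (fun n => c * ln n%:R + e n * ln n%:R) x = sumR (fun m => a m * psi (x / m%:R)) x.
    rewrite (@eq_sumR _ _ (fun k => dconv a Lam k * 1)); last first.
      by move=> n n0 _ _; rewrite mulr1 dconvC // -a_ln // /e; ring.
    rewrite -(sumR_dconv a Lam (fun=> 1)) ?ltW //; apply: eq_sumR => n _ _ _.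
    by congr (_ * _); apply: eq_sumR => m _ _ _; rewrite mulr1.
  by rewrite -!sumRZ -!sumRB; apply: eq_sumR => n _ _ _; rewrite /e; ring.
rewrite {}E.
have := Hgam x x1; have := Hl x x1; have := Hln x x1; have := sum_ln x1; have := He (Num.truncn x).
have [N0 Nx xN] := truncn_bounds x1.
have pl := ler_wpM2l K0 (powR_truncn_le x1 (ltW s0)).
rewrite -/(sumR e x).
move: (sumR (fun n => ln n%:R) x) (sumR (fun n => e n * ln n%:R) x) (sumR (fun n => n%:R^-1) x)
   (sumR (fun n => e n / n%:R) x) (sumR e x) => S1 S2 S3 S4 S5 h5 h1 h2 h4 h3.
have -> : c * S1 + S2 - x * (c * S3 + S4) - C * (c * (Num.truncn x)%:R + S5) =
  c * (S1 - (x * ln x - x)) + S2 - x * (c * (S3 - ln x - gam)) - x * (S4 - l) - C * (S5 + c * ((Num.truncn x)%:R - x)).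
  by rewrite /C; field; rewrite gt_eqF.
have xs1 : 1 <= x `^ s by apply: powR_ge1 => //; exact: ltW.
have ldx : ln x <= x `^ d / d by apply: ln_le_powR.
have lx : 0 <= ln x by rewrite ln_ge0.
have Et : x `^ t = x `^ s * x `^ d by rewrite -powRD_gt0 // /d addrC subrK.
have st' : x `^ s <= x `^ t by apply: ler_powR => //; exact: ltW.
have xl : x `^ s * ln x <= x `^ t / d by rewrite Et -mulrA ler_wpM2l // powR_ge0.
have lt' : ln x <= x `^ t / d by apply: le_trans xl; rewrite ler_peMl.
have g1 : `|c * (S1 - (x * ln x - x))| <= c * (2 / d + 10) * x `^ t.
  rewrite normrM gtr0_norm // -mulrA ler_wpM2l //; apply: le_trans h1 _.
  rewrite (_ : (2 / d + 10) * x `^ t = 2 * (x `^ t / d) + 10 * x `^ t); last by ring.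
  move: lt' st' xs1; lra.
have g2 : `|S2| <= K * (1 + s^-1 + d^-1) * x `^ t.
  apply: le_trans h2 _; rewrite -!mulrA ler_wpM2l // mulrDr [_ * x `^ t]mulrDl.
  apply: lerD; last by rewrite [d^-1 * _]mulrC.
  by rewrite [x `^ s * _]mulrC ler_wpM2l //; lra.
have g3 : `|x * (c * (S3 - ln x - gam))| <= 4 * c * x `^ t.
  rewrite !normrM (gtr0_norm x0) (gtr0_norm c0) mulrCA.
  have : x * `|S3 - ln x - gam| <= 4 by rewrite mulrC -ler_pdivlMr.
  move=> /(ler_wpM2l c0') /le_trans; apply; rewrite [4 * c]mulrC -mulrA ler_wpM2l //; lra.
have g4 : `|x * (S4 - l)| <= K' * x `^ t.
  rewrite normrM (gtr0_norm x0); apply: le_trans (ler_wpM2l (ltW x0) h4) _.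
  by rewrite mulrCA ler_wpM2l // powRB1_gt0 // mulrC divfK ?gt_eqF.
have g5 : `|C * (S5 + c * ((Num.truncn x)%:R - x))| <= `|C| * (K + c) * x `^ t.
  rewrite normrM -mulrA ler_wpM2l //; apply: le_trans (ler_normD _ _) _.
  rewrite mulrDl; apply: lerD; first by apply: le_trans h5 _; apply: le_trans pl _; rewrite ler_wpM2l.
  rewrite normrM gtr0_norm // ler_wpM2l // ler_norml; apply/andP; split; lra.
apply: le_trans (ler_normB _ _) _; apply: le_trans (lerD (ler_normB _ _) g5) _.
apply: le_trans (lerD (lerD (ler_normB _ _) g4) (lexx _)) _.
apply: le_trans (lerD (lerD (lerD (ler_normD _ _) g3) (lexx _)) (lexx _)) _.
by rewrite /K1 !mulrDl; lra.
Qed.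

(** With [F y = psi y - y - C] and [G] its sum against [a], inversion expresses [F x] as the sum of
    [mu n G (x/n)]. As [G y] is [O(y^t)] and [|mu| <= a], [sumR_powR_weight] bounds this by [O(x)].
    Inserting the factor [ln (x/n)] yields the second estimate. *)
Lemma chebyshev_T : exists C K1 K3, 0 <= K1 /\ 0 <= K3 /\ forall x, 1 <= x ->
  `|psi x - x - C| <= K1 * x /\
  `|(psi x - x - C) * ln x + sumR (fun k => Lam k * (psi (x / k%:R) - x / k%:R - C)) x| <= K3 * x.
Proof.
have [C [K1 [K10 HG]]] := sum_a_psi.
have [mu [mu_inv mu_le]] := dirichlet_inverse Lam_ge0 a1 a_ln.
pose F y := psi y - y - C.
pose G y := sumR (fun m => a m * F (y / m%:R)) y.
pose Ka := c + K; have Ka0 : 0 <= Ka by rewrite addr_ge0 // ltW.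
(* Room above [t] for the factor [ln (x/n)]. *)
pose t2 := (1 + t) / 2.
have t20 : 0 < t2 by rewrite /t2; move: t0; lra.
have t21 : t2 < 1 by rewrite /t2; move: t1; lra.
have tt2 : 0 < t2 - t by rewrite /t2; move: t1; lra.
exists C, (K1 * (Ka / (1 - t))), ((K1 / (t2 - t)) * (Ka / (1 - t2))).
have p1 : 0 <= Ka / (1 - t) by rewrite divr_ge0 // subr_ge0 ltW.
have p2 : 0 <= Ka / (1 - t2) by rewrite divr_ge0 // subr_ge0 ltW.
split; first by rewrite mulr_ge0.
split; first by rewrite mulr_ge0 // divr_ge0 // ltW.
move=> x x1; have x0 : 0 < x by lra. have x0' := ltW x0.
have Fk (m n : nat) : F (x / m%:R / n%:R) = F (x / (m * n)%N%:R) by rewrite natrM invfM mulrA.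
split.
  have -> : psi x - x - C = sumR (fun n => mu n * G (x / n%:R)) x.
    transitivity (sumR (fun k => dconv mu a k * F (x / k%:R)) x).
      rewrite (@eq_sumR _ _ (fun k => dunit R k * F (x / k%:R))); last by move=> n n0 _ _; rewrite mu_inv.
      by rewrite sumR_dunit // divr1.
    rewrite -(sumR_dconv mu a (fun k => F (x / k%:R))) //; apply: eq_sumR => n _ _ _.
    by congr (_ * _); apply: eq_sumR => m _ _ _; rewrite Fk.
  apply: le_trans (ler_norm_sumR _ _) _.
  apply: le_trans (_ : sumR (fun n => K1 * (a n * (x / n%:R) `^ t)) x <= _).
    apply: le_sumR => n n0 n0' xn; rewrite normrM mulrCA ler_pM // ?mu_le //; exact: HG.
  rewrite sumRZ -mulrA ler_wpM2l //; apply: (sumR_powR_weight t0 t1 Ka0 x1 sumN_a_le).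
have -> : (psi x - x - C) * ln x + sumR (fun k => Lam k * (psi (x / k%:R) - x / k%:R - C)) x =
    sumR (fun n => mu n * (ln (x / n%:R) * G (x / n%:R))) x.
  (* For [k = n m] the factor [ln (x/n)] is [ln (x/k) + ln m]: the first part inverts to [F x ln x],
     and in the second [mu] convolved with [a ln] is [Lam]. *)
  pose f1 k := ln (x / k%:R) * F (x / k%:R).
  transitivity (sumR (fun k => dconv mu a k * f1 k) x + sumR (fun k => dconv mu (fun m => a m * ln m%:R) k * F (x / k%:R)) x).
    congr (_ + _).
      rewrite (@eq_sumR _ _ (fun k => dunit R k * f1 k)); last by move=> n n0 _ _; rewrite mu_inv.
      by rewrite sumR_dunit // /f1 divr1 mulrC.
    apply: eq_sumR => n n0 _ _; congr (_ * _).
    rewrite (@eq_dconv R mu _ mu (dconv a Lam)) //; last by move=> d /andP[d0 _]; rewrite dconvC // a_ln.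
    rewrite dconvA // (@eq_dconv R (dconv mu a) Lam (dunit R) Lam) //; last by move=> d /andP[d0 _]; apply: mu_inv.
    by rewrite dconv1u.
  rewrite -(sumR_dconv mu a f1) // -(sumR_dconv mu _ (fun k => F (x / k%:R))) // -sumRD.
  apply: eq_sumR => n n0 n0' xn; rewrite -mulrDr; congr (_ * _).
  rewrite -sumRD -sumRZ; apply: eq_sumR => m m0 m0' xm; rewrite /f1 -Fk.
  have -> : x / (n * m)%N%:R = x / n%:R / m%:R by rewrite natrM invfM mulrA.
  have xn0 : 0 < x / n%:R by rewrite divr_gt0.
  by rewrite (ln_div (x := x / n%:R)) ?posrE //; ring.
apply: le_trans (ler_norm_sumR _ _) _.
apply: le_trans (_ : sumR (fun n => K1 / (t2 - t) * (a n * (x / n%:R) `^ t2)) x <= _).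
  apply: le_sumR => n n0 n0' xn; rewrite !normrM [X in _ <= X]mulrCA ler_pM // ?mu_le // ?mulr_ge0 //.
  have l0 : 0 <= ln (x / n%:R) by rewrite ln_ge0.
  rewrite ger0_norm //; have := ln_le_powR tt2 xn => h.
  have E : (x / n%:R) `^ t2 = (x / n%:R) `^ (t2 - t) * (x / n%:R) `^ t.
    by rewrite -powRD_gt0 ?divr_gt0 // subrK.
  rewrite E (_ : _ / _ * _ = ((x / n%:R) `^ (t2 - t) / (t2 - t)) * (K1 * (x / n%:R) `^ t)); last by ring.
  by apply: ler_pM => //; apply: HG.
by rewrite sumRZ -mulrA ler_wpM2l ?divr_ge0 ?(ltW tt2) //; apply: (sumR_powR_weight t20 t21 Ka0 x1 sumN_a_le).
Qed.

End SelbergFormula.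

(** * Chebyshev, Selberg and Mertens estimates for [Lam] *)

Section MertensChebyshev.
Variable R : realType.
Variables (Lam a : nat -> R) (c s K : R).
Hypothesis Lam_ge0 : forall n, 0 <= Lam n.
Hypothesis a1 : a 1%N = 1.
Hypothesis a_ln : forall n, (0 < n)%N -> a n * ln n%:R = dconv Lam a n.
Hypotheses (c0 : 0 < c) (s0 : 0 < s) (s1 : s < 1) (K0 : 0 <= K).
Hypothesis count : forall N, `|sumN a N - c * N%:R| <= K * N%:R `^ s.
Local Notation psi := (psi Lam).

Lemma ln_le_id (x : R) : 0 < x -> ln x <= x.
Proof.
move=> x0; have h : -1 < x - 1 by lra.
by have := le_ln1Dx h; rewrite [1 + _]addrC subrK; lra.
Qed.

(** The constant [C] is removed from [chebyshev_T]: it contributes [C (ln x + psi x)], which is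
    [O(x)] by the first estimate there. *)
Lemma selberg_formula : exists K1, 0 <= K1 /\ forall x, 1 <= x ->
  psi x <= K1 * x /\ `|(psi x - x) * ln x + sumR (fun k => Lam k * (psi (x / k%:R) - x / k%:R)) x| <= K1 * x.
Proof.
have [C [K1 [K3 [K10 [K30 H]]]]] := chebyshev_T Lam_ge0 a1 a_ln c0 s0 s1 K0 count.
pose K2 := 1 + K1 + `|C|.
have K20 : 0 <= K2 by rewrite /K2; have := normr_ge0 C; lra.
have hpsi x : 1 <= x -> 0 <= psi x <= K2 * x.
  move=> x1; apply/andP; split; first by apply: sumN_ge0.
  have [h _] := H x x1.
  have : `|C| * 1 <= `|C| * x by rewrite ler_wpM2l.
  by move: h; rewrite /K2 ler_norml => /andP[_ h]; have := ler_norm C; lra.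
exists (K2 + K3 + `|C| * (1 + K2)).
have q : 0 <= `|C| * (1 + K2) by rewrite mulr_ge0 // addr_ge0.
split; first by lra.
move=> x x1; have x0 : 0 < x by lra.
have q' := mulr_ge0 q (ltW x0); have q3 := mulr_ge0 K30 (ltW x0); have q2 := mulr_ge0 K20 (ltW x0).
have /andP[p0 p1] := hpsi x x1.
split; first by lra.
have [_ h] := H x x1.
have -> : (psi x - x) * ln x + sumR (fun k => Lam k * (psi (x / k%:R) - x / k%:R)) x =
  ((psi x - x - C) * ln x + sumR (fun k => Lam k * (psi (x / k%:R) - x / k%:R - C)) x) + C * (ln x + psi x).
  rewrite [in X in _ = X + _](@eq_sumR _ _ (fun k => Lam k * (psi (x / k%:R) - x / k%:R) - C * Lam k)).
    by rewrite sumRB sumRZ -/(psi x); ring.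
  by move=> n _ _ _; ring.
apply: le_trans (ler_normD _ _) _; apply: le_trans (lerD h (lexx _)) _.
rewrite normrM; have lx : 0 <= ln x by rewrite ln_ge0.
have lx' := ln_le_id x0.
rewrite (@ger0_norm _ (ln x + psi x)) ?addr_ge0 //.
have : `|C| * (ln x + psi x) <= `|C| * ((1 + K2) * x) by rewrite ler_wpM2l //; lra.
lra.
Qed.

(** The sum of [a n ln n] is computed twice: as [c x ln x + O(x)] from the regularity of [a], and as
    the sum of [Lam n] times the sum of [a] up to [x/n], which is [c x] times the wanted sum up to
    [O(x)]. *)
Lemma mertens_Lam : exists M, 0 <= M /\ forall x, 1 <= x ->
  `|sumR (fun n => Lam n / n%:R) x - ln x| <= M.
Proof.
have [K1 [K10 H]] := selberg_formula.
have s1' : 0 < 1 - s by rewrite subr_gt0.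
pose e n := a n - c.
have He N : `|sumN e N| <= K * N%:R `^ s by rewrite /e sumNB sumN_const.
have Hln := sum_ln_power_saving s0 s1 K0 He.
pose B := c * 12 + c + K * (1 + s^-1 + (1 - s)^-1).
pose D := K * (K1 / (1 - s)) + c * K1.
have sv : 0 < s^-1 by rewrite invr_gt0.
have dv : 0 < (1 - s)^-1 by rewrite invr_gt0.
have c0' := ltW c0.
have q0 : 0 <= K * (1 + s^-1 + (1 - s)^-1) by rewrite mulr_ge0 //; lra.
have B0 : 0 <= B by rewrite /B; lra.
have D0 : 0 <= D by rewrite /D addr_ge0 ?mulr_ge0 // ltW.
exists ((B + D) / c); split; first by rewrite divr_ge0 // addr_ge0.
move=> x x1; have x0 : 0 < x by lra. have x0' := ltW x0.
have lx : 0 <= ln x by rewrite ln_ge0. have lx' := ln_le_id x0.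
have h1 : `|sumR (fun n => a n * ln n%:R) x - c * (x * ln x)| <= B * x.
  have -> : sumR (fun n => a n * ln n%:R) x - c * (x * ln x) =
     c * (sumR (fun n => ln n%:R) x - (x * ln x - x)) + sumR (fun n => e n * ln n%:R) x - c * x.
    rewrite (@eq_sumR _ (fun n => a n * ln n%:R) (fun n => c * ln n%:R + e n * ln n%:R)).
      by rewrite sumRD sumRZ; ring.
    by move=> n _ _ _; rewrite /e; ring.
  apply: le_trans (ler_normB _ _) _; rewrite (@ger0_norm _ (c * x)) ?mulr_ge0 //.
  apply: le_trans (lerD (ler_normD _ _) (lexx _)) _.
  rewrite normrM gtr0_norm //.
  have g1 := ler_wpM2l c0' (sum_ln x1).
  have g2 : c * (2 * ln x + 10) <= c * (12 * x) by rewrite ler_wpM2l //; lra.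
  have g3 : K * x `^ s * (1 + s^-1 + ln x) <= K * (1 + s^-1 + (1 - s)^-1) * x.
    rewrite -!mulrA ler_wpM2l // mulrDr [X in _ <= X]mulrDl.
    have xs : x `^ s <= x by rewrite -[X in _ <= X]powRr1 //; apply: ler_powR => //; exact: ltW.
    apply: lerD; first by rewrite mulrC ler_wpM2l //; lra.
    have := ln_le_powR s1' x1 => /(ler_wpM2l (powR_ge0 x s)) /le_trans; apply.
    by rewrite mulrA -powRD_gt0 // addrC subrK powRr1 // mulrC.
  have := Hln x x1; rewrite /B; lra.
have h2 : `|sumR (fun n => a n * ln n%:R) x - c * x * sumR (fun n => Lam n / n%:R) x| <= D * x.
  have -> : sumR (fun n => a n * ln n%:R) x = sumR (fun n => Lam n * sumR a (x / n%:R)) x.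
    rewrite (@eq_sumR _ _ (fun k => dconv Lam a k * 1)); last by move=> n n0 _ _; rewrite mulr1 a_ln.
    rewrite -(sumR_dconv Lam a (fun=> 1)) //; apply: eq_sumR => n _ _ _.
    by congr (_ * _); apply: eq_sumR => m _ _ _; rewrite mulr1.
  rewrite -sumRZ -sumRB; apply: le_trans (ler_norm_sumR _ _) _.
  have -> : D * x = K * (K1 / (1 - s) * x) + c * (K1 * x) by rewrite /D; ring.
  apply: le_trans (_ : sumR (fun n => K * (Lam n * (x / n%:R) `^ s) + c * Lam n) x <= _).
    apply: le_sumR => n n0 n0' xn.
    have -> : Lam n * sumR a (x / n%:R) - c * x * (Lam n / n%:R) = Lam n * (sumR a (x / n%:R) - c * (x / n%:R)) by ring.
    rewrite normrM ger0_norm // (_ : _ + _ = Lam n * (K * (x / n%:R) `^ s + c)); last by ring.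
    rewrite ler_wpM2l //; have [N0 Nx xN] := truncn_bounds xn.
    move: N0 Nx xN (powR_truncn_le xn (ltW s0)) (count (Num.truncn (x / n%:R))); rewrite -/(sumR a _).
    move: (x / n%:R) (sumR _ _) => y S N0 Nx xN py h.
    have := ler_wpM2l K0 py; have := ler_wpM2l c0' Nx; have := ler_wpM2l c0' (ltW xN).
    move: h; rewrite !ler_norml => /andP[h h'] *; apply/andP; split; lra.
  rewrite sumRD !sumRZ; apply: lerD; rewrite ler_wpM2l //; last by have [] := H x x1.
  apply: sumR_powR_weight => // N.
  case: N => [|N]; first by rewrite sumN0 mulr0.
  have := H N.+1%:R; rewrite /psi /sumR natrK ler1n => /(_ isT)[].
  by [].
rewrite ler_pdivlMr // -(ler_pM2r x0).
have : `|c * x * (sumR (fun n => Lam n / n%:R) x - ln x)| <= (B + D) * x.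
  move: h1 h2; move: (sumR _ _) (sumR _ _) => S T; rewrite !ler_norml => /andP[u1 u2] /andP[u3 u4].
  by apply/andP; split; lra.
by rewrite normrM (@gtr0_norm _ (c * x)) ?mulr_gt0 // => h; rewrite -mulrA mulrC.
Qed.

End MertensChebyshev.

(** * Consequences of Selberg's formula for the error term *)

Section SelbergConsequences.
Variable R : realType.
Variables (Lam : nat -> R) (K : R).
Hypothesis Lam_ge0 : forall n, 0 <= Lam n.
Hypothesis K0 : 0 <= K.
Local Notation psi := (psi Lam).
Definition psi_err (x : R) : R := psi x - x.
Local Notation Er := psi_err.
Hypothesis Hpsi : forall x, 1 <= x -> psi x <= K * x.
Hypothesis HM : forall x, 1 <= x -> `|sumR (fun n => Lam n / n%:R) x - ln x| <= K.
(* The Tatuzawa-Iseki form of Selberg's identity. *)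
Hypothesis HT : forall x, 1 <= x ->
  `|Er x * ln x + sumR (fun k => Lam k * Er (x / k%:R)) x| <= K * x.

(** The analogue of Selberg's function [Lambda_2]; its sum is regular before that of [Lam] is known
    to be. *)
Definition selberg_weight (k : nat) : R := Lam k * ln k%:R + dconv Lam Lam k.
Local Notation w := selberg_weight.

Lemma psi_ge0 x : 0 <= psi x. Proof. exact: sumN_ge0. Qed.

Lemma psi_le (x y : R) : x <= y -> psi x <= psi y.
Proof. by move=> xy; apply: le_sumNr => //; exact: le_truncn. Qed.

Lemma selberg_weight_ge n : (0 < n)%N -> Lam n * ln n%:R <= w n.
Proof.
move=> n0; rewrite /w lerDl /dconv sumr_ge0 // => d _; exact: mulr_ge0.
Qed.

Lemma selberg_weight_ge0 n : (0 < n)%N -> 0 <= w n.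
Proof.
move=> n0; apply: le_trans (selberg_weight_ge n0); rewrite mulr_ge0 // ln_ge0 // ler1n //.
Qed.

Lemma psi_err_abs x : 1 <= x -> `|Er x| <= (K + 1) * x.
Proof.
move=> x1; have := Hpsi x1; have := psi_ge0 x; have : 0 <= K * x by (rewrite mulr_ge0 //; lra).
by rewrite /Er => *; rewrite ler_norml; apply/andP; split; lra.
Qed.

(** Abel summation turns Mertens' sum and the harmonic sum into sums of [psi m] and of [m] against
    [1/m - 1/(m+1)]; both are [ln N + O(1)], so their difference is bounded. *)
Lemma sum_psi_err_bounded : exists M, forall N,
  `|sumN (fun m => Er m%:R * (m%:R^-1 - m.+1%:R^-1)) N| <= M.
Proof.
have [gam Hg] := harmonic_sum R.
exists (K + K + 4 + `|gam| + 1) => -[|N].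
  rewrite sumN0 normr0; have := normr_ge0 gam; move: K0; lra.
have N1 : (1 : R) <= N.+1%:R by rewrite ler1n.
have pN : psi N.+1%:R = sumN Lam N.+1 by rewrite /psi /sumR natrK.
have := HM N1; have := Hg _ N1; rewrite /sumR natrK.
rewrite (abel_sumN Lam) -[sumN (fun n => n%:R^-1) N.+1](@eq_sumN _ (fun n => 1 * n%:R^-1)); last by move=> *; rewrite mul1r.
rewrite (abel_sumN (fun=> 1)).
have -> : sumN (fun m => Er m%:R * (m%:R^-1 - m.+1%:R^-1)) N.+1 =
   sumN (fun n => sumN Lam n * (n%:R^-1 - n.+1%:R^-1)) N.+1 - sumN (fun n => sumN (fun=> 1) n * (n%:R^-1 - n.+1%:R^-1)) N.+1.
  by rewrite -sumNB; apply: eq_sumN => n _; rewrite /Er /psi /sumR natrK sumN_const; ring.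
have h1 : 0 <= sumN Lam N.+1 / N.+2%:R <= K.
  rewrite divr_ge0 ?sumN_ge0 //= ler_pdivrMr ?ltr0n // -pN; apply: le_trans (Hpsi N1) _.
  by rewrite ler_wpM2l // ler_nat.
have h2 : 0 <= sumN (fun=> 1 : R) N.+1 / N.+2%:R <= 1.
  by rewrite sumN_const mul1r divr_ge0 ?ler0n //= ler_pdivrMr ?ltr0n // mul1r ler_nat.
have h3 : 4 / N.+1%:R <= (4 : R) by rewrite ler_pdivrMr ?ltr0n // ler_peMr.
move: h1 h2 h3; move: (sumN _ _) (sumN _ _) (ln N.+1%:R) (4 / N.+1%:R) (sumN _ _ / _) (sumN _ _ / _) => C D l q A B.
move=> /andP[a b] /andP[c d] e; rewrite !ler_norml => /andP[f g] /andP[h i].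
by have := ler_norm gam; have := ler_norm (- gam); rewrite normrN => *; apply/andP; split; lra.
Qed.

(** Selberg's symmetry formula: in [HT] the term [psi x ln x] may be replaced by the sum of
    [Lam k ln k], since the sum of [Lam k ln (x/k)] is [O(x)], and [HM] evaluates the sum of
    [x Lam k / k]. *)
Lemma selberg_weight_sum : exists K2, 0 <= K2 /\ forall x, 1 <= x ->
  `|sumR w x - 2 * x * ln x| <= K2 * x.
Proof.
pose K3 := K / (1 - 2^-1) / 2^-1.
have K30 : 0 <= K3 by rewrite /K3 !divr_ge0 //; lra.
exists (K + K + K3); split; first by rewrite !addr_ge0.
move=> x x1; have x0 : 0 < x by lra. have x0' := ltW x0.
have h1 : 0 <= sumR (fun k => Lam k * ln (x / k%:R)) x <= K3 * x.
  apply/andP; split.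
    by apply: sumN_ge0 => n /sumR_range[? _ xn]; rewrite mulr_ge0 // ln_ge0.
  apply: le_trans (_ : sumR (fun k => Lam k * (x / k%:R) `^ 2^-1 / 2^-1) x <= _).
    apply: le_sumR => n n0 n0' xn; rewrite -mulrA ler_wpM2l //; apply: ln_le_powR => //; lra.
  rewrite sumRZr; rewrite /K3 mulrAC ler_pM2r; last by lra.
  apply: sumR_powR_weight => //; try lra.
  move=> [|N]; first by rewrite sumN0 mulr0.
  by have := @Hpsi N.+1%:R; rewrite /psi /sumR natrK ler1n => ->.
have E : sumR w x - 2 * x * ln x = (Er x * ln x + sumR (fun k => Lam k * Er (x / k%:R)) x)
    + x * (sumR (fun n => Lam n / n%:R) x - ln x) - sumR (fun k => Lam k * ln (x / k%:R)) x.
  have -> : sumR w x = sumR (fun k => Lam k * ln k%:R) x + sumR (fun k => Lam k * psi (x / k%:R)) x.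
    rewrite [sumR w x]sumRD; congr (_ + _).
    rewrite (@eq_sumR _ _ (fun k => dconv Lam Lam k * 1)); last by move=> *; rewrite mulr1.
    rewrite -(sumR_dconv Lam Lam (fun=> 1)) //; apply: eq_sumR => n _ _ _.
    by congr (_ * _); apply: eq_sumR => m _ _ _; rewrite mulr1.
  have -> : sumR (fun k => Lam k * ln (x / k%:R)) x = psi x * ln x - sumR (fun k => Lam k * ln k%:R) x.
    rewrite /psi -sumRZr -sumRB; apply: eq_sumR => n n0 n0' _.
    by rewrite ln_div ?posrE //; ring.
  have -> : sumR (fun k => Lam k * Er (x / k%:R)) x = sumR (fun k => Lam k * psi (x / k%:R)) x - x * sumR (fun n => Lam n / n%:R) x.
    by rewrite -sumRZ -sumRB; apply: eq_sumR => n _ _ _; rewrite /Er; ring.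
  by rewrite /Er; ring.
rewrite E; have := HT x1; have := ler_wpM2l x0' (HM x1); rewrite -{1}(gtr0_norm x0) -normrM.
move: h1; move: (sumR _ _) (_ + sumR _ _) (x * (_ - _)) => A B C; rewrite !ler_norml => /andP[? ?] /andP[? ?] /andP[? ?].
by apply/andP; split; lra.
Qed.

(** [HT] is applied a second time at each [x/n] with weight [Lam n]. The sums of [Lam n Er (x/n)]
    times [ln x] cancel, leaving [Er] against [Lam ln] and against the convolution square of [Lam]
    with opposite signs; absolute values merge the two into [w]. *)
Lemma psi_err_iterated : exists K3, 0 <= K3 /\ forall x, 1 <= x ->
  `|Er x| * ln x ^+ 2 <= sumR (fun k => w k * `|Er (x / k%:R)|) x + K3 * x * (1 + ln x).
Proof.
exists (K + K + K * K); split; first by rewrite !addr_ge0 // mulr_ge0.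
move=> x x1; have x0 : 0 < x by lra. have x0' := ltW x0.
have lx : 0 <= ln x by rewrite ln_ge0.
pose Q y := Er y * ln y + sumR (fun k => Lam k * Er (y / k%:R)) y.
have HQ y : 1 <= y -> `|Q y| <= K * y by apply: HT.
have E : Er x * ln x ^+ 2 = Q x * ln x - sumR (fun n => Lam n * Q (x / n%:R)) x
    - sumR (fun k => Lam k * ln k%:R * Er (x / k%:R)) x + sumR (fun k => dconv Lam Lam k * Er (x / k%:R)) x.
  have -> : sumR (fun k => dconv Lam Lam k * Er (x / k%:R)) x =
       sumR (fun n => Lam n * Q (x / n%:R)) x - sumR (fun n => Lam n * (Er (x / n%:R) * ln (x / n%:R))) x.
    rewrite -sumRB -(sumR_dconv Lam Lam (fun k => Er (x / k%:R))) //; apply: eq_sumR => n _ _ _.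
    rewrite -mulrBr /Q addrC addKr; congr (_ * _); apply: eq_sumR => m _ _ _.
    by rewrite natrM invfM mulrA.
  have -> : sumR (fun n => Lam n * (Er (x / n%:R) * ln (x / n%:R))) x =
       ln x * sumR (fun n => Lam n * Er (x / n%:R)) x - sumR (fun k => Lam k * ln k%:R * Er (x / k%:R)) x.
    rewrite -sumRZ -sumRB; apply: eq_sumR => n n0 n0' _.
    by rewrite ln_div ?posrE //; ring.
  by rewrite /Q; ring.
rewrite -(ger0_norm lx) -normrX -normrM E.
apply: le_trans (ler_normD _ _) _; apply: le_trans (lerD (ler_normB _ _) (lexx _)) _.
apply: le_trans (lerD (lerD (ler_normB _ _) (lexx _)) (lexx _)) _.
have h1 : `|Q x * ln x| <= K * x * ln x by rewrite normrM (ger0_norm lx) ler_wpM2r // HQ.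
have h2 : `|sumR (fun n => Lam n * Q (x / n%:R)) x| <= K * x * (ln x + K).
  apply: le_trans (ler_norm_sumR _ _) _.
  apply: le_trans (_ : sumR (fun n => K * x * (Lam n / n%:R)) x <= _).
    apply: le_sumR => n n0 n0' xn; rewrite normrM ger0_norm //.
    rewrite (_ : K * x * _ = Lam n * (K * (x / n%:R))); last by ring.
    by rewrite ler_wpM2l // HQ.
  rewrite sumRZ ler_wpM2l ?mulr_ge0 //; have := HM x1; rewrite ler_norml => /andP[_ ?]; lra.
have h3 : `|sumR (fun k => Lam k * ln k%:R * Er (x / k%:R)) x| + `|sumR (fun k => dconv Lam Lam k * Er (x / k%:R)) x|
   <= sumR (fun k => w k * `|Er (x / k%:R)|) x.
  apply: le_trans (lerD (ler_norm_sumR _ _) (ler_norm_sumR _ _)) _.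
  rewrite -sumRD; apply: le_sumR => n n0 n0' xn; rewrite !normrM /w mulrDl.
  rewrite !(ger0_norm (Lam_ge0 _)) (@ger0_norm _ (ln _)) ?ln_ge0 ?ler1n //.
  by rewrite (@ger0_norm _ (dconv _ _ _)) // /dconv sumr_ge0 // => d _; exact: mulr_ge0.
have h4 : 0 <= K * x by rewrite mulr_ge0.
have h5 := mulr_ge0 h4 K0. have h6 := mulr_ge0 h4 lx. have h7 := mulr_ge0 h5 lx.
move: h1 h2 h3; rewrite (@ger0_norm _ (ln x)) //; lra.
Qed.

(** As [Lam ln <= w] and the sum of [w] is [2 x ln x + O(x)], an increment of [psi] lies between 0
    and [2 (y - x)] up to [O(x / ln x)]; subtracting [y - x] centres this interval at 0. *)
Lemma psi_err_variation : exists K4, 0 <= K4 /\ forall x y, 1 <= x -> x <= y -> y <= 2 * x ->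
  `|Er y - Er x| * ln x <= (y - x) * ln x + K4 * x.
Proof.
have [K2 [K20 HW]] := selberg_weight_sum.
exists (4 + 3 * K2); split; first by lra.
move=> x y x1 xy y2; have x0 : 0 < x by lra.
have lx : 0 <= ln x by rewrite ln_ge0.
have y1 : 1 <= y by lra.
have up : (psi y - psi x) * ln x <= 2 * (y - x) * ln x + (4 + 3 * K2) * x.
  have : sumR (fun n => w n - ln x * Lam n) x <= sumR (fun n => w n - ln x * Lam n) y.
    apply: le_sumNr; last exact: le_truncn.
    move=> n /andP[nx _]; have n0 : (0 < n)%N by apply: leq_ltn_trans nx.
    rewrite subr_ge0; apply: le_trans (selberg_weight_ge n0); rewrite mulrC ler_wpM2l //.
    rewrite ler_ln ?posrE ?ltr0n //; apply: ltW; rewrite -truncn_lt_nat //; lra.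
  rewrite !sumRB !sumRZ -/(psi x) -/(psi y).
  have := HW x x1; have := HW y y1; rewrite !ler_norml => /andP[? ?] /andP[? ?].
  have /andP[l1 l2] := ln_sub_le x0 xy.
  have l3 : ln y - ln x <= 1 by apply: le_trans l2 _; rewrite ler_pdivrMr //; lra.
  have l4 : 2 * y * (ln y - ln x) <= 2 * y * 1 by rewrite ler_wpM2l //; lra.
  have l5 : K2 * y <= K2 * (2 * x) by rewrite ler_wpM2l.
  lra.
have pm := psi_le xy.
rewrite -[`|_ - _|]/(`|(psi y - y) - (psi x - x)|).
have h1 : 0 <= (psi y - psi x) * ln x by rewrite mulr_ge0 //; lra.
have h2 : 0 <= (y - x) * ln x by rewrite mulr_ge0 //; lra.
have h3 : 0 <= (4 + 3 * K2) * x by rewrite mulr_ge0 //; lra.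
rewrite -{1}(ger0_norm lx) -normrM ler_norml; apply/andP; split; lra.
Qed.

(** The leading coefficient 1 of [ln x ^ 2] matches that in [psi_err_iterated]: a bound
    [|Er y| <= alp y] reproduces itself, and any systematic deficit improves it. *)
Lemma selberg_weight_sum_inv : exists K5, 0 <= K5 /\ forall x, 1 <= x ->
  sumR (fun k => w k / k%:R) x <= ln x ^+ 2 + K5 * (1 + ln x).
Proof.
have [K2 [K20 HW]] := selberg_weight_sum.
have [gam Hg] := harmonic_sum R.
pose K5 := 5 + K2 * (6 + `|gam|).
exists K5; split; first by rewrite /K5 addr_ge0 // mulr_ge0 // addr_ge0.
move=> x x1; have x0 : 0 < x by lra.
have lx : 0 <= ln x by rewrite ln_ge0.
have WN n : (0 < n)%N -> sumN w n <= 2 * n%:R * ln n%:R + K2 * n%:R.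
  by move=> n0; have := HW n%:R; rewrite /sumR natrK ler1n => /(_ n0); rewrite ler_norml => /andP[_]; lra.
(* Each new term is [2 ln (N+1) / (N+2)], below the increment of the squared logarithm. *)
have sq N : sumN (fun n => 2 * n%:R * ln (n%:R : R) * (n%:R^-1 - n.+1%:R^-1)) N <= ln N.+1%:R ^+ 2.
  elim: N => [|N IH]; first by rewrite sumN0 ln1 expr0n.
  rewrite sumNS; have n0 : (0 : R) < N.+1%:R by rewrite ltr0n.
  have -> : 2 * N.+1%:R * ln (N.+1%:R : R) * (N.+1%:R^-1 - N.+2%:R^-1) = 2 * ln N.+1%:R * N.+2%:R^-1.
    by rewrite -[N.+2%:R]natr1; move: n0; move: (N.+1%:R : R) => b; move: (ln _) => l b0; field; lra.
  have /andP[l1 l2] := @ln_natS R N.+1 (ltn0Sn N).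
  have l3 : N.+2%:R^-1 <= ln N.+2%:R - ln (N.+1%:R : R).
    apply: le_trans (ln_sub_ge _ _); rewrite ?ltr0n ?ler_nat //.
    by rewrite -{2}[N.+2%:R]natr1 [_ + 1]addrC addrK mul1r.
  have l4 : 0 <= ln (N.+1%:R : R) by rewrite ln_ge0 // ler1n.
  have : 2 * ln N.+1%:R * N.+2%:R^-1 <= (ln N.+2%:R + ln N.+1%:R) * (ln N.+2%:R - ln (N.+1%:R : R)).
    by apply: ler_pM => //; [rewrite mulr_ge0 | lra].
  move: IH; move: (sumN _ _) => S; move: (ln N.+2%:R) (_ / _) => l i; rewrite !expr2; lra.
have [N0 Nx xN] := truncn_bounds x1.
rewrite /sumR abel_sumN.
have n0 : (0 : R) < (Num.truncn x)%:R by rewrite ltr0n.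
have lN : ln (Num.truncn x)%:R <= ln x by rewrite ler_ln ?posrE.
have lN0 : 0 <= ln ((Num.truncn x)%:R : R) by rewrite ln_ge0 // ler1n.
have lN1 : ln (Num.truncn x).+1%:R <= ln x + 1.
  have /andP[_] := @ln_natS R _ N0.
  have : (Num.truncn x)%:R^-1 <= (1 : R) by rewrite invf_le1 // ler1n.
  by move: lN; move: (ln _.+1%:R) (_^-1) => *; lra.
have h1 : sumN w (Num.truncn x) / (Num.truncn x).+1%:R <= 2 * ln x + K2.
  rewrite ler_pdivrMr ?ltr0n //; apply: le_trans (WN _ N0) _.
  have : (Num.truncn x)%:R * (2 * ln (Num.truncn x)%:R + K2) <= (Num.truncn x).+1%:R * (2 * ln x + K2).
    by apply: ler_pM; rewrite ?ler0n ?ler_nat //; lra.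
  lra.
have h2 : sumN (fun n => sumN w n * (n%:R^-1 - n.+1%:R^-1)) (Num.truncn x) <=
   (ln x + 1) ^+ 2 + K2 * (ln x + 4 + `|gam|).
  apply: le_trans (_ : sumN (fun n => 2 * n%:R * ln n%:R * (n%:R^-1 - n.+1%:R^-1) + K2 * n%:R^-1) (Num.truncn x) <= _).
    apply: le_sumN => n /andP[n1 _].
    have d0 : (0 : R) <= n%:R^-1 - n.+1%:R^-1 by rewrite subr_ge0 lef_pV2 ?posrE ?ltr0n // ler_nat.
    apply: le_trans (ler_wpM2r d0 (WN _ n1)) _; rewrite mulrDl lerD2l -mulrA ler_wpM2l //.
    have : (0 : R) < n%:R by rewrite ltr0n.
    rewrite -[n.+1%:R]natr1; move: (n%:R : R) => b b0.
    rewrite (_ : b * _ = (b + 1)^-1); last by field; lra.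
    by rewrite lef_pV2 ?posrE; lra.
  rewrite sumND sumNZ; apply: lerD.
    apply: le_trans (sq _) _; rewrite ler_sqr ?nnegrE //; last by lra.
    by rewrite ln_ge0 // ler1n.
  rewrite ler_wpM2l //; have := Hg x x1; rewrite /sumR ler_norml => /andP[_].
  have : 4 / x <= 4 by rewrite ler_pdivrMr //; lra.
  have := ler_norm gam; lra.
apply: le_trans (lerD h1 h2) _.
have g0 := normr_ge0 gam.
have := mulr_ge0 K20 lx; have := mulr_ge0 K20 (mulr_ge0 g0 lx); rewrite /K5; lra.
Qed.

End SelbergConsequences.

(** * Where the error term is small *)

Section SelbergEndgame.
Variable R : realType.
Variables (Lam : nat -> R) (K : R).
Hypothesis Lam_ge0 : forall n, 0 <= Lam n.
Hypothesis K0 : 0 <= K.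
Local Notation psi := (psi Lam).
Local Notation Er := (psi_err Lam).
Local Notation w := (selberg_weight Lam).
Hypothesis Hpsi : forall x, 1 <= x -> psi x <= K * x.
Hypothesis HM : forall x, 1 <= x -> `|sumR (fun n => Lam n / n%:R) x - ln x| <= K.
Hypothesis HT : forall x, 1 <= x ->
  `|Er x * ln x + sumR (fun k => Lam k * Er (x / k%:R)) x| <= K * x.

Lemma ln_ge_expR (L x : R) : expR L <= x -> L <= ln x.
Proof. by move=> h; rewrite -(expRK L) ler_ln ?posrE ?expR_gt0 // (lt_le_trans (expR_gt0 L)). Qed.

Lemma psi_err_near (eta : R) : 0 < eta -> exists y0, 1 <= y0 /\ forall x y, y0 <= x -> x <= y -> y <= 2 * x ->
  `|Er y - Er x| <= (y - x) + eta * x.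
Proof.
move=> e0; have [K4 [K40 H]] := psi_err_variation Lam_ge0 K0 Hpsi HM HT.
exists (expR (1 + K4 / eta)).
have q0 : 0 <= K4 / eta by rewrite divr_ge0 // ltW.
split; first by apply: le_trans (expR_ge1Dx _); lra.
move=> x y xy0 xy y2.
have x1 : 1 <= x by apply: le_trans xy0; apply: le_trans (expR_ge1Dx _); lra.
have l1 : 1 + K4 / eta <= ln x by apply: ln_ge_expR.
have l0 : 0 < ln x by lra.
rewrite -(ler_pM2r l0); apply: le_trans (H x y x1 xy y2) _.
rewrite [X in _ <= X]mulrDl lerD2l mulrAC ler_pM2r; last by lra.
by rewrite mulrC -ler_pdivrMr //; lra.
Qed.

(* The averages of [Er m / m^2] stay bounded, so [Er] cannot keep a constant
   sign with size at least [delta * m] on a long multiplicative interval, and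
   it cannot jump across zero without passing near it. *)
Lemma psi_err_small_value (delta : R) : 0 < delta -> delta <= 1 -> exists T y0, [/\ 0 < T, 1 <= y0 &
  forall y, y0 <= y -> exists z, [/\ y <= z, z <= y * expR T & `|Er z| <= delta * z]].
Proof.
move=> d0 d1; have [M HMs] := sum_psi_err_bounded Lam_ge0 K0 Hpsi HM.
have M0 : 0 <= M by apply: le_trans (HMs 0%N); exact: normr_ge0.
have d20 : 0 < delta / 2 by lra.
have [y1 [y11 Hy1]] := psi_err_near d20.
(* Chosen so that [delta (T - 2)] exceeds [2 M]; the 2 pays for rounding at the lower end of the
   interval. *)
pose T := 2 * M / delta + 3.
have q0 : 0 <= 2 * M / delta by rewrite divr_ge0 ?mulr_ge0 //; lra.
have T0 : 0 < T by rewrite /T; lra.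
exists T, (y1 + 2 / delta); split => //.
  have q1 : 0 < 2 / delta by rewrite divr_gt0.
  lra.
move=> y yy; apply: contrapT => nz.
have dv : 0 < 2 / delta by rewrite divr_gt0.
have y1' : 1 <= y by lra. have y0 : 0 < y by lra.
have big z : y <= z -> z <= y * expR T -> delta * z < `|Er z|.
  by move=> z1 z2; rewrite ltNge; apply/negP => h; apply: nz; exists z.
pose A := Num.truncn y; pose B := Num.truncn (y * expR T).
have eT : 1 <= expR T by apply: le_trans (expR_ge1Dx _); lra.
have yT : 1 <= y * expR T by rewrite mulr_ege1.
have [A0 Ay yA] := truncn_bounds y1'. have [B0 By yB] := truncn_bounds yT.
rewrite -/A -/B in A0 Ay yA B0 By yB.
have mge m : (A < m)%N -> y <= m%:R by move=> am; apply: ltW; rewrite -truncn_lt_nat ?(ltW y0).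
have bigm m : (A < m <= B)%N -> delta * m%:R < `|Er m%:R|.
  move=> /andP[am mb]; apply: big.
    exact: mge.
  by rewrite -truncn_ge_nat // mulr_ge0 // ltW // expR_gt0.
(* A change of sign between [m] and [m + 1] needs a jump above [2 delta m], but [psi_err_near]
   allows at most [1 + delta m / 2], and [delta m >= 2]. *)
have pers m : (A < m)%N -> (m.+1 <= B)%N -> (0 < Er m%:R) = (0 < Er m.+1%:R).
  move=> am mb; have h1 := bigm m; have h2 := bigm m.+1.
  have {h1} := h1 _; rewrite am (ltnW mb) => /(_ isT) h1.
  have {h2} := h2 _; rewrite (ltn_trans am (ltnSn m)) mb => /(_ isT) h2.
  have ym := mge _ am.
  have := Hy1 m%:R m.+1%:R _ _ _; rewrite ler_nat leqnSn -[m.+1%:R]natr1.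
  have m1 : 2 <= delta * m%:R by rewrite mulrC -ler_pdivrMr //; lra.
  move: h1 h2; rewrite -[m.+1%:R]natr1; move: m1 ym; move: (m%:R : R) => b m1 ym h1 h2.
  move=> /(_ _ isT _)/wrap[]; [lra|lra|].
  move: h1 h2; move: (Er b) (Er (b + 1)) => u v.
  rewrite ler_norml => h1 h2 /andP[h3 h4].
  apply/idP/idP => p0; rewrite ltNge; apply/negP => n0.
    by move: h1; rewrite gtr0_norm // => h1; move: h2; rewrite ler0_norm //; lra.
  by move: h2; rewrite gtr0_norm // => h2; move: h1; rewrite ler0_norm //; lra.
have sgn m : (A.+1 <= m)%N -> (m <= B)%N -> (0 < Er m%:R) = (0 < Er A.+1%:R).
  elim: m => // m IH; rewrite leq_eqVlt => /orP[/eqP <- //|am] mb.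
  by rewrite -(pers m) // IH // ltnW.
pose g m := Er m%:R * (m%:R^-1 - m.+1%:R^-1).
have gm m : (0 < m)%N -> 0 < m%:R^-1 - m.+1%:R^-1 :> R.
  by move=> m0; rewrite subr_gt0 ltf_pV2 ?posrE ?ltr0n // ltr_nat.
pose sg : R := if 0 < Er A.+1%:R then 1 else -1.
have sgE m : (A < m <= B)%N -> sg * Er m%:R = `|Er m%:R|.
  move=> /andP[am mb]; rewrite /sg -(sgn m) //; case: ltP => h; first by rewrite gtr0_norm // mul1r.
  by rewrite ler0_norm // mulN1r.
have lower N : (A <= N)%N -> (N <= B)%N -> delta * (ln N.+2%:R - ln A.+2%:R) <= sg * (sumN g N - sumN g A).
  elim: N => [|N IH]; first by rewrite leqn0 => /eqP ->; rewrite !subrr !mulr0.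
  rewrite leq_eqVlt => /orP[/eqP ->|]; first by rewrite !subrr !mulr0.
  rewrite ltnS => AN NB; have := IH AN (ltnW NB); rewrite sumNS.
  have h := bigm N.+1; have {h} := h _; rewrite ltnS AN NB => /(_ isT) h.
  have n0 : (0 : R) < N.+1%:R by rewrite ltr0n.
  have : delta * (ln N.+3%:R - ln N.+2%:R) <= sg * g N.+1.
    rewrite /g mulrA sgE ?ltnS ?AN //.
    have /andP[_ l2] := @ln_natS R N.+2 (ltn0Sn _).
    apply: le_trans (ler_wpM2l (ltW d0) l2) _.
    apply: le_trans (ler_wpM2r (ltW (gm _ _)) (ltW h)) => //.
    rewrite -mulrA ler_wpM2l //; first exact: ltW.
    by rewrite -[N.+2%:R]natr1; move: n0; move: (N.+1%:R : R) => b b0; rewrite (_ : b * _ = (b + 1)^-1) //; field; lra.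
  move: (ln N.+3%:R) (ln N.+2%:R) (ln A.+2%:R) (g N.+1) (sumN _ _) (sumN _ _) => *; lra.
have AB : (A <= B)%N by apply: le_truncn; rewrite ler_peMr // ltW.
have := lower B AB (leqnn _).
have up : sg * (sumN g B - sumN g A) <= 2 * M.
  apply: le_trans (ler_norm _) _; rewrite normrM.
  have -> : `|sg| = 1 by rewrite /sg; case: ifP; rewrite ?normrN normr1.
  rewrite mul1r; apply: le_trans (ler_normB _ _) _.
  by have := HMs B; have := HMs A; rewrite /g; lra.
have l1 : ln y + T <= ln B.+2%:R.
  rewrite -[T]expRK -lnM ?posrE ?expR_gt0 // ler_ln ?posrE ?mulr_gt0 ?expR_gt0 ?ltr0n //.
  by apply: ltW; apply: lt_trans yB _; rewrite natr1 ltr_nat.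
have l2 : ln A.+2%:R <= ln y + 2.
  have yy2 : y <= y + 2 by lra.
  have /andP[_ h] := ln_sub_le y0 yy2.
  have h2 : (y + 2 - y) / y <= 2 by rewrite ler_pdivrMr //; lra.
  have h3 : ln A.+2%:R <= ln (y + 2) by rewrite ler_ln ?posrE ?ltr0n //; [rewrite -addn2 natrD; lra | lra].
  by move: h h2 h3; move: (ln A.+2%:R) (_ / y) => *; lra.
have : delta * (T - 2) <= delta * (ln B.+2%:R - ln A.+2%:R).
  by rewrite ler_pM2l //; move: l1 l2; move: (ln B.+2%:R) (ln A.+2%:R) => *; lra.
have -> : delta * (T - 2) = 2 * M + delta by rewrite /T; field; lra.
move: up; move: (ln B.+2%:R) (ln A.+2%:R) (sg * _) => *; lra.
Qed.

(** On the block [1/k >= 1/X], so the mass is at least the increment of the sum of [w] divided by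
    [X]; with the main term [2 X ln X] and [1/(1+eta) <= 1 - eta/2] this is [eta ln X] up to a
    constant. *)
Lemma selberg_weight_mass (eta : R) : 0 < eta -> eta <= 1 -> exists C, 0 <= C /\ forall X, 1 + eta <= X ->
  eta * ln X - C <= sumR (fun k => w k / k%:R) X - sumR (fun k => w k / k%:R) (X / (1 + eta)).
Proof.
move=> e0 e1; have [K2 [K20 HW]] := selberg_weight_sum Lam_ge0 K0 Hpsi HM HT.
exists (2 * K2); split; first by lra.
move=> X X1; have X0 : 0 < X by lra.
have e10 : 0 < 1 + eta by lra.
have Y1 : 1 <= X / (1 + eta) by rewrite ler_pdivlMr // mul1r.
have YX : X / (1 + eta) <= X by rewrite ler_pdivrMr // ler_peMr; lra.
have h1 : sumR (fun k => w k / k%:R - X^-1 * w k) (X / (1 + eta)) <= sumR (fun k => w k / k%:R - X^-1 * w k) X.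
  apply: le_sumNr; last exact: le_truncn.
  move=> n /andP[nx nX]; have n0 : (0 < n)%N by apply: leq_ltn_trans nx.
  have n0' : (0 : R) < n%:R by rewrite ltr0n.
  rewrite subr_ge0 mulrC ler_wpM2l ?selberg_weight_ge0 // lef_pV2 ?posrE //.
  by rewrite -truncn_ge_nat // ltW.
move: h1; rewrite !sumRB !sumRZ.
have := HW X; have := HW (X / (1 + eta)) Y1.
have -> : 1 <= X by lra. move=> h2 /(_ isT) h3.
have lX : 0 <= ln X by rewrite ln_ge0 //; lra.
have lYX : ln (X / (1 + eta)) <= ln X by rewrite ler_ln ?posrE // divr_gt0.
have main : eta * ln X - 2 * K2 <= X^-1 * (sumR w X - sumR w (X / (1 + eta))).
  rewrite [X^-1 * _]mulrC ler_pdivlMr //.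
  move: h2 h3; rewrite !ler_norml => /andP[_ h2] /andP[h3 _].
  have h4 : 2 * (X / (1 + eta)) * ln (X / (1 + eta)) <= 2 * (X / (1 + eta)) * ln X.
    by rewrite ler_wpM2l //; lra.
  have h5 : X / (1 + eta) <= X * (1 - eta / 2).
    by rewrite ler_pdivrMr // -mulrA ler_peMr //; nra.
  have h6 := ler_wpM2r lX h5.
  have h7 := ler_wpM2l K20 YX.
  move: h2 h3 h4 h6 h7; move: (sumR w X) (sumR w _) (ln X) (ln _) (X / _) => *; lra.
move: main; rewrite mulrBr; move: (sumR _ _) (sumR _ _) (_ * sumR _ _) (_ * sumR _ _) => *; lra.
Qed.

End SelbergEndgame.

(** * Lowering the bound on the error term *)

Section SelbergImprovement.
Variable R : realType.
Variables (Lam : nat -> R) (K : R).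
Hypothesis Lam_ge0 : forall n, 0 <= Lam n.
Hypothesis K0 : 0 <= K.
Local Notation psi := (psi Lam).
Local Notation Er := (psi_err Lam).
Local Notation w := (selberg_weight Lam).
Hypothesis Hpsi : forall x, 1 <= x -> psi x <= K * x.
Hypothesis HM : forall x, 1 <= x -> `|sumR (fun n => Lam n / n%:R) x - ln x| <= K.
Hypothesis HT : forall x, 1 <= x ->
  `|Er x * ln x + sumR (fun k => Lam k * Er (x / k%:R)) x| <= K * x.

Lemma sumN_subrange (D u : nat -> R) (b : R) N N' M' M :
  (N <= N')%N -> (N' <= M')%N -> (M' <= M)%N ->
  (forall k, (N < k <= M)%N -> 0 <= D k) -> (forall k, (N' < k <= M')%N -> b * u k <= D k) ->
  b * (sumN u M' - sumN u N') <= sumN D M - sumN D N.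
Proof.
move=> h1 h2 h3 D0 Du.
have g1 : sumN D M' <= sumN D M.
  by apply: le_sumNr => // k /andP[? ?]; apply: D0; rewrite (leq_ltn_trans _ (_ : M' < k)%N) // (leq_trans h1).
have g2 : sumN D N <= sumN D N'.
  by apply: le_sumNr => // k /andP[? ?]; apply: D0; apply/andP; split => //; apply: leq_trans h3; apply: leq_trans h2.
have g3 : sumN (fun k => D k - b * u k) N' <= sumN (fun k => D k - b * u k) M'.
  by apply: le_sumNr => // k hk; rewrite subr_ge0 Du.
move: g3; rewrite !sumNB !sumNZ; lra.
Qed.

(** [psi_err_small_value] gives a [z] with [Er z] small in a window of fixed ratio. By
    [psi_err_near], [Er] stays small on [[z, (1+eta) z]], and [X = x / z] carries this interval to
    the summation variable. The factor [expR 1], which is at least 2, makes room for twice [E] below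
    [X]. *)
Lemma psi_err_block (a0 : R) : 0 < a0 -> a0 <= 1 -> exists T Y0, [/\ 0 < T, 1 <= Y0 & forall x E,
  0 < E -> Y0 * (E * expR T * expR 1) <= x -> exists X, [/\ E * 2 <= X, X <= E * expR T * expR 1 &
    forall k, 0 < k -> X / (1 + a0 / 16) < k -> k <= X -> `|Er (x / k)| <= a0 / 2 * (x / k)]].
Proof.
(* For [y] in [[z, (1+eta) z]] one gets [|Er y| <= delta z + (y - z) + eta z <= 3/8 a0 z], below
   half of [a0 y]. *)
move=> a00 a01; pose delta := a0 / 4; pose eta := a0 / 16.
have d0 : 0 < delta by rewrite /delta; lra. have d1 : delta <= 1 by rewrite /delta; lra.
have e0 : 0 < eta by rewrite /eta; lra. have e1 : eta <= 1 by rewrite /eta; lra.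
have [T [y1 [T0 y11 Hz]]] := psi_err_small_value Lam_ge0 K0 Hpsi HM HT d0 d1.
have [y2 [y21 Hn]] := psi_err_near Lam_ge0 K0 Hpsi HM HT e0.
exists T, (y1 + y2); split => //; first by lra.
move=> x E E0 xE; pose E' := E * expR T * expR 1.
have E'0 : 0 < E' by rewrite !mulr_gt0 // expR_gt0.
have yY : y1 + y2 <= x / E' by rewrite ler_pdivlMr.
have [|z [z1 z2 z3]] := Hz (x / E'); first by clear -yY y21 Lam_ge0 K0 Hpsi HM HT; lra.
have z0 : 0 < z by clear -z1 yY y21 y11 Lam_ge0 K0 Hpsi HM HT; lra.
have ez : 1 + eta <= 2 by clear -e1 Lam_ge0 K0 Hpsi HM HT; lra.
have ep : 0 < 1 + eta by clear -e0 Lam_ge0 K0 Hpsi HM HT; lra.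
pose X := x / z.
have X1 : X <= E' by rewrite /X ler_pdivrMr // mulrC -ler_pdivrMr.
have ex2 : 2 <= expR 1 :> R by have := expR_ge1Dx (1 : R); clear -Lam_ge0 K0 Hpsi HM HT; lra.
have X2 : E * 2 <= X.
  rewrite /X ler_pdivlMr //; move: z2; rewrite mulrAC ler_pdivlMr // /E'.
  have -> : z * (E * expR T * expR 1) = (z * (E * expR 1)) * expR T by ring.
  rewrite ler_pM2r ?expR_gt0 // => h; apply: le_trans h; rewrite mulrC ler_wpM2l ?(ltW z0) //.
  by rewrite ler_wpM2l // ltW.
exists X; split => // k k0' Xk kX.
have g1 : z <= x / k by rewrite ler_pdivlMr // mulrC -ler_pdivlMr.
have g2 : x / k <= (1 + eta) * z.
  rewrite ler_pdivrMr //; move: Xk; rewrite ltr_pdivrMr // /X ltr_pdivrMr // => h.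
  by apply: ltW; apply: lt_le_trans h _; rewrite -/eta mulrAC mulrC [k * _]mulrC mulrA.
have g3 : x / k <= 2 * z by apply: le_trans g2 _; rewrite ler_pM2r.
have := Hn z (x / k) _ g1 g3 => /(_ _)/wrap[]; first by clear -z1 yY y11 Lam_ge0 K0 Hpsi HM HT; lra.
move: g1 g2; move: (x / k) => y' g1 g2 h.
have h1 : `|Er y'| <= `|Er y' - Er z| + `|Er z| by rewrite -{1}(subrK (Er z) (Er y')) ler_normD.
have h2 : a0 * z <= a0 * y' by rewrite ler_pM2l.
have h3 : 0 < a0 * z by rewrite mulr_gt0.
by move: h z3 g2 h1; rewrite /delta /eta; clear -h2 h3 Lam_ge0 K0 Hpsi HM HT; lra.
Qed.

(** The amount by which the term [k] in the sum of [psi_err_iterated], divided by [x], falls short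
    of its bound through [alp]. *)
Definition deficit (alp x : R) (k : nat) : R := w k / k%:R * (alp - `|Er (x / k%:R)| / (x / k%:R)).

(** Deficits are nonnegative by the assumed bound, and on the block of [psi_err_block] each is at
    least [a0/2] times [w k / k], whose mass [selberg_weight_mass] bounds below. *)
Lemma psi_err_gain (a0 : R) : 0 < a0 -> a0 <= 1 -> exists T C Y0, [/\ 0 < T, 0 <= C, 1 <= Y0 & forall alp x E,
  a0 <= alp -> 1 <= E -> Y0 * (E * expR T * expR 1) <= x ->
  (forall k : R, 0 < k -> k <= E * expR T * expR 1 -> `|Er (x / k)| <= alp * (x / k)) ->
  a0 / 2 * (a0 / 16 * ln E - C) <= sumR (deficit alp x) (E * expR T * expR 1) - sumR (deficit alp x) E].
Proof.
move=> a00 a01; pose eta := a0 / 16.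
have e0 : 0 < eta by rewrite /eta; lra. have e1 : eta <= 1 by rewrite /eta; lra.
have [T [Y0 [T0 Y01 HX]]] := psi_err_block a00 a01.
have [C [C0 Hm]] := selberg_weight_mass Lam_ge0 K0 Hpsi HM HT e0 e1.
exists T, C, Y0; split => // alp x E ale E1 xE Hk.
pose D := deficit alp x; rewrite -/D.
have E0 : 0 < E by clear -E1 Lam_ge0 K0 Hpsi HM HT; lra.
have E'0 : 0 < E * expR T * expR 1 by rewrite !mulr_gt0 ?expR_gt0.
have x0 : 0 < x by apply: lt_le_trans xE; rewrite mulr_gt0 //; clear -Y01 Lam_ge0 K0 Hpsi HM HT; lra.
have [X [X1 X2 HXk]] := HX x E E0 xE.
have ep : 0 < 1 + eta by clear -e0 Lam_ge0 K0 Hpsi HM HT; lra.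
have ep2 : 1 + eta <= 2 by clear -e1 Lam_ge0 K0 Hpsi HM HT; lra.
have X0 : 0 < X by clear -X1 E0 Lam_ge0 K0 Hpsi HM HT; lra.
have Xe : 1 + eta <= X by clear -X1 E1 ep2 Lam_ge0 K0 Hpsi HM HT; lra.
have u0 (k : nat) : (0 < k)%N -> 0 <= w k / k%:R by move=> k0; rewrite divr_ge0 // selberg_weight_ge0.
apply: le_trans (@sumN_subrange D (fun k => w k / k%:R) (a0 / 2) _ (Num.truncn (X / (1 + eta))) (Num.truncn X) _ _ _ _ _ _).
- rewrite ler_pM2l; last by clear -a00 Lam_ge0 K0 Hpsi HM HT; lra.
  apply: le_trans (Hm X Xe); rewrite lerD2r ler_pM2l // ler_ln ?posrE //.
  by clear -X1 E0 Lam_ge0 K0 Hpsi HM HT; lra.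
- by apply: le_truncn; rewrite ler_pdivlMr //; apply: le_trans X1; rewrite ler_pM2l.
- by apply: le_truncn; rewrite ler_pdivrMr // ler_peMr ?(ltW X0) //; clear -e0 Lam_ge0 K0 Hpsi HM HT; lra.
- exact: le_truncn.
- move=> k /andP[k1 k2]; have k0 : (0 < k)%N by apply: leq_ltn_trans k1.
  have k0' : (0 : R) < k%:R by rewrite ltr0n.
  rewrite mulr_ge0 ?u0 // subr_ge0 ler_pdivrMr ?divr_gt0 //; apply: Hk => //.
  by rewrite -truncn_ge_nat // ltW.
move=> k /andP[k1 k2]; have k0 : (0 < k)%N by apply: leq_ltn_trans k1.
have k0' : (0 : R) < k%:R by rewrite ltr0n.
rewrite /D /deficit mulrC ler_wpM2l ?u0 //.
have kX : k%:R <= X by rewrite -truncn_ge_nat // ltW.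
have Xk : X / (1 + eta) < k%:R by rewrite -truncn_lt_nat // ltW // divr_gt0.
have := HXk _ k0' Xk kX; rewrite -ler_pdivrMr ?divr_gt0 //.
by clear -ale Lam_ge0 K0 Hpsi HM HT; lra.
Qed.

(** The points [exp (j T')] cut the range into about [ln x / T'] blocks, and the gain on the [j]-th
    grows like its logarithm [j T']. The total is therefore quadratic in [ln x], of the order of the
    main term. It matters that [kap] is chosen before [alp]. *)
Lemma psi_err_gain_total (a0 : R) : 0 < a0 -> a0 <= 1 -> exists kap Y0, [/\ 0 < kap, 1 <= Y0 & forall alp Y,
  a0 <= alp -> Y0 <= Y -> (forall y, Y <= y -> `|Er y| <= alp * y) ->
  exists C, 0 <= C /\ forall x, C <= ln x -> exists E, [/\ 1 <= E, E <= x, x <= C * E &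
  2 * kap * ln x ^+ 2 - C * ln x <= sumR (deficit alp x) E]].
Proof.
move=> a00 a01; have [T [C [Y0 [T0 C0 Y01 HG]]]] := psi_err_gain a00 a01.
pose eta := a0 / 16; have e0 : 0 < eta by rewrite /eta; lra.
pose T' := T + 1; have T'0 : 0 < T' by rewrite /T'; lra.
have ET : expR T * expR 1 = expR T' :> R by rewrite -expRD.
(* Summing [a0/2 eta T' j] over [j < ln x / T'] gives [a0 eta / (4 T')] times [ln x ^ 2], which is
   [2 kap ln x ^ 2]. *)
exists (a0 * eta / (8 * T')), Y0; split => //; first by rewrite divr_gt0 // mulr_gt0.
move=> alp Y ale YY HY.
have Y1 : 1 <= Y by clear -YY Y01 Lam_ge0 K0 Hpsi HM HT; lra. have Y'0 : 0 < Y by clear -Y1 Lam_ge0 K0 Hpsi HM HT; lra.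
pose B := ln Y / T' + 1.
have lY : 0 <= ln Y by rewrite ln_ge0.
have B0 : 0 <= B by rewrite /B addr_ge0 // divr_ge0 // ltW.
pose C1 := (a0 / 2) * (eta * B + eta / 2 + C / T').
have C10 : 0 <= C1.
  have r1 : 0 <= eta * B by rewrite mulr_ge0 // ltW.
  have r2 : 0 <= C / T' by rewrite divr_ge0 // ltW.
  by rewrite /C1 mulr_ge0 //; clear -a00 r1 r2 e0 Lam_ge0 K0 Hpsi HM HT; lra.
have r4 : 0 <= Y * expR T' by rewrite mulr_ge0 ?expR_ge0 // ltW.
have q2 : 0 <= T' * B by apply: mulr_ge0 => //; exact: ltW.
exists (C1 + Y * expR T' + T' * B + ln Y); split; first by rewrite !addr_ge0.
move=> x; set l := ln x => ll.
have [l0 lTB lYl] : [/\ 0 <= l, T' * B <= l & ln Y <= l] by split; clear -ll C10 r4 q2 lY Lam_ge0 K0 Hpsi HM HT; lra.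
have x0 : 0 < x by rewrite ltNge; apply/negP => /ln0; rewrite -/l => l0'; move: lTB lYl; rewrite l0' /B mulrDr mulr1 mulrCA divff ?gt_eqF // mulr1; clear -T'0 lY Lam_ge0 K0 Hpsi HM HT; lra.
pose L := (l - ln Y) / T'.
have L0 : 0 <= L by rewrite /L divr_ge0 ?(ltW T'0) // subr_ge0.
pose J := Num.truncn L.
have JL : J%:R <= L by rewrite truncn_le.
have LJ : L < J%:R + 1 by rewrite natr1 truncnS_gt.
pose E (j : nat) : R := expR (j%:R * T').
have E1 j : 1 <= E j.
  by rewrite /E -[X in X <= _]expR0 ler_expR mulr_ge0 // ltW.
have ES j : E j.+1 = E j * expR T * expR 1 by rewrite /E -!expRD -natr1 /T'; congr expR; ring.
have Emono i j : (i <= j)%N -> E i <= E j by move=> ij; rewrite ler_expR ler_wpM2r ?ler_nat // ltW.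
have EJ : Y * E J <= x.
  rewrite /E -(lnK (x := Y)) ?posrE // -(lnK (x := x)) ?posrE // -expRD ler_expR.
  by move: JL; rewrite /L ler_pdivlMr // -/l; clear -Lam_ge0 K0 Hpsi HM HT; lra.
have EJ' : x <= Y * expR T' * E J.
  rewrite /E -(lnK (x := Y)) ?posrE // -{1}(lnK (x := x)) ?posrE // -!expRD ler_expR.
  by move: LJ; rewrite /L ltr_pdivrMr // -/l; clear -Lam_ge0 K0 Hpsi HM HT; lra.
have EJ0 : 0 < E J by apply: expR_gt0.
exists (E J); split => //.
- by apply: le_trans EJ; rewrite ler_peMl // ltW.
- apply: le_trans EJ' _; rewrite ler_pM2r //; clear -C10 q2 lY Lam_ge0 K0 Hpsi HM HT; lra.
pose D := deficit alp x; rewrite -/D.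
have Hk (j : nat) (k : R) : (j <= J)%N -> 0 < k -> k <= E j -> `|Er (x / k)| <= alp * (x / k).
  move=> jJ k0 kj; apply: HY; rewrite ler_pdivlMr //; apply: le_trans EJ; rewrite ler_pM2l //.
  by apply: le_trans kj _; apply: Emono.
have D0 : 0 <= sumR D (E 0%N).
  apply: sumN_ge0 => k hk; have [k0' kE _] := sumR_range hk; have /andP[k0 _] := hk.
  rewrite mulr_ge0 ?divr_ge0 ?selberg_weight_ge0 // subr_ge0 ler_pdivrMr ?divr_gt0 //.
  by apply: (Hk 0%N).
have lower j : (j <= J)%N -> a0 / 2 * (eta * T' * (j%:R * (j%:R - 1) / 2) - C * j%:R) <= sumR D (E j).
  elim: j => [|j IH] jJ; first by rewrite mul0r mul0r !mulr0 subrr mulr0.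
  have xE : Y0 * (E j * expR T * expR 1) <= x.
    apply: le_trans EJ; rewrite -ES; apply: ler_pM => //; first by apply: le_trans Y01.
      exact: expR_ge0.
    exact: Emono.
  have := HG alp x (E j) ale (E1 j) xE _ => /(_ _)/wrap[].
    by move=> k k0; rewrite -ES => kE; apply: Hk kE.
  have := IH (ltnW jJ); rewrite -ES /E expRK -/(E j) -/(E j.+1) -[j.+1%:R]natr1 -/D -/eta.
  move: (sumR D _) (sumR D _) (j%:R : R) => S1 S2 b; clear -Lam_ge0 K0 Hpsi HM HT; lra.
apply: le_trans (lower J (leqnn J)).
have JT : J%:R <= l / T'.
  by apply: le_trans JL _; rewrite /L ler_pM2r ?invr_gt0 //; clear -lY Lam_ge0 K0 Hpsi HM HT; lra.
have TJ : l / T' - B <= J%:R.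
  by move: LJ; rewrite /L /B mulrBl; clear -Lam_ge0 K0 Hpsi HM HT; lra.
have lB : B <= l / T' by rewrite ler_pdivlMr // mulrC.
have J2 : l / T' * (l / T') - 2 * B * (l / T') <= J%:R * J%:R.
  have : (l / T' - B) * (l / T' - B) <= J%:R * J%:R by apply: ler_pM => //; rewrite subr_ge0.
  have := mulr_ge0 B0 B0; clear -Lam_ge0 K0 Hpsi HM HT; lra.
have r6 : 0 <= (Y * expR T' + T' * B + ln Y) * l by rewrite mulr_ge0 // !addr_ge0.
apply: le_trans (_ : 2 * (a0 * eta / (8 * T')) * l ^+ 2 - C1 * l <= _); first by clear -r6 Lam_ge0 K0 Hpsi HM HT; lra.
have -> : 2 * (a0 * eta / (8 * T')) * l ^+ 2 - C1 * l =
   a0 / 2 * (eta * T' / 2 * (l / T' * (l / T') - 2 * B * (l / T')) - (eta * T' / 2 + C) * (l / T')).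
  by rewrite /C1; field; rewrite gt_eqF.
rewrite ler_pM2l; last by clear -a00 Lam_ge0 K0 Hpsi HM HT; lra.
have eT : 0 <= eta * T' / 2 by rewrite divr_ge0 // mulr_ge0 // ltW.
have h1 : eta * T' / 2 * (l / T' * (l / T') - 2 * B * (l / T')) <= eta * T' / 2 * (J%:R * J%:R).
  by rewrite ler_wpM2l.
have h2 : (eta * T' / 2 + C) * J%:R <= (eta * T' / 2 + C) * (l / T').
  by rewrite ler_wpM2l // addr_ge0.
by move: h1 h2; move: (l / T') (J%:R : R) => p j; clear -Lam_ge0 K0 Hpsi HM HT; lra.
Qed.

(** The gain [2 kap ln x ^ 2] enters [psi_err_iterated]: one half absorbs the errors linear in
    [ln x], the other lowers [alp]. As [kap] depends only on [eps], finitely many rounds bring [alp]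
    down to [eps]. *)
Lemma psi_err_improve (eps : R) : 0 < eps -> exists kap, 0 < kap /\ forall alp x0, eps <= alp ->
  (forall x, x0 <= x -> `|Er x| <= alp * x) ->
  exists x1, forall x, x1 <= x -> `|Er x| <= (alp - kap) * x.
Proof.
move=> eps0; pose a0 := Num.min eps 1.
have a00 : 0 < a0 by rewrite lt_min eps0 ltr01.
have a01 : a0 <= 1 by rewrite ge_min lexx orbT.
have a0e : a0 <= eps by rewrite ge_min lexx.
have [kap [Y0 [kap0 Y01 HG]]] := psi_err_gain_total a00 a01.
have [K2 [K20 HW]] := selberg_weight_sum Lam_ge0 K0 Hpsi HM HT.
have [K3 [K30 Hit]] := psi_err_iterated Lam_ge0 K0 HM HT.
have [K5 [K50 Hu]] := selberg_weight_sum_inv Lam_ge0 K0 Hpsi HM HT.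
clearbody a0; exists kap; split => // alp x0 ale Hx0.
pose Y := `|x0| + Y0.
have Yx0 : x0 <= Y by rewrite /Y; have := ler_norm x0; clear -Y01 Lam_ge0 K0 Hpsi HM HT; lra.
have Yy1 : Y0 <= Y by rewrite /Y; have := normr_ge0 x0; clear -Lam_ge0 K0 Hpsi HM HT; lra.
have alp0 : 0 <= alp by clear -ale eps0 Lam_ge0 K0 Hpsi HM HT; lra.
have [|//||C [C0 HC]] := HG alp Y; [by clear -ale a0e Lam_ge0 K0 Hpsi HM HT; lra| |].
  by move=> y Yy; apply: Hx0; apply: le_trans Yx0 Yy.
pose C2 := (K + 1) * (C * (2 + K2)).
have C20 : 0 <= C2 by rewrite !mulr_ge0 // addr_ge0.
pose C' := alp * K5 + C + C2 + K3.
have C'0 : 0 <= C' by rewrite /C' !addr_ge0 // mulr_ge0.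
have q1 : 0 <= 2 * C' / kap by apply: divr_ge0; [exact: mulr_ge0 | exact: ltW].
exists (expR (1 + 2 * C' / kap + C)) => x xl.
pose l := ln x; have ll : 1 + 2 * C' / kap + C <= l by apply: ln_ge_expR.
have x1 : 1 <= x by apply: le_trans xl; apply: le_trans (expR_ge1Dx _); clear -q1 C0 Lam_ge0 K0 Hpsi HM HT; lra.
have xp : 0 < x by clear -x1 Lam_ge0 K0 Hpsi HM HT; lra.
have l0 : 0 <= l by rewrite ln_ge0.
have [|E [E1 Ex xE LB]] := HC x; first by clear -ll q1 l Lam_ge0 K0 Hpsi HM HT; rewrite -/l; lra.
have E0 : 0 < E by clear -E1 Lam_ge0 K0 Hpsi HM HT; lra.
pose u k := w k / k%:R.
pose V y := `|Er y| / y.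
pose D := deficit alp x.
move: LB; rewrite -/l -/D => LB.
have u0 k : (0 < k)%N -> 0 <= u k by move=> k0; rewrite divr_ge0 // selberg_weight_ge0.
have trx : (Num.truncn E <= Num.truncn x)%N by apply: le_truncn.
have main : sumR (fun k => u k * V (x / k%:R)) E <=
    alp * (l ^+ 2 + K5 * (1 + l)) - (2 * kap * l ^+ 2 - C * l).
  have -> : sumR (fun k => u k * V (x / k%:R)) E = alp * sumR u E - sumR D E.
    by rewrite -sumRZ -sumRB; apply: eq_sumN => k _; rewrite /D /deficit /u /V; ring.
  apply: lerB => //; rewrite ler_wpM2l //; apply: le_trans (Hu x x1).
  by apply: le_sumNr => // k /andP[k0 _]; apply: u0; apply: leq_ltn_trans k0.
(* Between [E] and [x] the ratio is at most [C], so the trivial bound on [Er] costs only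
   [O(1 + ln x)]. *)
have rest : sumR (fun k => u k * V (x / k%:R)) x - sumR (fun k => u k * V (x / k%:R)) E <= C2 * (1 + l).
  have hw : sumR w x <= (2 + K2) * (1 + l) * x.
    have := HW x x1; rewrite ler_norml => /andP[_]; rewrite -/l.
    have := mulr_ge0 K20 (mulr_ge0 l0 (ltW xp)); clear -xp Lam_ge0 K0 Hpsi HM HT; lra.
  have h1 : sumR (fun k => (K + 1) * (w k / E) - u k * V (x / k%:R)) E <=
            sumR (fun k => (K + 1) * (w k / E) - u k * V (x / k%:R)) x.
    apply: le_sumNr => // k /andP[k1 k2]; have k0 : (0 < k)%N by apply: leq_ltn_trans k1.
    have k0' : (0 : R) < k%:R by rewrite ltr0n.
    have kx : k%:R <= x by rewrite -truncn_ge_nat // ltW.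
    have xk1 : 1 <= x / k%:R by rewrite ler_pdivlMr // mul1r.
    have xk0 : 0 < x / k%:R by rewrite divr_gt0.
    have Ek : E <= k%:R by apply: ltW; rewrite -truncn_lt_nat // ltW.
    rewrite subr_ge0 mulrC; apply: ler_pM.
    - by rewrite divr_ge0 // ltW.
    - exact: u0.
    - by rewrite ler_pdivrMr //; apply: (psi_err_abs Lam_ge0 K0 Hpsi).
    by rewrite ler_wpM2l ?selberg_weight_ge0 // lef_pV2 ?posrE.
  move: h1; rewrite !sumRB !sumRZ !sumRZr => h1.
  have s0 : 0 <= (K + 1) * (sumR w E / E).
    rewrite mulr_ge0 ?divr_ge0 ?addr_ge0 ?ler01 ?(ltW E0) //.
    by apply: sumN_ge0 => k /andP[k0 _]; apply: selberg_weight_ge0.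
  have h3 : (K + 1) * (sumR w x / E) <= C2 * (1 + l).
    rewrite /C2 -mulrA ler_wpM2l ?addr_ge0 // ler_pdivrMr //; apply: le_trans hw _.
    have -> : C * (2 + K2) * (1 + l) * E = (2 + K2) * (1 + l) * (C * E) by ring.
    by rewrite ler_wpM2l // mulr_ge0 // addr_ge0.
  move: h1 s0 h3; move: (sumR _ _) (sumR _ _) ((K + 1) * _) ((K + 1) * _) => *; lra.
have fin : `|Er x| * l ^+ 2 <= x * (alp * l ^+ 2 - 2 * kap * l ^+ 2 + C' * (1 + l)).
  apply: le_trans (Hit x x1) _.
  have -> : sumR (fun k => w k * `|Er (x / k%:R)|) x = x * sumR (fun k => u k * V (x / k%:R)) x.
    rewrite -sumRZ; apply: eq_sumR => k _ k0 _; rewrite /u /V; field.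
    by rewrite !gt_eqF.
  rewrite -/l -mulrA mulrCA -mulrDr ler_pM2l //.
  move: main rest; rewrite /C'; have := mulr_ge0 C0 l0.
  move: (sumR _ _) (sumR _ _) (l ^+ 2) => S1 S2 l2; clear -C0 Lam_ge0 K0 Hpsi HM HT; lra.
have l1 : 1 <= l by clear -ll q1 C0 Lam_ge0 K0 Hpsi HM HT; lra.
have l20 : 0 < l ^+ 2 by rewrite exprn_gt0 //; clear -l1 Lam_ge0 K0 Hpsi HM HT; lra.
rewrite -(ler_pM2r l20); apply: le_trans fin _.
rewrite [X in _ <= X]mulrAC -[X in _ <= X]mulrC ler_pM2l //.
have : C' * (1 + l) <= kap * l ^+ 2.
  have h1 : 2 * C' <= kap * l by rewrite [kap * l]mulrC -ler_pdivrMr //; clear -ll C0 Lam_ge0 K0 Hpsi HM HT; lra.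
  have h2 : C' * (1 + l) <= C' * (2 * l) by rewrite ler_wpM2l //; clear -l1 Lam_ge0 K0 Hpsi HM HT; lra.
  have h3 : 2 * C' * l <= kap * l * l by rewrite ler_wpM2r.
  by move: h2 h3; rewrite expr2; clear -Lam_ge0 K0 Hpsi HM HT; lra.
clear -Lam_ge0 K0 Hpsi HM HT; lra.
Qed.

Lemma psi_err_small (eps : R) : 0 < eps -> exists x0, forall x, x0 <= x -> `|Er x| <= eps * x.
Proof.
move=> e0; have [kap [k0 H]] := psi_err_improve e0.
have step n : exists x0, forall x, x0 <= x -> `|Er x| <= Num.max eps (K + 1 - n%:R * kap) * x.
  elim: n => [|n [x0 IH]].
    exists 1 => x x1; apply: le_trans (psi_err_abs Lam_ge0 K0 Hpsi x1) _.
    by rewrite ler_wpM2r //; [lra | rewrite mul0r subr0 le_max lexx orbT].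
  have [|x1 Hx1] := H _ _ _ IH; first by rewrite le_max lexx.
  exists (Num.max 0 x1) => x; rewrite ge_max => /andP[x00 xx]; apply: le_trans (Hx1 x xx) _.
  rewrite ler_wpM2r // -natr1 mulrDl mul1r; case: (leP eps (K + 1 - n%:R * kap)) => h.
    by rewrite le_max; apply/orP; right; lra.
  by rewrite le_max; apply/orP; left; lra.
have [x0 Hx0] := step (Num.truncn ((K + 1) / kap)).+1.
exists (Num.max 0 x0) => x; rewrite ge_max => /andP[x00 xx]; apply: le_trans (Hx0 x xx) _.
rewrite ler_wpM2r // ge_max lexx /=.
have := @truncnS_gt _ ((K + 1) / kap); rewrite ltr_pdivrMr //; lra.
Qed.

End SelbergImprovement.

(** * From weighted sums to counting primes *)

Section PrimeCounting.
Variable R : realType.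

Lemma selberg_pnt (Lam a : nat -> R) (c s K : R) :
  (forall n, 0 <= Lam n) -> a 1%N = 1 ->
  (forall n, (0 < n)%N -> a n * ln n%:R = dconv Lam a n) ->
  0 < c -> 0 < s -> s < 1 -> 0 <= K ->
  (forall N, `|sumN a N - c * N%:R| <= K * N%:R `^ s) ->
  forall eps, 0 < eps -> exists x0, forall x, x0 <= x -> `|sumR Lam x - x| <= eps * x.
Proof.
move=> L0 a1 aln c0 s0 s1 K0 cnt eps e0.
have [K1 [K10 H1]] := selberg_formula L0 a1 aln c0 s0 s1 K0 cnt.
have [M [M0 H2]] := mertens_Lam L0 a1 aln c0 s0 s1 K0 cnt.
apply: (@psi_err_small R Lam (K1 + M)) => //; first exact: addr_ge0.
- move=> x x1; have [h _] := H1 x x1; apply: le_trans h _.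
  by rewrite ler_wpM2r ?lerDl //; lra.
- by move=> x x1; apply: le_trans (H2 x x1) _; rewrite lerDr.
by move=> x x1; have [_ h] := H1 x x1; apply: le_trans h _; rewrite ler_wpM2r ?lerDl //; lra.
Qed.

Lemma powR_little_o (r eps K : R) : r < 1 -> 0 < eps -> exists x0, 1 <= x0 /\ forall x, x0 <= x -> K * x `^ r <= eps * x.
Proof.
move=> r1 e0; have r1' : 0 < 1 - r by lra.
exists (Num.max 1 ((`|K| / eps) `^ (1 - r)^-1)); rewrite le_max lexx; split => // x.
rewrite ge_max => /andP[x1 xK]; have x0 : 0 < x by lra.
have h : `|K| / eps <= x `^ (1 - r).
  have := @ge0_ler_powR R (1 - r) (ltW r1') _ _ _ _ xK; rewrite !nnegrE powR_ge0 (ltW x0) => /(_ isT isT).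
  by rewrite -powRrM mulVf ?gt_eqF // powRr1 // divr_ge0 // ltW.
rewrite (_ : eps * x = eps * x `^ (1 - r) * x `^ r).
  rewrite ler_wpM2r ?powR_ge0 //; apply: le_trans (ler_norm K) _.
  by rewrite mulrC -ler_pdivrMr.
by rewrite -mulrA -powRD_gt0 // subrK powRr1 // ltW.
Qed.

Definition sum_primes (r : nat -> R) (x : R) : R := sumR (fun n => if prime n then r n else 0) x.

(** A proper power [p^k <= x] has [p <= sqrt x], and [k <= 2 ln x] because [ln 2 >= 1/2]. Summing
    [B ln x] over all such pairs and bounding each logarithm by [8 x^(1/8)] gives [O(x^(3/4))]. *)
Lemma sum_nonprime_prime_powers (Lam : nat -> R) (B : R) : 0 <= B ->
  (forall n, 0 <= Lam n) -> (forall n, Lam n != 0 -> exists p k, prime p /\ n = (p ^ k)%N) ->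
  (forall n, (0 < n)%N -> Lam n <= B * ln n%:R) ->
  forall eps, 0 < eps -> exists x0, forall x, x0 <= x -> sumR (fun n => if prime n then 0 else Lam n) x <= eps * x.
Proof.
move=> B0 L0 Lpp LB eps e0.
have r1 : 3 / 4 < 1 :> R by lra.
have [x0 [x01 Hx0]] := powR_little_o (B * (24 * 8)) r1 e0.
exists x0 => x xx; apply: le_trans (Hx0 x xx); have x1 : 1 <= x by lra.
have xp : 0 < x by lra.
have lx : 0 <= ln x by rewrite ln_ge0.
pose N := Num.truncn x; have [N0 Nx xN] := truncn_bounds x1; rewrite -/N in N0 Nx xN.
pose Q := Num.truncn (x `^ 2^-1); pose L := Num.truncn (2 * ln x).
have x2 : 1 <= x `^ 2^-1 by apply: powR_ge1 => //; lra.
have ln2 : 1 / 2 <= ln (2 : R).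
  have := @ln_sub_ge R 1 2 ltr01; rewrite ln1 subr0 => h.
  by apply: le_trans (h _); lra.
have key n : (0 < n <= N)%N -> (if prime n then 0 else Lam n) <=
    \sum_(1 <= b < Q.+1) \sum_(0 <= k < L.+1) (b ^ k == n)%N%:R * (B * ln x).
  move=> /andP[n0 nN].
  have t0 b k : 0 <= (b ^ k == n)%N%:R * (B * ln x) :> R by rewrite !mulr_ge0.
  have s0 : 0 <= \sum_(1 <= b < Q.+1) \sum_(0 <= k < L.+1) (b ^ k == n)%N%:R * (B * ln x).
    by apply: sumr_ge0 => b _; apply: sumr_ge0.
  case: ifPn => // np; have [->//|nz] := eqVneq (Lam n) 0.
  have [p [k [pp En]]] := Lpp n nz.
  have nx : n%:R <= x by rewrite (le_trans _ Nx) // ler_nat.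
  have kL : (k <= L)%N.
    rewrite truncn_ge_nat ?mulr_ge0 //.
    have : k%:R * ln 2 <= ln x.
      apply: le_trans (_ : k%:R * ln p%:R <= _).
        by rewrite ler_wpM2l // ler_ln ?posrE ?ltr0n ?prime_gt0 // ler_nat prime_gt1.
      rewrite mulr_natl -lnXn ?ltr0n ?prime_gt0 // -natrX -En ler_ln ?posrE // ltr0n //.
    have : k%:R * (1 / 2) <= k%:R * ln (2 : R) by rewrite ler_wpM2l.
    lra.
  have pQ : (p <= Q)%N.
    rewrite truncn_ge_nat ?powR_ge0 //.
    have k2 : (1 < k)%N.
      case: (k) En => [|[|//]] En; last by move: np; rewrite En expn1 pp.
      by move: nz (LB n n0) (L0 n); rewrite En expn0 ln1 mulr0 => nz h1 h2; rewrite eq_le h1 h2 in nz.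
    have : (p ^ 2)%N%:R <= x.
      by apply: le_trans nx; rewrite ler_nat En leq_pexp2l ?prime_gt0.
    rewrite natrX => h; have := @ge0_ler_powR R 2^-1 _ _ _ _ _ h.
    rewrite !nnegrE exprn_ge0 ?ler0n // (ltW xp) => /(_ _ isT isT)/wrap[]; first by lra.
    by rewrite -powR_mulrn ?ler0n // -powRrM mulfV ?pnatr_eq0 // powRr1 ?ler0n.
  rewrite (bigD1_seq p) ?mem_index_iota ?iota_uniq ?prime_gt0 //= (bigD1_seq k) ?mem_index_iota ?iota_uniq //=.
  rewrite -En eqxx mul1r -addrA; apply: le_trans (LB n n0) _; rewrite -[X in X <= _]addr0 lerD //.
    by rewrite ler_wpM2l // ler_ln ?posrE ?ltr0n.
  by rewrite addr_ge0 //; apply: sumr_ge0 => b _ //; apply: sumr_ge0.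
apply: le_trans (le_sumN key) _.
rewrite /sumN exchange_big /=.
apply: le_trans (_ : \sum_(1 <= b < Q.+1) \sum_(0 <= k < L.+1) B * ln x <= _).
  apply: ler_sum => b _; rewrite exchange_big /=; apply: ler_sum => k _.
  rewrite -mulr_suml ler_piMl ?mulr_ge0 //.
  rewrite -natr_sum -[X in _ <= X]/(1%:R) ler_nat.
  have [/andP[h1 h2]|h] := boolP (1 <= b ^ k < N.+1)%N.
    rewrite (bigD1_seq (b ^ k)%N) ?mem_index_iota ?iota_uniq ?h1 //= eqxx big1 // => i /negbTE.
    by rewrite eq_sym => ->.
  rewrite big_nat_cond big1 // => i /andP[hi _]; case: eqP => // E; by rewrite E hi in h.
under eq_bigr do rewrite sumr_const_nat subn0 -mulr_natr.
rewrite sumr_const_nat subn1 /= -mulr_natr.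
have hQ : Q%:R <= x `^ 2^-1 by rewrite truncn_le powR_ge0.
have h8 : ln x <= 8 * x `^ 8^-1 by have := @ln_le_powR R x 8^-1 _ x1; rewrite invrK mulrC; apply; lra.
have x8 : 1 <= x `^ 8^-1 by apply: powR_ge1 => //; lra.
have hL : L.+1%:R <= 3 * (8 * x `^ 8^-1).
  rewrite -natr1; have : L%:R <= 2 * ln x by rewrite truncn_le mulr_ge0.
  lra.
have E34 : x `^ (3 / 4) = x `^ 2^-1 * (x `^ 8^-1 * x `^ 8^-1).
  by rewrite -!powRD_gt0 //; congr (_ `^ _); lra.
rewrite E34.
have g1 : L.+1%:R * ln x <= 3 * (8 * x `^ 8^-1) * (8 * x `^ 8^-1) by apply: ler_pM.
have g2 : Q%:R * (L.+1%:R * ln x) <= x `^ 2^-1 * (3 * (8 * x `^ 8^-1) * (8 * x `^ 8^-1)).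
  by apply: ler_pM => //; rewrite mulr_ge0.
rewrite mul1r (_ : _ *+ Q = B * (Q%:R * (L.+1%:R * ln x))); last by rewrite -mulr_natr; ring.
apply: le_trans (ler_wpM2l B0 g2) _; move: (x `^ _) (x `^ _) => u v; clear; lra.
Qed.

(** As [ln p <= ln x], the product of [ln x] with the count majorizes the weighted sum directly,
    without partial summation. *)
Lemma prime_count_lower (Lam r : nat -> R) (B : R) : 0 <= B ->
  (forall n, 0 <= Lam n) -> (forall n, Lam n != 0 -> exists p k, prime p /\ n = (p ^ k)%N) ->
  (forall n, (0 < n)%N -> Lam n <= B * ln n%:R) ->
  (forall p, prime p -> Lam p <= r p * ln p%:R) -> (forall p, 0 <= r p) ->
  (forall eps, 0 < eps -> exists x0, forall x, x0 <= x -> `|sumR Lam x - x| <= eps * x) ->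
  forall eps, 0 < eps -> exists x0, forall x, x0 <= x -> (1 - eps) * x <= ln x * sum_primes r x.
Proof.
move=> B0 L0 Lpp LB Lr r0 Hpsi eps e0; have e2 : 0 < eps / 2 by lra.
have [x1 H1] := Hpsi _ e2; have [x2 H2] := sum_nonprime_prime_powers B0 L0 Lpp LB e2.
exists (Num.max x1 x2) => x; rewrite ge_max => /andP[h1 h2].
have E : sumR Lam x = sumR (fun n => if prime n then Lam n else 0) x + sumR (fun n => if prime n then 0 else Lam n) x.
  by rewrite -sumRD; apply: eq_sumR => n _ _ _; case: ifP; rewrite ?addr0 ?add0r.
have h3 : sumR (fun n => if prime n then Lam n else 0) x <= ln x * sum_primes r x.
  rewrite /sum_primes -sumRZ; apply: le_sumR => n n0 n0' xn; case: ifP => pn; last by rewrite mulr0.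
  have nx : n%:R <= x by move: xn; rewrite ler_pdivlMr // mul1r.
  by apply: le_trans (Lr n pn) _; rewrite mulrC ler_wpM2r // ler_ln ?posrE // (lt_le_trans n0').
have := H1 x h1; have := H2 x h2; rewrite E ler_norml => h4 /andP[h5 _]; lra.
Qed.

Lemma sumN_indicator_le (y : R) N : 0 <= y -> sumN (fun n => ((n%:R <= y)%R)%:R) N <= y.
Proof.
move=> y0; elim: N => [|N IH]; first by rewrite sumN0.
rewrite sumNS; have [h|h] := boolP (N.+1%:R <= y); last by rewrite addr0.
apply: le_trans h; rewrite -natr1 lerD2r.
apply: le_trans (_ : sumN (fun=> 1) N <= _); last by rewrite sumN_const mul1r.
by apply: le_sumN => n _; rewrite lern1 leq_b1.
Qed.

(** Primes above [x^(1-e)] have logarithm at least [(1-e) ln x]; those below are at most [x^(1-e)]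
    in number, which is negligible. *)
Lemma prime_count_upper (Lam : nat -> R) :
  (forall n, 0 <= Lam n) -> (forall p, prime p -> ln p%:R <= Lam p) ->
  (forall eps, 0 < eps -> exists x0, forall x, x0 <= x -> `|sumR Lam x - x| <= eps * x) ->
  forall eps, 0 < eps -> exists x0, forall x, x0 <= x -> ln x * sum_primes (fun=> 1) x <= (1 + eps) * x.
Proof.
move=> L0 Lp Hpsi eps' e'0; pose eps := Num.min eps' 1.
have eps0 : 0 < eps by rewrite lt_min e'0 ltr01.
have eps1 : eps <= 1 by rewrite ge_min lexx orbT.
have epse : eps <= eps' by rewrite ge_min lexx.
clearbody eps; pose e := eps / 8; have e0 : 0 < e by rewrite /e; lra.
have [x1 H1] := Hpsi _ e0.
have r1 : 1 - e / 2 < 1 by lra.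
have [x2 [x21 H2]] := powR_little_o (2 / e) r1 e0.
exists (Num.max x1 x2) => x; rewrite ge_max => /andP[h1 h2].
have xx1 : 1 <= x by lra. have x0 : 0 < x by lra.
have lx : 0 <= ln x by rewrite ln_ge0.
have e1 : e < 1 by rewrite /e; lra.
pose y := x `^ (1 - e).
have y0 : 0 < y by rewrite powR_gt0.
have ly : ln y = (1 - e) * ln x by rewrite ln_powR.
have h3 : (1 - e) * ln x * sum_primes (fun=> 1) x <= sumR Lam x + (1 - e) * ln x * y.
  apply: le_trans (_ : sumR (fun n => Lam n + (1 - e) * ln x * ((n%:R <= y)%R)%:R) x <= _); last first.
    rewrite sumRD sumRZ lerD2l ler_wpM2l ?mulr_ge0 ?subr_ge0 ?(ltW e1) //.
    by apply: sumN_indicator_le; exact: ltW.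
  have c0 : 0 <= (1 - e) * ln x by rewrite mulr_ge0 // subr_ge0 ltW.
  rewrite /sum_primes -sumRZ; apply: le_sumR => n n0 n0' xn; case: ifP => pn; last first.
    by rewrite mulr0 addr_ge0 // mulr_ge0.
  case: (leP n%:R y) => ny; first by rewrite lerDr.
  rewrite mulr0 addr0 mulr1 -ly; apply: le_trans (Lp n pn).
  by rewrite ler_ln ?posrE // ltW.
have h4 : ln x * y <= e * x.
  apply: le_trans (H2 x h2); rewrite /y (_ : 1 - e / 2 = e / 2 + (1 - e)); last by lra.
  rewrite (powRD_gt0 (e / 2) (1 - e) x0) mulrA ler_wpM2r ?powR_ge0 //.
  have e20 : 0 < e / 2 by lra.
  by have := ln_le_powR e20 xx1; rewrite invfM invrK mulrC [_^-1 * _]mulrC.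
have := H1 x h1; rewrite ler_norml => /andP[_ h5].
have h6 : (1 - e) * (ln x * sum_primes (fun=> 1) x) <= (1 - e) * ((1 + eps') * x).
  rewrite mulrA; apply: le_trans h3 _.
  have h7 : (1 - e) * (ln x * y) <= 1 * (e * x).
    by apply: ler_pM => //; rewrite ?mulr_ge0 ?(ltW y0) // ?subr_ge0 ?(ltW e1) //; lra.
  have h8 : 1 + e + e <= (1 - e) * (1 + eps').
    apply: le_trans (_ : (1 - e) * (1 + eps) <= _); last by rewrite ler_wpM2l //; lra.
    have : eps * eps <= eps * 1 by rewrite ler_pM2l.
    rewrite /e; lra.
  have := ler_wpM2r (ltW x0) h8; lra.
by move: h6; rewrite ler_pM2l // subr_gt0.
Qed.

End PrimeCounting.

(** * Ideals of index prime to the discriminant *)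

Section Ideals.
Local Open Scope classical_set_scope.
Variable O : comNzRingType.
Implicit Types (M N P Q J L : set O) (x y z : O).

Definition is_ideal M := [/\ M 0, (forall x y, M x -> M y -> M (x + y)) & (forall a x, M x -> M (a * x))].
Definition principal x : set O := [set y | exists a, y = x * a].
Definition ideal_prod M N : set O :=
  [set x | exists2 s : seq (O * O), (forall u, u \in s -> M u.1 /\ N u.2) & x = \sum_(u <- s) u.1 * u.2].
Definition ideal_exp M k : set O := iter k (ideal_prod M) setT.

Lemma ideal0 M : is_ideal M -> M 0. Proof. by case. Qed.
Lemma idealD M x y : is_ideal M -> M x -> M y -> M (x + y). Proof. by case=> _ h _; apply: h. Qed.
Lemma idealMl M a x : is_ideal M -> M x -> M (a * x). Proof. by case=> _ _ h; apply: h. Qed.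
Lemma idealMr M a x : is_ideal M -> M x -> M (x * a). Proof. by rewrite mulrC; apply: idealMl. Qed.
Lemma idealN M x : is_ideal M -> M x -> M (- x).
Proof. by move=> iM Mx; rewrite -mulN1r; apply: idealMl. Qed.
Lemma idealB M x y : is_ideal M -> M x -> M y -> M (x - y).
Proof. by move=> iM Mx My; apply: idealD => //; apply: idealN. Qed.
Lemma idealB_sym M x y : is_ideal M -> M (x - y) -> M (y - x).
Proof. by move=> iM Mx; rewrite -opprB; apply: idealN. Qed.
Lemma idealB_trans M x y z : is_ideal M -> M (x - y) -> M (y - z) -> M (x - z).
Proof. by move=> iM h1 h2; rewrite (_ : x - z = (x - y) + (y - z)); [apply: idealD|rewrite addrA subrK]. Qed.
Lemma ideal_sum M (I : Type) (r : seq I) (Pr : pred I) (F : I -> O) :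
  is_ideal M -> (forall i, Pr i -> M (F i)) -> M (\sum_(i <- r | Pr i) F i).
Proof. by move=> iM h; apply: (big_ind M) => //; [exact: ideal0|move=> *; apply: idealD]. Qed.
Lemma idealT : is_ideal setT. Proof. by []. Qed.

Lemma ideal_eqT M : is_ideal M -> M 1 -> M = setT.
Proof. by move=> iM M1; apply/seteqP; split => // x _; rewrite -[x]mulr1; apply: idealMl. Qed.

Lemma principal_ideal x : is_ideal (principal x).
Proof.
split; first by exists 0; rewrite mulr0.
  by move=> _ _ [a ->] [b ->]; exists (a + b); rewrite mulrDr.
by move=> a _ [b ->]; exists (a * b); rewrite mulrCA.
Qed.

Lemma principal_self x : principal x x. Proof. by exists 1; rewrite mulr1. Qed.

Lemma principal_sub M x : is_ideal M -> M x -> principal x `<=` M.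
Proof. by move=> iM Mx _ [a ->]; apply: idealMr. Qed.

Lemma ideal_prod_mul M N x y : M x -> N y -> ideal_prod M N (x * y).
Proof. by move=> Mx Ny; exists [:: (x, y)]; rewrite ?big_seq1 // => u; rewrite inE => /eqP ->. Qed.

Lemma ideal_prod_ideal M N : is_ideal M -> is_ideal (ideal_prod M N).
Proof.
move=> iM; split; first by exists [::]; rewrite ?big_nil.
  move=> x y [s hs ->] [t ht ->]; exists (s ++ t); rewrite ?big_cat // => u.
  by rewrite mem_cat => /orP[/hs|/ht].
move=> a x [s hs ->]; exists [seq (a * u.1, u.2) | u <- s].
  by move=> _ /mapP[u us ->] /=; have [? ?] := hs u us; split => //; apply: idealMl.
by rewrite big_map mulr_sumr; apply: eq_bigr => u _; rewrite mulrA.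
Qed.

Lemma ideal_prod_min M N J : is_ideal J -> (forall x y, M x -> N y -> J (x * y)) -> ideal_prod M N `<=` J.
Proof.
move=> iJ h x [s hs ->]; rewrite big_seq_cond; apply: ideal_sum => // u /andP[us _].
by have [? ?] := hs u us; apply: h.
Qed.

Lemma ideal_prodC M N : ideal_prod M N = ideal_prod N M.
Proof.
have h A B : ideal_prod A B `<=` ideal_prod B A.
  move=> x [s hs ->]; exists [seq (u.2, u.1) | u <- s].
    by move=> _ /mapP[u us ->] /=; have [? ?] := hs u us.
  by rewrite big_map; apply: eq_bigr => u _; rewrite mulrC.
by apply/seteqP; split; apply: h.
Qed.

Lemma ideal_prodS M M' N N' : M `<=` M' -> N `<=` N' -> ideal_prod M N `<=` ideal_prod M' N'.
Proof. by move=> h h' x [s hs ->]; exists s => // u us; have [/h ? /h' ?] := hs u us. Qed.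

Lemma ideal_prodA M N P : is_ideal M -> is_ideal N -> is_ideal P ->
  ideal_prod M (ideal_prod N P) = ideal_prod (ideal_prod M N) P.
Proof.
have h A B C : is_ideal A -> is_ideal B -> is_ideal C ->
    ideal_prod A (ideal_prod B C) `<=` ideal_prod (ideal_prod A B) C.
  move=> iA iB iC; have iAB : is_ideal (ideal_prod A B) by apply: ideal_prod_ideal.
  apply: ideal_prod_min; first exact: ideal_prod_ideal.
  move=> x y Ax [s hs ->]; rewrite mulr_sumr big_seq_cond; apply: ideal_sum => [|u /andP[us _]].
    exact: ideal_prod_ideal.
  by have [? ?] := hs u us; rewrite mulrA; apply: ideal_prod_mul => //; apply: ideal_prod_mul.
move=> iM iN iP; apply/seteqP; split; first exact: h.
rewrite ideal_prodC [X in _ `<=` X]ideal_prodC (ideal_prodC M) (ideal_prodC N P).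
exact: h.
Qed.

Lemma ideal_prod_subl M N : is_ideal M -> ideal_prod M N `<=` M.
Proof. by move=> iM; apply: ideal_prod_min => // x y Mx _; apply: idealMr. Qed.

Lemma ideal_prod_subr M N : is_ideal N -> ideal_prod M N `<=` N.
Proof. by move=> iN; apply: ideal_prod_min => // x y _ Ny; apply: idealMl. Qed.

Lemma ideal_prodT M : is_ideal M -> ideal_prod M setT = M.
Proof.
move=> iM; apply/seteqP; split; first exact: ideal_prod_subl.
by move=> x Mx; rewrite -[x]mulr1; apply: ideal_prod_mul.
Qed.

Lemma ideal_prod1 M : is_ideal M -> ideal_prod setT M = M.
Proof. by move=> iM; rewrite ideal_prodC ideal_prodT. Qed.

Lemma ideal_prod_principal x M : is_ideal M -> ideal_prod (principal x) M = [set y | exists2 m, M m & y = x * m].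
Proof.
move=> iM; apply/seteqP; split.
  apply: ideal_prod_min.
    split; first by exists 0; rewrite ?mulr0 //; apply: ideal0.
      by move=> _ _ [a Ma ->] [b Mb ->]; exists (a + b); rewrite ?mulrDr //; apply: idealD.
    by move=> a _ [b Mb ->]; exists (a * b); [apply: idealMl|rewrite mulrCA].
  by move=> _ y [a ->] My; exists (a * y); rewrite ?mulrA //; apply: idealMl.
by move=> _ [m Mm ->]; apply: ideal_prod_mul => //; apply: principal_self.
Qed.

Lemma ideal_exp_ideal M k : is_ideal M -> is_ideal (ideal_exp M k).
Proof. by move=> iM; elim: k => [|k IH] //=; apply: ideal_prod_ideal. Qed.

Lemma ideal_expS M k : ideal_exp M k.+1 = ideal_prod M (ideal_exp M k). Proof. by []. Qed.

Lemma ideal_exp_sub M k : is_ideal M -> ideal_exp M k.+1 `<=` ideal_exp M k.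
Proof. by move=> iM; rewrite ideal_expS; apply: ideal_prod_subr; apply: ideal_exp_ideal. Qed.

Definition maximal_ideal P := [/\ is_ideal P, ~ P 1 & forall J, is_ideal J -> P `<=` J -> J = P \/ J = setT].

Lemma maximal_prime P A B : maximal_ideal P -> is_ideal A -> is_ideal B ->
  ideal_prod A B `<=` P -> A `<=` P \/ B `<=` P.
Proof.
move=> [iP P1 mP] iA iB AB; have [|nA] := pselect (A `<=` P); [by left|right].
pose J := [set x | exists p a, [/\ P p, A a & x = p + a]].
have iJ : is_ideal J.
  split; first by exists 0, 0; rewrite addr0; split => //; apply: ideal0.
    move=> _ _ [p [a [Pp Aa ->]]] [q [b [Pq Ab ->]]]; exists (p + q), (a + b).
    by split; [apply: idealD|apply: idealD|rewrite addrACA].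
  move=> c _ [p [a [Pp Aa ->]]]; exists (c * p), (c * a); rewrite mulrDr; split => //; exact: idealMl.
have PJ : P `<=` J by move=> p Pp; exists p, 0; rewrite addr0; split => //; apply: ideal0.
have [JP|JT] := mP J iJ PJ.
  case: nA => a Aa; rewrite -JP; exists 0, a; rewrite add0r; split => //; exact: ideal0.
have : J 1 by rewrite JT.
move=> [p [a [Pp Aa E]]] b Bb; rewrite -[b]mul1r E mulrDl; apply: idealD => //; first exact: idealMr.
by apply: AB; apply: ideal_prod_mul.
Qed.

Hypothesis dom : forall x y, x * y = 0 -> x = 0 \/ y = 0.

Lemma mul_cancel x y z : x != 0 -> x * y = x * z -> y = z.
Proof.
move=> x0 /eqP; rewrite -subr_eq0 -mulrBr => /eqP /dom[] h; first by rewrite h eqxx in x0.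
by apply/eqP; rewrite -subr_eq0 h.
Qed.

(** Invertibility without a fraction field: the inverse fractional ideal is [Q] divided by [k]. *)
Definition invertible M := is_ideal M /\ exists Q k, [/\ is_ideal Q, k != 0 & ideal_prod M Q = principal k].

Lemma invertibleT : invertible setT.
Proof.
split => //; exists setT, 1; split => //; rewrite ?oner_neq0 // ideal_prodT //.
by apply/esym/ideal_eqT; [apply: principal_ideal|apply: principal_self].
Qed.

Lemma principal_cancel k A B : k != 0 -> is_ideal A -> is_ideal B ->
  ideal_prod (principal k) A `<=` ideal_prod (principal k) B -> A `<=` B.
Proof.
move=> k0 iA iB; rewrite !ideal_prod_principal // => h x Ax.
have [|y By /(mul_cancel k0) ->] // := h (k * x); first by exists x.
Qed.

Lemma invertible_cancel M A B : invertible M -> is_ideal A -> is_ideal B ->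
  ideal_prod M A `<=` ideal_prod M B -> A `<=` B.
Proof.
move=> [iM [Q [k [iQ k0 E]]]] iA iB h; apply: (principal_cancel k0) => //.
rewrite -E (ideal_prodC M) -!ideal_prodA //; exact: ideal_prodS.
Qed.

Lemma invertible_inj M A B : invertible M -> is_ideal A -> is_ideal B ->
  ideal_prod M A = ideal_prod M B -> A = B.
Proof. by move=> iM iA iB E; apply/seteqP; split; apply: (invertible_cancel iM) => //; rewrite E. Qed.

Lemma mulr_dom_neq0 x y : x != 0 -> y != 0 -> x * y != 0.
Proof. by move=> x0 y0; apply/eqP => /dom[] h; [move: x0|move: y0]; rewrite h eqxx. Qed.

Lemma invertible_prod M N : invertible M -> invertible N -> invertible (ideal_prod M N).
Proof.
move=> [iM [Q [k [iQ k0 E]]]] [iN [Q' [k' [iQ' k'0 E']]]]; split; first exact: ideal_prod_ideal.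
exists (ideal_prod Q Q'), (k * k'); split; first exact: ideal_prod_ideal.
  exact: mulr_dom_neq0.
rewrite -ideal_prodA ?(ideal_prodA iN iQ iQ') ?(ideal_prodC N Q) -?(ideal_prodA iQ iN iQ') ?E';
  try exact: ideal_prod_ideal; try exact: principal_ideal; rewrite ?ideal_prodA ?E //; try exact: principal_ideal.
rewrite ideal_prod_principal; last exact: principal_ideal.
apply/seteqP; split; first by move=> _ [_ [a ->] ->]; exists a; rewrite mulrA.
by move=> _ [a ->]; exists (k' * a); rewrite ?mulrA //; exists a.
Qed.

(** To contain is to divide: the quotient is [Q J] divided by [k], which is integral because [Q J]
    lies in [Q M = (k)]. *)
Lemma invertible_dvd M J : invertible M -> is_ideal J -> J `<=` M ->
  exists L, is_ideal L /\ J = ideal_prod M L.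
Proof.
move=> [iM [Q [k [iQ k0 E]]]] iJ JM.
have iQJ : is_ideal (ideal_prod Q J) by apply: ideal_prod_ideal.
have QJk : ideal_prod Q J `<=` principal k by rewrite -E ideal_prodC; apply: ideal_prodS.
exists [set y | ideal_prod Q J (k * y)].
have iL : is_ideal [set y | ideal_prod Q J (k * y)].
  split; first by rewrite /= mulr0; apply: ideal0.
    by move=> x y /= h h'; rewrite mulrDr; apply: idealD.
  by move=> a x /= h; rewrite mulrCA; apply: idealMl.
split => //; have kL : ideal_prod (principal k) [set y | ideal_prod Q J (k * y)] = ideal_prod Q J.
  rewrite ideal_prod_principal //; apply/seteqP; split; first by move=> _ [m h ->].
  by move=> x h; have [a xE] := QJk x h; exists a => //=; rewrite -xE.
have kE : ideal_prod (principal k) J =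
   ideal_prod (principal k) (ideal_prod M [set y | ideal_prod Q J (k * y)]).
  have iMl := ideal_prod_ideal [set y | ideal_prod Q J (k * y)] iM.
  rewrite (ideal_prodC M) ideal_prodA //; last exact: principal_ideal.
  by rewrite kL -E (ideal_prodC _ M) ideal_prodA.
apply/seteqP; split; apply: (principal_cancel k0); rewrite -?kE //; exact: ideal_prod_ideal.
Qed.

End Ideals.

(** * Index of ideals through transversals *)

Section Index.
Local Open Scope classical_set_scope.
Variable O : comNzRingType.
Implicit Types (M N P Q J L : set O) (x y z : O) (s t : seq O).

Definition incongruent M s := uniq s /\ forall x y, x \in s -> y \in s -> M (x - y) -> x = y.
Definition covers N M s := forall x, N x -> exists2 y, y \in s & M (x - y).
(** The index as the length of an explicit transversal of [N] modulo [M], so that no quotient ring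
    has to be formed. *)
Definition has_index N M (m : nat) :=
  exists s, [/\ size s = m, (forall x, x \in s -> N x), incongruent M s & covers N M s].

(** Pigeonhole: choosing a covering representative is injective, since two elements with the same
    representative are congruent. *)
Lemma incongruent_size_le N M s t : is_ideal M -> (forall x, x \in s -> N x) ->
  incongruent M s -> covers N M t -> (size s <= size t)%N.
Proof.
move=> iM sN [us inc] cov.
have [f Hf] : {f : O -> O & forall x, x \in s -> f x \in t /\ M (x - f x)}.
  apply: (@choice O O (fun x y => x \in s -> y \in t /\ M (x - y))) => x.
  have [xs|nxs] := boolP (x \in s); last by exists 0.
  by have [y yt My] := cov x (sN x xs); exists y.
have uf : uniq (map f s).
  rewrite map_inj_in_uniq // => x y xs ys E; apply: inc => //.
  have [_ h1] := Hf x xs; have [_ h2] := Hf y ys.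
  by apply: idealB_trans h1 _ => //; rewrite E; apply: idealB_sym.
rewrite -(size_map f); apply: uniq_leq_size => // _ /mapP[x xs ->].
by have [] := Hf x xs.
Qed.

Lemma has_index_inj N M m m' : is_ideal M -> has_index N M m -> has_index N M m' -> m = m'.
Proof.
move=> iM [s [<- sN si sc]] [t [<- tN ti tc]]; apply/eqP; rewrite eqn_leq.
by rewrite (incongruent_size_le iM sN si tc) (incongruent_size_le iM tN ti sc).
Qed.

Lemma transversal_refine M s : is_ideal M -> exists t,
  [/\ {subset t <= s}, incongruent M t & forall x, x \in s -> exists2 y, y \in t & M (x - y)].
Proof.
move=> iM; elim: s => [|x s [t [ts [ut it] ct]]]; first by exists [::].
have [[y yt My]|nex] := pselect (exists2 y, y \in t & M (x - y)).
  exists t; split => // [z /ts zs|z]; first by rewrite inE zs orbT.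
  by rewrite inE => /orP[/eqP ->|/ct //]; exists y.
exists (x :: t); split.
- by move=> z; rewrite !inE => /orP[->//|/ts ->]; rewrite orbT.
- split => /=.
    rewrite ut andbT; apply/negP => xt; apply: nex; exists x => //; rewrite subrr; exact: ideal0.
  move=> u v; rewrite !inE => /orP[/eqP ->|ut'] /orP[/eqP ->|vt] // h.
  + by case: nex; exists v.
  + by case: nex; exists u => //; apply: idealB_sym.
  by apply: it.
move=> z; rewrite inE => /orP[/eqP ->|/ct[y yt My]].
  by exists x; rewrite ?inE ?eqxx // subrr; apply: ideal0.
by exists y; rewrite ?inE ?yt ?orbT.
Qed.

(** Each class of the cover that meets [N] is given a representative in [N], and congruent
    representatives are then pruned. *)
Lemma covers_has_index N M s : is_ideal M -> covers setT M s -> exists m, has_index N M m.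
Proof.
move=> iM cs; pose g y := xget 0 [set x | N x /\ M (x - y)].
pose s' := [seq g y | y <- s & `[< exists x, N x /\ M (x - y) >]].
have gP y : (exists x, N x /\ M (x - y)) -> N (g y) /\ M (g y - y).
  by move=> [x hx]; rewrite /g; case: xgetP => // /(_ x).
have [t [ts it ct]] := transversal_refine s' iM.
exists (size t), t; split => //.
  by move=> x /ts /mapP[y]; rewrite mem_filter => /andP[/asboolP h _] ->; have [] := gP y h.
move=> x Nx; have [y ys My] := cs x I.
have ex : exists x, N x /\ M (x - y) by exists x.
have [|z zt Mz] := ct (g y).
  by apply/mapP; exists y => //; rewrite mem_filter ys andbT; apply/asboolP.
exists z => //; apply: idealB_trans Mz => //; apply: idealB_trans My _ => //.
by apply: idealB_sym => //; have [] := gP y ex.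
Qed.

Lemma has_index_sub N M m : is_ideal M -> has_index setT M m -> exists k, has_index N M k.
Proof. by move=> iM [s [_ _ _ cs]]; apply: covers_has_index cs. Qed.

Lemma covers_subset N M M' s : M `<=` M' -> covers N M s -> covers N M' s.
Proof. by move=> MM h x Nx; have [y ys /MM] := h x Nx; exists y. Qed.

Lemma has_index_gt0 N M m : N 0 -> has_index N M m -> (0 < m)%N.
Proof. by move=> N0 [[|x s] [<- _ _ cs]] //; have [] := cs 0 N0. Qed.

Lemma has_index1 M : is_ideal M -> has_index setT M 1 -> M = setT.
Proof.
move=> iM [[|y [|z s]] [// _ _ _ cs]]; apply: ideal_eqT => //.
have [u] := cs 1 I; rewrite inE => /eqP -> h1; have [v] := cs 0 I; rewrite inE => /eqP -> h2.
by rewrite -[1](subr0 1); apply: idealB_trans h1 _ => //; apply: idealB_sym.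
Qed.

Lemma has_indexT : has_index setT setT 1.
Proof.
exists [:: 0]; split => //; first by split => // x y; rewrite !inE => /eqP -> /eqP ->.
by move=> x _; exists 0; rewrite ?inE.
Qed.

Lemma has_index_mul L N M k m : is_ideal L -> is_ideal N -> is_ideal M -> M `<=` N -> N `<=` L ->
  has_index L N k -> has_index N M m -> has_index L M (k * m).
Proof.
move=> iL iN iM MN NL [s [<- sL [us si] sc]] [t [<- tN [ut ti] tc]].
exists [seq x + y | x <- s, y <- t]; split.
- by rewrite size_allpairs.
- by move=> _ /allpairsP[[x y] [/= xs yt ->]]; apply: idealD => //; [apply: sL|apply/NL/tN].
- have key x y x' y' : x \in s -> y \in t -> x' \in s -> y' \in t -> M (x + y - (x' + y')) -> x = x' /\ y = y'.
    move=> xs yt xs' yt' h; have E : x = x'.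
      apply: si => //; have -> : x - x' = (x + y - (x' + y')) - (y - y') by ring.
      by apply: idealB => //; [apply: MN|apply: idealB => //; apply: tN].
    split => //; apply: ti => //; move: h; rewrite E.
    by rewrite (_ : x' + y - (x' + y') = y - y') //; ring.
  split.
    rewrite allpairs_uniq // => -[x y] [x' y'] /allpairsP[[a b] [/= as_ bt [-> ->]]] /allpairsP[[c d] [/= cs dt [-> ->]]] /= E.
    by have [|-> ->] := key a b c d as_ bt cs dt; rewrite // E subrr; apply: ideal0.
  move=> _ _ /allpairsP[[x y] [/= xs yt ->]] /allpairsP[[x' y'] [/= xs' yt' ->]] h.
  by have [-> ->] := key _ _ _ _ xs yt xs' yt' h.
move=> z Lz; have [x xs Nx] := sc z Lz; have [y yt My] := tc _ Nx.
by exists (x + y); [apply/allpairsP; exists (x, y)|rewrite opprD addrA].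
Qed.

Hypothesis dom : forall x y, x * y = 0 -> x = 0 \/ y = 0.

(* Translation by [x] permutes the classes, so the class of [m * x] is trivial. *)
Lemma has_index_kill N M m x : is_ideal N -> is_ideal M -> has_index N M m -> N x -> M (x *+ m).
Proof.
move=> iN iM [s [<- sN [us si] sc]] Nx.
have [f Hf] : {f : O -> O & forall y, y \in s -> f y \in s /\ M (y + x - f y)}.
  apply: (@choice O O (fun y z => y \in s -> z \in s /\ M (y + x - z))) => y.
  have [ys|nys] := boolP (y \in s); last by exists 0.
  by have [z zs Mz] := sc (y + x) (idealD iN (sN y ys) Nx); exists z.
have pf : perm_eq (map f s) s.
  have uf : uniq (map f s).
    rewrite map_inj_in_uniq // => a b as_ bs E; apply: si => //.
    have [_ h1] := Hf a as_; have [_ h2] := Hf b bs.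
    rewrite (_ : a - b = (a + x - f a) - (b + x - f b)); first exact: idealB.
    by rewrite E; ring.
  have /(uniq_min_size uf) : {subset map f s <= s} by move=> _ /mapP[a as_ ->]; have [] := Hf a as_.
  by rewrite size_map leqnn => /(_ isT)[_ h]; apply: uniq_perm.
have -> : x *+ size s = \sum_(y <- s) (y + x - f y).
  have E : \sum_(y <- s) f y = \sum_(y <- s) y by rewrite -(big_map f predT id) /=; apply: perm_big.
  by rewrite sumrB big_split /= E addrAC subrr add0r big_const_seq count_predT iter_addr_0.
by rewrite big_seq_cond; apply: ideal_sum => // y /andP[ys _]; have [] := Hf y ys.
Qed.

(** [N / N P] is a line over the field [O / P]: for [y] in [N] outside [N P], the ideal [y O + N P]
    is all of [N] by maximality of [P], and [y a] lies in [N P] exactly for [a] in [P].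
    Multiplication by [y] therefore carries over a transversal. *)
Lemma has_index_prod_maximal N P m : invertible N -> maximal_ideal P ->
  has_index setT P m -> has_index N (ideal_prod N P) m.
Proof.
move=> inN mP; have [iN _] := inN; have [iP P1 maxP] := mP.
have iNP : is_ideal (ideal_prod N P) by apply: ideal_prod_ideal.
have [y [Ny nNP]] : exists y, N y /\ ~ ideal_prod N P y.
  apply: contrapT => h; apply: P1.
  have : setT `<=` P.
    apply: (invertible_cancel dom inN) => //; rewrite ideal_prodT // => z Nz.
    by apply: contrapT => nz; apply: h; exists z.
  by apply.
pose J := [set x | exists a z, ideal_prod N P z /\ x = y * a + z].
have iJ : is_ideal J.
  split; first by exists 0, 0; rewrite mulr0 addr0; split => //; apply: ideal0.
    move=> _ _ [a [z [hz ->]]] [b [z' [hz' ->]]]; exists (a + b), (z + z'); split; first exact: idealD.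
    by rewrite mulrDr addrACA.
  move=> c _ [a [z [hz ->]]]; exists (c * a), (c * z); split; first exact: idealMl.
  by rewrite mulrDr mulrCA.
have JN : J `<=` N.
  move=> _ [a [z [hz ->]]]; apply: idealD => //; first exact: idealMr.
  exact: ideal_prod_subl hz.
have NPJ : ideal_prod N P `<=` J by move=> z hz; exists 0, z; rewrite mulr0 add0r.
have Jy : J y by exists 1, 0; rewrite mulr1 addr0; split => //; apply: ideal0.
have JE : J = N.
  have [L [iL JL]] := invertible_dvd dom inN iJ JN.
  have PL : P `<=` L by apply: (invertible_cancel dom inN) => //; rewrite -JL.
  have [LP|LT] := maxP L iL PL; last by rewrite JL LT ideal_prodT.
  by case: nNP; rewrite -LP -JL.
have KE : [set a | ideal_prod N P (y * a)] = P.
  have [] // := maxP [set a | ideal_prod N P (y * a)].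
  - split; first by rewrite /= mulr0; apply: ideal0.
      by move=> a b /= ha hb; rewrite mulrDr; apply: idealD.
    by move=> a b /= hb; rewrite mulrCA; apply: idealMl.
  - by move=> a Pa /=; apply: ideal_prod_mul.
  move=> E; have : [set a | ideal_prod N P (y * a)] 1 by rewrite E.
  by rewrite /= mulr1.
have KP a : ideal_prod N P (y * a) <-> P a by rewrite -{2}KE.
move=> [s [<- _ [us si] sc]]; exists (map ( *%R y) s); split; first by rewrite size_map.
- by move=> _ /mapP[a _ ->]; apply: idealMr.
- have inj : {in s &, injective ( *%R y)}.
    move=> a b as_ bs E; apply: si => //; apply/KP; rewrite mulrBr E subrr; exact: ideal0.
  split; first by rewrite map_inj_in_uniq.
  move=> _ _ /mapP[a as_ ->] /mapP[b bs ->]; rewrite -mulrBr => /KP h; congr (_ * _); exact: si.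
move=> x; rewrite -{1}JE => -[a [z [hz ->]]]; have [b bs Pb] := sc a I.
exists (y * b); first exact: map_f.
by rewrite addrAC -mulrBr; apply: idealD => //; apply/KP.
Qed.

End Index.

(** * Factorization of the ideals prime to [D] *)

Section GoodIdeals.
Local Open Scope classical_set_scope.
Variable O : comNzRingType.
Implicit Types (M N P Q J L : set O) (x y z : O).
Variables (n D : nat).
Hypothesis dom : forall x y, x * y = 0 -> x = 0 \/ y = 0.
Hypothesis natr_neq0 : forall k, (0 < k)%N -> k%:R != 0 :> O.
Hypothesis index_natr : forall k, (0 < k)%N -> has_index setT (principal (k%:R : O)) (k ^ n).
(** The last two clauses make [P] and [Q] comaximal, so [P] divides [p] exactly once. Away from [D]
    this cofactor stands in for integral closedness of the order. *)
Hypothesis prime_inverse : forall p P, prime p -> ~~ (p %| D)%N -> maximal_ideal P -> P p%:R ->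
  exists Q q, [/\ is_ideal Q, ideal_prod P Q = principal p%:R, Q q & P (1 - q)].

Definition good M := is_ideal M /\ exists d, [/\ (0 < d)%N, coprime d D & M d%:R].

Lemma good_ideal M : good M -> is_ideal M. Proof. by case. Qed.

Lemma goodT : good setT.
Proof. by split => //; exists 1%N; rewrite coprime1n. Qed.

Lemma good_sup M N : good M -> is_ideal N -> M `<=` N -> good N.
Proof. by move=> [_ [d [d0 dD Md]]] iN MN; split => //; exists d; split => //; apply: MN. Qed.

(** [M] contains [(d)], whose index [d ^ n] is prime to [D], and the index of [M] divides it. *)
Lemma good_index M : good M -> exists m, [/\ has_index setT M m, (0 < m)%N & coprime m D].
Proof.
move=> [iM [d [d0 dD Md]]]; have := index_natr d0; set pd := principal _ => hd.
have ipd : is_ideal pd by apply: principal_ideal.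
have pdM : pd `<=` M by apply: principal_sub.
have [s [_ _ _ cs]] := hd.
have [m hm] := covers_has_index setT iM (covers_subset pdM cs).
have [k hk] := has_index_sub M ipd hd.
have E := has_index_inj ipd hd (has_index_mul (@idealT O) iM ipd pdM (@subsetT _ M) hm hk).
exists m; split => //; first exact: has_index_gt0 hm.
have h : coprime (m * k) D by rewrite -E coprimeXl.
by move: h; rewrite coprimeMl => /andP[].
Qed.

Lemma index_dvd M J m k : is_ideal M -> is_ideal J -> M `<=` J ->
  has_index setT M m -> has_index setT J k -> (k %| m)%N.
Proof.
move=> iM iJ MJ hm hk; have [l hl] := has_index_sub J iM hm.
have -> := has_index_inj iM hm (has_index_mul (@idealT O) iJ iM MJ (@subsetT _ J) hk hl).
exact: dvdn_mulr.
Qed.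

Lemma index_lt M J m k : is_ideal M -> is_ideal J -> M `<=` J -> J != M ->
  has_index setT M m -> has_index setT J k -> (k < m)%N.
Proof.
move=> iM iJ MJ nJM hm hk; have [l hl] := has_index_sub J iM hm.
have -> := has_index_inj iM hm (has_index_mul (@idealT O) iJ iM MJ (@subsetT _ J) hk hl).
have k0 : (0 < k)%N by apply: has_index_gt0 hk.
have l0 : (0 < l)%N by apply: has_index_gt0 (ideal0 iJ) hl.
rewrite ltn_Pmulr //; case: l l0 hl => [//|[_|//]] [[|y [|z s]] [// _ _ _ cs]].
case/eqP: nJM; apply/seteqP; split => // x Jx.
have [u] := cs x Jx; rewrite inE => /eqP -> h1.
have [v] := cs 0 (ideal0 iJ); rewrite inE => /eqP -> h2.
by rewrite -[x](subr0 x); apply: idealB_trans h1 _ => //; apply: idealB_sym.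
Qed.

Lemma index_multiple_lt M J m : good M -> is_ideal J -> M `<=` J -> J != M ->
  has_index setT M m -> exists k, has_index setT J k /\ (k < m)%N.
Proof.
move=> gM iJ MJ nJM hm; have [k [hk _ _]] := good_index (good_sup gM iJ MJ).
by exists k; split => //; apply: (index_lt (good_ideal gM) iJ MJ nJM hm hk).
Qed.

(** Induction on the index, which drops strictly in a larger ideal, in place of Zorn's lemma. *)
Lemma exists_maximal M : good M -> ~ M 1 -> exists P, [/\ maximal_ideal P, good P & M `<=` P].
Proof.
move=> gM; have [m [hm _ _]] := good_index gM.
elim/ltn_ind: m => m IH in M gM hm * => M1.
have iM := good_ideal gM.
have [mM|nmM] := pselect (maximal_ideal M); first by exists M; split.
have [J [iJ MJ JM J1]] : exists J, [/\ is_ideal J, M `<=` J, J != M & ~ J 1].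
  apply: contrapT => h; apply: nmM; split => // J iJ MJ.
  have [->|JM] := eqVneq J M; [by left|right]; apply: (ideal_eqT iJ).
  by apply: contrapT => J1; apply: h; exists J.
have [k [hk km]] := index_multiple_lt gM iJ MJ JM hm.
have [P [mP gP JP]] := IH k km J (good_sup gM iJ MJ) hk J1.
by exists P; split => // x /MJ /JP.
Qed.

Lemma maximal_prime_elt P x y : maximal_ideal P -> P (x * y) -> P x \/ P y.
Proof.
move=> mP; have [iP _ _] := mP => Pxy.
have [] := maximal_prime mP (principal_ideal x) (principal_ideal y).
- apply: ideal_prod_min => // _ _ [a ->] [b ->].
  by rewrite mulrACA; apply: idealMr.
- by move=> h; left; apply: h; apply: principal_self.
- by move=> h; right; apply: h; apply: principal_self.
Qed.

Lemma maximal_good_prime P : maximal_ideal P -> good P -> exists p, [/\ prime p, ~~ (p %| D)%N & P p%:R].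
Proof.
move=> mP [iP [d [d0 dD Pd]]]; have [_ P1 _] := mP.
elim/ltn_ind: d => d IH in d0 dD Pd *.
have [d1|d1] := leqP d 1.
  by have E : d = 1%N; [apply/eqP; rewrite eqn_leq d1 d0|case: P1; rewrite E in Pd].
have pp := pdiv_prime d1; have E : d = (pdiv d * (d %/ pdiv d))%N by rewrite mulnC divnK // pdiv_dvd.
have := dD; rewrite {1}E coprimeMl => /andP[c1 c2].
move: Pd; rewrite {1}E natrM => /(maximal_prime_elt mP)[] h.
  by exists (pdiv d); split => //; rewrite -prime_coprime.
have q0 : (0 < d %/ pdiv d)%N by rewrite divn_gt0 ?pdiv_gt0 // pdiv_leq.
by apply: IH q0 c2 h; rewrite ltn_Pdiv // prime_gt1.
Qed.

Lemma maximal_good_invertible P : maximal_ideal P -> good P -> invertible P.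
Proof.
move=> mP gP; have [p [pp pD Pp]] := maximal_good_prime mP gP.
have [Q [q [iQ E _ _]]] := prime_inverse pp pD mP Pp.
by split; [exact: good_ideal|exists Q, p%:R; split => //; apply: natr_neq0; apply: prime_gt0].
Qed.

Lemma ideal_coprime1 P k l : is_ideal P -> (0 < k)%N -> coprime k l -> P k%:R -> P l%:R -> P 1.
Proof.
move=> iP k0 /(coprimeP _ k0)[[u v] /= E] Pk Pl.
have -> : (1 : O) = (u * k - v * l)%N%:R by rewrite E.
rewrite natrB; last by rewrite ltnW // -subn_gt0 E.
by rewrite !natrM; apply: idealB => //; apply: idealMl.
Qed.

(* If [P M = M] then [q / p] acts on [M] for every [q] in the inverse ideal of
   [P]; taking [q = 1] modulo [P] and iterating contradicts [d] in [M]. *)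
Lemma prod_maximal_neq M P : good M -> maximal_ideal P -> good P -> ideal_prod P M != M.
Proof.
move=> gM mP gP; apply/eqP => E; have [iM [d [d0 dD Md]]] := gM.
have [p [pp pD Pp]] := maximal_good_prime mP gP.
have [Q [q [iQ EQ Qq Pq]]] := prime_inverse pp pD mP Pp.
have [iP P1 _] := mP.
have act m : M m -> exists2 m', M m' & q * m = p%:R * m'.
  move=> Mm; have : ideal_prod Q M (q * m) by apply: ideal_prod_mul.
  by rewrite -{1}E ideal_prodA // (ideal_prodC Q) EQ ideal_prod_principal.
have it k : exists2 m', M m' & q ^+ k * d%:R = p%:R ^+ k * m'.
  elim: k => [|k [m' Mm' IH]]; first by exists d%:R; rewrite ?expr0.
  by have [m'' ? Em] := act _ Mm'; exists m'' => //; rewrite exprS -mulrA IH mulrCA Em exprSr mulrA.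
have p0 : (0 < p)%N by apply: prime_gt0.
pose e := logn p d; have /dvdnP[d' Ed] := pfactor_dvdnn p d; rewrite -/e in Ed.
have pd' : coprime p d'.
  rewrite prime_coprime //; apply/negP => /dvdnP[d'' E'].
  have := pfactor_dvdn e.+1 pp d0; rewrite -/e ltnn Ed E' -mulnA -expnS dvdn_mull //.
have [m' Mm'] := it e.+1; rewrite Ed natrM natrX => Em.
have qd : q ^+ e.+1 * d'%:R = p%:R * m'.
  apply: (@mul_cancel O dom (p%:R ^+ e)); first by rewrite -natrX natr_neq0 // expn_gt0 p0.
  transitivity (q ^+ e.+1 * (d'%:R * p%:R ^+ e)); first by ring.
  by rewrite Em exprSr; ring.
have Pqk k : P (1 - q ^+ k).
  elim: k => [|k IH]; first by rewrite expr0 subrr; apply: ideal0.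
  by rewrite exprS (_ : 1 - _ = (1 - q) + q * (1 - q ^+ k)); [apply: idealD => //; apply: idealMl|ring].
apply: P1; apply: (ideal_coprime1 iP p0 pd' Pp).
have -> : d'%:R = (1 - q ^+ e.+1) * d'%:R + p%:R * m' by rewrite -qd; ring.
by apply: idealD => //; apply: idealMr.
Qed.

(** The induction step for the results below: [M] is divided by a maximal ideal containing it, and
    [prod_maximal_neq] makes the quotient strictly larger, hence of smaller index. *)
Lemma good_split M m : good M -> has_index setT M m -> ~ M 1 -> exists P L,
  [/\ maximal_ideal P, good P, good L, M = ideal_prod P L & exists2 l, has_index setT L l & (l < m)%N].
Proof.
move=> gM hm M1; have [P [mP gP MP]] := exists_maximal gM M1.
have iM := good_ideal gM.
have [L [iL E]] := invertible_dvd dom (maximal_good_invertible mP gP) iM MP.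
have ML : M `<=` L by rewrite E; apply: ideal_prod_subr.
have gL := good_sup gM iL ML.
have nLM : L != M by rewrite E eq_sym prod_maximal_neq.
have [k [hk km]] := index_multiple_lt gM iL ML nLM hm.
by exists P, L; split => //; exists k.
Qed.

Lemma good_invertible M : good M -> invertible M.
Proof.
move=> gM; have [m [hm _ _]] := good_index gM.
elim/ltn_ind: m => m IH in M gM hm *.
have [M1|M1] := pselect (M 1).
  by rewrite (ideal_eqT (good_ideal gM) M1); apply: invertibleT.
have [P [L [mP gP gL -> [l hl lm]]]] := good_split gM hm M1.
by apply: invertible_prod => //; [apply: maximal_good_invertible|apply: IH lm _ _ hl].
Qed.

Lemma has_index_prod P L m l : maximal_ideal P -> good L ->
  has_index setT P m -> has_index setT L l -> has_index setT (ideal_prod P L) (m * l).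
Proof.
move=> mP gL hm hl; have iL := good_ideal gL; have [iP _ _] := mP.
rewrite ideal_prodC mulnC; apply: has_index_mul hl _ => //.
- exact: ideal_prod_ideal.
- exact: ideal_prod_subl.
by apply: has_index_prod_maximal => //; apply: good_invertible.
Qed.

Lemma good_prod M N : good M -> good N -> good (ideal_prod M N).
Proof.
move=> [iM [d [d0 dD Md]]] [iN [e [e0 eD Ne]]]; split; first exact: ideal_prod_ideal.
exists (d * e)%N; rewrite muln_gt0 d0 coprimeMl dD natrM; split => //; exact: ideal_prod_mul.
Qed.

Lemma good_exp M k : good M -> good (ideal_exp M k).
Proof. by move=> gM; elim: k => [|k IH]; [exact: goodT|apply: good_prod]. Qed.

Lemma has_index_exp_prod P k L m l : maximal_ideal P -> good P -> good L ->
  has_index setT P m -> has_index setT L l -> has_index setT (ideal_prod (ideal_exp P k) L) (m ^ k * l).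
Proof.
move=> mP gP gL hm hl; have iP := good_ideal gP.
elim: k => [|k IH]; first by rewrite mul1n ideal_prod1 //; apply: good_ideal.
rewrite ideal_expS -ideal_prodA ?expnS ?mulnA; try exact: good_ideal; last by apply: good_ideal; apply: good_exp.
by rewrite -mulnA; apply: has_index_prod => //; apply: good_prod => //; apply: good_exp.
Qed.

Lemma maximal_index_gt1 P m : maximal_ideal P -> has_index setT P m -> (1 < m)%N.
Proof.
move=> [iP P1 _] hm; rewrite ltn_neqAle (has_index_gt0 _ hm) // andbT; apply/eqP => E.
by apply: P1; rewrite -E in hm; rewrite (has_index1 iP hm).
Qed.

(** Together with [sub_exp_prod_eq] this computes the [P]-adic valuation, read as the largest [k]
    with [M] inside the [k]-th power of [P], and takes the place of unique factorization. A factor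
    [P0] other than [P] leaves it unchanged because [P] is prime. *)
Lemma sub_exp_prod_neq P P0 L k : maximal_ideal P -> good P -> maximal_ideal P0 -> good P0 -> P != P0 -> good L ->
  ideal_prod P0 L `<=` ideal_exp P k <-> L `<=` ideal_exp P k.
Proof.
move=> mP gP mP0 gP0 nP gL; have [iP _ _] := mP; have [iP0 P01 max0] := mP0; have iL := good_ideal gL.
split; last by move=> h x /(ideal_prod_subr iL) /h.
elim: k => [//|k IH] h.
have iE : is_ideal (ideal_exp P k) by apply: ideal_exp_ideal.
have hk : L `<=` ideal_exp P k by apply: IH => x /h; apply: ideal_exp_sub.
have inE : invertible (ideal_exp P k) by apply: good_invertible; apply: good_exp.
have [L' [iL' EL]] := invertible_dvd dom inE iL hk.
have P0L' : ideal_prod P0 L' `<=` P.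
  apply: (invertible_cancel dom inE) => //; first exact: ideal_prod_ideal.
  by rewrite ideal_prodA // (ideal_prodC _ P0) -ideal_prodA // -EL [X in _ `<=` X]ideal_prodC.
have [P0P|L'P] := maximal_prime mP iP0 iL' P0L'.
  have [EP|EP] := max0 P iP P0P; first by rewrite EP eqxx in nP.
  by case: mP => _ P1 _; case: P1; rewrite EP.
by rewrite EL ideal_expS ideal_prodC; apply: ideal_prodS.
Qed.

Lemma sub_exp_prod_eq P L k : maximal_ideal P -> good P -> good L ->
  ideal_prod P L `<=` ideal_exp P k.+1 <-> L `<=` ideal_exp P k.
Proof.
move=> mP gP gL; have iL := good_ideal gL; have iE : is_ideal (ideal_exp P k) by apply: ideal_exp_ideal; apply: good_ideal.
split; last by move=> h; apply: ideal_prodS.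
by apply: (invertible_cancel dom) => //; apply: maximal_good_invertible.
Qed.

End GoodIdeals.

(** * Counting function and von Mangoldt function of the good ideals *)

Section IdealZeta.
Local Open Scope classical_set_scope.
Variable R : realType.
Variable O : comNzRingType.
Implicit Types (M P Q J L : set O) (x y z : O).
Variables (n D : nat).
Hypothesis dom : forall x y, x * y = 0 -> x = 0 \/ y = 0.
Hypothesis natr_neq0 : forall k, (0 < k)%N -> k%:R != 0 :> O.
Hypothesis index_natr : forall k, (0 < k)%N -> has_index setT (principal (k%:R : O)) (k ^ n).
Hypothesis prime_inverse : forall p P, prime p -> ~~ (p %| D)%N -> maximal_ideal P -> P p%:R ->
  exists Q q, [/\ is_ideal Q, ideal_prod P Q = principal p%:R, Q q & P (1 - q)].

Definition goods (m : nat) : seq (set O) :=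
  xget [::] [set s | uniq s /\ forall M, M \in s <-> good D M /\ has_index setT M m].

(* An ideal of index [m] contains [m], hence is determined by which members of
   a finite set of representatives modulo [m] it contains. *)
Lemma goods_spec m : uniq (goods m) /\ forall M, M \in goods m <-> good D M /\ has_index setT M m.
Proof.
rewrite /goods; case: xgetP => [//|nex]; exfalso.
suff [s hs] : exists s, uniq s /\ forall M, M \in s <-> good D M /\ has_index setT M m by case: (nex s).
case: m {nex} => [|m].
  exists [::]; split => // M; split => // -[_ hm].
  by have := has_index_gt0 (I : setT (0 : O)) hm.
have [s [_ _ _ cs]] := index_natr (ltn0Sn m).
pose ok M := good D M /\ has_index setT M m.+1.
have rep x : exists2 y, y \in s & forall M, ok M -> (M x <-> M y).
  have [y ys [a E]] := cs x I; exists y => // M [gM hM]; have iM := good_ideal gM.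
  have Mxy : M (x - y).
    by rewrite E; apply: idealMr => //; apply: (has_index_kill (@idealT O) iM hM (I : setT (1 : O))).
  by split => h; [rewrite -(subKr x y)|rewrite -(subrK y x)]; [apply: idealB|apply: idealD].
pose mask M : (size s).-tuple bool := map_tuple (fun y => `[< M y >]) (in_tuple s).
have mask_inj M M' : ok M -> ok M' -> mask M = mask M' -> M = M'.
  have h A B : ok A -> ok B -> mask A = mask B -> A `<=` B.
    move=> okA okB E x Ax; have [y ys hy] := rep x.
    apply/(hy _ okB)/asboolP; have /eq_in_map/(_ y ys) <- : [seq `[< A y >] | y <- s] = [seq `[< B y >] | y <- s].
      by have := congr1 val E.
    by apply/asboolP/(hy _ okA).
  by move=> okM okM' E; apply/seteqP; split; apply: h.
pose g (t : (size s).-tuple bool) : set O := xget set0 [set M | ok M /\ mask M = t].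
have gP M : ok M -> g (mask M) = M.
  move=> okM; rewrite /g; case: xgetP => [M' _ [okM' E]|]; first exact: mask_inj.
  by move=> /(_ M) h; exfalso; apply: h.
exists (undup [seq M <- map g (enum {: (size s).-tuple bool}) | `[< ok M >] ]); split; first exact: undup_uniq.
move=> M; rewrite mem_undup mem_filter; split; first by case/andP => /asboolP.
move=> okM; apply/andP; split; first by apply/asboolP.
by apply/mapP; exists (mask M); rewrite ?mem_enum // gP.
Qed.

Lemma mem_goods m M : M \in goods m <-> good D M /\ has_index setT M m.
Proof. by have [_] := goods_spec m. Qed.

Lemma goods_uniq m : uniq (goods m). Proof. by have [] := goods_spec m. Qed.

Definition ideal_count (m : nat) : R := (size (goods m))%:R.
Definition primes_of e : seq (set O) := [seq P <- goods e | `[< maximal_ideal P >]].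
Definition prime_pairs N : seq (nat * set O) := [seq (e, P) | e <- index_iota 1 N.+1, P <- primes_of e].
Definition sum_prime_powers N (F : nat -> set O -> nat -> R) : R :=
  \sum_(u <- prime_pairs N) \sum_(1 <= k < N.+1) F u.1 u.2 k.
(** Each power of a maximal ideal that has index [d] contributes [ln] of the index of the maximal
    ideal. The cutoff [d] for indices and exponents loses nothing, since [e ^ k = d] with [1 < e]
    and [0 < k] bounds both by [d]. *)
Definition ideal_mangoldt (d : nat) : R := sum_prime_powers d (fun e _ k => (e ^ k == d)%N%:R * ln e%:R).

Lemma prime_pairsP N e P : (e, P) \in prime_pairs N <->
  [/\ (1 < e <= N)%N, maximal_ideal P, good D P & has_index setT P e].
Proof.
split.
  case/allpairsPdep => [e' [P' [+ + [-> ->]]]]; rewrite mem_index_iota mem_filter ltnS => /andP[e0 eN] /andP[/asboolP mP /mem_goods[gP hP]].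
  by rewrite eN (maximal_index_gt1 mP hP).
move=> [/andP[e1 eN] mP gP hP]; apply/allpairsPdep; exists e, P; split => //.
  by rewrite mem_index_iota ltnS eN ltnW.
by rewrite mem_filter; apply/andP; split; [apply/asboolP|apply/mem_goods].
Qed.

Lemma prime_pairs_uniq N : uniq (prime_pairs N).
Proof.
apply: allpairs_uniq_dep; first exact: iota_uniq.
  by move=> e _; apply: filter_uniq; apply: goods_uniq.
by move=> [e P] [e' P'] _ _ /= [-> ->].
Qed.

Lemma expn_gt_self e k : (1 < e)%N -> (k < e ^ k)%N. Proof. exact: ltn_expl. Qed.

Lemma expn_ge_base e k : (1 < e)%N -> (0 < k)%N -> (e <= e ^ k)%N.
Proof. by move=> e1; case: k => // k _; rewrite -{1}[e]expn1 leq_pexp2l // ltnW. Qed.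

Lemma ideal_mangoldtE d N : (0 < d <= N)%N ->
  ideal_mangoldt d = sum_prime_powers N (fun e _ k => (e ^ k == d)%N%:R * ln e%:R).
Proof.
move=> /andP[d0 dN]; rewrite /ideal_mangoldt /sum_prime_powers.
have inner e : (1 < e)%N -> \sum_(1 <= k < N.+1) (e ^ k == d)%N%:R * ln (e%:R : R) =
     \sum_(1 <= k < d.+1) (e ^ k == d)%N%:R * ln e%:R.
  move=> e1; rewrite (@big_cat_nat _ _ _ d.+1) //= [X in _ + X]big_nat_cond [X in _ + X]big1 ?addr0 //.
  move=> k /andP[/andP[dk _] _]; case: eqP => [E|_]; last by rewrite mul0r.
  by have := expn_gt_self k e1; rewrite E; lia.
have -> : prime_pairs N = prime_pairs d ++ [seq (e, P) | e <- index_iota d.+1 N.+1, P <- primes_of e].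
  rewrite /prime_pairs -flatten_cat -map_cat; congr (flatten (map _ _)).
  by rewrite /index_iota !subSS !subn0 -{1}(subnKC dN) iotaD add1n.
rewrite big_cat /= [X in _ = _ + X]big1_seq ?addr0; last first.
  move=> [e P] /andP[_] /allpairsPdep[e' [P' [+ + [-> ->]]]]; rewrite mem_index_iota => /andP[de eN].
  rewrite mem_filter => /andP[/asboolP mP /mem_goods[gP hP]] /=; have e1 := maximal_index_gt1 mP hP.
  rewrite big_nat_cond big1 // => k /andP[/andP[k0 _] _]; case: eqP => [E|_]; last by rewrite mul0r.
  by have := expn_ge_base e1 k0; rewrite E; lia.
rewrite big_seq [RHS]big_seq; apply: eq_bigr => -[e P] /prime_pairsP[/andP[e1 _] _ _ _] /=.
by rewrite inner.
Qed.

Lemma exp_sub_index P e M m k : maximal_ideal P -> good D P -> has_index setT P e ->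
  good D M -> has_index setT M m -> M `<=` ideal_exp P k ->
  exists L l, [/\ good D L, has_index setT L l, M = ideal_prod (ideal_exp P k) L & m = (e ^ k * l)%N].
Proof.
move=> mP gP he gM hm MP; have iM := good_ideal gM.
have gE := good_exp k gP.
have inE := good_invertible dom natr_neq0 index_natr prime_inverse gE.
have [L [iL EL]] := invertible_dvd dom inE iM MP.
have gL : good D L by apply: (good_sup gM iL); rewrite EL; apply: ideal_prod_subr.
have [l [hl _ _]] := good_index index_natr gL.
exists L, l; split => //; rewrite EL in hm.
apply: (has_index_inj _ hm); first by rewrite -EL.
exact: (has_index_exp_prod dom natr_neq0 index_natr prime_inverse).
Qed.

(** The logarithm of the factorization of [M], with the multiplicity of [P] written as the number of
    [k >= 1] for which [M] lies in the [k]-th power of [P]. Each [good_split] raises a single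
    multiplicity by one. *)
Lemma log_index M m N : good D M -> has_index setT M m -> (m <= N)%N ->
  ln (m%:R : R) = sum_prime_powers N (fun e P k => `[< M `<=` ideal_exp P k >]%:R * ln e%:R).
Proof.
elim/ltn_ind: m => m IH in M * => gM hm mN.
have [M1|M1] := pselect (M 1).
  have E := ideal_eqT (good_ideal gM) M1; rewrite E in hm.
  have -> : m = 1%N by apply: has_index_inj hm (has_indexT O).
  rewrite ln1 /sum_prime_powers big1_seq // => -[e P] /andP[_ /prime_pairsP[_ mP gP _]] /=.
  rewrite big_nat_cond big1 // => k /andP[/andP[k0 _] _]; case: asboolP; last by rewrite mul0r.
  rewrite E; case: k k0 => // k _ /(_ 1 I) h; have [iP P1 _] := mP; case: P1.
  by move: h; apply: ideal_prod_subl.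
have [P0 [L [mP0 gP0 gL EM [l hl lm]]]] := good_split dom natr_neq0 index_natr prime_inverse gM hm M1.
have [e0 [he0 _ _]] := good_index index_natr gP0.
have l0 : (0 < l)%N by apply: has_index_gt0 hl.
have e1 := maximal_index_gt1 mP0 he0.
have Em : m = (e0 * l)%N.
  apply: (has_index_inj (good_ideal gM) hm); rewrite EM.
  exact: (has_index_prod dom natr_neq0 index_natr prime_inverse).
have lN : (l <= N)%N by apply: leq_trans mN; apply: ltnW.
have e0N : (e0 <= N)%N by apply: leq_trans mN; rewrite Em leq_pmulr.
rewrite Em natrM lnM ?posrE ?ltr0n ?(ltnW e1) // (IH l lm L gL hl lN).
have -> : ln (e0%:R : R) = \sum_(u <- prime_pairs N) (u == (e0, P0))%:R * ln e0%:R.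
  rewrite (bigD1_seq (e0, P0)) ?prime_pairs_uniq //=; last by apply/prime_pairsP; rewrite e1.
  by rewrite eqxx mul1r big1 ?addr0 // => u /negbTE ->; rewrite mul0r.
rewrite /sum_prime_powers -big_split /= big_seq [RHS]big_seq; apply: eq_bigr => -[e P] /prime_pairsP[/andP[e1' eN] mP gP he] /=.
have [EP|nP] := eqVneq P P0; last first.
  have -> : ((e, P) == (e0, P0)) = false by apply/eqP => -[_ E]; rewrite E eqxx in nP.
  rewrite mul0r add0r; apply: eq_bigr => k _; congr (_%:R * _); congr nat_of_bool.
  by apply: asbool_equiv_eq; rewrite EM; symmetry; apply: (sub_exp_prod_neq dom natr_neq0 index_natr prime_inverse).
have Ee : e = e0 by rewrite EP in he; apply: has_index_inj he he0; have [] := mP0.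
rewrite EP Ee eqxx mul1r -!mulr_suml -[X in X + _]mul1r -mulrDl; congr (_ * _).
have N0 : (0 < N)%N by apply: leq_trans lN.
(* Passing from [L] to [P0 L] shifts [k] by one; the last term for [L] vanishes because the [N]-th
   power of the index of [P0] exceeds the index of [L]. *)
rewrite [RHS]big_nat_recl //= [in LHS]big_nat_recr //=.
have -> : `[< L `<=` ideal_exp P0 N >] = false.
  apply/asboolP => h; have [L' [l' [_ _ _ El]]] := exp_sub_index mP0 gP0 he0 gL hl h.
  have := expn_gt_self N e1; have : (0 < l')%N by (case: (l') El; lia).
  by move: lN; rewrite El; nia.
rewrite addr0; congr (_ + _).
  case: asboolP => // h; exfalso; apply: h.
  by rewrite EM /= ideal_prodT; [apply: ideal_prod_subl|]; have [] := mP0.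
apply: eq_big_nat => k /andP[k0 _]; congr (_%:R); congr nat_of_bool.
by apply: asbool_equiv_eq; rewrite EM; symmetry; apply: (sub_exp_prod_eq dom natr_neq0 prime_inverse).
Qed.

(** Multiplication by the [k]-th power of [P] is a bijection from the good ideals of index [m / e^k]
    onto those of index [m] that this power contains. *)
Lemma count_sub_exp e P k m : (0 < m)%N -> maximal_ideal P -> good D P -> has_index setT P e ->
  \sum_(M <- goods m) `[< M `<=` ideal_exp P k >]%:R = (e ^ k %| m)%N%:R * ideal_count (m %/ e ^ k) :> R.
Proof.
move=> m0 mP gP he; rewrite -natr_sum.
have -> : (\sum_(M <- goods m) `[< M `<=` ideal_exp P k >] = size [seq M <- goods m | `[< M `<=` ideal_exp P k >]])%N.
  by rewrite -sum1_size big_filter [RHS]big_mkcond; apply: eq_bigr => M _; case: asboolP.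
rewrite /ideal_count -natrM; congr (_%:R).
have e1 := maximal_index_gt1 mP he; have ek0 : (0 < e ^ k)%N by rewrite expn_gt0 ltnW.
have gE := good_exp k gP; have iE := good_ideal gE.
have inE := good_invertible dom natr_neq0 index_natr prime_inverse gE.
case: (boolP (e ^ k %| m)%N) => [/dvdnP[l El]|ndv]; last first.
  apply/eqP; rewrite mul0n size_eq0 -[_ == _]negbK -has_filter; apply/hasP => -[M /mem_goods[gM hM] /asboolP MP].
  have [L [l [_ _ _ El]]] := exp_sub_index mP gP he gM hM MP.
  by move: ndv; rewrite El dvdn_mulr.
rewrite mul1n El mulnK // -(size_map (ideal_prod (ideal_exp P k)) (goods l)).
apply: perm_size; apply: uniq_perm; first by rewrite filter_uniq // goods_uniq.
  rewrite map_inj_in_uniq ?goods_uniq // => A B /mem_goods[gA _] /mem_goods[gB _].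
  exact: (invertible_inj dom inE (good_ideal gA) (good_ideal gB)).
move=> M; rewrite mem_filter; apply/andP/mapP.
  move=> [/asboolP MP /mem_goods[gM hM]].
  have [L [l' [gL hL EM El']]] := exp_sub_index mP gP he gM hM MP.
  exists L => //; apply/mem_goods; split => //.
  have -> // : l = l'.
  by apply/eqP; rewrite -(eqn_pmul2r ek0) El' mulnC.
move=> [L /mem_goods[gL hL] ->]; split; first by apply/asboolP; apply: ideal_prod_subl.
apply/mem_goods; split; first exact: good_prod.
by rewrite mulnC; apply: (has_index_exp_prod dom natr_neq0 index_natr prime_inverse).
Qed.

(** [log_index] is summed over the good ideals of index [m], and the sums are exchanged so that
    [count_sub_exp] applies. *)
Lemma ideal_count_ln m : (0 < m)%N -> ideal_count m * ln m%:R = dconv ideal_mangoldt ideal_count m.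
Proof.
move=> m0; pose T F := sum_prime_powers m F.
transitivity (T (fun e P k => ln e%:R * ((e ^ k %| m)%N%:R * ideal_count (m %/ e ^ k)))).
  transitivity (\sum_(M <- goods m) ln (m%:R : R)).
    by rewrite big_const_seq count_predT iter_addr_0 /ideal_count mulr_natl.
  rewrite (eq_big_seq (fun M => T (fun e P k => `[< M `<=` ideal_exp P k >]%:R * ln e%:R))); last first.
    by move=> M /mem_goods[gM hM]; apply: log_index.
  rewrite /T /sum_prime_powers exchange_big /= big_seq [RHS]big_seq; apply: eq_bigr => -[e P] /prime_pairsP[_ mP gP he] /=.
  rewrite exchange_big /=; apply: eq_bigr => k _.
  by rewrite -mulr_suml (count_sub_exp k m0 mP gP he) mulrC.
transitivity (\sum_(1 <= d < m.+1) (if (d %| m)%N then T (fun e _ k => (e ^ k == d)%N%:R * ln e%:R) * ideal_count (m %/ d) else 0)); last first.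
  rewrite /dconv [RHS]big_mkcond; apply: eq_big_nat => d /andP[d0 dm]; case: ifP => // _.
  by rewrite (@ideal_mangoldtE d m) ?d0.
transitivity (\sum_(1 <= d < m.+1) T (fun e _ k => (e ^ k == d)%N%:R * ((d %| m)%N%:R * (ln e%:R * ideal_count (m %/ d))))).
  rewrite /T /sum_prime_powers [RHS]exchange_big /= big_seq [RHS]big_seq; apply: eq_bigr => -[e P] /prime_pairsP[/andP[e1 _] _ _ _] /=.
  rewrite [RHS]exchange_big /=; apply: eq_bigr => k _.
  have ek0 : (0 < e ^ k)%N by rewrite expn_gt0 ltnW.
  case: (boolP (e ^ k %| m)%N) => [dv|ndv].
    have hin : (e ^ k)%N \in index_iota 1 m.+1 by rewrite mem_index_iota ek0 ltnS; apply: dvdn_leq.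
    rewrite (bigD1_seq (e ^ k)%N hin (iota_uniq _ _)) eqxx dv /= !mul1r.
    by rewrite big1 ?addr0 // => d /negbTE; rewrite eq_sym => ->; rewrite mul0r.
  rewrite mul0r mulr0 big1 // => d _; case: eqP => [<-|_]; last by rewrite mul0r.
  by rewrite (negbTE ndv) mul0r mulr0.
apply: eq_bigr => d _; case: ifP => dv; last first.
  rewrite /T /sum_prime_powers big1 // => u _; rewrite big1 // => k _.
  by rewrite mul0r mulr0.
rewrite /T /sum_prime_powers mulr_suml; apply: eq_bigr => u _; rewrite mulr_suml; apply: eq_bigr => k _.
by rewrite mul1r mulrA.
Qed.

Lemma ideal_count1 : ideal_count 1 = 1.
Proof.
rewrite /ideal_count (_ : goods 1 = [:: setT]) //.
apply: perm_small_eq => //; apply: uniq_perm => //; first exact: goods_uniq.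
move=> M; rewrite inE; apply/idP/eqP.
  by move=> /mem_goods[gM hM]; apply: has_index1 (good_ideal gM) hM.
by move=> ->; apply/mem_goods; split; [exact: goodT|exact: has_indexT].
Qed.

Lemma ideal_mangoldt_ge0 d : 0 <= ideal_mangoldt d.
Proof.
rewrite /ideal_mangoldt /sum_prime_powers big_seq sumr_ge0 // => -[e P] /prime_pairsP[/andP[e1 _] _ _ _].
by apply: sumr_ge0 => k _; rewrite mulr_ge0 // ln_ge0 // ler1n ltnW.
Qed.

Lemma maximal_index_prime_power P e : maximal_ideal P -> good D P -> has_index setT P e ->
  exists p j, [/\ prime p, ~~ (p %| D)%N, P p%:R & e = (p ^ j)%N].
Proof.
move=> mP gP he; have [iP _ _] := mP; have [p [pp pD Pp]] := maximal_good_prime mP gP.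
have h := index_natr (prime_gt0 pp).
have := index_dvd (principal_ideal (p%:R : O)) iP (principal_sub iP Pp) h he.
by move=> /(dvdn_pfactor _ _ pp)[j _ ->]; exists p, j.
Qed.

Lemma ideal_mangoldt_prime_power d : ideal_mangoldt d != 0 -> exists p k, prime p /\ d = (p ^ k)%N.
Proof.
move=> nz; have [[e [P [k [h E]]]]|nex] := pselect (exists e P k, (e, P) \in prime_pairs d /\ (e ^ k)%N = d).
  have [_ mP gP he] := (prime_pairsP _ _ _).1 h.
  have [p [j [pp _ _ Ee]]] := maximal_index_prime_power mP gP he.
  by exists p, (j * k)%N; rewrite -E Ee expnM.
case/eqP: nz; rewrite /ideal_mangoldt /sum_prime_powers big1_seq // => -[e P] /andP[_ h].
rewrite big1 // => k _ /=; case: eqP => [E|_]; last by rewrite mul0r.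
by case: nex; exists e, P, k.
Qed.

(** All powers of index [d] belong to ideals over the one prime [p] dividing [d], and [log_index]
    for [(p)], of index [p ^ n], bounds the sum of [ln e] over those ideals by [n ln p]. *)
Lemma ideal_mangoldt_le d : (0 < d)%N -> ideal_mangoldt d <= n%:R * ln d%:R.
Proof.
move=> d0; have ld : 0 <= ln (d%:R : R) by rewrite ln_ge0 // ler1n.
have [[e0 [P0 [k0 [h E]]]]|nex] := pselect (exists e P k, (e, P) \in prime_pairs d /\ (e ^ k)%N = d /\ (0 < k)%N); last first.
  rewrite /ideal_mangoldt /sum_prime_powers big1_seq ?mulr_ge0 // => -[e P] /andP[_ h].
  rewrite big_nat_cond big1 // => k /andP[/andP[k0 _] _] /=; case: eqP => [E|_]; last by rewrite mul0r.
  by case: nex; exists e, P, k.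
have [/andP[e01 _] mP0 gP0 he0] := (prime_pairsP _ _ _).1 h.
have [p [j [pp pD Pp Ee0]]] := maximal_index_prime_power mP0 gP0 he0.
case: E => E k00.
have p0 := prime_gt0 pp.
have pd : (p %| d)%N.
  rewrite -E Ee0 -expnM; apply: dvdn_exp => //; rewrite muln_gt0 k00 andbT.
  by case: (j) Ee0 e01 => // ->; rewrite expn0.
have uni e P k : (e, P) \in prime_pairs d -> (e ^ k)%N = d -> P p%:R.
  move=> /prime_pairsP[/andP[e1 _] mP gP he] Ed.
  have [p' [j' [pp' _ Pp' Ee]]] := maximal_index_prime_power mP gP he.
  suff -> : p = p' by [].
  have : (p %| p' ^ (j' * k))%N by rewrite expnM -Ee Ed.
  by rewrite Euclid_dvdX // dvdn_prime2 // => /andP[/eqP].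
pose pO := principal (p%:R : O).
have ipO : is_ideal pO by apply: principal_ideal.
have gpO : good D pO by split => //; exists p; split => //; [rewrite prime_coprime|apply: principal_self].
have hpO : has_index setT pO (p ^ n) by apply: index_natr.
pose N := maxn d (p ^ n).
have L := log_index gpO hpO (leq_maxr d _).
have ge1 e P : (e, P) \in prime_pairs N -> 0 <= ln (e%:R : R).
  by move=> /prime_pairsP[/andP[e1 _] _ _ _]; rewrite ln_ge0 // ler1n ltnW.
have le1 : \sum_(u <- prime_pairs d) `[< u.2 p%:R >]%:R * ln u.1%:R <= ln ((p ^ n)%N%:R : R).
  rewrite L -/N /sum_prime_powers.
  apply: le_trans (_ : \sum_(u <- prime_pairs N) `[< u.2 p%:R >]%:R * ln u.1%:R <= _); last first.
    rewrite big_seq [X in _ <= X]big_seq; apply: ler_sum => -[e P] hu /=.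
    have [/andP[e1 eN] mP gP he] := (prime_pairsP _ _ _).1 hu.
    rewrite big_nat_recl ?(leq_trans (ltnW e1)) //= -[X in X <= _]addr0; apply: lerD.
      rewrite ler_wpM2r ?(ge1 _ _ hu) // ler_nat; case: asboolP => // Pp'; case: asboolP => // nn.
      by exfalso; apply: nn; rewrite ideal_prodT; [apply: principal_sub|]; case: mP.
    by apply: sumr_ge0 => k _; rewrite mulr_ge0 // (ge1 _ _ hu).
  have sub : {subset prime_pairs d <= prime_pairs N}.
    move=> [e P] /prime_pairsP[/andP[e1 ed] mP gP he]; apply/prime_pairsP; split => //.
    by rewrite e1 (leq_trans ed) // leq_maxl.
  rewrite -(big_rmcond_in (fun u => u \in prime_pairs d)) /=.
    rewrite [X in _ <= X](bigID (fun u => u \in prime_pairs d)) /= -[X in X <= _]addr0; apply: lerD.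
      rewrite -big_filter -[X in _ <= X]big_filter le_eqVlt; apply/orP; left; apply/eqP.
      apply: perm_big; apply: uniq_perm; rewrite ?filter_uniq ?prime_pairs_uniq // => u.
      by rewrite !mem_filter; case: (boolP (u \in prime_pairs d)) => // /sub ->.
    by rewrite big_seq_cond; apply: sumr_ge0 => -[e P] /andP[hu _]; rewrite mulr_ge0 // (ge1 _ _ hu).
  by move=> u hu; rewrite hu.
apply: le_trans (_ : ln ((p ^ n)%N%:R) <= _).
  apply: le_trans le1; rewrite /ideal_mangoldt /sum_prime_powers big_seq [X in _ <= X]big_seq.
  apply: ler_sum => -[e P] hu /=; have [/andP[e1 eN] mP gP he] := (prime_pairsP _ _ _).1 hu.
  rewrite -mulr_suml ler_wpM2r ?ln_ge0 ?ler1n 1?ltnW // -natr_sum ler_nat.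
  have [[k /andP[k1 kd] Ek]|nk] := pselect (exists2 k, (0 < k < d.+1)%N & (e ^ k)%N = d).
    rewrite (bigD1_seq k) ?mem_index_iota ?k1 ?iota_uniq //= big1 ?addn0.
      by rewrite Ek eqxx; case: asboolP => // nP; case: nP; apply: uni hu Ek.
    move=> k' kk'; case: eqP => // Ek'; case/eqP: kk'; apply/eqP.
    by rewrite -(eqn_exp2l _ _ e1) Ek Ek'.
  rewrite big_nat_cond big1 // => k /andP[hk _]; case: eqP => // Ek; by case: nk; exists k.
have pR : 0 < (p%:R : R) by rewrite ltr0n.
have dR : 0 < (d%:R : R) by rewrite ltr0n.
rewrite natrX lnXn // -[_ *+ n]mulr_natl; apply: ler_wpM2l => //.
by rewrite ler_ln ?posrE // ler_nat; apply: dvdn_leq.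
Qed.

End IdealZeta.

(** * The number of ideals of bounded index *)

Section Determinants.
Implicit Types (n : nat) (a e : int).

Lemma prod_lipschitz (I : Type) (s : seq I) (u v : I -> int) a e : 0 <= a ->
  (forall i, `|u i| <= a) -> (forall i, `|v i| <= a) -> (forall i, `|u i - v i| <= e) ->
  `|\prod_(i <- s) u i - \prod_(i <- s) v i| <= (size s)%:R * a ^+ (size s).-1 * e.
Proof.
move=> a0 ua va uv; elim: s => [|i s IH]; first by rewrite !big_nil subrr normr0 /= !mul0r.
rewrite !big_cons /=.
have vs : `|\prod_(i <- s) v i| <= a ^+ size s.
  by elim: (s) => [|j t IHt]; rewrite ?big_nil ?normr1 // big_cons normrM exprS ler_pM.
have -> : u i * \prod_(j <- s) u j - v i * \prod_(j <- s) v j =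
  u i * (\prod_(j <- s) u j - \prod_(j <- s) v j) + (u i - v i) * \prod_(j <- s) v j by ring.
apply: le_trans (ler_normD _ _) _; rewrite !normrM.
apply: le_trans (lerD (ler_pM _ _ (ua i) IH) (ler_pM _ _ (uv i) vs)) _ => //.
case: (size s) => [|k] /=; first by rewrite le_eqVlt; apply/orP; left; apply/eqP; ring.
by rewrite le_eqVlt; apply/orP; left; apply/eqP; rewrite exprS -[k.+2]addn1 natrD; ring.
Qed.

Lemma det_bound n (A : 'M[int]_n) a : (forall i j, `|A i j| <= a) -> `|\det A| <= n`!%:R * a ^+ n.
Proof.
move=> h; rewrite /determinant; apply: le_trans (ler_norm_sum _ _ _) _.
apply: le_trans (_ : \sum_(s : 'S_n) a ^+ n <= _); last by rewrite sumr_const card_Sn mulr_natl.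
apply: ler_sum => s _; rewrite normrM normrX normrN1 expr1n mul1r normr_prod.
rewrite -[X in _ <= _ ^+ X](card_ord n) -prodr_const.
by apply: ler_prod => i _; rewrite normr_ge0 h.
Qed.

Lemma det_lipschitz n (A B : 'M[int]_n) a e : 0 <= a -> (forall i j, `|A i j| <= a) -> (forall i j, `|B i j| <= a) ->
  (forall i j, `|A i j - B i j| <= e) -> `|\det A - \det B| <= (n`! * n)%:R * a ^+ n.-1 * e.
Proof.
move=> a0 hA hB hAB; rewrite /determinant -sumrB; apply: le_trans (ler_norm_sum _ _ _) _.
apply: le_trans (_ : \sum_(s : 'S_n) (n%:R * a ^+ n.-1 * e) <= _); last first.
  by rewrite sumr_const card_Sn -[_ *+ _]mulr_natl natrM !mulrA.
apply: ler_sum => s _; rewrite -mulrBr normrM normrX normrN1 expr1n mul1r.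
have sz : size (index_enum 'I_n) = n by rewrite /index_enum unlock -enumT size_enum_ord.
by have := @prod_lipschitz _ (index_enum 'I_n) (fun i => A i (s i)) (fun i => B i (s i)) a e; rewrite sz; apply.
Qed.

Lemma adj_bound n (A : 'M[int]_n) a i j : (forall i j, `|A i j| <= a) -> `|(\adj A) i j| <= n.-1`!%:R * a ^+ n.-1.
Proof.
move=> h; rewrite mxE /cofactor normrM normrX normrN1 expr1n mul1r.
by apply: det_bound => i' j'; rewrite !mxE.
Qed.

(** In Smith normal form the lattice is a product of the multiples of the diagonal entries, whose
    residues form a box of [|det A|] points; the unimodular [R] carries the box back. *)
Lemma det_index_box n (A : 'M[int]_n) : \det A != 0 -> exists s : seq 'rV[int]_n,
  [/\ size s = `|\det A|%N, uniq s,
      (forall x y, x \in s -> y \in s -> (exists z, x - y = z *m A) -> x = y) &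
      (forall x, exists2 y, y \in s & exists z, x - y = z *m A)].
Proof.
have [L uL [R uR [d _ EA]]] := int_Smith_normal_form A.
pose dd (i : nat) : int := nth 0 d i.
set S := \matrix_(i, j) _ in EA.
have ES : S = diag_mx (\row_i dd i) by apply/matrixP => i j; rewrite !mxE.
have detS : \det S = \prod_(i < n) dd i by rewrite ES det_diag; apply: eq_bigr => i _; rewrite mxE.
have abs1 (U : 'M[int]_n) : U \in unitmx -> `|\det U|%N = 1%N 
  by rewrite unitmxE => /mulrV/(congr1 absz); rewrite abszM => /eqP; rewrite muln_eq1 => /andP[/eqP].
have detA : `|\det A|%N = (\prod_(i < n) `|dd i|)%N.
  by rewrite EA !det_mulmx !abszM (abs1 L uL) (abs1 R uR) mul1n muln1 detS; apply: (big_morph _ abszM).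
move=> nz; have d0 i : dd i != 0 :> int \/ (n <= i)%N.
  have [|ni] := leqP n i; [by right|left].
  apply: contraNneq nz => E; rewrite EA !det_mulmx detS (bigD1 (Ordinal ni)) //= E.
  by rewrite mul0r mulr0 mul0r.
have d0' (i : 'I_n) : dd i != 0 by have [//|] := d0 i; rewrite leqNgt ltn_ord.
pose T := {dffun forall i : 'I_n, 'I_(`|dd i|)}.
pose g (f : T) : 'rV[int]_n := (\row_i ((f i : nat)%:Z)) *m R.
have unS (z : 'rV[int]_n) : \row_i (z 0 i * dd i) = z *m S :> 'rV[int]_n.
  by apply/rowP => i; rewrite ES mul_mx_diag !mxE.
have latt (x y : 'rV[int]_n) : (exists z, x *m R - y *m R = z *m A) <-> exists z : 'rV[int]_n, forall i, x 0 i - y 0 i = z 0 i * dd i.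
  split => -[z Ez].
    exists (z *m L) => i; have : (x - y) = z *m L *m S.
      by apply: (can_inj (mulmxK uR)); rewrite mulmxBl Ez EA !mulmxA.
    by rewrite -unS => /rowP/(_ i); rewrite !mxE.
  exists (z *m invmx L); rewrite EA !mulmxA mulmxKV // -mulmxBl; congr (_ *m R).
  by rewrite -unS; apply/rowP => i; rewrite !mxE Ez.
have small (i : 'I_n) (x y : 'I_(`|dd i|)) z : (x : nat)%:Z - (y : nat)%:Z = z * dd i -> x = y.
  move=> E; have hx := ltn_ord x; have hy := ltn_ord y; apply: val_inj => /=.
  have h : (dd i %| (x : nat)%:Z - (y : nat)%:Z)%Z by rewrite E dvdz_mull.
  have : ((x : nat)%:Z == (y : nat)%:Z %[mod `|dd i|%N])%Z by rewrite eqz_mod_dvd dvdzE /=.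
  by rewrite !modz_nat !modn_small // => /eqP[].
have gE f f' : (exists z, g f - g f' = z *m A) -> f = f'.
  move=> /latt[z Ez]; apply/ffunP => i; apply: (small i _ _ (z 0 i)).
  by have := Ez i; rewrite !mxE.
exists [seq g f | f <- enum {: T}]; split.
- rewrite size_map -cardE card_dep_ffun detA foldrE big_map.
  rewrite -(big_enum_cond _ _ (fun i : 'I_n => true)) /= big_filter.
  by rewrite enumT; apply: eq_bigr => i _; rewrite card_ord.
- rewrite map_inj_uniq ?enum_uniq // => f f' E; apply: gE; exists 0; by rewrite E subrr mul0mx.
- move=> _ _ /mapP[f _ ->] /mapP[f' _ ->] h; congr g; exact: gE.
move=> x; pose y := x *m invmx R; have Ex : x = y *m R by rewrite mulmxKV.
clearbody y.
have lt (i : 'I_n) : (`|(y 0%R i %% dd i)%Z| < `|dd i|)%N.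
  have := ltz_mod (y 0 i) (d0' i); have := modz_ge0 (y 0 i) (d0' i); lia.
pose f : T := [ffun i => Ordinal (lt i)].
exists (g f); first by apply: map_f; rewrite mem_enum.
rewrite Ex; apply/latt; exists (\row_i divz (y 0 i) (dd i)) => i; rewrite !mxE ffunE /=.
have := modz_ge0 (y 0 i) (d0' i); have := divz_eq (y 0 i) (dd i); lia.
Qed.

End Determinants.

Lemma addfun_int (U V : zmodType) (f : U -> V) : (forall x y, f (x + y) = f x + f y) ->
  forall k x, f (x *~ k) = f x *~ k.
Proof.
move=> fD k x; have f0 : f 0 = 0 by apply: (addrI (f 0)); rewrite -fD !addr0.
have fN z : f (- z) = - f z by apply: (addrI (f z)); rewrite -fD !subrr f0.
have fn m : f (x *+ m) = f x *+ m.
  by elim: m => [|m IH]; rewrite ?mulr0n // !mulrS fD IH.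
by case: k => m; rewrite ?NegzE ?mulrNz -?pmulrn ?fN fn.
Qed.

Lemma addfun_sum (U V : zmodType) (f : U -> V) : (forall x y, f (x + y) = f x + f y) ->
  forall (I : Type) (r : seq I) (P : pred I) F, f (\sum_(i <- r | P i) F i) = \sum_(i <- r | P i) f (F i).
Proof.
move=> fD I r P F; apply: big_morph => //.
by apply: (addrI (f 0)); rewrite -fD !addr0.
Qed.

Lemma absz_sum_le (I : finType) (F : I -> int) : (`|(\sum_i F i)%R| <= \sum_i `|F i|)%N.
Proof. by elim/big_ind2: _ => // a b c d h1 h2; lia. Qed.

Lemma abszD_le (a b : int) : (`|(a + b)%R| <= `|a| + `|b|)%N. Proof. lia. Qed.

Lemma absz_natmul (a : int) k : `|(a *+ k)%R|%N = (`|a| * k)%N.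
Proof. by rewrite -mulr_natr abszM natz. Qed.

Lemma absz_shift (a r : nat) : (a < r.*2.+1)%N -> (`|(a%:Z - r%:Z)%R| <= r)%N. Proof. lia. Qed.

(** * Size and norm in an order with integral coordinates *)

Section Coordinates.
Local Open Scope classical_set_scope.
Variables (O : comNzRingType) (n : nat) (co : O -> 'rV[int]_n) (oc : 'rV[int]_n -> O).
Hypotheses (coK : cancel co oc) (ocK : cancel oc co).
Hypothesis coD : forall x y, co (x + y) = co x + co y.
Hypothesis dom : forall x y : O, x * y = 0 -> x = 0 \/ y = 0.
Implicit Types (x y z : O).

Lemma co0 : co 0 = 0. Proof. by apply: (addrI (co 0)); rewrite -coD !addr0. Qed.
Lemma coN x : co (- x) = - co x. Proof. by apply: (addrI (co x)); rewrite -coD !subrr co0. Qed.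
Lemma coB x y : co (x - y) = co x - co y. Proof. by rewrite coD coN. Qed.
Lemma ocD u v : oc (u + v) = oc u + oc v.
Proof. by apply: (can_inj coK); rewrite coD !ocK. Qed.
Lemma co_natr k x : co (k%:R * x) = co x *+ k.
Proof. by rewrite mulr_natl; elim: k => [|k IH]; rewrite ?co0 // !mulrS coD IH. Qed.

Definition mul_mx x : 'M[int]_n := \matrix_(i < n) co (oc (delta_mx 0 i) * x).

Lemma scale_int_row (k : int) (v : 'rV[int]_n) : k *: v = v *~ k.
Proof. by rewrite -scaler_int intz. Qed.

Lemma co_mul x y : co (x * y) = co x *m mul_mx y.
Proof.
rewrite -{1}(coK x) [co x in LHS]row_sum_delta mulmx_sum_row.
have fD u v : co (oc (u + v) * y) = co (oc u * y) + co (oc v * y) by rewrite ocD mulrDl coD.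
rewrite (addfun_sum fD); apply: eq_bigr => i _.
by rewrite !scale_int_row (addfun_int fD) rowK.
Qed.

Lemma mul_mxM x y : mul_mx (x * y) = mul_mx x *m mul_mx y.
Proof. by apply/row_matrixP => i; rewrite row_mul !rowK mulrA co_mul. Qed.

Lemma mul_mxB x y : mul_mx (x - y) = mul_mx x - mul_mx y.
Proof. by apply/row_matrixP => i; rewrite linearB /= !rowK mulrBr coB. Qed.

Lemma mul_mx_natr k : mul_mx k%:R = (k%:R)%:M.
Proof.
apply/row_matrixP => i; rewrite rowK mulrC co_natr ocK; apply/rowP => j.
by rewrite mulmxnE !mxE eqxx /= eq_sym; case: eqP; rewrite ?mulr0n ?mul0rn // mulr1n.
Qed.

Definition cnrm x : nat := \max_(i < n) `|co x 0%R i|%N.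
Definition ideal_norm x : nat := `|\det (mul_mx x)|%N.

Lemma cnrmP x r : (cnrm x <= r)%N <-> forall i, (`|co x 0%R i| <= r)%N.
Proof. by split => [/bigmax_leqP h i|h]; [apply: h|apply/bigmax_leqP => i _]. Qed.

Lemma cnrm_coord x i : (`|co x 0%R i| <= cnrm x)%N. Proof. by apply: (cnrmP x (cnrm x)).1. Qed.

Lemma cnrmD x y : (cnrm (x + y) <= cnrm x + cnrm y)%N.
Proof. by apply/cnrmP => i; rewrite coD mxE; apply: leq_trans (abszD_le _ _) _; rewrite leq_add ?cnrm_coord. Qed.

Lemma cnrmN x : cnrm (- x) = cnrm x.
Proof. by apply: eq_bigr => i _; rewrite coN mxE abszN. Qed.

Lemma cnrmB x y : (cnrm (x - y) <= cnrm x + cnrm y)%N. Proof. by rewrite -(cnrmN y) cnrmD. Qed.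

Lemma cnrm_natr_le k x : (cnrm (k%:R * x) <= k * cnrm x)%N.
Proof. by apply/cnrmP => i; rewrite co_natr mulmxnE -mulr_natr abszM natz /= mulnC leq_mul2l cnrm_coord orbT. Qed.

Lemma cnrm_natr_ge k x : (k * cnrm x <= cnrm (k%:R * x))%N.
Proof.
case: k => [|k]; first by rewrite mul0n.
rewrite mulnC -leq_divRL //; apply/cnrmP => i; rewrite leq_divRL //.
by have := cnrm_coord (k.+1%:R * x) i; rewrite co_natr mulmxnE absz_natmul.
Qed.

Lemma cnrm_natr k x : cnrm (k%:R * x) = (k * cnrm x)%N.
Proof. by apply/eqP; rewrite eqn_leq cnrm_natr_le cnrm_natr_ge. Qed.

Lemma cnrm_eq0 x : cnrm x = 0%N -> x = 0.
Proof.
move=> h; apply: (can_inj coK); rewrite co0; apply/rowP => i; rewrite mxE.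
by have := cnrm_coord x i; rewrite h; lia.
Qed.

Lemma mul_entry_bound : exists K, forall x i j, (`|mul_mx x i j| <= K * cnrm x)%N.
Proof.
(* [E] bounds the structure constants of the basis. *)
pose E := (\max_(i < n) \max_(j < n) \max_(l < n) `|co (oc (delta_mx 0%R i) * oc (delta_mx 0%R l)) 0%R j|)%N.
exists (n * E)%N => x i j.
rewrite mxE mulrC co_mul mxE.
apply: leq_trans (absz_sum_le _) _.
apply: leq_trans (_ : (\sum_(l < n) cnrm x * E <= _)%N); last by rewrite sum_nat_const card_ord; nia.
apply: leq_sum => l _; rewrite abszM leq_mul ?cnrm_coord // mxE mulrC.
apply: leq_trans (leq_bigmax i); apply: leq_trans (leq_bigmax j); exact: (leq_bigmax l).
Qed.


Lemma cnrm_mul_bound : exists K, forall x y, (cnrm (x * y) <= K * (cnrm x * cnrm y))%N.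
Proof.
have [K hK] := mul_entry_bound; exists (n * K)%N => x y; apply/cnrmP => j.
rewrite co_mul mxE; apply: leq_trans (absz_sum_le _) _.
apply: leq_trans (_ : (\sum_(l < n) cnrm x * (K * cnrm y) <= _)%N); last by rewrite sum_nat_const card_ord; nia.
by apply: leq_sum => l _; rewrite abszM leq_mul ?cnrm_coord.
Qed.

Lemma ideal_normM x y : ideal_norm (x * y) = (ideal_norm x * ideal_norm y)%N.
Proof. by rewrite /ideal_norm mul_mxM det_mulmx abszM. Qed.

Lemma ideal_norm_natr k : ideal_norm k%:R = (k ^ n)%N.
Proof. by rewrite /ideal_norm mul_mx_natr det_scalar abszX natz. Qed.

Lemma entry_int K : (forall x i j, (`|mul_mx x i j| <= K * cnrm x)%N) ->
  forall x r i j, (cnrm x <= r)%N -> `|mul_mx x i j| <= (K * r)%N%:R :> int.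
Proof. by move=> hK x r i j hr; rewrite natz -abszE lez_nat (leq_trans (hK x i j)) // leq_mul2l hr orbT. Qed.

Lemma ideal_norm_lipschitz : exists K, forall r x y, (cnrm x <= r)%N -> (cnrm y <= r)%N ->
  (ideal_norm x <= ideal_norm y + K * (r ^ n.-1 * cnrm (x - y)))%N.
Proof.
have [K hK] := mul_entry_bound; have hZ := entry_int hK.
exists (n`! * n * K ^ n.-1 * K)%N => r x y hx hy.
have h := @det_lipschitz n (mul_mx x) (mul_mx y) (K * r)%N%:R (K * cnrm (x - y))%N%:R (ler0n _ _)
  (fun i j => hZ x r i j hx) (fun i j => hZ y r i j hy).
have : `|\det (mul_mx x) - \det (mul_mx y)| <= (n`! * n)%:R * (K * r)%:R ^+ n.-1 * (K * cnrm (x - y))%:R :> int.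
  by apply: h => i j; have := hZ (x - y) _ i j (leqnn _); rewrite mul_mxB !mxE.
rewrite -natrX -!natrM natz -abszE lez_nat /ideal_norm expnMn; move: (K ^ _)%N (r ^ _)%N => a b.
by move: (\det _) (\det _) => u v; nia.
Qed.

Lemma ideal_norm_bound : exists K, forall x, (ideal_norm x <= K * cnrm x ^ n)%N.
Proof.
have [K hK] := mul_entry_bound; exists (n`! * K ^ n)%N => x.
have := det_bound (fun i j => entry_int hK i j (leqnn (cnrm x))).
by rewrite -natrX -natrM natz -abszE lez_nat expnMn mulnA.
Qed.

(** The adjugate inverts multiplication by [x] up to the determinant, so a product cannot be too
    small compared with its factors. *)
Lemma cnrm_cancel_bound : exists K, forall x y, (cnrm y * ideal_norm x <= K * (cnrm x ^ n.-1 * cnrm (y * x)))%N.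
Proof.
have [K hK] := mul_entry_bound; exists (n * (n.-1`! * K ^ n.-1))%N => x y.
rewrite mulnC; have E : co (y * x) *m \adj (mul_mx x) = \det (mul_mx x) *: co y.
  by rewrite co_mul -mulmxA mul_mx_adj mul_mx_scalar.
have ab i j : (`|(\adj (mul_mx x))%R i j| <= n.-1`! * K ^ n.-1 * cnrm x ^ n.-1)%N.
  have := adj_bound i j (fun i j => entry_int hK i j (leqnn (cnrm x))).
  by rewrite -natrX -natrM natz -abszE lez_nat expnMn mulnA.
have [x0|x0] := posnP (ideal_norm x); first by rewrite x0.
rewrite mulnC -leq_divRL //; apply/cnrmP => j; rewrite leq_divRL //.
have -> : (`|co y 0%R j| * ideal_norm x)%N = `|(\det (mul_mx x) *: co y) 0%R j|%N.
  by rewrite mxE abszM mulnC.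
rewrite -E mxE; apply: leq_trans (absz_sum_le _) _.
apply: leq_trans (_ : (\sum_(l < n) cnrm (y * x) * (n.-1`! * K ^ n.-1 * cnrm x ^ n.-1) <= _)%N); last first.
  by rewrite sum_nat_const card_ord; move: (_`!) (K ^ _)%N (cnrm x ^ _)%N => a b c; nia.
by apply: leq_sum => l _; rewrite abszM leq_mul ?cnrm_coord.
Qed.

Lemma ideal_norm_gt0 x : x != 0 -> (0 < ideal_norm x)%N.
Proof.
move=> x0; rewrite /ideal_norm absz_gt0; apply/negP => /eqP d0.
have : exists2 v : 'rV_n, v != 0 & v *m mul_mx x = 0 by apply/det0P; rewrite d0.
move=> [v v0]; rewrite -(ocK v) -co_mul -co0 => /(can_inj coK) /dom[] h.
  by case/eqP: v0; rewrite -(ocK v) h co0.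
by rewrite h eqxx in x0.
Qed.

Lemma principal_index x : x != 0 -> has_index setT (principal x) (ideal_norm x).
Proof.
move=> /ideal_norm_gt0; rewrite /ideal_norm absz_gt0 => /det_index_box[s [ss us si sc]].
have latt u v : principal x (u - v) <-> exists z : 'rV[int]_n, co u - co v = z *m mul_mx x.
  split; first by move=> [a E]; exists (co a); rewrite -coB E mulrC co_mul.
  by move=> [z E]; exists (oc z); apply: (can_inj coK); rewrite mulrC co_mul ocK coB.
exists (map oc s); rewrite size_map ss; split => //.
  split; first by rewrite map_inj_uniq //; apply: can_inj ocK.
  move=> _ _ /mapP[u us' ->] /mapP[v vs ->] /latt; rewrite !ocK => h; congr oc; exact: si.
move=> u _; have [v vs h] := sc (co u); exists (oc v); first exact: map_f.
by apply/latt; rewrite ocK.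
Qed.

(** Division with remainder by the lattice [(x)]: Cramer's coordinates of [g] are rounded, and the
    remainder has coordinates of absolute value below 1 with respect to the rows of [mul_mx x]. *)
Lemma reduce_modulo : exists K, forall g x, x != 0 -> exists q, (cnrm (g - q * x) <= K * cnrm x)%N.
Proof.
have [K hK] := mul_entry_bound; exists (n * K)%N => g x x0.
have := ideal_norm_gt0 x0; rewrite /ideal_norm absz_gt0; set d := \det _ => d0.
pose y := co g *m \adj (mul_mx x).
have E : d *: co g = y *m mul_mx x by rewrite -mulmxA mul_adj_mx mul_mx_scalar.
pose q : 'rV[int]_n := \row_i divz (y 0 i) d.
pose r : 'rV[int]_n := \row_i modz (y 0 i) d.
have Ey : y = d *: q + r by apply/rowP => i; rewrite !mxE mulrC -divz_eq.
exists (oc q); have Er : d *: co (g - oc q * x) = r *m mul_mx x.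
  by rewrite coB co_mul ocK scalerBr E Ey mulmxDl -scalemxAl addrAC subrr add0r.
have d1 : (0 < `|d|)%N by rewrite absz_gt0.
apply/cnrmP => j; rewrite -(leq_pmul2l d1) -abszM.
have -> : d * co (g - oc q * x) 0 j = (r *m mul_mx x) 0 j by rewrite -Er mxE.
rewrite mxE; apply: leq_trans (absz_sum_le _) _.
apply: leq_trans (_ : (\sum_(l < n) `|d| * (K * cnrm x) <= _)%N); last by rewrite sum_nat_const card_ord; nia.
apply: leq_sum => l _; rewrite abszM leq_mul // mxE.
by have := ltz_mod (y 0 l) d0; have := modz_ge0 (y 0 l) d0; lia.
Qed.

Definition cbox r : seq O :=
  [seq oc (\row_i ((f i : nat)%:Z - r%:Z)) | f : {ffun 'I_n -> 'I_(r.*2.+1)}].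

Lemma mem_cbox r x : (x \in cbox r) = (cnrm x <= r)%N.
Proof.
apply/mapP/idP => [[f _ ->]|h].
  by apply/cnrmP => i; rewrite ocK mxE; apply: absz_shift.
have hi i : (absz (co x 0%R i + r%:Z)%R < r.*2.+1)%N by have := cnrm_coord x i; lia.
exists [ffun i => Ordinal (hi i)]; first by rewrite mem_enum.
apply: (can_inj coK); rewrite ocK; apply/rowP => i; rewrite mxE ffunE /=.
by have := cnrm_coord x i; lia.
Qed.

Lemma cbox_uniq r : uniq (cbox r).
Proof.
rewrite map_inj_uniq ?enum_uniq // => f f' /(can_inj ocK) /rowP E; apply/ffunP => i.
by have := E i; rewrite !mxE => h; apply: val_inj => /=; lia.
Qed.

Lemma cbox_size r : size (cbox r) = (r.*2.+1 ^ n)%N.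
Proof. by rewrite size_map -cardE card_ffun !card_ord. Qed.

End Coordinates.


Section Matching.
Variable R : realType.

(** Only the nonzero terms need partners, so either list may contain further elements where its
    summand vanishes. *)
Lemma sum_match (I J : eqType) (r : seq I) (s : seq J) (F : I -> R) (G : J -> R) (rel : I -> J -> Prop) :
  uniq r -> uniq s ->
  (forall i, i \in r -> F i != 0 -> exists2 j, j \in s & rel i j) ->
  (forall j, j \in s -> G j != 0 -> exists2 i, i \in r & rel i j) ->
  (forall i j, i \in r -> j \in s -> rel i j -> F i = G j) ->
  (forall i i' j, rel i j -> rel i' j -> i = i') ->
  (forall i j j', rel i j -> rel i j' -> j = j') ->
  \sum_(i <- r) F i = \sum_(j <- s) G j.
Proof.
move=> ur us hF hG FG inj fct.
have -> : \sum_(i <- r) F i = \sum_(i <- r) \sum_(j <- s) `[< rel i j >]%:R * F i.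
  rewrite big_seq [RHS]big_seq; apply: eq_bigr => i ir.
  have [->|Fi] := eqVneq (F i) 0; first by rewrite big1 // => j _; rewrite mulr0.
  have [j js ij] := hF i ir Fi.
  rewrite (bigD1_seq j js us) /= (asboolT ij) mul1r big1 ?addr0 // => j' nj.
  case: asboolP => [h|_]; last by rewrite mul0r.
  by rewrite (fct _ _ _ h ij) eqxx in nj.
have -> : \sum_(j <- s) G j = \sum_(j <- s) \sum_(i <- r) `[< rel i j >]%:R * G j.
  rewrite big_seq [RHS]big_seq; apply: eq_bigr => j js.
  have [->|Gj] := eqVneq (G j) 0; first by rewrite big1 // => i _; rewrite mulr0.
  have [i ir ij] := hG j js Gj.
  rewrite (bigD1_seq i ir ur) /= (asboolT ij) mul1r big1 ?addr0 // => i' ni.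
  case: asboolP => [h|_]; last by rewrite mul0r.
  by rewrite (inj _ _ _ h ij) eqxx in ni.
rewrite exchange_big /= big_seq [RHS]big_seq; apply: eq_bigr => j js.
rewrite big_seq [RHS]big_seq; apply: eq_bigr => i ir.
by case: asboolP => [h|_]; [rewrite (FG i j ir js h)|rewrite !mul0r].
Qed.

End Matching.

(** Collects what the lattice point count takes from coordinates, with a single constant [bnd] in
    all inequalities, so that the count itself is free of matrices. *)
Record lattice_order (O : comNzRingType) (n : nat) := LatticeOrder {
  nrm : O -> nat;
  idn : O -> nat;
  box : nat -> seq O;
  cube : nat -> seq O;
  bnd : nat;
  bnd_gt0 : (0 < bnd)%N;
  rank_gt0 : (0 < n)%N;
  nrm1 : (nrm 1 <= bnd)%N;
  nrmB : forall x y, (nrm (x - y) <= nrm x + nrm y)%N;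
  nrm_natr : forall k x, nrm (k%:R * x) = (k * nrm x)%N;
  nrm_eq0 : forall x, nrm x = 0%N -> x = 0;
  nrm_mul : forall x y, (nrm (x * y) <= bnd * (nrm x * nrm y))%N;
  idn_mul : forall x y, idn (x * y) = (idn x * idn y)%N;
  idn_natr : forall k, idn k%:R = (k ^ n)%N;
  idn_gt0 : forall x, x != 0 -> (0 < idn x)%N;
  idn_index : forall x, x != 0 -> has_index setT (principal x) (idn x);
  idn_bound : forall x, (idn x <= bnd * nrm x ^ n)%N;
  idn_lipschitz : forall r x y, (nrm x <= r)%N -> (nrm y <= r)%N ->
    (idn x <= idn y + bnd * (r ^ n.-1 * nrm (x - y)))%N;
  nrm_cancel : forall x y, (nrm y * idn x <= bnd * (nrm x ^ n.-1 * nrm (y * x)))%N;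
  nrm_reduce : forall g x, x != 0 -> exists q, (nrm (g - q * x) <= bnd * nrm x)%N;
  mem_box : forall r x, (x \in box r) = (nrm x <= r)%N;
  box_uniq : forall r, uniq (box r);
  box_size : forall r, size (box r) = (r.*2.+1 ^ n)%N;
  cube_uniq : forall k, uniq (cube k);
  cube_size : forall k, size (cube k) = (k ^ n)%N;
  cube_nrm : forall k x, x \in cube k -> (nrm x <= k)%N;
  cube_div : forall k, (0 < k)%N -> forall x, exists q y, y \in cube k /\ x = k%:R * q + y;
  cube_incongruent : forall k x y q, x \in cube k -> y \in cube k -> x - y = k%:R * q -> x = y
}.

(** * Trading ideals for lattice points and cofactors *)

Section Pairing.
Local Open Scope classical_set_scope.
Variables (R : realType) (O : comNzRingType) (n D : nat) (L : lattice_order O n).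
Implicit Types (M J : set O) (x y z : O).
Hypothesis D1 : (1 < D)%N.
Hypothesis dom : forall x y, x * y = 0 -> x = 0 \/ y = 0.
Hypothesis prime_inverse : forall p (P : set O), prime p -> ~~ (p %| D)%N -> maximal_ideal P -> P p%:R ->
  exists Q q, [/\ is_ideal Q, ideal_prod P Q = principal p%:R, Q q & P (1 - q)].
Notation K := (bnd L).
Notation nrm := (nrm L).
Notation idn := (idn L).
Notation box := (box L).

Lemma nrm0 : nrm 0 = 0%N.
Proof. by have := nrm_natr L 0 0; rewrite mul0r mul0n. Qed.

Lemma nrmN x : nrm (- x) = nrm x.
Proof.
have h z : (nrm (- z) <= nrm z)%N by have := nrmB L 0 z; rewrite nrm0 sub0r.
by apply/eqP; rewrite eqn_leq h /= -{1}(opprK x) h.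
Qed.

Lemma nrmD x y : (nrm (x + y) <= nrm x + nrm y)%N.
Proof. by rewrite -{1}(opprK y) -(nrmN y) nrmB. Qed.

Lemma order_natr_neq0 k : (0 < k)%N -> k%:R != 0 :> O.
Proof.
move=> k0; apply/eqP => E; have := nrm_natr L k 1; rewrite E mul0r nrm0 => /esym/eqP.
by rewrite muln_eq0 eqn0Ngt k0 => /eqP /(@nrm_eq0 _ _ L) /eqP; rewrite oner_eq0.
Qed.

Lemma order_index_natr k : (0 < k)%N -> has_index setT (principal (k%:R : O)) (k ^ n).
Proof. by move=> k0; rewrite -(idn_natr L); apply: idn_index; apply: order_natr_neq0. Qed.

Let nz := order_natr_neq0.
Let ixn := order_index_natr.
Let inv := good_invertible dom nz ixn prime_inverse.

Definition unital x := principal (D%:R : O) (x - 1).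

Lemma unital_neq0 x : unital x -> x != 0.
Proof.
move=> [a E]; apply/eqP => x0; have : principal (D%:R : O) 1 by exists (- a); rewrite mulrN -E x0 sub0r opprK.
move=> /(ideal_eqT (principal_ideal _)) h; have := ixn (ltnW D1); rewrite h => hT.
have := has_index_inj (@idealT O) hT (has_indexT O).
by have := ltn_expl n D1; have := rank_gt0 L; lia.
Qed.

(** Pigeonhole in the smallest box with more than [m] points: minimality gives [(2 s - 1)^n <= m],
    and a difference of two points of the box has size at most [2 s]. *)
Lemma short_nonzero M m : is_ideal M -> has_index setT M m -> exists x, [/\ M x, x != 0 & (nrm x ^ n <= 2 ^ n * m)%N].
Proof.
move=> iM hm; have m0 : (0 < m)%N by apply: has_index_gt0 hm.
have n0 := rank_gt0 L.
have ex : exists s, (m < s.*2.+1 ^ n)%N.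
  by exists m; apply: leq_trans (_ : m.*2.+1 <= _)%N; [lia|rewrite -[X in (X <= _)%N]expn1 leq_pexp2l].
case: (ex_minnP ex) => s hs smin.
have s0 : (0 < s)%N by case: (s) hs => //; rewrite exp1n; lia.
have hs1 : (s.*2.-1 ^ n <= m)%N.
  rewrite leqNgt; apply/negP => h; have : (s <= s.-1)%N; last by lia.
  by apply: smin; rewrite (_ : s.-1.*2.+1 = s.*2.-1) //; lia.
have [inc|] := pselect (incongruent M (box s)).
  have [t [st _ _ ct]] := hm.
  by have := incongruent_size_le (N := setT) iM (fun x _ => I) inc ct; rewrite st box_size leqNgt hs.
move=> ninc; have [x [y [xs ys Mxy nxy]]] : exists x y, [/\ x \in box s, y \in box s, M (x - y) & x != y].
  apply: contrapT => h; apply: ninc; split; first exact: box_uniq.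
  by move=> x y xs ys Mxy; apply/eqP; apply: contrapT => /negP nxy; apply: h; exists x, y.
exists (x - y); rewrite subr_eq0; split => //.
move: xs ys; rewrite !mem_box => hx hy.
apply: leq_trans (_ : (2 * s.*2.-1) ^ n <= _)%N; last by rewrite expnMn leq_mul2l hs1 orbT.
by rewrite leq_exp2r //; apply: leq_trans (nrmB L x y) _; lia.
Qed.

(** [2 K D] comes from [short_unital]; the 4 keeps the constant positive and at least [2 (K + 1)],
    which [cell_term_near] relies on. *)
Definition short_bound := (2 * K * D + 4)%N.
Notation C1 := short_bound.

(** For suitable [u] the integer [m u] lies in [M] and is 1 modulo [D]; reducing it modulo [D x0],
    with [x0] a short element of [M], keeps both properties and makes it short. *)
Lemma short_unital M m : good D M -> has_index setT M m -> exists x, [/\ M x, unital x & (nrm x ^ n <= C1 ^ n * m)%N].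
Proof.
move=> gM hm; have iM := good_ideal gM; have n0 := rank_gt0 L.
have [m' [hm' m0 cm]] := good_index ixn gM; have Em := has_index_inj iM hm' hm; rewrite {}Em in hm' m0 cm.
have [x0 [Mx0 x00 hx0]] := short_nonzero iM hm.
have D0 : (0 < D)%N by apply: ltnW.
have [u [w E]] : exists u w, (m * u = w * D + 1)%N.
  case: (egcdnP D m0) => u w E _; exists u, w.
  by rewrite mulnC E (eqP cm).
have Dx0 : D%:R * x0 != 0 by apply: mulr_dom_neq0 => //; apply: nz.
have [q hq] := nrm_reduce L (m * u)%N%:R Dx0.
exists ((m * u)%:R - q * (D%:R * x0)); split.
- apply: idealB => //; last by rewrite mulrA; apply: idealMl.
  by rewrite natrM; apply: idealMr => //; apply: (has_index_kill (@idealT O) iM hm (I : setT (1 : O))).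
- exists (w%:R - q * x0); rewrite E natrD natrM; ring.
apply: leq_trans (_ : (2 * K * D) ^ n * m <= _)%N; last by rewrite leq_mul2r leq_exp2r // /C1; lia.
apply: leq_trans (_ : (K * D * nrm x0) ^ n <= _)%N.
  by rewrite leq_exp2r // (leq_trans hq) // nrm_natr mulnA.
by rewrite expnMn -(mulnA 2) (expnMn 2) -mulnA mulnCA; nia.
Qed.


(* A weight on the lattice points of a given ideal of index [m]: it is Lipschitz, vanishes when
   [x^n] exceeds [2 C1^n m], and equals [m] on the short element given by [short_unital]. *)
Definition tent (x m : R) : R := Num.min m (Num.max 0 (2 * m - x ^+ n / (C1 ^ n)%N%:R)).
(** Replaces the sharp cutoff at [Y]: it is Lipschitz, it scales with its arguments, and it stays
    below [m], as [quotient_lipschitz] will require. *)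
Definition hat (Y m : R) : R := Num.min m (Num.max 0 (Y - m)).
Definition idx M : nat := xget 0%N [set m | has_index setT M m].
Definition units_in M := fun x => `[< M x /\ unital x >].
Definition weight M r : R := \sum_(x <- box r | units_in M x) tent (nrm x)%:R (idx M)%:R.

Lemma idxE M m : is_ideal M -> has_index setT M m -> idx M = m.
Proof.
move=> iM hm; rewrite /idx; case: xgetP => [k _ hk|/(_ m)//].
exact: (has_index_inj iM hk hm).
Qed.

Lemma good_idx M : good D M -> [/\ has_index setT M (idx M), (0 < idx M)%N & coprime (idx M) D].
Proof. by move=> gM; have [m [hm m0 mD]] := good_index ixn gM; rewrite (idxE (good_ideal gM) hm). Qed.

Lemma C1_gt0 : 0 < (C1 ^ n)%N%:R :> R.
Proof. by rewrite ltr0n expn_gt0 /C1 addn4. Qed.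

Lemma tent_ge0 (x m : R) : 0 <= m -> 0 <= tent x m.
Proof. by move=> m0; rewrite /tent le_min m0 le_max lexx. Qed.

Lemma tent_le (x m : R) : tent x m <= m. Proof. by rewrite /tent ge_min lexx. Qed.

Lemma hat_ge0 (Y m : R) : 0 <= m -> 0 <= hat Y m.
Proof. by move=> m0; rewrite /hat le_min m0 le_max lexx. Qed.

Lemma hat_le (Y m : R) : hat Y m <= m. Proof. by rewrite /hat ge_min lexx. Qed.

Lemma hat_neq0 (Y m : R) : 0 <= m -> hat Y m != 0 -> m < Y.
Proof.
move=> m0 h; rewrite ltNge; apply: contra h => h.
by rewrite /hat max_l ?subr_le0 // min_r.
Qed.

Lemma tent_neq0 (x m : R) : 0 <= m -> tent x m != 0 -> x ^+ n < (C1 ^ n)%N%:R * (2 * m).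
Proof.
move=> m0; rewrite -ltr_pdivrMl ?C1_gt0 // mulrC => h; rewrite ltNge; apply: contra h => h.
by rewrite /tent max_l ?subr_le0 // min_r.
Qed.

Lemma tent_eq (x m : R) : 0 <= m -> x ^+ n <= (C1 ^ n)%N%:R * m -> tent x m = m.
Proof.
move=> m0; rewrite -ler_pdivrMl ?C1_gt0 // mulrC => h; rewrite /tent min_l // le_max; apply/orP; right.
by rewrite mulr2n mulrDl mul1r -addrA lerDl subr_ge0.
Qed.

(** The element of [short_unital] alone contributes [idx M], so the [weight] can serve as a
    denominator. *)
Lemma weight_ge M r : good D M -> (C1 ^ n * idx M <= r ^ n)%N -> (idx M)%:R <= weight M r.
Proof.
move=> gM hr; have [hm m0 _] := good_idx gM; have n0 := rank_gt0 L.
have [x [Mx ux hx]] := short_unital gM hm.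
have xr : x \in box r by rewrite mem_box -(leq_exp2r _ _ n0) (leq_trans hx).
rewrite /weight big_mkcond (bigD1_seq x xr (box_uniq L r)) /=.
rewrite /units_in (asboolT (conj Mx ux)) tent_eq ?ler0n //; last by rewrite -natrX -natrM ler_nat.
rewrite lerDl; apply: sumr_ge0 => y _; case: ifP => // _; exact: tent_ge0.
Qed.

Definition goods_upto N : seq (set O) := [seq M | m <- index_iota 1 N.+1, M <- goods O D m].

Lemma mem_goods_upto N M : M \in goods_upto N <-> good D M /\ (idx M <= N)%N.
Proof.
split.
  case/allpairsPdep => m [M' [+ + ->]]; rewrite mem_index_iota ltnS => /andP[m0 mN].
  by move=> /(mem_goods D ixn)[gM hm]; rewrite (idxE (good_ideal gM) hm).
move=> [gM hM]; have [hm m0 _] := good_idx gM.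
apply/allpairsPdep; exists (idx M), M; split => //; first by rewrite mem_index_iota m0 ltnS.
exact/(mem_goods D ixn).
Qed.

Lemma goods_upto_uniq N : uniq (goods_upto N).
Proof.
apply: allpairs_uniq_dep; first exact: iota_uniq.
  by move=> m _; apply: (goods_uniq D ixn).
move=> [m M] [m' M'] /allpairsPdep[a [b [_ hb [-> ->]]]] /allpairsPdep[a' [b' [_ hb' [-> ->]]]] /= E.
move: hb hb' => /(mem_goods D ixn)[gb hb] /(mem_goods D ixn)[gb' hb'].
by rewrite E in hb *; rewrite (has_index_inj (good_ideal gb') hb hb').
Qed.

Lemma sum_goods_upto N (F : nat -> R) :
  \sum_(M <- goods_upto N) F (idx M) = \sum_(1 <= m < N.+1) (size (goods O D m))%:R * F m.
Proof.
rewrite big_allpairs_dep /=; apply: eq_bigr => m _.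
rewrite (eq_big_seq (fun=> F m)); first by rewrite big_const_seq count_predT iter_addr_0 mulr_natl.
by move=> M /(mem_goods D ixn)[gM hm]; rewrite (idxE (good_ideal gM) hm).
Qed.

(** Bounds both the index of the cofactors [J] and the size of the multipliers [k] that occur in the
    pairing. *)
Definition codiff_radius := (2 * (C1 ^ n) * K)%N.
(** The quotients [k / idx J] are short elements of the inverse of [J] that are 1 modulo [D]. *)
Definition codiff J : seq O :=
  [seq k <- box codiff_radius | `[< (forall j, J j -> principal ((idx J)%:R : O) (k * j)) /\
                                    principal (D%:R : O) (k - (idx J)%:R) >]].

(** The index of [M] when [(x) = M J], written so that it makes sense for every [x]. *)
Definition cell_size J x : R := (idn x)%:R / (idx J)%:R.
(* If [M J = (x)] then the short elements of [M] that are [1] modulo [D] are among the [x * k / idx J] with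
   [k] in [codiff J], so the sum below is the [weight] of [M]; the maximum makes the denominator positive for every [x]. *)
Definition cell_weight J x : R :=
  Num.max (cell_size J x) (\sum_(k <- codiff J) tent ((nrm (x * k))%:R / (idx J)%:R) (cell_size J x)).
Definition cell_term Y J x : R := hat Y (cell_size J x) * tent (nrm x)%:R (cell_size J x) / cell_weight J x.


(** [D] is invertible modulo [x], so a prime common to [D] and to an integer of [(x)] can be divided
    out of that integer. *)
Lemma unital_good x : unital x -> good D (principal x).
Proof.
move=> ux; have x0 := unital_neq0 ux; split; first exact: principal_ideal.
have [a E] := ux; have ip := principal_ideal x.
have hd : principal x (idn x)%:R.
  by apply: (has_index_kill (@idealT O) ip (idn_index L x0) (I : setT (1 : O))).
have d0 := idn_gt0 L x0; move: (idn x) hd d0 => d.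
elim/ltn_ind: d => d IH hd d0.
have [cd|] := boolP (coprime d D); first by exists d.
rewrite /coprime => /negbTE gN.
have g1 : (1 < gcdn d D)%N by move: gN; have := gcdn_gt0 d D; rewrite d0; case: (gcdn d D) => [|[|]].
have pp := pdiv_prime g1; set p := pdiv _ in pp.
have /dvdnP[d' Ed] : (p %| d)%N by apply: dvdn_trans (pdiv_dvd _) (dvdn_gcdl _ _).
have /dvdnP[D' ED] : (p %| D)%N by apply: dvdn_trans (pdiv_dvd _) (dvdn_gcdr _ _).
have d'0 : (0 < d')%N by case: (d') Ed d0 => // ->; rewrite mul0n.
apply: (IH d') => //; first by rewrite Ed ltn_Pmulr // prime_gt1.
have hD : principal x ((D * d')%N%:R) by rewrite ED -mulnA (mulnC p) -Ed natrM; apply: idealMl.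
have -> : d'%:R = x * d'%:R - (D * d')%N%:R * a.
  rewrite natrM; have -> : D%:R * d'%:R * a = D%:R * a * d'%:R by ring.
  by rewrite -E; ring.
by apply: idealB => //; [exists d'%:R|apply: idealMr].
Qed.

Lemma idx_prod M J : good D M -> good D J -> idx (ideal_prod M J) = (idx M * idx J)%N.
Proof.
move=> gM gJ; have [hM _ _] := good_idx gM; have [hJ _ _] := good_idx gJ.
have iJ := good_ideal gJ.
apply: idxE; first by apply: ideal_prod_ideal; apply: good_ideal gM.
move: (idx M) hM => m; elim/ltn_ind: m M gM => m IH M gM hM.
have [M1|M1] := pselect (M 1).
  have E := ideal_eqT (good_ideal gM) M1; rewrite E ideal_prod1 //; rewrite E in hM.
  by rewrite (has_index_inj (@idealT O) hM (has_indexT O)) mul1n.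
have [P [M' [mP gP gM' EM [l hl lm]]]] := good_split dom nz ixn prime_inverse gM hM M1.
have [hP _ _] := good_idx gP.
have Em : m = (idx P * l)%N.
  apply: (has_index_inj (good_ideal gM) hM); rewrite EM.
  exact: (has_index_prod dom nz ixn prime_inverse).
rewrite EM -ideal_prodA ?(good_ideal gP) ?(good_ideal gM') //; last first.
- exact: good_ideal gM'.
- exact: good_ideal gP.
rewrite Em -mulnA; apply: (has_index_prod dom nz ixn prime_inverse) => //.
  exact: good_prod.
exact: IH.
Qed.

Section Pair.
Variables (M J : set O) (x : O).
Hypotheses (gM : good D M) (gJ : good D J) (ux : unital x) (E : principal x = ideal_prod M J).

Lemma pair_idn : idn x = (idx M * idx J)%N.
Proof.
rewrite -idx_prod // -E; symmetry; apply: idxE; first exact: principal_ideal.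
by apply: idn_index; apply: unital_neq0.
Qed.

Lemma pair_cell_size : cell_size J x = (idx M)%:R.
Proof.
have [_ j0 _] := good_idx gJ.
by rewrite /cell_size pair_idn natrM mulfK // pnatr_eq0 -lt0n.
Qed.

(** Elements [y] of [M] and multipliers [k] correspond through [c y = x k] with [c = idx J]; as [c]
    is prime to [D], the congruence conditions on [y] and on [k] agree. *)
Lemma pair_weight r : (nrm x)%:R ^+ n < (C1 ^ n)%N%:R * (2 * (idx M)%:R) :> R ->
  (C1 ^ n)%N%:R * (2 * (idx M)%:R) <= r%:R ^+ n :> R ->
  weight M r = \sum_(k <- codiff J) tent ((nrm (x * k))%:R / (idx J)%:R) (idx M)%:R.
Proof.
move=> hx hr; have [hM m0 _] := good_idx gM; have [hJ c0 cD] := good_idx gJ.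
have iM := good_ideal gM; have iJ := good_ideal gJ.
set c := idx J in c0 cD *; set m := idx M in m0 hx hr *.
have x0 := unital_neq0 ux; have cO0 : c%:R != 0 :> O by apply: nz.
have Jc : J c%:R by rewrite -[c%:R]mulr1 mulr_natl; have := has_index_kill (@idealT O) iJ hJ (I : setT (1 : O)).
have Jx : J x by apply: (ideal_prod_subr (M := M) iJ); rewrite -E; apply: principal_self.
have [a Ea] := ux; have cR : 0 < c%:R :> R by rewrite ltr0n.
have hxN : (nrm x ^ n < C1 ^ n * (2 * m))%N by rewrite -(ltr_nat R) natrX !natrM.
have n0 := rank_gt0 L.
have unit_mod k y : c%:R * y = x * k -> principal (D%:R : O) (k - c%:R) <-> unital y.
  move=> Eck; split => [[e Ee]|[b Eb]].
    case: (egcdnP D c0) => u w Eu _; rewrite (eqP cD) in Eu.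
    exists (u%:R * (e + a * k) - w%:R * (y - 1)).
    have Ec : u%:R * c%:R = w%:R * D%:R + 1 :> O by rewrite -!natrM Eu natrD.
    have E1 : c%:R * (y - 1) = D%:R * (e + a * k).
      have -> : c%:R * (y - 1) = (x - 1) * k + (k - c%:R) by rewrite mulrBr Eck; ring.
      by rewrite Ea Ee; ring.
    transitivity ((u%:R * c%:R - w%:R * D%:R) * (y - 1)); first by rewrite Ec; ring.
    have -> : (u%:R * c%:R - w%:R * D%:R) * (y - 1) = u%:R * (c%:R * (y - 1)) - w%:R * D%:R * (y - 1) by ring.
    by rewrite E1; ring.
  exists (c%:R * b - a * k).
  have -> : k - c%:R = c%:R * (y - 1) - (x - 1) * k by rewrite mulrBr Eck; ring.
  by rewrite Ea Eb; ring.
rewrite /weight -big_filter; apply: (@sum_match R _ _ _ _ _ _ (fun y k => c%:R * y = x * k)).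
- by rewrite filter_uniq // box_uniq.
- by rewrite filter_uniq // box_uniq.
- move=> y; rewrite mem_filter => /andP[/asboolP[My uy] _] /(tent_neq0 (ler0n _ _)) hy.
  have [k Ek] : principal x (c%:R * y) by rewrite E mulrC; apply: ideal_prod_mul.
  exists k => //; rewrite mem_filter mem_box; apply/andP; split.
    apply/asboolP; split; last exact/(unit_mod k y).
    move=> j Jj; have [b Eb] : principal x (y * j) by rewrite E; apply: ideal_prod_mul.
    exists b; apply: (mul_cancel dom x0); rewrite mulrA -Ek -mulrA Eb; ring.
  have hyN : (nrm y ^ n < C1 ^ n * (2 * m))%N by rewrite -(ltr_nat R) natrX !natrM.
  (* The size of [k] is at most [K |x|^(n-1) c |y|] over the norm [m c] of [x]; both [x] and [y]
     have [n]-th power below [2 C1^n m], so [m] and [c] drop out. *)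
  have hb := nrm_cancel L x k; rewrite mulrC -Ek nrm_natr pair_idn -/m -/c in hb.
  have hxy : (nrm x ^ n.-1 * nrm y <= C1 ^ n * (2 * m))%N.
    apply: leq_trans (_ : maxn (nrm x) (nrm y) ^ n <= _)%N; last first.
      by case: (leqP (nrm x) (nrm y)) => _; apply: ltnW.
    rewrite -[X in (_ <= _ ^ X)%N](prednK n0) expnSr leq_mul ?leq_maxr //.
    by case: (n.-1) => // n'; rewrite leq_exp2r // leq_maxl.
  rewrite /codiff_radius -(leq_pmul2r (_ : 0 < m * c)%N) ?muln_gt0 ?m0 ?c0 //.
  apply: leq_trans hb _; apply: leq_trans (_ : K * (c * (C1 ^ n * (2 * m))) <= _)%N; last first.
    by move: (C1 ^ n)%N => C; nia.
  by rewrite leq_mul2l mulnCA leq_mul2l hxy !orbT.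
- move=> k; rewrite mem_filter => /andP[/asboolP[kJ kD] _] /(tent_neq0 (ler0n _ _)) hk.
  have [y Ey] := kJ x Jx; exists y; last by rewrite -Ey mulrC.
  have Ey' : c%:R * y = x * k by rewrite -Ey mulrC.
  rewrite mem_filter mem_box; apply/andP; split.
    apply/asboolP; split; last exact/(unit_mod k y).
    have inJ := inv gJ.
    apply: (invertible_cancel dom inJ (principal_ideal y) iM) (principal_self y).
    rewrite ideal_prodC ideal_prod_principal // => _ [j Jj ->].
    have [b Eb] := kJ j Jj; rewrite ideal_prodC -E; exists b.
    apply: (mul_cancel dom cO0); rewrite mulrA Ey' -mulrA Eb; ring.
  rewrite -(leq_exp2r _ _ n0) -(ler_nat R) !natrX.
  apply: le_trans hr; apply: ltW; move: hk.
  by rewrite -Ey' nrm_natr natrM mulrC mulKf ?gt_eqF.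
- by move=> y k _ _ Ek; rewrite -Ek nrm_natr natrM mulrAC mulfV ?mul1r ?gt_eqF.
- by move=> y y' k Ek; rewrite -Ek => /(mul_cancel dom cO0).
- by move=> y k k' -> /(mul_cancel dom x0).
Qed.

End Pair.

(** [hat] is multiplied and divided by the [weight] of [M], whose numerator is opened as a sum over
    lattice points. For each [x] the divisors [M] of [(x)] are then exchanged for their cofactors
    [J], of which a finite set independent of [Y] suffices. *)
Theorem pairing_identity (Y : R) N r : Y <= N%:R -> (C1 ^ n)%N%:R * (2 * Y) <= r%:R ^+ n ->
  \sum_(1 <= m < N.+1) (size (goods O D m))%:R * hat Y m%:R =
  \sum_(J <- goods_upto codiff_radius) \sum_(x <- box r | units_in J x) cell_term Y J x.
Proof.
move=> YN hr; rewrite -(sum_goods_upto N (fun m => hat Y m%:R)).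
have n0 := rank_gt0 L.
have big M : hat Y (idx M)%:R != 0 -> (C1 ^ n)%N%:R * (2 * (idx M)%:R) <= r%:R ^+ n :> R.
  by move=> /(hat_neq0 (ler0n _ _)) h; apply: le_trans hr; rewrite ler_wpM2l ?ler0n // ler_wpM2l // ltW.
transitivity (\sum_(M <- goods_upto N) \sum_(x <- box r | units_in M x)
    hat Y (idx M)%:R * tent (nrm x)%:R (idx M)%:R / weight M r).
  rewrite big_seq [RHS]big_seq; apply: eq_bigr => M /mem_goods_upto[gM _].
  have [->|nz0] := eqVneq (hat Y (idx M)%:R) 0; first by rewrite big1 // => x _; rewrite !mul0r.
  have [_ m0 _] := good_idx gM.
  have w0 : 0 < weight M r.
    apply: lt_le_trans (weight_ge gM _); first by rewrite ltr0n.
    rewrite -(ler_nat R) natrX natrM; apply: le_trans (big M nz0).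
    by rewrite ler_wpM2l ?ler0n // ler_peMl ?ler0n // ler1n.
  by rewrite -mulr_suml -mulr_sumr mulfK // gt_eqF.
have sw (s : seq (set O)) (F : set O -> O -> R) : \sum_(M <- s) \sum_(x <- box r | units_in M x) F M x =
    \sum_(x <- box r) \sum_(M <- s | units_in M x) F M x.
  under eq_bigr do rewrite big_mkcond; rewrite exchange_big /=; apply: eq_bigr => x _.
  by rewrite -big_mkcond.
rewrite !sw; apply: eq_bigr => x _.
have [ux|nux] := pselect (unital x); last first.
  by rewrite big1 ?big1 // => M /asboolP[].
rewrite -big_filter -[RHS]big_filter.
apply: (@sum_match R _ _ _ _ _ _ (fun M J => [/\ good D M, good D J & principal x = ideal_prod M J])).
- by rewrite filter_uniq // goods_upto_uniq.
- by rewrite filter_uniq // goods_upto_uniq.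
- move=> M; rewrite mem_filter => /andP[/asboolP[Mx _] /mem_goods_upto[gM _]] nz0.
  have [J [iJ E]] := invertible_dvd dom (inv gM) (principal_ideal x) (principal_sub (good_ideal gM) Mx).
  have gJ : good D J by apply: (good_sup (unital_good ux) iJ); rewrite E; apply: ideal_prod_subr.
  exists J => //; rewrite mem_filter; apply/andP; split.
    apply/asboolP; split => //; apply: (ideal_prod_subr (M := M) iJ); rewrite -E; exact: principal_self.
  apply/mem_goods_upto; split => //.
  have [_ m0 _] := good_idx gM.
  have /tent_neq0 hx : tent (nrm x)%:R (idx M)%:R != 0.
    by apply: contraNneq nz0 => ->; rewrite mulr0 mul0r.
  have hxN : (nrm x ^ n < C1 ^ n * (2 * idx M))%N by rewrite -(ltr_nat R) natrX !natrM hx.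
  have := idn_bound L x; rewrite (pair_idn gM gJ ux E) /codiff_radius => hb.
  rewrite -(leq_pmul2l m0); apply: leq_trans hb _.
  apply: leq_trans (leq_mul (leqnn K) (ltnW hxN)) _; move: (C1 ^ n)%N => C; nia.
- move=> J; rewrite mem_filter => /andP[/asboolP[Jx _] /mem_goods_upto[gJ _]] nz0.
  have [M [iM E]] := invertible_dvd dom (inv gJ) (principal_ideal x) (principal_sub (good_ideal gJ) Jx).
  rewrite ideal_prodC in E.
  have gM : good D M by apply: (good_sup (unital_good ux) iM); rewrite E; apply: ideal_prod_subl.
  exists M => //; rewrite mem_filter; apply/andP; split.
    apply/asboolP; split => //; apply: (ideal_prod_subl (N := J) iM); rewrite -E; exact: principal_self.
  apply/mem_goods_upto; split => //; rewrite -(ler_nat R); apply: le_trans YN; apply: ltW.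
  apply: hat_neq0 (ler0n _ _) _; rewrite -(pair_cell_size gM gJ ux E); apply: contraNneq nz0 => h.
  by rewrite /cell_term h !mul0r.
- move=> M J + _ [gM gJ E]; rewrite mem_filter => /andP[/asboolP[Mx _] _].
  rewrite /cell_term /cell_weight (pair_cell_size gM gJ ux E).
  have [->|h0] := eqVneq (hat Y (idx M)%:R) 0; first by rewrite !mul0r.
  have [->|t0] := eqVneq (tent (nrm x)%:R (idx M)%:R) 0; first by rewrite mulr0 !mul0r.
  rewrite -(pair_weight gM gJ ux E (tent_neq0 (ler0n _ _) t0) (big M h0)) max_r //.
  apply: weight_ge => //; rewrite -(ler_nat R) natrX natrM; apply: le_trans (big M h0).
  by rewrite ler_wpM2l ?ler0n // ler_peMl ?ler0n // ler1n.
- move=> M M' J [gM gJ E] [gM' _ E'].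
  apply: (invertible_inj dom (inv gJ) (good_ideal gM) (good_ideal gM')).
  by rewrite ideal_prodC -E E' ideal_prodC.
- move=> M J J' [gM gJ E] [_ gJ' E'].
  by apply: (invertible_inj dom (inv gM) (good_ideal gJ) (good_ideal gJ')); rewrite -E E'.
Qed.

End Pairing.

(** * Lipschitz continuity and homogeneity of the summand *)

Section Lipschitz.
Variable R : realType.
Implicit Types (a b c d t v x y : R).

Lemma pow_lipschitz x y a k : 0 <= x -> x <= a -> 0 <= y -> y <= a ->
  `|x ^+ k - y ^+ k| <= k%:R * a ^+ k.-1 * `|x - y|.
Proof.
move=> x0 xa y0 ya; rewrite subrXX normrM mulrC ler_wpM2r // (le_trans (ler_norm_sum _ _ _)) //.
apply: le_trans (_ : \sum_(i < k) a ^+ k.-1 <= _); last by rewrite sumr_const card_ord mulr_natl.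
apply: ler_sum => i _; rewrite ger0_norm ?mulr_ge0 ?exprn_ge0 //.
have -> : k.-1 = (k.-1 - i + i)%N by have := ltn_ord i; lia.
rewrite exprD (_ : (k.-1 - i + i - i = k - i.+1)%N); last by lia.
rewrite (_ : (k.-1 - i = k - i.+1)%N); last by lia.
by apply: ler_pM; rewrite ?exprn_ge0 // lerXn2r // nnegrE // (le_trans x0).
Qed.

Lemma min_lipschitz a b c d : `|Num.min a b - Num.min c d| <= `|a - c| + `|b - d|.
Proof.
have h1 := ler_norm (a - c); have h2 := ler_norm (c - a); have h3 := ler_norm (b - d); have h4 := ler_norm (d - b).
rewrite distrC in h2; rewrite (distrC d) in h4.
by rewrite ler_norml /Num.min; case: ltP => ?; case: ltP => ?; apply/andP; split; lra.
Qed.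

Lemma max_lipschitz a b c d : `|Num.max a b - Num.max c d| <= `|a - c| + `|b - d|.
Proof.
have h1 := ler_norm (a - c); have h2 := ler_norm (c - a); have h3 := ler_norm (b - d); have h4 := ler_norm (d - b).
rewrite distrC in h2; rewrite (distrC d) in h4.
by rewrite ler_norml /Num.max; case: ltP => ?; case: ltP => ?; apply/andP; split; lra.
Qed.

(** With [v] and [t] at most [b], the ratios [v / b] and [t / b] are at most 1, so no lower bound on
    [b] enters. This is the reason for keeping [cell_weight] above [cell_size]. *)
Lemma quotient_lipschitz v t b v' t' b' : 0 <= v -> v <= b -> 0 <= t -> t <= b ->
  0 <= v' -> v' <= b' -> 0 <= t' -> t' <= b' ->
  `|v * t / b - v' * t' / b'| <= `|v - v'| + `|t - t'| + `|b - b'|.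
Proof.
wlog h : v t b v' t' b' / b' <= b.
  move=> H; have [hb|/ltW hb] := leP b' b; first exact: H.
  by move=> *; rewrite distrC (distrC v) (distrC t) (distrC b); apply: H.
move=> v0 vb t0 tb v'0 v'b' t'0 t'b'.
have [b0|b0] := eqVneq b' 0.
  have v'z : v' = 0 by apply/eqP; rewrite eq_le v'0 -b0 v'b'.
  rewrite v'z !mul0r !subr0 -addrA; apply: ler_wpDr; first by rewrite addr_ge0.
  have [->|bn] := eqVneq b 0; first by rewrite invr0 mulr0 normr0 normr_ge0.
  have bp : 0 < b by rewrite lt_neqAle eq_sym bn (le_trans v0).
  by rewrite -mulrA normrM ler_piMr // ger0_norm ?divr_ge0 ?ler_pdivrMr ?mul1r // ltW.
have b'p : 0 < b' by rewrite lt_neqAle eq_sym b0 (le_trans v'0).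
have bp : 0 < b by apply: lt_le_trans h.
have -> : v * t / b - v' * t' / b' = (v - v') * (t / b) + (t - t') * (v' / b) + (b' - b) * ((v' / b') * (t' / b)).
  by field; rewrite !gt_eqF.
have q1 z : 0 <= z -> z <= b -> `|z / b| <= 1.
  by move=> z0 zb; rewrite ger0_norm ?divr_ge0 ?ler_pdivrMr ?mul1r // ltW.
have q2 z : 0 <= z -> z <= b' -> `|z / b'| <= 1.
  by move=> z0 zb; rewrite ger0_norm ?divr_ge0 ?ler_pdivrMr ?mul1r // ltW.
apply: le_trans (ler_normD _ _) (lerD (le_trans (ler_normD _ _) (lerD _ _)) _).
- by rewrite normrM ler_piMr // q1.
- by rewrite normrM ler_piMr // q1 // (le_trans v'b').
rewrite normrM distrC ler_piMr // normrM mulr_ile1 // ?q2 // q1 //; exact: le_trans h.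
Qed.

End Lipschitz.

Section Scaling.
Local Open Scope classical_set_scope.
Variables (R : realType) (O : comNzRingType) (n D : nat) (L : lattice_order O n).
Implicit Types (M J : set O) (x y z : O).
Hypothesis D1 : (1 < D)%N.
Notation K := (bnd L).
Notation nrm := (nrm L).
Notation idn := (idn L).
Notation box := (box L).
Notation C1 := (short_bound D L).
Notation tent := (@tent R O n D L).
Notation hat := (@hat R).
Notation codiff := (codiff D L).
Notation cell_size := (@cell_size R O n L).
Notation cterm := (@cell_term R O n D L).
Notation cell_weight := (@cell_weight R O n D L).

Lemma tent_lipschitz (x m x' m' : R) :
  `|tent x m - tent x' m'| <= 3 * `|m - m'| + `|x ^+ n - x' ^+ n|.
Proof.
apply: le_trans (min_lipschitz _ _ _ _) _.
apply: le_trans (lerD (lexx _) (max_lipschitz _ _ _ _)) _; rewrite subrr normr0 add0r.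
have C0 := C1_gt0 R D L; set C := (_ ^ n)%N%:R in C0 *.
have -> : 2 * m - x ^+ n / C - (2 * m' - x' ^+ n / C) = 2 * (m - m') + (x' ^+ n - x ^+ n) / C by ring.
have h : `|2 * (m - m') + (x' ^+ n - x ^+ n) / C| <= 2 * `|m - m'| + `|x ^+ n - x' ^+ n|.
  apply: le_trans (ler_normD _ _) _; rewrite normrM normrM normfV (distrC (x' ^+ n)) ger0_norm //.
  rewrite lerD2l ler_piMr // (ger0_norm (ltW C0)) invf_le1 // ler1n expn_gt0 /C1.
  by rewrite addn4.
by move: h; set A := `|_ + _|; set B := `|m - m'|; move: (`|_ - _|) => E h; lra.
Qed.

Lemma idn_dist r x y : (nrm x <= r)%N -> (nrm y <= r)%N ->
  `|(idn x)%:R - (idn y)%:R : R| <= K%:R * (r ^ n.-1 * nrm (x - y))%N%:R.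
Proof.
move=> hx hy; have h1 := idn_lipschitz hx hy; have := idn_lipschitz hy hx.
rewrite -(nrmN L (y - x)) opprB => h2; rewrite -(ler_nat R) natrD natrM in h1; rewrite -(ler_nat R) natrD natrM in h2.
by rewrite ler_norml; apply/andP; split; lra.
Qed.

Lemma nrm_dist x y : `|(nrm x)%:R - (nrm y)%:R : R| <= (nrm (x - y))%:R.
Proof.
have h1 := nrmD L (x - y) y; have h2 := nrmD L (y - x) x; rewrite !subrK in h1 h2.
rewrite -(nrmN L (y - x)) opprB in h2; rewrite -(ler_nat R) natrD in h1; rewrite -(ler_nat R) natrD in h2.
by rewrite ler_norml; apply/andP; split; lra.
Qed.

Lemma idx_gt0 J : good D J -> (0 < idx J)%N.
Proof. by move=> gJ; have [_ j0 _] := good_idx L gJ. Qed.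

Lemma cell_size_ge0 J x : 0 <= cell_size J x.
Proof. by rewrite /cell_size divr_ge0. Qed.

Lemma cell_weight_ge J x : cell_size J x <= cell_weight J x.
Proof. by rewrite /cell_weight le_max lexx. Qed.

(** The norm varies by at most order [r^(n-1)] per unit step. That [A] depends neither on [J] nor on
    [Y] allows one error bound for all scales. *)
Lemma cell_term_lipschitz : exists2 A : R, 0 <= A & forall J, good D J -> forall Y r x y,
  (nrm x <= r)%N -> (nrm y <= r)%N ->
  `|cterm Y J x - cterm Y J y| <= A * (r ^ n.-1 * nrm (x - y))%N%:R.
Proof.
pose RK := codiff_radius D L; pose T : R := 3 * K%:R + n%:R * (K * RK)%:R ^+ n.
pose S : R := (size (box RK))%:R.
have T0 : 0 <= T by rewrite addr_ge0 ?mulr_ge0 ?exprn_ge0.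
exists (2 * K%:R + (3 * K%:R + n%:R) + (K%:R + S * T)).
  by rewrite !addr_ge0 ?mulr_ge0.
move=> J gJ Y r x y hx hy; have c1 := idx_gt0 gJ; set P := (_ * _)%N%:R.
have P0 : 0 <= P by rewrite ler0n.
have c0 : 1 <= (idx J)%:R^-1^-1 :> R by rewrite invrK ler1n.
have ci : `|(idx J)%:R^-1 : R| <= 1.
  by rewrite ger0_norm ?invr_ge0 ?ler0n // invf_le1 ?ltr0n // ler1n.
have hm : `|cell_size J x - cell_size J y| <= K%:R * P.
  rewrite /cell_size -mulrBl normrM; apply: le_trans (_ : `|(idn x)%:R - (idn y)%:R| * 1 <= _).
    by rewrite ler_wpM2l.
  by rewrite mulr1 idn_dist.
have hn : `|(nrm x)%:R ^+ n - (nrm y)%:R ^+ n : R| <= n%:R * P.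
  apply: le_trans (pow_lipschitz (a := r%:R) _ _ _ _ _) _; rewrite ?ler0n ?ler_nat //.
  by rewrite -mulrA /P natrM natrX ler_wpM2l ?ler_wpM2l ?exprn_ge0 // nrm_dist.
have hk k : k \in codiff J ->
    `|tent ((nrm (x * k))%:R / (idx J)%:R) (cell_size J x) - tent ((nrm (y * k))%:R / (idx J)%:R) (cell_size J y)| <= T * P.
  rewrite mem_filter mem_box => /andP[_ hk].
  apply: le_trans (tent_lipschitz _ _ _ _) _; rewrite /T [X in _ <= X]mulrDl; apply: lerD; first by rewrite -mulrA ler_wpM2l.
  have bnd z : (nrm z <= r)%N -> (nrm (z * k))%:R / (idx J)%:R <= (K * RK * r)%N%:R :> R.
    move=> hz; apply: le_trans (_ : (nrm (z * k))%:R * 1 <= _).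
      by rewrite ler_wpM2l // (le_trans (ler_norm _) ci).
    rewrite mulr1 ler_nat (leq_trans (nrm_mul L z k)) // -mulnA leq_mul2l mulnC leq_mul ?orbT //.
  have n0 := rank_gt0 L.
  apply: le_trans (pow_lipschitz (a := (K * RK * r)%N%:R) _ _ _ _ _) _; rewrite ?divr_ge0 ?bnd //.
  rewrite -!mulrA ler_wpM2l // -mulrBl.
  apply: le_trans (_ : (K * RK * r)%N%:R ^+ n.-1 * (K * RK * nrm (x - y))%N%:R <= _).
    rewrite ler_wpM2l ?exprn_ge0 //; apply: le_trans (_ : `|(nrm (x * k))%:R - (nrm (y * k))%:R| * 1 <= _).
      by rewrite normrM ler_wpM2l.
    rewrite mulr1; apply: le_trans (nrm_dist _ _) _; rewrite -mulrBl ler_nat.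
    by rewrite (leq_trans (nrm_mul L _ k)) // -mulnA leq_mul2l mulnC leq_mul ?orbT.
  rewrite le_eqVlt; apply/orP; left; apply/eqP; rewrite /P -!natrX -!natrM; congr (_%:R).
  by rewrite -[X in (_ = _ ^ X * _)%N](prednK n0) expnS !expnMn; ring.
have hw : `|cell_weight J x - cell_weight J y| <= (K%:R + S * T) * P.
  apply: le_trans (max_lipschitz _ _ _ _) _; rewrite [X in _ <= X]mulrDl; apply: lerD => //.
  rewrite -sumrB; apply: le_trans (ler_norm_sum _ _ _) _.
  apply: le_trans (_ : \sum_(k <- codiff J) T * P <= _).
    by rewrite big_seq [X in _ <= X]big_seq; apply: ler_sum => k /hk.
  rewrite big_const_seq count_predT iter_addr_0 -mulr_natl -mulrA ler_wpM2r ?mulr_ge0 // ler_nat.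
  by rewrite size_filter count_size.
have hh : `|hat Y (cell_size J x) - hat Y (cell_size J y)| <= 2 * K%:R * P.
  apply: le_trans (min_lipschitz _ _ _ _) _.
  apply: le_trans (lerD (lexx _) (max_lipschitz _ _ _ _)) _; rewrite subrr normr0 add0r.
  have -> : Y - cell_size J x - (Y - cell_size J y) = cell_size J y - cell_size J x by ring.
  by rewrite (distrC (cell_size J y)) -mulrA; move: hm; move: (`|_|) (_ * P) => u w; lra.
have ht : `|tent (nrm x)%:R (cell_size J x) - tent (nrm y)%:R (cell_size J y)| <= (3 * K%:R + n%:R) * P.
  apply: le_trans (tent_lipschitz _ _ _ _) _; rewrite [X in _ <= X]mulrDl -[X in _ <= X + _]mulrA; apply: lerD => //.
  by rewrite ler_wpM2l.
have le1 z : hat Y (cell_size J z) <= cell_weight J z by apply: le_trans (hat_le _ _) (cell_weight_ge _ _).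
have le2 z : tent (nrm z)%:R (cell_size J z) <= cell_weight J z by apply: le_trans (tent_le _ _ _ _) (cell_weight_ge _ _).
apply: le_trans (quotient_lipschitz _ (le1 x) _ (le2 x) _ (le1 y) _ (le2 y)) _;
  rewrite ?hat_ge0 ?tent_ge0 ?cell_size_ge0 //.
by rewrite [X in _ <= X]mulrDl [X in _ <= X + _]mulrDl; apply: lerD => //; apply: lerD.
Qed.

Lemma hat_scale (a Y m : R) : 0 <= a -> hat (a * Y) (a * m) = a * hat Y m.
Proof. by move=> a0; rewrite /hat minr_pMr // maxr_pMr // mulr0 mulrBr. Qed.

Lemma tent_scale (k x m : R) : 0 <= k -> tent (k * x) (k ^+ n * m) = k ^+ n * tent x m.
Proof.
by move=> k0; rewrite /tent minr_pMr ?exprn_ge0 // maxr_pMr ?exprn_ge0 // mulr0 mulrBr exprMn mulrCA !mulrA.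
Qed.

Lemma cell_size_scale J k x : cell_size J (k%:R * x) = k%:R ^+ n * cell_size J x.
Proof. by rewrite /cell_size idn_mul idn_natr natrM natrX mulrA. Qed.

Lemma cell_term_scale J (Y : R) k x : (0 < k)%N -> cterm (k%:R ^+ n * Y) J (k%:R * x) = k%:R ^+ n * cterm Y J x.
Proof.
move=> k0; have kR : 0 < k%:R :> R by rewrite ltr0n.
have kn : k%:R ^+ n != 0 :> R by rewrite expf_neq0 // gt_eqF.
have kn0 : 0 <= k%:R ^+ n :> R by rewrite exprn_ge0 // ltW.
rewrite /cterm cell_size_scale hat_scale // nrm_natr natrM tent_scale ?ler0n //.
have -> : cell_weight J (k%:R * x) = k%:R ^+ n * cell_weight J x.
  rewrite /cell_weight cell_size_scale maxr_pMr // mulr_sumr; congr (Num.max _ _).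
  by apply: eq_bigr => z _; rewrite -(mulrA k%:R) nrm_natr natrM -mulrA tent_scale ?ler0n.
rewrite invfM -!mulrA; congr (_ * (_ * _)); rewrite mulrCA; congr (_ * _).
by rewrite mulrA mulfV // mul1r.
Qed.

Lemma cell_term_support J (Y : R) x : cterm Y J x != 0 -> (nrm x)%:R ^+ n < (C1 ^ n)%N%:R * (2 * Y).
Proof.
move=> h; have /(hat_neq0 (cell_size_ge0 J x)) h1 : hat Y (cell_size J x) != 0.
  by apply: contraNneq h => e; rewrite /cell_term e !mul0r.
have /(tent_neq0 (cell_size_ge0 J x)) h2 : tent (nrm x)%:R (cell_size J x) != 0.
  by apply: contraNneq h => e; rewrite /cell_term e mulr0 mul0r.
by apply: (lt_trans h2); rewrite ltr_pM2l ?C1_gt0 // ltr_pM2l.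
Qed.

End Scaling.

(** * Comparing the smoothed count at two scales *)

Section SmoothCount.
Local Open Scope classical_set_scope.
Variables (R : realType) (O : comNzRingType) (n D : nat) (L : lattice_order O n).
Implicit Types (M J : set O) (x z : O).
Hypothesis D1 : (1 < D)%N.
Hypothesis dom : forall x y : O, x * y = 0 -> x = 0 \/ y = 0.
Hypothesis prime_inverse : forall p (P : set O), prime p -> ~~ (p %| D)%N -> maximal_ideal P -> P p%:R ->
  exists Q q, [/\ is_ideal Q, ideal_prod P Q = principal p%:R, Q q & P (1 - q)].
Notation K := (bnd L).
Notation nrm := (nrm L).
Notation box := (box L).
Notation C1 := (short_bound D L).
Notation cterm := (@cell_term R O n D L).
Notation uin := (units_in D).

Definition cell_list J r : seq O := [seq x <- box r | uin J x].

(* A multiple of [D] and of every index [idx J] that occurs, so translations by multiples of it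
   preserve [J] and the class modulo [D]. *)
Definition cell_modulus := (D * (codiff_radius D L)`!)%N.
Notation e := cell_modulus.

Lemma modulus_gt0 : (0 < e)%N. Proof. by rewrite muln_gt0 (ltnW D1) fact_gt0. Qed.

Lemma modulus_unital a : principal (D%:R : O) (e%:R * a).
Proof. by exists ((codiff_radius D L)`!%:R * a); rewrite natrM mulrA. Qed.

Lemma modulus_mem J a : good D J -> (idx J <= codiff_radius D L)%N -> J (e%:R * a).
Proof.
move=> gJ hJ; have iJ := good_ideal gJ; have [h c0 _] := good_idx L gJ.
have : (idx J %| e)%N by apply: dvdn_mull; apply: dvdn_fact; rewrite c0.
move=> /dvdnP[f ->]; rewrite natrM mulrAC; apply: idealMl => //.
exact: (has_index_kill (@idealT O) iJ h (I : setT (1 : O))).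
Qed.

Lemma unital_translate J l x z : good D J -> (idx J <= codiff_radius D L)%N ->
  uin J ((l * e + 1)%N%:R * x + e%:R * z) = uin J x.
Proof.
move=> gJ hJ; have iJ := good_ideal gJ; rewrite /units_in.
have E : (l * e + 1)%N%:R * x + e%:R * z = x + e%:R * (l%:R * x + z) by rewrite natrD natrM; ring.
rewrite E; have hj := modulus_mem (l%:R * x + z) gJ hJ; have hD := modulus_unital (l%:R * x + z).
move: (e%:R * _) hj hD => w hj hD; have iD := principal_ideal (D%:R : O).
apply: asbool_equiv_eq; split => -[Jx ux]; split.
- by rewrite -(addrK w x); apply: idealB.
- by rewrite /unital (_ : x - 1 = x + w - 1 - w); [apply: idealB|ring].
- exact: idealD.
by rewrite /unital addrAC; apply: idealD.
Qed.

(** As [k = l e + 1] is prime to [e], every lattice point is uniquely [k x + e z] with [z] in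
    [cube k]; as [k] is 1 modulo [e], that point satisfies the conditions of [units_in] exactly when
    [x] does. *)
Lemma tile_sum J (Y : R) k l r : good D J -> (idx J <= codiff_radius D L)%N -> (k = l * e + 1)%N ->
  (forall x, cterm Y J x != 0 -> (nrm x + e * k <= k * r)%N) ->
  \sum_(x <- box (k * (r + e)) | uin J x) cterm Y J x =
  \sum_(x <- cell_list J r) \sum_(z <- cube L k) cterm Y J (k%:R * x + e%:R * z).
Proof.
move=> gJ hJ Ek hr; have k0 : (0 < k)%N by rewrite Ek addn1.
have iJ := good_ideal gJ; have e0 := modulus_gt0.
have lk : k%:R = l%:R * e%:R + 1 :> O by rewrite Ek natrD natrM.
transitivity (\sum_(u <- [seq (x, z) | x <- cell_list J r, z <- cube L k]) cterm Y J (k%:R * u.1 + e%:R * u.2)); last first.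
  by rewrite big_allpairs_dep.
rewrite -big_filter.
apply: (@sum_match R _ _ _ _ _ _ (fun y u => y = k%:R * u.1 + e%:R * u.2 /\ u.2 \in cube L k)).
- by rewrite filter_uniq // box_uniq.
- by apply: allpairs_uniq_dep => [|x _|[x z] [x' z'] _ _ /= [-> ->]//]; rewrite ?filter_uniq ?box_uniq // cube_uniq.
- move=> y; rewrite mem_filter => /andP[uy _] /hr hy.
  have [q [z [zc Ez]]] := cube_div L k0 (- (l%:R * y)).
  have Ey : y = k%:R * (y + e%:R * q) + e%:R * z.
    have -> : k%:R * (y + e%:R * q) + e%:R * z = k%:R * y + e%:R * (k%:R * q + z) by ring.
    by rewrite -Ez lk; ring.
  exists (y + e%:R * q, z) => //; apply/allpairsPdep; exists (y + e%:R * q), z; split => //.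
  rewrite mem_filter mem_box; apply/andP; split.
    by move: uy; rewrite {1}Ey Ek unital_translate.
  rewrite -(leq_pmul2l k0) -(nrm_natr L); apply: leq_trans hy.
  have -> : k%:R * (y + e%:R * q) = y - e%:R * z by rewrite {2}Ey addrK.
  by apply: leq_trans (nrmB L _ _) _; rewrite leq_add2l nrm_natr leq_mul2l cube_nrm ?orbT.
- move=> u /allpairsPdep[x [z [+ zc ->]]] _ /=; rewrite mem_filter mem_box => /andP[ux hx].
  exists (k%:R * x + e%:R * z) => //; rewrite mem_filter mem_box; apply/andP; split.
    by rewrite Ek unital_translate.
  apply: leq_trans (nrmD L _ _) _; rewrite !nrm_natr mulnDr leq_add ?leq_mul2l ?hx ?orbT //.
  by rewrite (mulnC k e) leq_mul2l cube_nrm ?orbT.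
- by move=> y u _ _ [-> _].
- by move=> y y' u [-> _] [-> _].
move=> y [x z] [x' z'] [/= -> hz] [/= E hz'].
have Ez : z = z'.
  apply: (cube_incongruent (q := z - z' - l%:R * (x' - x)) hz hz').
  have E1 : e%:R * (z - z') = k%:R * (x' - x) by rewrite mulrBr mulrBr; apply/eqP; rewrite subr_eq addrAC -E; apply/eqP; ring.
  transitivity (k%:R * (z - z') - l%:R * (e%:R * (z - z'))); first by rewrite lk; ring.
  by rewrite E1; ring.
by move: E; rewrite Ez => /addIr /(mul_cancel dom (order_natr_neq0 L k0)) ->.
Qed.

Definition smooth_count (Y : R) : R :=
  \sum_(1 <= m < (Num.truncn Y).+2) (size (goods O D m))%:R * hat Y m%:R.

Lemma smooth_countE (Y : R) r : 0 <= Y -> (C1 ^ n)%N%:R * (2 * Y) <= r%:R ^+ n ->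
  smooth_count Y = \sum_(J <- goods_upto O D (codiff_radius D L)) \sum_(x <- box r | uin J x) cterm Y J x.
Proof.
move=> Y0 hr; apply: (pairing_identity D1 dom prime_inverse) => //.
by rewrite ltW // truncnS_gt.
Qed.

Lemma double_pow (w : R) : 0 <= w -> (C1 ^ n)%N%:R * (2 * w ^+ n) <= (2 * C1%:R * w) ^+ n.
Proof.
move=> w0; have n0 := rank_gt0 L.
rewrite !exprMn natrX mulrCA -mulrA ler_wpM2r ?mulr_ge0 ?exprn_ge0 //.
by rewrite -natrX ler_nat -[X in (X <= _)%N]expn1 leq_exp2l.
Qed.

Lemma box_radius_ok (y : R) r : 0 <= y -> 2 * C1%:R * y <= r%:R -> (C1 ^ n)%N%:R * (2 * y ^+ n) <= r%:R ^+ n.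
Proof.
move=> y0 hr; apply: le_trans (double_pow y0) _.
by rewrite lerXn2r ?nnegrE ?mulr_ge0.
Qed.

(** Each of the [k^n] points [k x + e z] of a tile is moved to [k x], where homogeneity gives [k^n]
    times the term at [x]. A move costs order [(k y)^(n-1) k], and there are at most of order
    [(k y)^n] points. *)
Theorem smooth_scaling : exists2 A : R, 0 <= A & forall (y : R) l k, 1 <= y -> (k = l * e + 1)%N ->
  `|smooth_count ((k%:R * y) ^+ n) - k%:R ^+ (n + n) * smooth_count (y ^+ n)| <=
  A * (k%:R ^+ (n + n) * y ^+ (n + n.-1)).
Proof.
have [A A0 hA] := cell_term_lipschitz R D L.
pose Js := goods_upto O D (codiff_radius D L).
(* Both [r + e] and the side [2 r + 1] of the box will be at most [K5 y]. *)
pose K5 := (4 * C1 + 3 + 2 * e)%N.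
have n0 := rank_gt0 L.
exists ((size Js)%:R * (A * e%:R * K5%:R ^+ (n + n.-1))).
  by rewrite !mulr_ge0 ?exprn_ge0.
move=> y l k y1 Ek; have k0 : (0 < k)%N by rewrite Ek addn1.
have y0 : 0 <= y by apply: le_trans y1.
have k1 : 1 <= k%:R :> R by rewrite ler1n.
have Cy0 : 0 <= 2 * C1%:R * y by rewrite !mulr_ge0.
pose r := (Num.truncn (2 * C1%:R * y) + 1 + e)%N.
have [t1 t2] := andP (truncn_itv Cy0).
have rlo : 2 * C1%:R * y + e%:R <= r%:R.
  by rewrite /r natrD lerD2r addn1 ltW.
have aff1 (a b : nat) : (4 * a + 3 + 2 * b)%N%:R = 4 * a%:R + 3 + 2 * b%:R :> R.
  by rewrite (natrD _ (4 * a + 3)) (natrD _ (4 * a)) !natrM.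
have aff2 (a b : nat) : (a + 1 + b + b)%N%:R = a%:R + 1 + b%:R + b%:R :> R.
  by rewrite (natrD _ (a + 1 + b)) (natrD _ (a + 1)) (natrD _ a).
have aff3 (a b : nat) : ((a + 1 + b).*2.+1)%N%:R = 2 * a%:R + 3 + 2 * b%:R :> R.
  by rewrite -addn1 -mul2n (natrD _ (2 * _)) natrM (natrD _ (a + 1)) (natrD _ a); ring.
have e0R : 0 <= e%:R :> R by [].
have C0R : 0 <= C1%:R :> R by [].
have pure (t C e' : R) : 0 <= e' -> 0 <= C -> t <= 2 * C * y ->
    t + 1 + e' + e' <= (4 * C + 3 + 2 * e') * y /\ 2 * t + 3 + 2 * e' <= (4 * C + 3 + 2 * e') * y.
  by move=> h1 h2 h3; clear -h1 h2 h3 y1; split; nra.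
have [q1 q2] := pure _ _ _ e0R C0R t1.
have rhi : (r + e)%N%:R <= K5%:R * y by rewrite /r /K5 aff1 aff2.
have rhi2 : (r.*2.+1)%:R <= K5%:R * y by rewrite /r /K5 aff1 aff3.
have ok1 : (C1 ^ n)%N%:R * (2 * y ^+ n) <= r%:R ^+ n.
  by apply: box_radius_ok => //; apply: le_trans rlo; rewrite lerDl.
have ok2 : (C1 ^ n)%N%:R * (2 * (k%:R * y) ^+ n) <= (k * (r + e))%N%:R ^+ n.
  apply: box_radius_ok; first by rewrite mulr_ge0.
  rewrite natrM mulrCA ler_wpM2l //; apply: le_trans (_ : r%:R <= _); last by rewrite ler_nat leq_addr.
  by apply: le_trans rlo; rewrite lerDl.
have yn0 : 0 <= y ^+ n by rewrite exprn_ge0.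
have kyn0 : 0 <= (k%:R * y) ^+ n by rewrite exprn_ge0 // mulr_ge0.
rewrite (smooth_countE yn0 ok1) (smooth_countE kyn0 ok2) mulr_sumr -sumrB.
apply: le_trans (ler_norm_sum _ _ _) _.
set bd := _ * (_ * y ^+ _).
apply: le_trans (_ : \sum_(J <- Js) (A * e%:R * K5%:R ^+ (n + n.-1)) * (k%:R ^+ (n + n) * y ^+ (n + n.-1)) <= _); last first.
  by rewrite big_const_seq count_predT iter_addr_0 -[_ *+ size Js]mulr_natl /bd (mulrA (size Js)%:R).
rewrite big_seq [X in _ <= X]big_seq; apply: ler_sum => J /(mem_goods_upto D L)[gJ hJ].
rewrite (tile_sum (l := l) (r := r) gJ hJ Ek); last first.
  move=> x /cell_term_support h.
  have h2 : (nrm x)%:R ^+ n < (2 * C1%:R * (k%:R * y)) ^+ n.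
    by apply: lt_le_trans h (double_pow _); rewrite mulr_ge0.
  have h3 : (nrm x)%:R < 2 * C1%:R * (k%:R * y).
    by rewrite -(@ltr_pXn2r R n) ?nnegrE ?mulr_ge0.
  rewrite -(ler_nat R) natrD (natrM _ e k) (natrM _ k r); apply: ltW; apply: lt_le_trans (_ : 2 * C1%:R * (k%:R * y) + e%:R * k%:R <= _).
    by rewrite ltrD2r.
  rewrite (mulrC e%:R) mulrCA -mulrDr ler_wpM2l //; exact: rlo.
have -> : k%:R ^+ (n + n) * \sum_(x <- box r | uin J x) cterm (y ^+ n) J x =
    \sum_(x <- cell_list J r) \sum_(z <- cube L k) cterm ((k%:R * y) ^+ n) J (k%:R * x).
  rewrite -big_filter mulr_sumr; apply: eq_bigr => x _.
  rewrite big_const_seq count_predT iter_addr_0 cube_size -[_ *+ (k ^ n)]mulr_natl natrX exprMn cell_term_scale //.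
  by rewrite exprD mulrA.
rewrite -sumrB.
have each x z : x \in cell_list J r -> z \in cube L k ->
    `|cterm ((k%:R * y) ^+ n) J (k%:R * x + e%:R * z) - cterm ((k%:R * y) ^+ n) J (k%:R * x)| <=
    A * ((k * (r + e)) ^ n.-1 * (e * k))%N%:R.
  rewrite mem_filter mem_box => /andP[_ hx] hz; have hzk := cube_nrm hz.
  apply: le_trans (hA J gJ _ (k * (r + e))%N _ _ _ _) _.
  - apply: leq_trans (nrmD L _ _) _; rewrite !nrm_natr mulnDr leq_add ?leq_mul2l ?hx ?orbT //.
    by rewrite (mulnC k e) leq_mul2l hzk orbT.
  - by rewrite nrm_natr leq_mul2l (leq_trans hx) ?orbT // leq_addr.
  rewrite ler_wpM2l // ler_nat leq_mul2l addrAC subrr add0r nrm_natr leq_mul2l hzk !orbT //.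
apply: le_trans (_ : \sum_(x <- cell_list J r) \sum_(z <- cube L k) A * ((k * (r + e)) ^ n.-1 * (e * k))%N%:R <= _).
  apply: le_trans (ler_norm_sum _ _ _) _; rewrite big_seq [X in _ <= X]big_seq; apply: ler_sum => x hx.
  rewrite -sumrB; apply: le_trans (ler_norm_sum _ _ _) _.
  by rewrite big_seq [X in _ <= X]big_seq; apply: ler_sum => z hz; apply: each.
rewrite !big_const_seq !count_predT !iter_addr_0 cube_size -[_ *+ (k ^ n)]mulr_natl -[_ *+ size _]mulr_natl.
have hs : (size (cell_list J r))%:R <= (K5%:R * y) ^+ n.
  apply: le_trans (_ : (size (box r))%:R <= _); first by rewrite ler_nat size_filter count_size.
  by rewrite box_size natrX lerXn2r ?nnegrE ?mulr_ge0.
have hr : ((k * (r + e)) ^ n.-1)%N%:R <= k%:R ^+ n.-1 * (K5%:R * y) ^+ n.-1.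
  by rewrite natrX natrM exprMn ler_wpM2l ?exprn_ge0 // lerXn2r ?nnegrE ?mulr_ge0.
apply: le_trans (_ : (K5%:R * y) ^+ n * (k%:R ^+ n * (A * (k%:R ^+ n.-1 * (K5%:R * y) ^+ n.-1 * (e%:R * k%:R)))) <= _).
  apply: ler_pM => //; first by rewrite !mulr_ge0.
  rewrite natrX ler_wpM2l ?exprn_ge0 // ler_wpM2l // natrM (natrM _ e k) ler_wpM2r ?mulr_ge0 //.
rewrite le_eqVlt; apply/orP; left; apply/eqP.
have -> : k%:R ^+ (n + n) = k%:R ^+ n * (k%:R ^+ n.-1 * k%:R) :> R by rewrite -exprSr prednK // -exprD.
by rewrite !exprMn !exprD; ring.
Qed.

End SmoothCount.

(** * From the smoothed count to the sharp one *)

Section SmoothToSharp.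
Variables (R : realType) (a : nat -> R) (n : nat).
Hypotheses (a_ge0 : forall m, 0 <= a m) (n0 : (0 < n)%N).
Implicit Types (Y y : R).

(** Runs to the first integer beyond [Y], so that [hat_sum] agrees with [smooth_count] by
    definition. *)
Definition ramp_sum (F : R -> R -> R) Y : R := \sum_(1 <= m < (Num.truncn Y).+2) a m * F Y m%:R.
Definition cone Y (m : R) : R := Num.max 0 (Y - m).

Lemma ramp_sumE (F : R -> R -> R) Y N : (forall m : R, Y <= m -> F Y m = 0) -> Y <= N%:R -> 0 <= Y ->
  ramp_sum F Y = \sum_(1 <= m < N.+2) a m * F Y m%:R.
Proof.
move=> F0 YN Y0; have tN : ((Num.truncn Y).+2 <= N.+2)%N.
  by rewrite !ltnS -(ler_nat R) (le_trans _ YN) // truncn_le.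
rewrite /ramp_sum [RHS](@big_cat_nat _ _ _ (Num.truncn Y).+2) //= [X in _ = _ + X]big_nat_cond [X in _ = _ + X]big1 ?addr0 //.
move=> m /andP[/andP[h _] _]; rewrite F0 ?mulr0 //.
apply: ltW; apply: lt_le_trans (truncnS_gt Y) _; rewrite ler_nat ltnW //.
Qed.

Lemma cone_zero Y (m : R) : Y <= m -> cone Y m = 0.
Proof. by move=> h; rewrite /cone max_l // subr_le0. Qed.

Lemma hat_zero Y (m : R) : 0 <= m -> Y <= m -> hat Y m = 0.
Proof. by move=> m0 h; rewrite /hat max_l ?subr_le0 // min_r. Qed.

(** A triangle of base [Y] with its peak at [Y / 2] is a combination of two cones, which makes
    [cone_sum] a dyadic sum of values of [hat_sum]. *)
Lemma hat_cone Y (m : R) : 0 <= m -> hat Y m = cone Y m - 2 * cone (Y / 2) m.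
Proof.
move=> m0; have [h|h] := leP Y m; first by rewrite hat_zero // !cone_zero //; lra.
rewrite /hat /cone [Num.max 0 (Y - m)]max_r ?subr_ge0 1?ltW //.
have [h2|h2] := leP m (Y / 2); first by rewrite min_l ?max_r; lra.
by rewrite min_r ?max_l; lra.
Qed.

Lemma hat_mono Y Y' (m : R) : Y <= Y' -> hat Y m <= hat Y' m.
Proof.
move=> h; rewrite {2}/hat le_min hat_le /=; apply: le_trans (_ : Num.max 0 (Y - m) <= _).
  by rewrite /hat ge_min lexx orbT.
by rewrite ge_max !le_max lexx lerD2r h orbT.
Qed.

Lemma cone_mono Y Y' (m : R) : Y <= Y' -> cone Y m <= cone Y' m.
Proof. by move=> h; rewrite /cone ge_max !le_max lexx lerD2r h orbT. Qed.

Definition hat_sum := ramp_sum (@hat R).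
Definition cone_sum := ramp_sum cone.

Lemma hat_sumE Y N : Y <= N%:R -> 0 <= Y -> hat_sum Y = \sum_(1 <= m < N.+2) a m * hat Y m%:R.
Proof.
move=> YN Y0; pose F (Y m : R) := if 0 <= m then hat Y m else 0.
have -> : hat_sum Y = ramp_sum F Y by apply: eq_bigr => m _; rewrite /F ler0n.
rewrite (ramp_sumE _ YN) //; last by move=> m h; rewrite /F; case: ifP => // m0; apply: hat_zero.
by apply: eq_bigr => m _; rewrite /F ler0n.
Qed.

Lemma hat_sum_ge0 Y : 0 <= hat_sum Y.
Proof. by apply: sumr_ge0 => m _; rewrite mulr_ge0 // hat_ge0. Qed.

Lemma hat_sum_mono Y Y' : 0 <= Y -> Y <= Y' -> hat_sum Y <= hat_sum Y'.
Proof.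
move=> Y0 h; have hN : Y' <= ((Num.truncn Y').+1)%:R by rewrite ltW // truncnS_gt.
rewrite (hat_sumE (le_trans h hN)) // (hat_sumE hN) ?(le_trans Y0) //.
by apply: ler_sum => m _; rewrite ler_wpM2l // hat_mono.
Qed.

Lemma cone_sum_hat Y : 0 <= Y -> cone_sum Y = hat_sum Y + 2 * cone_sum (Y / 2).
Proof.
move=> Y0; have hN : Y <= ((Num.truncn Y).+1)%:R by rewrite ltW // truncnS_gt.
have hY : Y / 2 <= Y by lra.
have Y20 : 0 <= Y / 2 by lra.
rewrite (hat_sumE hN) // /cone_sum (ramp_sumE (@cone_zero _) hN) // (ramp_sumE (@cone_zero _) (le_trans hY hN)) //.
rewrite mulr_sumr -big_split /=; apply: eq_bigr => m _.
by rewrite hat_cone ?ler0n //; ring.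
Qed.

Lemma cone_sum_small Y : 0 <= Y -> Y < 1 -> cone_sum Y = 0.
Proof.
move=> Y0 Y1; rewrite /cone_sum /ramp_sum big_nat_cond big1 // => m /andP[/andP[m1 _] _].
by rewrite cone_zero ?mulr0 // (le_trans (ltW Y1)) // ler1n.
Qed.

(** [cone_sum] is the integral of the monotone counting function, so its difference quotients on
    either side of [N] bracket the count. *)
Lemma cone_sum_upper N (H : R) : 0 <= H -> sumN a N * H <= cone_sum (N%:R + H) - cone_sum N%:R.
Proof.
move=> H0; set Z := N%:R + H; have hZ : Z <= ((Num.truncn Z).+1)%:R by rewrite ltW // truncnS_gt.
have NZ : N%:R <= Z by rewrite lerDl.
rewrite /cone_sum (ramp_sumE (@cone_zero _) hZ) ?addr_ge0 // (ramp_sumE (@cone_zero _) (le_trans NZ hZ)) //.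
rewrite -sumrB /sumN mulr_suml.
have NT : (N.+1 <= (Num.truncn Z).+3)%N.
  by move: (le_trans NZ hZ); rewrite ler_nat; lia.
rewrite [X in _ <= X](@big_cat_nat _ _ _ N.+1) //= -[X in X <= _]addr0; apply: lerD.
  apply: ler_sum_nat => m /andP[_ mN]; rewrite -mulrBr ler_wpM2l //.
  have : m%:R <= N%:R :> R by rewrite ler_nat.
  by move=> h; rewrite /cone /Z !max_r; lra.
by apply: sumr_ge0 => m _; rewrite -mulrBr mulr_ge0 // subr_ge0 cone_mono.
Qed.

Lemma cone_sum_lower N (H : R) : 0 <= H -> H <= N%:R -> cone_sum N%:R - cone_sum (N%:R - H) <= sumN a N * H.
Proof.
move=> H0 HN; set Z := N%:R - H; have Z0 : 0 <= Z by rewrite subr_ge0.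
have ZN : Z <= N%:R by rewrite lerBlDr lerDl.
rewrite /cone_sum (ramp_sumE (@cone_zero _) (lexx N%:R)) // (ramp_sumE (@cone_zero _) ZN) //.
rewrite -sumrB /sumN mulr_suml big_nat_recr //= -[X in _ <= X]addr0; apply: lerD.
  apply: ler_sum_nat => m /andP[_ mN]; rewrite -mulrBr ler_wpM2l //.
  have : m%:R <= N%:R :> R by rewrite ler_nat -ltnS.
  move=> h; rewrite /cone [Num.max 0 (N%:R - _)]max_r ?subr_ge0 //.
  have [h2|h2] := leP Z m%:R; [rewrite max_l|rewrite max_r]; rewrite /Z in h2 *; lra.
rewrite !cone_zero ?mulr0 ?subrr // ?ler_nat //.
by apply: le_trans ZN _; rewrite ler_nat.
Qed.

Section Limit.
Variables (A : R) (e : nat).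
Hypothesis A_ge0 : 0 <= A.
Hypothesis scaling : forall y l k, 1 <= y -> (k = l * e + 1)%N ->
  `|hat_sum ((k%:R * y) ^+ n) - k%:R ^+ (n + n) * hat_sum (y ^+ n)| <= A * (k%:R ^+ (n + n) * y ^+ (n + n.-1)).
Hypothesis e_gt0 : (0 < e)%N.

Let u y := hat_sum (y ^+ n) / y ^+ (n + n).

Lemma scaled_close y l k : 1 <= y -> (k = l * e + 1)%N -> `|u (k%:R * y) - u y| <= A / y.
Proof.
move=> y1 Ek; have y0 : 0 < y by apply: lt_le_trans y1.
have k0 : 0 < k%:R :> R by rewrite ltr0n Ek addn1.
have d0 : 0 < (k%:R * y) ^+ (n + n) by rewrite exprn_gt0 // mulr_gt0.
have -> : u (k%:R * y) - u y = (hat_sum ((k%:R * y) ^+ n) - k%:R ^+ (n + n) * hat_sum (y ^+ n)) / (k%:R * y) ^+ (n + n).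
  have P0 : k%:R ^+ (n + n) != 0 :> R by rewrite expf_neq0 ?gt_eqF.
  have Q0 : y ^+ (n + n) != 0 by rewrite expf_neq0 ?gt_eqF.
  rewrite /u; move: (hat_sum (y ^+ n)) (hat_sum _) => v w; rewrite exprMn; move: P0 Q0.
  move: (k%:R ^+ (n + n)) (y ^+ (n + n)) => P Q P0 Q0.
  by field; rewrite P0 Q0.
rewrite normrM normfV (gtr0_norm d0) ler_pdivrMr //; apply: le_trans (scaling y1 Ek) _.
rewrite le_eqVlt; apply/orP; left; apply/eqP.
have Ey : y ^+ (n + n) = y ^+ (n + n.-1) * y by rewrite -exprSr -addnS prednK.
by rewrite [(_ * _) ^+ _]exprMn Ey; field; rewrite gt_eqF.
Qed.

(** The scaling law relates [y] only to its multiples by [k = 1] modulo [e]. Two scales are linked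
    through multiples that nearly agree, taken so large that a step of [e] changes the ratio by less
    than [eps]. *)
Lemma comparable_multiples y y' eps : 1 <= y -> 1 <= y' -> 0 < eps -> exists l l' k k',
  [/\ (k = l * e + 1)%N, (k' = l' * e + 1)%N, k%:R * y <= k'%:R * y' & k'%:R * y' <= (1 + eps) * (k%:R * y)].
Proof.
move=> y1 y'1 eps0; have e0 : 0 < e%:R :> R by rewrite ltr0n.
have y0 : 0 < y by apply: lt_le_trans y1. have y'0 : 0 < y' by apply: lt_le_trans y'1.
pose B := (e.+1)%:R * y' / eps; have B0 : 0 <= B by rewrite !mulr_ge0 ?invr_ge0 // ltW.
pose l := (Num.truncn B).+1; pose k := (l * e + 1)%N.
have kB : B <= k%:R.
  apply: ltW; apply: lt_le_trans (truncnS_gt B) _; rewrite ler_nat /k -/l.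
  by move: e_gt0; nia.
pose q := k%:R * y / y'; have q0 : 0 <= q by rewrite !mulr_ge0 ?invr_ge0 // ltW.
have qe0 : 0 <= q / e%:R by rewrite mulr_ge0 ?invr_ge0.
pose l' := (Num.truncn (q / e%:R)).+1.
have [t1 t2] := andP (truncn_itv qe0).
exists l, l', k, (l' * e + 1)%N; split => //.
  rewrite -ler_pdivrMr // -/q natrD natrM.
  have : q < l'%:R * e%:R by rewrite -ltr_pdivrMr.
  by move=> h; apply: ltW; apply: lt_trans h _; rewrite ltrDl.
rewrite -ler_pdivlMr // mulrDl mul1r mulrDl -/q.
have h1 : (e.+1)%:R <= eps * (k%:R * y) / y'.
  rewrite ler_pdivlMr // -ler_pdivrMl // mulrC -/B; apply: le_trans kB _.
  by rewrite ler_peMr.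
apply: le_trans (lerD (lexx q) h1).
rewrite natrD natrM /l' -[(Num.truncn _).+1]addn1 natrD mulrDl mul1r -addrA -[e.+1]addn1 (natrD _ e) lerD2r.
by rewrite -ler_pdivlMr.
Qed.

(** Normalized sums at two scales are compared along nearly equal multiples by monotonicity of
    [hat_sum]; letting [eps] tend to 0 gives the hypothesis of [squeeze_limit]. *)
Lemma hat_sum_limit : exists l, forall y, 1 <= y -> `|hat_sum (y ^+ n) - l * y ^+ (n + n)| <= A * y ^+ (n + n.-1).
Proof.
pose c y : R := Num.max 1 y.
have c1 y : 1 <= c y by rewrite /c le_max lexx.
have [|l hl] := @squeeze_limit R R 0 (fun y => u (c y)) (fun y => A / c y).
  move=> y y'; move: (c1 y) (c1 y'); move: (c y) (c y') => {}y {}y' y1 y'1.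
  have y0 : 0 < y by apply: lt_le_trans y1. have y'0 : 0 < y' by apply: lt_le_trans y'1.
  set w := u y' + A / y'.
  have w0 : 0 <= w by rewrite addr_ge0 ?divr_ge0 ?hat_sum_ge0 ?exprn_ge0 // ltW.
  have step eps : 0 < eps -> u y - A / y <= (1 + eps) ^+ (n + n) * w.
    move=> eps0; have [l [l' [k [k' [Ek Ek' h1 h2]]]]] := comparable_multiples y1 y'1 eps0.
    have k0 : 0 < k%:R :> R by rewrite ltr0n Ek addn1.
    have k'0 : 0 < k'%:R :> R by rewrite ltr0n Ek' addn1.
    have := scaled_close y1 Ek; rewrite ler_norml => /andP[c2 _].
    have := scaled_close y'1 Ek'; rewrite ler_norml => /andP[_ c3].
    have d0 : 0 < k%:R * y by rewrite mulr_gt0. have d'0 : 0 < k'%:R * y' by rewrite mulr_gt0.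
    apply: le_trans (_ : u (k%:R * y) <= _); first by lra.
    apply: le_trans (_ : (1 + eps) ^+ (n + n) * u (k'%:R * y') <= _); last first.
      by rewrite ler_wpM2l ?exprn_ge0 // ?addr_ge0 // ?(ltW eps0) // /w; lra.
    rewrite {1}/u ler_pdivrMr ?exprn_gt0 //.
    apply: le_trans (_ : hat_sum ((k'%:R * y') ^+ n) <= _).
      by apply: hat_sum_mono; rewrite ?exprn_ge0 ?lerXn2r ?nnegrE // ltW.
    have -> : (1 + eps) ^+ (n + n) * u (k'%:R * y') * (k%:R * y) ^+ (n + n) =
        hat_sum ((k'%:R * y') ^+ n) * (((1 + eps) * (k%:R * y)) / (k'%:R * y')) ^+ (n + n).
      by rewrite expr_div_n [((1 + eps) * _) ^+ _]exprMn /u; ring.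
    by rewrite ler_peMr ?hat_sum_ge0 // exprn_ege1 // ler_pdivlMr // mul1r.
  apply/ler_addgt0Pl => d d0; pose B : R := 2 ^+ (n + n).
  have B0 : 0 < B by rewrite exprn_gt0.
  have den0 : 0 < B * (w + 1) + d by rewrite addr_gt0 // mulr_gt0 // ltr_wpDl.
  (* Makes [eps B w <= d], since [eps (B (w + 1) + d) = d]. *)
  pose eps := d / (B * (w + 1) + d).
  have eps0 : 0 < eps by rewrite divr_gt0.
  have eps1 : eps <= 1 by rewrite ler_pdivrMr // mul1r lerDr; apply: mulr_ge0; [exact: ltW|exact: addr_ge0].
  have pw m : (1 + eps) ^+ m <= 1 + eps * 2 ^+ m.
    suff : (1 + eps) ^+ m <= 1 + eps * (2 ^+ m - 1) by clear -eps0; lra.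
    elim: m => [|m IH]; first by rewrite !expr0 subrr mulr0 addr0.
    have p1 : 1 <= (2 : R) ^+ m by rewrite exprn_ege1 // ler1n.
    rewrite !exprS; apply: le_trans (ler_wpM2l _ IH) _; first by rewrite addr_ge0 // ltW.
    rewrite -subr_ge0; have -> : 1 + eps * (2 * 2 ^+ m - 1) - (1 + eps) * (1 + eps * (2 ^+ m - 1)) =
      eps * (1 - eps) * (2 ^+ m - 1) by ring.
    by apply: mulr_ge0; [apply: mulr_ge0; [exact: ltW|by rewrite subr_ge0]|by rewrite subr_ge0].
  apply: le_trans (step _ eps0) _; apply: le_trans (ler_wpM2r w0 (pw _)) _.
  have e1 : eps * B * w + eps * B + eps * d = d.
    by rewrite -[RHS](divfK (lt0r_neq0 den0)) -/eps; ring.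
  have h1 : 0 <= eps * B by rewrite mulr_ge0 // ltW.
  have h2 : 0 <= eps * d by rewrite mulr_ge0 // ltW.
  rewrite -/B mulrDl mul1r addrC lerD2r; clear -e1 h1 h2; lra.
exists l => y y1; have := hl y; rewrite /c max_r // /u => h.
have y0 : 0 < y by apply: lt_le_trans y1.
have yn : 0 < y ^+ (n + n) by rewrite exprn_gt0.
have -> : hat_sum (y ^+ n) - l * y ^+ (n + n) = (hat_sum (y ^+ n) / y ^+ (n + n) - l) * y ^+ (n + n).
  by field; rewrite gt_eqF.
rewrite normrM (gtr0_norm yn); apply: le_trans (ler_wpM2r (ltW yn) h) _.
have Ey : y ^+ (n + n) = y ^+ (n + n.-1) * y by rewrite -exprSr -addnS prednK.
by rewrite Ey mulrACA mulVf ?gt_eqF // mulr1.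
Qed.

End Limit.


(** Unfolding [cone_sum_hat] sums [2^j l (Y / 2^j)^2], which gives [2 l Y^2]. The error satisfies
    [err Y <= A Y^s + 2 err (Y/2)], a contraction of ratio [rho = 2^(1-s)] because [s > 1]. *)
Lemma cone_sum_limit A l : 0 <= A ->
  (forall y, 1 <= y -> `|hat_sum (y ^+ n) - l * y ^+ (n + n)| <= A * y ^+ (n + n.-1)) ->
  exists2 B, 0 <= B & forall Y, 0 <= Y -> `|cone_sum Y - 2 * l * Y ^+ 2| <= B * Y `^ (2 - (2 * n%:R)^-1).
Proof.
(* The hypothesis has exponent [2 - 1/n] in [Y], which is only 1 for [n = 1]; halving the saving
   keeps [s > 1]. *)
move=> A0 hA; set s := 2 - _.
have nR : 1 <= n%:R :> R by rewrite ler1n.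
have n0R : 0 < n%:R :> R by rewrite ltr0n.
have i1 : 0 < (2 * n%:R)^-1 :> R by rewrite invr_gt0 mulr_gt0.
have i2 : (2 * n%:R)^-1 <= 2^-1 :> R by rewrite lef_pV2 ?posrE ?mulr_gt0 //; lra.
have s2 : s <= 2 by rewrite /s; lra.
have s1 : 1 < s by rewrite /s; lra.
have hb Y : 1 <= Y -> `|hat_sum Y - l * Y ^+ 2| <= A * Y `^ s.
  move=> Y1; have Y0 : 0 < Y by apply: lt_le_trans Y1.
  pose y := Y `^ n%:R^-1.
  have pw m : y ^+ m = Y `^ (m%:R / n%:R) by rewrite /y -powR_mulrn ?powR_ge0 // -powRrM mulrC.
  have y1 : 1 <= y by rewrite /y -[X in X <= _](powRr0 Y); apply: ler_powR => //; rewrite invr_ge0 ltW.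
  have Ey : y ^+ n = Y by rewrite pw divff ?gt_eqF // powRr1 // ltW.
  have Eyy : y ^+ (n + n) = Y ^+ 2 by rewrite exprD Ey expr2.
  have := hA y y1; rewrite Ey Eyy => h; apply: le_trans h _; rewrite ler_wpM2l // pw.
  apply: ler_powR => //; rewrite ler_pdivrMr // /s natrD -subn1 natrB //.
  have -> : (2 - (2 * n%:R)^-1) * n%:R = 2 * n%:R - 2^-1 :> R by field; rewrite gt_eqF.
  by lra.
pose rho := 2 * (2^-1 : R) `^ s.
have rho0 : 0 <= rho by rewrite mulr_ge0 ?powR_ge0.
have rho1 : rho < 1.
  have h2 : 0 < (2^-1 : R) by rewrite invr_gt0.
  have -> : rho = (2^-1) `^ (s - 1).
    rewrite /rho [in LHS](_ : s = 1 + (s - 1)); last by ring.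
    by rewrite powRD_gt0 // powRr1 ?ltW // mulrA mulfV ?gt_eqF // mul1r.
  have sp : 0 < s - 1 by lra.
  by have := @gt0_ltr_powR R _ sp 2^-1 1; rewrite !nnegrE powR1 => h; apply: h => //; lra.
have r1 : 0 < 1 - rho by rewrite subr_gt0.
pose B := 2 * `|l| + A / (1 - rho).
have B0 : 0 <= B by apply: addr_ge0; [exact: mulr_ge0|apply: divr_ge0 => //; exact: ltW].
have Bge : A <= (1 - rho) * B.
  have e1 : (1 - rho) * (A / (1 - rho)) = A by rewrite mulrC divfK // gt_eqF.
  by rewrite /B mulrDr e1 lerDr; apply: mulr_ge0; [exact: ltW|exact: mulr_ge0].
exists B => // Y Y0.
have [k hk] : exists k, Y < 2 ^+ k.
  exists (Num.truncn Y).+1; apply: lt_trans (truncnS_gt Y) _.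
  by rewrite -natrX ltr_nat ltn_expl.
elim: k Y Y0 hk => [|k IH] Y Y0 hk.
  rewrite expr0 in hk; rewrite cone_sum_small // sub0r normrN.
  have [->|Yn] := eqVneq Y 0; first by rewrite expr0n /= mulr0 normr0 mulr_ge0 ?powR_ge0.
  have Yp : 0 < Y by rewrite lt_neqAle eq_sym Yn.
  rewrite normrM normrM ger0_norm // (ger0_norm (exprn_ge0 2 Y0)).
  apply: le_trans (_ : 2 * `|l| * Y `^ s <= _); last first.
    by rewrite ler_wpM2r ?powR_ge0 // /B lerDl divr_ge0 // ltW.
  rewrite ler_wpM2l ?mulr_ge0 // -powR_mulrn //.
  by apply: ger_powR => //; rewrite Yp ltW.
have [Y1|Y1] := ltP Y 1; first by apply: (IH Y Y0); apply: lt_le_trans Y1 _; rewrite exprn_ege1 // ler1n.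
rewrite cone_sum_hat //.
have hY2 : Y / 2 < 2 ^+ k by rewrite ltr_pdivrMr // -exprSr.
have h2 := IH (Y / 2) (divr_ge0 Y0 (ler0n _ _)) hY2.
have h1 := hb Y Y1.
have E : (Y / 2) `^ s = Y `^ s * (2^-1) `^ s by rewrite powRM // invr_ge0.
have -> : hat_sum Y + 2 * cone_sum (Y / 2) - 2 * l * Y ^+ 2 =
   (hat_sum Y - l * Y ^+ 2) + 2 * (cone_sum (Y / 2) - 2 * l * (Y / 2) ^+ 2) by field.
apply: le_trans (ler_normD _ _) _; rewrite (normrM 2) ger0_norm //.
apply: le_trans (_ : A * Y `^ s + 2 * (B * (Y / 2) `^ s) <= _).
  by apply: lerD => //; rewrite ler_wpM2l.
have -> : A * Y `^ s + 2 * (B * (Y / 2) `^ s) = (A + rho * B) * Y `^ s by rewrite E /rho; ring.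
by rewrite ler_wpM2r ?powR_ge0 //; lra.
Qed.

(** Difference quotients of [2 l Y^2] over a step [H] are [4 l N] up to [2 l H], and the error of
    [cone_sum] adds order [N^s / H]; the choice [H = N^(s/2)] balances the two. *)
Lemma count_asymptotic A l : 0 <= A ->
  (forall y, 1 <= y -> `|hat_sum (y ^+ n) - l * y ^+ (n + n)| <= A * y ^+ (n + n.-1)) ->
  exists2 K, 0 <= K & forall N, `|sumN a N - 4 * l * N%:R| <= K * N%:R `^ (1 - (4 * n%:R)^-1).
Proof.
move=> A0 hA; have [B B0 hB] := cone_sum_limit A0 hA.
set s := 2 - _ in hB; set t := 1 - _.
have nR : 1 <= n%:R :> R by rewrite ler1n.
have n0R : 0 < n%:R :> R by rewrite ltr0n.
have i1 : 0 < (4 * n%:R)^-1 :> R by rewrite invr_gt0 mulr_gt0.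
have i2 : (4 * n%:R)^-1 <= 4^-1 :> R by rewrite lef_pV2 ?posrE ?mulr_gt0 //; lra.
have st : s = t + t.
  by rewrite /s /t; field; rewrite gt_eqF.
have t0 : 0 < t by rewrite /t; lra.
have t1 : t <= 1 by rewrite /t; lra.
exists (2 * `|l| + 5 * B) => [|N]; first by rewrite addr_ge0 ?mulr_ge0.
have [->|N0] := posnP N; first by rewrite sumN0 mulr0 subr0 normr0 mulr_ge0 ?powR_ge0 ?addr_ge0 ?mulr_ge0.
have NR : 1 <= N%:R :> R by rewrite ler1n.
have Np : 0 < N%:R :> R by rewrite ltr0n.
set H := N%:R `^ t; have H0 : 0 < H by rewrite powR_gt0.
have HN : H <= N%:R by rewrite /H -[X in _ <= X](powRr1 (ltW Np)) ler_powR.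
have HH : N%:R `^ s = H ^+ 2 by rewrite st powRD_gt0 // expr2.
have s0 : 0 <= s by rewrite st addr_ge0 // ltW.
have s2 : s <= 2 by rewrite st; lra.
have p1 : (N%:R + H) `^ s <= 4 * H ^+ 2.
  apply: le_trans (_ : (2 * N%:R) `^ s <= _).
    by apply: ge0_ler_powR; rewrite ?nnegrE //; clear -H0 HN Np; lra.
  rewrite powRM // HH ler_wpM2r ?exprn_ge0 ?(ltW H0) //.
  apply: le_trans (_ : 2 `^ 2 <= _); first by rewrite ler_powR // ler1n.
  by rewrite powR_mulrn // -natrX.
have p2 : (N%:R - H) `^ s <= H ^+ 2.
  by rewrite -HH; apply: ge0_ler_powR; rewrite ?nnegrE ?subr_ge0 //; lra.
have u1 := cone_sum_upper N (ltW H0); have u2 := cone_sum_lower (ltW H0) HN.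
have b1 := hB (N%:R + H) (addr_ge0 (ltW Np) (ltW H0)).
have b2 := hB N%:R (ltW Np); rewrite HH in b2.
have b3 : `|cone_sum (N%:R - H) - 2 * l * (N%:R - H) ^+ 2| <= B * (N%:R - H) `^ s by apply: hB; rewrite subr_ge0.
have b1' := le_trans b1 (ler_wpM2l B0 p1); have b3' := le_trans b3 (ler_wpM2l B0 p2).
have l1 := ler_norm l; have l2 : - l <= `|l| by rewrite -normrN ler_norm.
have l3 : `|l| * H ^+ 2 >= l * H ^+ 2 by rewrite ler_wpM2r // exprn_ge0 // ltW.
have l4 : `|l| * H ^+ 2 >= - l * H ^+ 2 by rewrite ler_wpM2r // exprn_ge0 // ltW.
move: b1' b2 b3'; rewrite !ler_norml => /andP[_ b1'] /andP[b2 b2'] /andP[_ b3'].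
clear -u1 u2 b1' b2 b2' b3' l3 l4 H0 B0.
move: u1 u2 b1' b2 b2' b3' l3 l4; rewrite !expr2.
move: (sumN a N) (cone_sum (N%:R + H)) (cone_sum (N%:R - H)) (cone_sum N%:R) => S c1 c2 c3.
move: (N%:R : R) (`|l|) => x al.
move=> u1 u2 b1 b2 b2' b3 l3 l4; apply/andP; split; rewrite -(ler_pM2r H0); nra.
Qed.

End SmoothToSharp.

Lemma sum_subset_ge (R : realType) (I : eqType) (s t : seq I) (f : I -> R) :
  uniq s -> uniq t -> {subset s <= t} -> (forall i, 0 <= f i) -> \sum_(i <- s) f i <= \sum_(i <- t) f i.
Proof.
move=> us ut st f0; rewrite [X in _ <= X](bigID (mem s)) /= -[X in X <= _]addr0; apply: lerD; last first.
  by apply: sumr_ge0.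
rewrite -[X in _ <= X]big_filter le_eqVlt; apply/orP; left; apply/eqP; apply: perm_big.
apply: uniq_perm => //; first by rewrite filter_uniq.
by move=> i; rewrite mem_filter; case: (boolP (i \in s)) => //= /st ->.
Qed.

(** * Positivity of the density of ideals *)

Section Positivity.
Local Open Scope classical_set_scope.
Variables (R : realType) (O : comNzRingType) (n D : nat) (L : lattice_order O n).
Implicit Types (M J : set O) (x z : O).
Hypothesis D1 : (1 < D)%N.
Hypothesis dom : forall x y : O, x * y = 0 -> x = 0 \/ y = 0.
Hypothesis prime_inverse : forall p (P : set O), prime p -> ~~ (p %| D)%N -> maximal_ideal P -> P p%:R ->
  exists Q q, [/\ is_ideal Q, ideal_prod P Q = principal p%:R, Q q & P (1 - q)].
Notation K := (bnd L).
Notation nrm := (nrm L).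
Notation box := (box L).
Notation C1 := (short_bound D L).
Notation cterm := (@cell_term R O n D L).

Lemma cell_term_ge0 (Y : R) J x : 0 <= cterm Y J x.
Proof.
have m0 := @cell_size_ge0 R O n L J x.
by rewrite divr_ge0 ?mulr_ge0 ?hat_ge0 ?tent_ge0 // (le_trans m0) // cell_weight_ge.
Qed.

Lemma idx_setT : idx (setT : set O) = 1%N.
Proof. by apply: (idxE (@idealT O)); apply: has_indexT. Qed.

Lemma cell_size_setT x : @cell_size R O n L setT x = (idn L x)%:R.
Proof. by rewrite /cell_size idx_setT divr1. Qed.

(** Close to the integer [b] the norm of [x] is within a quarter of [b^n] from [b^n]. Then [tent]
    takes its full value, [hat] is at least [b^n / 2], and the denominator is at most the norm times
    one more than the number of points of the box. *)
Lemma cell_term_near (b q s : nat) x : (4 * D * K * (K + 1) ^ n.-1 <= q)%N -> (0 < b)%N -> (s * q <= b)%N ->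
  (nrm (x - b%:R) <= D * s)%N ->
  (b%:R ^+ n) / 2 / (size (box (codiff_radius D L))).+1%:R <= cterm ((2 * b%:R) ^+ n) setT x.
Proof.
move=> hq b0 hs hx; have n0 := rank_gt0 L; have K0 := bnd_gt0 L.
have D0 : (0 < D)%N by apply: ltnW.
have bR : 0 < b%:R :> R by rewrite ltr0n.
have bn0 : 0 < b%:R ^+ n :> R by rewrite exprn_gt0.
have Dsb : (D * s <= b)%N.
  apply: leq_trans hs; rewrite mulnC leq_mul2l; apply/orP; right; apply: leq_trans hq.
  have h : (0 < (K + 1) ^ n.-1)%N by rewrite expn_gt0 addn1.
  rewrite (_ : 4 * D * K * (K + 1) ^ n.-1 = D * (4 * K * (K + 1) ^ n.-1))%N; last by ring.
  by rewrite leq_pmulr // !muln_gt0 K0.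
have hb : (nrm b%:R <= b * K)%N by rewrite -[b%:R]mulr1 nrm_natr leq_mul2l nrm1 orbT.
have hxb : (nrm x <= b * (K + 1))%N.
  by rewrite -(subrK b%:R x); apply: leq_trans (nrmD L _ _) _; rewrite mulnDr muln1 addnC leq_add // (leq_trans hx).
have hbb : (nrm b%:R <= b * (K + 1))%N by rewrite (leq_trans hb) // leq_mul2l leq_addr orbT.
have hd := @idn_dist R O n L _ _ _ hxb hbb.
have key : (4 * (K * ((b * (K + 1)) ^ n.-1 * nrm (x - b%:R))) <= b ^ n)%N.
  rewrite -[X in (_ <= _ ^ X)%N](prednK n0) expnS expnMn.
  apply: leq_trans (_ : b ^ n.-1 * (4 * D * K * (K + 1) ^ n.-1 * s) <= _)%N.
    move: hx; move: (nrm (x - _)) => v; move: (b ^ n.-1)%N ((K + 1) ^ n.-1)%N => u w hx.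
    rewrite (_ : 4 * (K * (u * w * v)) = 4 * K * u * w * v)%N; last by ring.
    rewrite (_ : u * (4 * D * K * w * s) = 4 * K * u * w * (D * s))%N; last by ring.
    by rewrite leq_mul2l hx orbT.
  by rewrite [X in (_ <= X)%N]mulnC leq_mul2l; apply/orP; right; apply: leq_trans hs; rewrite mulnC leq_mul2l hq orbT.
set m := (idn L x)%:R in hd.
have hm : `|m - b%:R ^+ n| <= b%:R ^+ n / 4.
  rewrite idn_natr natrX in hd; apply: le_trans hd _; rewrite ler_pdivlMr // mulrC -!natrM -natrX ler_nat.
  exact: key.
have [m1 m2] : 3 / 4 * b%:R ^+ n <= m /\ m <= 5 / 4 * b%:R ^+ n.
  by move: hm; rewrite ler_norml => /andP[h1 h2]; clear -h1 h2; split; lra.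
have m0 : 0 < m by clear -m1 bn0; lra.
have Et : tent D L (nrm x)%:R m = m.
  apply: tent_eq; first exact: ltW.
  apply: le_trans (_ : (b * (K + 1))%N%:R ^+ n <= _); first by rewrite lerXn2r ?nnegrE // ler_nat.
  apply: le_trans (_ : (C1 ^ n)%N%:R * (3 / 4 * b%:R ^+ n) <= _); last by rewrite ler_wpM2l.
  rewrite natrM exprMn mulrC mulrA ler_wpM2r ?exprn_ge0 //.
  have h4 : (2 ^ n * (K + 1) ^ n <= C1 ^ n)%N by rewrite -expnMn leq_exp2r // /short_bound; nia.
  apply: le_trans (_ : (2 ^ n * (K + 1) ^ n)%N%:R * (3 / 4) <= _); last by rewrite ler_wpM2r ?ler_nat // divr_ge0.
  have h2 : (2 <= 2 ^ n)%N by rewrite -[X in (X <= _)%N]expn1 leq_exp2l.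
  rewrite natrM (natrX _ (K + 1)) -mulrA mulrCA ler_peMr ?exprn_ge0 //.
  have : 2 <= (2 ^ n)%N%:R :> R by rewrite ler_nat.
  by move: ((2 ^ n)%N%:R : R) => w hw; lra.
have hh : b%:R ^+ n / 2 <= hat ((2 * b%:R) ^+ n) m.
  have h2 : 2 <= 2 ^+ n :> R by rewrite -natrX ler_nat -[X in (X <= _)%N]expn1 leq_exp2l.
  rewrite /hat le_min le_max exprMn; apply/andP; split; first by clear -m1 bn0; lra.
  by apply/orP; right; clear -m2 h2 bn0; nra.
set S := size _; have S0 : 0 < S.+1%:R :> R by rewrite ltr0n.
have hw : @cell_weight R O n D L setT x <= S.+1%:R * m.
  rewrite /cell_weight cell_size_setT -/m ge_max; apply/andP; split; first by rewrite ler_peMl ?(ltW m0) // ler1n.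
  apply: le_trans (_ : \sum_(k <- codiff D L setT) m <= _); first by apply: ler_sum => k _; apply: tent_le.
  rewrite big_const_seq count_predT iter_addr_0 -[_ *+ size _]mulr_natl ler_wpM2r ?(ltW m0) // ler_nat.
  by rewrite (leq_trans _ (leqnSn S)) // size_filter count_size.
have w0 : 0 < @cell_weight R O n D L setT x.
  by apply: lt_le_trans (cell_weight_ge _ _ _ _ _); rewrite cell_size_setT.
rewrite /cell_term cell_size_setT -/m Et ler_pdivlMr //.
apply: le_trans (ler_wpM2l _ hw) _; first by rewrite !divr_ge0 // ltW.
by rewrite mulrA divfK ?gt_eqF // ler_wpM2r // ltW.
Qed.

(** What remains is [l > 0]. For [b = 1] modulo [D], the term [J = setT] contains the points
    [b + D x] with [x] in a box of side comparable to [b], each contributing order [b^n]. So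
    [hat_sum] at [(2 b)^n] is at least of order [b^(2n)], which [l <= 0] would contradict for large
    [b]. *)
Theorem ideal_count_asymptotic : exists c K s : R, [/\ 0 < c, 0 <= K, 0 < s, s < 1 &
  forall N, `|sumN (ideal_count R O D) N - c * N%:R| <= K * N%:R `^ s].
Proof.
have n0 := rank_gt0 L; have K0 := bnd_gt0 L.
have nz := order_natr_neq0 L.
pose a : nat -> R := ideal_count R O D.
have a0 m : 0 <= a m by [].
have [A A0 hA] := smooth_scaling R L D1 dom prime_inverse.
have [l hl] := @hat_sum_limit R a n a0 n0 A _ A0 (fun y l k => hA y l k) (modulus_gt0 L D1).
have [K1 K10 hK] := @count_asymptotic R a n a0 n0 A l A0 hl.
have nR : 1 <= n%:R :> R by rewrite ler1n.
have i1 : 0 < (4 * n%:R)^-1 :> R by rewrite invr_gt0 mulr_gt0 // ltr0n.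
have i2 : (4 * n%:R)^-1 <= 4^-1 :> R by rewrite lef_pV2 ?posrE ?mulr_gt0 ?ltr0n //; lra.
exists (4 * l), K1, (1 - (4 * n%:R)^-1); split => //; [|lra|lra].
rewrite mulr_gt0 //.
pose q := (4 * D * K * (K + 1) ^ n.-1)%N.
have q0 : (0 < q)%N by rewrite !muln_gt0 K0 (ltnW D1) expn_gt0 addn1.
pose S := size (box (codiff_radius D L)).
pose kap : R := (q%:R ^+ n)^-1 / 2 / S.+1%:R.
have kap0 : 0 < kap by rewrite !divr_gt0 ?invr_gt0 ?exprn_gt0 ?ltr0n.
have low rho (b := (D * rho + 1)%N) : kap * b%:R ^+ (n + n) <= smooth_count O D ((2 * b%:R) ^+ n).
  have b0 : (0 < b)%N by rewrite /b addn1.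
  pose s := (b %/ q)%N; have hs : (s * q <= b)%N by apply: leq_divM.
  have hs2 : (b < s.+1 * q)%N by rewrite ltn_ceil.
  pose r := (4 * C1 * b)%N.
  have ok : (C1 ^ n)%N%:R * (2 * (2 * b%:R) ^+ n) <= r%:R ^+ n :> R.
    by apply: box_radius_ok; rewrite ?mulr_ge0 // /r !natrM mulrA le_eqVlt; apply/orP; left; apply/eqP; ring.
  rewrite (smooth_countE D1 dom prime_inverse _ ok) ?exprn_ge0 ?mulr_ge0 //.
  have hT : (setT : set O) \in goods_upto O D (codiff_radius D L).
    apply/(mem_goods_upto D L); split; first exact: goodT.
    by rewrite idx_setT /codiff_radius !muln_gt0 expn_gt0 K0 /short_bound addn4.
  rewrite (bigD1_seq _ hT (goods_upto_uniq D L _)) /=.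
  apply: ler_wpDr; first by apply: sumr_ge0 => J _; apply: sumr_ge0 => x _; apply: cell_term_ge0.
  pose X := [seq b%:R + D%:R * x | x <- box s].
  have uX : uniq X.
    rewrite map_inj_uniq ?box_uniq // => x x' /addrI /(mul_cancel dom) -> //; exact: nz (ltnW D1).
  rewrite -big_filter; apply: le_trans (@sum_subset_ge R _ X _ _ uX _ _ _); first last.
  - by move=> x; apply: cell_term_ge0.
  - move=> _ /mapP[x + ->]; rewrite mem_box => hx; rewrite mem_filter mem_box; apply/andP; split.
      apply/asboolP; split => //; exists (rho%:R + x); rewrite /b natrD natrM; ring.
    apply: leq_trans (nrmD L _ _) _; rewrite nrm_natr.
    have h1 : (nrm b%:R <= b * K)%N by rewrite -[b%:R]mulr1 nrm_natr leq_mul2l nrm1 orbT.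
    apply: leq_trans (leq_add h1 (leq_mul (leqnn D) hx)) _.
    have h2 : (D * s <= b)%N.
      apply: leq_trans hs; rewrite mulnC leq_mul2l; apply/orP; right.
      rewrite /q (_ : 4 * D * K * (K + 1) ^ n.-1 = D * (4 * K * (K + 1) ^ n.-1))%N; last by ring.
      by rewrite leq_pmulr // !muln_gt0 K0 expn_gt0 addn1.
    rewrite /r /short_bound; have := D1; move: h2; move: (D * s)%N => w h2 D1'; nia.
  - by rewrite filter_uniq // box_uniq.
  apply: le_trans (_ : \sum_(x <- X) b%:R ^+ n / 2 / S.+1%:R <= _); last first.
    rewrite big_seq [X in _ <= X]big_seq; apply: ler_sum => _ /mapP[x + ->]; rewrite mem_box => hx.
    apply: (cell_term_near (leqnn q) b0 hs).
    by rewrite addrAC subrr add0r nrm_natr leq_mul2l hx orbT.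
  rewrite big_const_seq count_predT iter_addr_0 size_map box_size -[_ *+ (_ ^ n)]mulr_natl natrX.
  have h3 : (b%:R / q%:R) ^+ n <= s.*2.+1%:R ^+ n :> R.
    rewrite lerXn2r ?nnegrE ?divr_ge0 // ler_pdivrMr ?ltr0n // -natrM ler_nat ltnW // (leq_trans hs2) //.
    by rewrite leq_mul2r ltnS -addnn leq_addr orbT.
  apply: le_trans (ler_wpM2r _ h3); last by rewrite !divr_ge0 ?exprn_ge0.
  by rewrite /kap expr_div_n exprD le_eqVlt; apply/orP; left; apply/eqP; ring.
rewrite ltNge; apply/negP => l0.
pose B := 2 ^+ (n + n) * A / kap.
have B0 : 0 <= B by rewrite divr_ge0 ?mulr_ge0 ?exprn_ge0 // ltW.
pose rho := (Num.truncn B).+1; pose b := (D * rho + 1)%N.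
have bB : B < b%:R.
  apply: lt_le_trans (truncnS_gt B) _; rewrite ler_nat /b -/rho; have := D1; nia.
have b0 : 0 < b%:R :> R by rewrite ltr0n /b addn1.
have b1 : 1 <= 2 * b%:R :> R.
  by have : 1 <= b%:R :> R; [rewrite ler1n /b addn1|lra].
have := hl (2 * b%:R) b1; rewrite ler_norml => /andP[_ h1].
have h2 : kap * b%:R ^+ (n + n) <= smooth_count O D ((2 * b%:R) ^+ n) := low rho.
have E : hat_sum a ((2 * b%:R) ^+ n) = smooth_count O D ((2 * b%:R) ^+ n) by [].
rewrite E in h1.
have h3 : l * (2 * b%:R) ^+ (n + n) <= 0 by rewrite mulr_le0_ge0 ?exprn_ge0 // mulr_ge0 // ltW.
have h4 : kap * b%:R ^+ (n + n) <= A * (2 * b%:R) ^+ (n + n.-1) by clear -h1 h2 h3; lra.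
have h5 : A * (2 * b%:R) ^+ (n + n.-1) * b%:R <= 2 ^+ (n + n) * A * b%:R ^+ (n + n).
  have -> : b%:R ^+ (n + n) = b%:R ^+ (n + n.-1) * b%:R :> R by rewrite -exprSr -addnS prednK.
  rewrite exprMn !mulrA ler_wpM2r ?(ltW b0) // ler_wpM2r ?exprn_ge0 ?(ltW b0) //.
  rewrite mulrC ler_wpM2r // ler_weXn2l //; first by rewrite ler1n.
  by rewrite leq_add2l leq_pred.
have h6 : kap * b%:R ^+ (n + n) * b%:R <= B * kap * b%:R ^+ (n + n).
  apply: le_trans (ler_wpM2r (ltW b0) h4) _; apply: le_trans h5 _.
  by rewrite /B divfK ?gt_eqF.
have p0 : 0 < kap * b%:R ^+ (n + n) by rewrite mulr_gt0 // exprn_gt0.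
have : b%:R <= B by rewrite -(ler_pM2l p0) (mulrC _ B) mulrA.
by rewrite leNgt bB.
Qed.

End Positivity.

(** * A lattice order from integral coordinates *)

Section Construction.
Local Open Scope classical_set_scope.
Variables (O : comNzRingType) (n : nat) (co : O -> 'rV[int]_n) (oc : 'rV[int]_n -> O).
Hypotheses (coK : cancel co oc) (ocK : cancel oc co).
Hypothesis coD : forall x y, co (x + y) = co x + co y.
Hypothesis dom : forall x y : O, x * y = 0 -> x = 0 \/ y = 0.
Hypothesis n0 : (0 < n)%N.
Notation nrm := (cnrm co).

Definition coord_cube k : seq O := [seq oc (\row_i (f i : nat)%:Z) | f : {ffun 'I_n -> 'I_k}].

Lemma coord_cubeP k x : x \in coord_cube k <-> forall i, (0 <= co x 0 i < k%:Z)%R.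
Proof.
split => [/mapP[f _ ->] i|h]; first by rewrite ocK mxE ltz_nat ltn_ord.
have hi i : (absz (co x 0%R i) < k)%N by have := h i; lia.
apply/mapP; exists [ffun i => Ordinal (hi i)]; first by rewrite mem_enum.
apply: (can_inj coK); rewrite ocK; apply/rowP => i; rewrite mxE ffunE /=; have := h i; lia.
Qed.

Lemma small_multiple_eq (k : nat) (u v z : int) : 0 <= u < k%:Z -> 0 <= v < k%:Z -> u - v = z * k%:Z -> u = v.
Proof. 
move=> /andP[u0 uk] /andP[v0 vk] E.
have [z1|[z1|z0]] : z >= 1 \/ z <= -1 \/ z = 0 by lia.
- by exfalso; nia.
- by exfalso; nia.
by move: E; rewrite z0 mul0r; lia. Qed.

Lemma lattice_order_of_coordinates : inhabited (lattice_order O n).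
Proof.
have [K1 h1] := cnrm_mul_bound coK ocK coD.
have [K2 h2] := ideal_norm_bound coK ocK coD.
have [K3 h3] := ideal_norm_lipschitz coK ocK coD.
have [K4 h4] := cnrm_cancel_bound coK ocK coD.
have [K5 h5] := reduce_modulo coK ocK coD dom.
pose K := (K1 + K2 + K3 + K4 + K5 + nrm 1 + 1)%N.
have up a b c : (a <= b * c -> b <= K -> a <= K * c)%N.
  by move=> h hb; apply: leq_trans h _; rewrite leq_mul2r hb orbT.
constructor; apply: (@LatticeOrder O n nrm (ideal_norm co oc) (cbox oc) coord_cube K).
- by rewrite /K addn1.
- exact: n0.
- by rewrite /K; lia.
- exact: (cnrmB coD).
- exact: (cnrm_natr coD).
- exact: (cnrm_eq0 coK coD).
- by move=> x y; apply: up (h1 x y) _; rewrite /K; lia.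
- exact: (ideal_normM coK ocK coD).
- exact: (ideal_norm_natr ocK coD).
- exact: (ideal_norm_gt0 coK ocK coD dom).
- exact: (principal_index coK ocK coD dom).
- by move=> x; apply: up (h2 x) _; rewrite /K; lia.
- move=> r x y hx hy; apply: leq_trans (h3 r x y hx hy) _.
  by rewrite leq_add2l leq_mul2r; apply/orP; right; rewrite /K; lia.
- by move=> x y; apply: up (h4 x y) _; rewrite /K; lia.
- by move=> g x x0; have [q hq] := h5 g x x0; exists q; apply: up hq _; rewrite /K; lia.
- exact: (mem_cbox coK ocK).
- exact: (cbox_uniq ocK).
- exact: cbox_size.
- move=> k; rewrite map_inj_uniq ?enum_uniq // => f f' /(can_inj ocK) /rowP E; apply/ffunP => i.
  by have := E i; rewrite !mxE => h; apply: val_inj => /=; lia.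
- by move=> k; rewrite size_map -cardE card_ffun !card_ord.
- by move=> k x /coord_cubeP h; apply/(cnrmP co) => i; have := h i; lia.
- move=> k k0 x; have kz : k%:Z != 0 by lia.
  exists (oc (\row_i divz (co x 0 i) k%:Z)), (oc (\row_i modz (co x 0 i) k%:Z)); split.
    by apply/coord_cubeP => i; rewrite ocK mxE modz_ge0 // ltz_pmod // ltz_nat.
  apply: (can_inj coK); rewrite coD (co_natr coD) !ocK; apply/rowP => i.
  by rewrite mxE mulmxnE !mxE -mulr_natr natz -divz_eq.
move=> k x y q /coord_cubeP hx /coord_cubeP hy E.
apply: (can_inj coK); apply/rowP => i; apply: (small_multiple_eq (hx i) (hy i) (z := co q 0 i)).
have := congr1 (fun v => co v 0 i) E; rewrite (coB coD) (co_natr coD) mulmxnE !mxE.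
by rewrite -[_ *+ k]mulr_natr natz.
Qed.

End Construction.

Section PrimeIdealTheorem.
Local Open Scope classical_set_scope.
Variables (R : realType) (O : comNzRingType) (n D : nat) (L : lattice_order O n).
Hypothesis D1 : (1 < D)%N.
Hypothesis dom : forall x y : O, x * y = 0 -> x = 0 \/ y = 0.
Hypothesis prime_inverse : forall p (P : set O), prime p -> ~~ (p %| D)%N -> maximal_ideal P -> P p%:R ->
  exists Q q, [/\ is_ideal Q, ideal_prod P Q = principal p%:R, Q q & P (1 - q)].

Theorem prime_ideal_theorem (eps : R) : 0 < eps ->
  exists x0, forall x, x0 <= x -> `|sumR (ideal_mangoldt R O D) x - x| <= eps * x.
Proof.
have nz := order_natr_neq0 L; have ixn := order_index_natr L.
have [c [K [s [c0 K0 s0 s1 hA]]]] := ideal_count_asymptotic R L D1 dom prime_inverse.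
apply: (selberg_pnt (a := ideal_count R O D) _ _ _ c0 s0 s1 K0 hA).
- by move=> m; apply: (ideal_mangoldt_ge0 R D ixn).
- exact: (ideal_count1 R D ixn).
- exact: (ideal_count_ln R dom nz ixn prime_inverse).
Qed.

End PrimeIdealTheorem.

(** * Roots of a polynomial modulo primes *)

Section Monogenic.
Local Open Scope classical_set_scope.
Variables (O : comNzRingType) (phi : {rmorphism {poly int} -> O}) (f u v : {poly int}) (D : nat).
Hypothesis phi_surj : forall x, exists a, x = phi a.
Hypothesis phi_ker : forall a, phi a = 0 <-> exists b, a = f * b.
Hypothesis f_monic : f \is monic.
Hypothesis discr : D%:R = u * f + v * f^`().
Implicit Types (a b : {poly int}) (M P : set O).

Let red p : {poly int} -> {poly 'F_p} := map_poly (fun z : int => z%:~R).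

Lemma redM p a b : red p (a * b) = red p a * red p b. Proof. exact: rmorphM. Qed.
Lemma redD p a b : red p (a + b) = red p a + red p b. Proof. exact: rmorphD. Qed.
Lemma redB p a b : red p (a - b) = red p a - red p b. Proof. exact: rmorphB. Qed.

Lemma intr_Fp_eq0 p (z : int) : prime p -> (z%:~R == 0 :> 'F_p) = (p %| `|z|)%N.
Proof.
move=> pp; case: z => m; rewrite ?NegzE ?abszN ?rmorphN ?oppr_eq0 /= -pmulrn;
  by rewrite -(dvdn_pcharf (pchar_Fp pp)).
Qed.

Lemma red_surj p (h : {poly 'F_p}) : prime p -> exists a, red p a = h.
Proof.
move=> pp; exists (\poly_(i < size h) Posz (nat_of_ord (nth 0%R h i))).
apply/polyP => i; rewrite coef_map coef_poly /=; case: ltnP => hi.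
  by rewrite -pmulrn natr_Zp.
by rewrite nth_default.
Qed.

Lemma red_eq p a b : prime p -> red p a = red p b -> exists c, a = b + p%:R * c.
Proof.
move=> pp /polyP E; exists (\poly_(i < size (a - b)) divz (a - b)`_i p).
apply/polyP => i; rewrite coefD mulr_natl coefMn coef_poly.
have dv : (p %| (a - b)`_i)%Z.
  rewrite dvdzE /= -intr_Fp_eq0 // coefB rmorphB subr_eq0 /=.
  by have := E i; rewrite !coef_map /= => ->.
case: ltnP => hi; last first.
  rewrite mul0rn addr0; apply/eqP; rewrite -subr_eq0 -coefB.
  by apply/eqP; apply: nth_default.
by rewrite -mulr_natr natz divzK // coefB addrC subrK.
Qed.

(** Dedekind's factorization at a prime not dividing [D]. A polynomial [G] of [P] of least degree
    modulo [p] divides the reduction of [f], with cofactor [H]; a common factor would divide [f] and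
    its derivative, hence [D], a unit modulo [p]. So [G] and [H] are coprime, and [Q = (p, H)] is
    the cofactor of [P = (p, G)]. *)
Lemma monogenic_prime_inverse p P : prime p -> ~~ (p %| D)%N -> maximal_ideal P -> P p%:R ->
  exists Q q, [/\ is_ideal Q, ideal_prod P Q = principal p%:R, Q q & P (1 - q)].
Proof.
move=> pp pD mP Pp; have [iP P1 _] := mP.
have Pred a b : red p a = red p b -> P (phi a) -> P (phi b).
  move=> /(red_eq pp)[c ->]; rewrite rmorphD rmorphM rmorph_nat => h.
  by rewrite -(addrK (p%:R * phi c) (phi b)); apply: idealB => //; apply: idealMr.
have fn0 : red p f != 0 by rewrite -size_poly_gt0 size_map_poly_id0 ?size_poly_gt0 ?monic_neq0 // (monicP f_monic) rmorph1 oner_neq0.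
have Pf : P (phi f) by rewrite (phi_ker f).2; [exact: ideal0|exists 1; rewrite mulr1].
pose mem k := `[< exists a, [/\ P (phi a), red p a != 0 & size (red p a) = k] >].
have exk : exists k, mem k by exists (size (red p f)); apply/asboolP; exists f.
case: (ex_minnP exk) => k /asboolP[G [PG G0 Gk]] kmin.
have gdv a : P (phi a) -> red p G %| red p a.
  move=> Pa; rewrite /dvdp; apply/negPn/negP => r0.
  have [q Eq] := red_surj (red p a %/ red p G) pp.
  have Er : red p (a - q * G) = red p a %% red p G.
    by rewrite redB redM Eq; apply/eqP; rewrite subr_eq addrC -divp_eq.
  have : mem (size (red p a %% red p G)).
    apply/asboolP; exists (a - q * G); rewrite Er; split => //.
    by rewrite rmorphB rmorphM; apply: idealB => //; apply: idealMl.
  by move=> /kmin; rewrite -Gk leqNgt ltn_modp G0.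
have /dvdpP[hq Ef] := gdv f Pf.
have [H EH] := red_surj hq pp.
have cop : coprimep (red p G) hq.
  rewrite /coprimep; set r := gcdp _ _.
  have rg : r %| red p G by apply: dvdp_gcdl. have rh : r %| hq by apply: dvdp_gcdr.
  have rf : r %| red p f by rewrite Ef; apply: dvdp_mull.
  have rf' : r %| (red p f)^`().
    by rewrite Ef derivM; apply: dvdp_add; [apply: dvdp_mull|apply: dvdp_mulr].
  have : r %| red p D%:R.
    rewrite discr redD !redM; apply: dvdp_add; apply: dvdp_mull => //.
    by rewrite -[red p f^`()]deriv_map.
  have -> : red p D%:R = (D%:R)%:P by rewrite /red rmorph_nat polyCMn.
  have c0 : D%:R != 0 :> 'F_p by rewrite -(dvdn_pcharf (pchar_Fp pp)).
  have cP0 : (D%:R)%:P != 0 :> {poly 'F_p} by rewrite polyC_eq0.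
  move=> /(dvdp_leq cP0); rewrite size_polyC c0 => h; rewrite eqn_leq h size_poly_gt0.
  by apply: contraNneq G0 => r0; move: rg; rewrite r0 dvd0p.
have /Bezout_eq1_coprimepP[[s t] /= Est] := cop.
have [S ES] := red_surj s pp; have [T ET] := red_surj t pp.
have [W EW] : exists W, 1 = S * G + T * H + p%:R * W.
  by apply: (red_eq pp); rewrite redD !redM ES ET EH Est /red rmorph1.
have [E EE] : exists E, f = H * G + p%:R * E.
  by apply: (red_eq pp); rewrite redM EH.
pose Q : set O := [set x | exists y z, x = p%:R * y + phi H * z].
have iQ : is_ideal Q.
  split; first by exists 0, 0; rewrite !mulr0 addr0.
    by move=> _ _ [y [z ->]] [y' [z' ->]]; exists (y + y'), (z + z'); ring.
  by move=> c _ [y [z ->]]; exists (c * y), (c * z); ring.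
have PE x : P x -> exists y z, x = p%:R * y + phi G * z.
  have [a ->] := phi_surj x => /gdv/dvdpP[h Eh]; have [b Eb] := red_surj h pp.
  have [c ->] : exists c, a = b * G + p%:R * c by apply: (red_eq pp); rewrite redM Eb.
  by exists (phi c), (phi b); rewrite rmorphD !rmorphM rmorph_nat; ring.
have Qp : Q p%:R by exists 1, 0; ring.
have QH : Q (phi H) by exists 0, 1; ring.
exists Q, (phi (T * H + p%:R * W)); split => //.
- apply/seteqP; split.
    apply: ideal_prod_min; first exact: principal_ideal.
    move=> _ _ /PE[y [z ->]] [y' [z' ->]].
    have E0 : phi H * phi G = - (p%:R * phi E).
      apply/eqP; rewrite -addr_eq0 -(rmorph_nat phi) -!rmorphM -rmorphD -EE.
      by apply/eqP/phi_ker; exists 1; rewrite mulr1.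
    exists (p%:R * y * y' + y * (phi H * z') + phi G * z * y' - phi E * z * z').
    transitivity (p%:R * (p%:R * y * y' + y * (phi H * z') + phi G * z * y') + (phi H * phi G) * (z * z')); first by ring.
    by rewrite E0; ring.
  have iPQ : is_ideal (ideal_prod P Q) by apply: ideal_prod_ideal.
  apply: principal_sub => //.
  have -> : p%:R = phi G * p%:R * phi S + p%:R * phi H * phi T + p%:R * p%:R * phi W :> O.
    have := congr1 phi EW; rewrite rmorph1 !rmorphD !rmorphM rmorph_nat => E1.
    transitivity (p%:R * (phi S * phi G + phi T * phi H + p%:R * phi W)); last by ring.
    by rewrite -E1 mulr1.
  by apply: idealD => //; [apply: idealD => //|]; apply: idealMr => //; apply: ideal_prod_mul.
- rewrite rmorphD !rmorphM rmorph_nat; apply: idealD => //; [exact: idealMl|exact: idealMr].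
have -> : 1 - phi (T * H + p%:R * W) = phi S * phi G.
  by rewrite -(rmorph1 phi) -rmorphB {1}EW -rmorphM; congr (phi _); ring.
exact: idealMl.
Qed.


Lemma prime_index_mem p M : prime p -> good D M -> has_index setT M p ->
  forall z : int, M (z%:~R) <-> (p %| `|z|)%N.
Proof.
move=> pp gM hM z; have iM := good_ideal gM; have p0 := prime_gt0 pp.
have Mp : M p%:R by apply: (has_index_kill (@idealT O) iM hM (I : setT (1 : O))).
have Mabs : M z%:~R <-> M `|z|%N%:R.
  by case: z => m; rewrite ?NegzE ?abszN ?rmorphN /= -pmulrn //; split => /(idealN iM); rewrite ?opprK.
rewrite Mabs; split => [Mz|/dvdnP[k ->]]; last by rewrite natrM; apply: idealMl.
apply/negPn/negP; rewrite -prime_coprime // => cp.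
have M1 := ideal_coprime1 iM p0 cp Mp Mz.
have E := ideal_eqT iM M1; rewrite E in hM.
have := has_index_inj (@idealT O) hM (has_indexT O).
by move=> E1; rewrite E1 in pp.
Qed.

(** Among ['X] and the integers [0, ..., p - 1] two are congruent modulo [M], and the integers are
    not congruent to each other; so ['X] reduces to an integer, which is the root. *)
Lemma prime_index_root p M : prime p -> good D M -> has_index setT M p ->
  exists t : 'F_p, forall a, M (phi a) <-> root (red p a) t.
Proof.
move=> pp gM hM; have iM := good_ideal gM; have hz := prime_index_mem pp gM hM.
have p0 := prime_gt0 pp.
have [k [kp Mk]] : exists k, (k < p)%N /\ M (phi 'X - k%:R).
  apply: contrapT => nex.
  pose s : seq O := phi 'X :: [seq k%:R | k <- iota 0 p].
  have sub i j : (i < p)%N -> (j < p)%N -> M (i%:R - j%:R) -> i = j.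
    have -> : i%:R - j%:R = (i%:Z - j%:Z)%:~R :> O by rewrite rmorphB /= -!pmulrn.
    by move=> hi hj /hz /dvdnP[[|w]]; nia.
  have inc : incongruent M s.
    split => [/=|x y].
      rewrite map_inj_in_uniq ?iota_uniq ?andbT; last first.
        move=> i j; rewrite !mem_iota !add0n => hi hj E; apply: sub => //; rewrite E subrr; exact: ideal0.
      apply/negP => /mapP[k]; rewrite mem_iota add0n => hk E.
      by apply: nex; exists k; rewrite E subrr; split => //; apply: ideal0.
    rewrite !inE => /orP[/eqP->|/mapP[i + ->]] /orP[/eqP->|/mapP[j + ->]] //; rewrite ?mem_iota ?add0n.
    - by move=> hj h; case: nex; exists j.
    - by move=> hi h; case: nex; exists i; split => //; apply: idealB_sym.
    by move=> hj hi h; rewrite (sub i j).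
  have [t [st _ _ ct]] := hM.
  have := incongruent_size_le (N := setT) iM (fun x _ => I) inc ct.
  by rewrite st /= size_map size_iota ltnn.
exists (k%:R); have ev a : M (phi a - (a.[k%:Z])%:~R).
  have /factor_theorem[b Eb] : root (a - (a.[k%:Z])%:P) k%:Z by rewrite rootE !hornerE subrr.
  have -> : (a.[k%:Z])%:~R = phi (a.[k%:Z])%:P by rewrite -[in RHS](intz (a.[k%:Z])) rmorph_int rmorph_int.
  rewrite -rmorphB Eb rmorphM; apply: idealMl => //.
  have -> : (k%:Z)%:P = k%:R :> {poly int} by rewrite -polyC_natr natz.
  by rewrite rmorphB rmorph_nat.
move=> a; have -> : root (red p a) k%:R = (p %| `|a.[k%:Z]|)%N.
  rewrite -intr_Fp_eq0 // rootE; congr (_ == 0).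
  by rewrite -[k%:R](rmorph_nat (intr : int -> 'F_p)) natz horner_map.
rewrite -hz; split => h.
  by rewrite -[X in M X](subKr (phi a)); apply: idealB.
by rewrite -(subrK (a.[k%:Z])%:~R (phi a)); apply: idealD.
Qed.

Variable n : nat.
Hypothesis index_natr : forall k, (0 < k)%N -> has_index setT (principal (k%:R : O)) (k ^ n).

Definition root_count p (h : {poly int}) := #|[pred t : 'F_p | root (map_poly (fun z : int => z%:~R) h) t]|.

(** An ideal of index [p] is determined by the residue to which ['X] reduces, and that residue is a
    root of [f]. *)
Lemma goods_prime_le p : prime p -> (size (goods O D p) <= root_count p f)%N.
Proof.
move=> pp; pose t M : 'F_p := xget 0 [set t | forall a, M (phi a) <-> root (red p a) t].
have tP M : M \in goods O D p -> forall a, M (phi a) <-> root (red p a) (t M).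
  move=> /(mem_goods D index_natr)[gM hM]; rewrite /t; case: xgetP => [t0 _ //|].
  by have [t0 h] := prime_index_root pp gM hM => /(_ t0).
rewrite -(size_map t) /root_count cardE; apply: uniq_leq_size.
  rewrite map_inj_in_uniq ?(goods_uniq D index_natr) // => M M' hM hM' E.
  apply/seteqP; split => x; have [a ->] := phi_surj x => /tP h; apply/tP => //.
    by rewrite -E; apply: h.
  by rewrite E; apply: h.
move=> _ /mapP[M hM ->]; rewrite mem_enum inE; apply/(tP M hM).
rewrite (phi_ker f).2; last by exists 1; rewrite mulr1.
by apply: ideal0; have [gM _] := (mem_goods D index_natr _ _).1 hM; apply: good_ideal gM.
Qed.

End Monogenic.

Lemma dconv_prime (R : realType) (u v : nat -> R) p : prime p -> dconv u v p = u 1%N * v p + u p * v 1%N.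
Proof.
move=> pp; have p0 := prime_gt0 pp; have p1 := prime_gt1 pp.
rewrite /dconv -big_filter (perm_big [:: 1%N; p]) /=.
  by rewrite !big_cons big_nil addr0 divn1 divnn p0.
apply: uniq_perm; rewrite ?filter_uniq ?iota_uniq //=; first by rewrite inE neq_ltn p1.
move=> d; rewrite mem_filter mem_index_iota !inE ltnS.
apply/idP/idP => [/andP[dp _]|/orP[/eqP->|/eqP->]]; last 2 first.
- by rewrite dvd1n p0.
- by rewrite dvdnn p0 leqnn.
by have /primeP[_ /(_ d dp)] := pp.
Qed.

Section RootCounting.
Local Open Scope classical_set_scope.
Variables (R : realType) (f u v : {poly int}) (D : nat).
Hypothesis f_monic : f \is monic.
Hypothesis f_size : (1 < size f)%N.
Hypothesis f_prime : forall a b : {poly int}, (exists c, a * b = f * c) ->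
  (exists c, a = f * c) \/ (exists c, b = f * c).
Hypothesis discr : D%:R = u * f + v * f^`().
Hypothesis D1 : (1 < D)%N.

Notation O := {poly %/ f}.
Let phi : {rmorphism {poly int} -> O} := in_qpoly f.

Lemma mk_monicE : mk_monic f = f :> {poly int}.
Proof. by rewrite /mk_monic f_size f_monic. Qed.

Lemma qpoly_surj (x : O) : exists a, x = phi a.
Proof.
by exists (val x); apply: val_inj => /=; rewrite Pdiv.CommonRing.rmodp_small //; apply: size_mk_monic.
Qed.

Lemma qpoly_ker a : phi a = 0 <-> exists b, a = f * b.
Proof.
split => [/(congr1 val) /= h|[b ->]].
  have /(Pdiv.RingMonic.rdvdpP f_monic)[b E] : Pdiv.CommonRing.rdvdp f a.
    by rewrite /Pdiv.CommonRing.rdvdp -[X in Pdiv.CommonRing.rmodp _ X]mk_monicE h.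
  by exists b; rewrite mulrC.
apply: val_inj => /=; apply/eqP; rewrite mk_monicE.
by have : Pdiv.CommonRing.rdvdp f (f * b) by apply/(Pdiv.RingMonic.rdvdpP f_monic); exists b; rewrite mulrC.
Qed.

Lemma qpoly_domain (x y : O) : x * y = 0 -> x = 0 \/ y = 0.
Proof.
have [a ->] := qpoly_surj x; have [b ->] := qpoly_surj y.
by rewrite -rmorphM => /qpoly_ker/f_prime[h|h]; [left|right]; apply/qpoly_ker.
Qed.

Let n := (size (mk_monic f)).-1.
Let co : O -> 'rV[int]_n := @npoly_rV int n.
Let oc : 'rV[int]_n -> O := @rVnpoly int n.

Lemma qpoly_coD (x y : O) : co (x + y) = co x + co y.
Proof. by apply/rowP => i; rewrite !mxE coefD. Qed.

Lemma qpoly_lattice : inhabited (lattice_order O n).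
Proof.
apply: (@lattice_order_of_coordinates O n co oc).
- exact: npoly_rV_K.
- exact: rVnpolyK.
- exact: qpoly_coD.
- exact: qpoly_domain.
by rewrite /n mk_monicE -subn1 subn_gt0.
Qed.

Let inv := monogenic_prime_inverse qpoly_surj qpoly_ker f_monic discr.

(** Read off from [ideal_count_ln] at a prime, where the convolution has only two terms. *)
Lemma ideal_mangoldt_prime p : prime p -> ideal_mangoldt R O D p = ideal_count R O D p * ln p%:R.
Proof.
move=> pp; have [L] := qpoly_lattice; have p0 := prime_gt0 pp; have p1 := prime_gt1 pp.
have nz := order_natr_neq0 L; have ixn := order_index_natr L.
have cl m : (0 < m)%N -> _ := @ideal_count_ln R O n D qpoly_domain nz ixn inv m.
have c1 := ideal_count1 R D ixn.
have l1 : ideal_mangoldt R O D 1 = 0.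
  have := cl 1%N isT; rewrite c1 ln1 mulr0 /dconv big_mkcond big_nat1 /= divn1 c1 mulr1 => <- //.
by rewrite cl // dconv_prime // l1 mul0r add0r c1 mulr1.
Qed.

(** In rank one the ideal [(p)] itself has index [p]. *)
Lemma ideal_count_linear p : size f = 2%N -> prime p -> ~~ (p %| D)%N -> 1 <= ideal_count R O D p.
Proof.
move=> f2 pp pD; have [L] := qpoly_lattice; have ixn := order_index_natr L.
rewrite /ideal_count ler1n.
have : principal (p%:R : O) \in goods O D p.
  apply/(mem_goods D ixn); split.
    by split; [exact: principal_ideal|exists p; rewrite prime_gt0 // prime_coprime //; split => //; apply: principal_self].
  have := ixn p (prime_gt0 pp); by rewrite /n mk_monicE f2 expn1.
by case: (goods O D p).
Qed.

Theorem root_count_lower (eps : R) : 0 < eps ->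
  exists x0, forall x, x0 <= x -> (1 - eps) * x <= ln x * sum_primes (fun p => (root_count p f)%:R) x.
Proof.
have [L] := qpoly_lattice.
have nz := order_natr_neq0 L; have ixn := order_index_natr L.
apply: (@prime_count_lower R (ideal_mangoldt R O D) _ n%:R (ler0n _ _)).
- by move=> m; apply: (ideal_mangoldt_ge0 R D ixn).
- by move=> m; apply: (ideal_mangoldt_prime_power ixn).
- by move=> m; apply: (ideal_mangoldt_le R qpoly_domain nz ixn inv).
- move=> p pp; rewrite ideal_mangoldt_prime // ler_wpM2r ?ln_ge0 ?ler1n ?prime_gt0 // ler_nat.
  exact: (goods_prime_le D qpoly_surj qpoly_ker f_monic ixn pp).
- by move=> p.
exact: (prime_ideal_theorem L D1 qpoly_domain inv).
Qed.

End RootCounting.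

(** * Cyclotomic and radical polynomials *)

Section PrimePolynomials.
Notation pZtoQ := (map_poly (intr : int -> rat)).
Notation pQtoC := (map_poly (ratr : rat -> algC)).

(** Division by a monic polynomial stays over the integers, and the remainder must vanish over the
    rationals by its degree. *)
Lemma dvd_rat_dvd_int (f a : {poly int}) : f \is monic -> pZtoQ f %| pZtoQ a -> exists c, a = f * c.
Proof.
move=> fm dv; have E := Pdiv.RingMonic.rdivp_eq fm a.
set r := Pdiv.CommonRing.rmodp a f in E; set c := Pdiv.CommonRing.rdivp a f in E.
have sr : (size r < size f)%N by apply: Pdiv.CommonRing.ltn_rmodpN0; apply: monic_neq0.
have inj : injective (intr : int -> rat) by apply: intr_inj.
have sz (g : {poly int}) : size (pZtoQ g) = size g by apply: size_map_inj_poly.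
have r0 : pZtoQ r = 0.
  have : pZtoQ f %| pZtoQ r.
    have -> : r = a - c * f by rewrite {1}E addrAC subrr add0r.
    by rewrite rmorphB rmorphM; apply: dvdp_sub => //; apply: dvdp_mull.
  by apply: contraTeq => rn0; apply/negP => /(dvdp_leq rn0); rewrite !sz leqNgt sr.
exists c; rewrite {1}E (_ : r = 0) ?addr0 1?mulrC //.
by apply/eqP; rewrite -size_poly_eq0 -sz r0 size_poly0.
Qed.

Definition prime_poly (f : {poly int}) := forall a b : {poly int}, (exists c, a * b = f * c) ->
  (exists c, a = f * c) \/ (exists c, b = f * c).

Lemma irreducible_prime_poly (f : {poly int}) : f \is monic -> irreducible_poly (pZtoQ f) -> prime_poly f.
Proof.
move=> fm [fs irr] a b [c E].
have dv : pZtoQ f %| pZtoQ a * pZtoQ b by rewrite -rmorphM E rmorphM; apply: dvdp_mulr.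
have [cop|ncop] := boolP (coprimep (pZtoQ f) (pZtoQ a)).
  by right; apply: dvd_rat_dvd_int => //; rewrite -(Gauss_dvdpr _ cop).
left; apply: dvd_rat_dvd_int => //.
rewrite -(eqp_dvdl _ (irr (gcdp (pZtoQ f) (pZtoQ a)) ncop (dvdp_gcdl _ _))); exact: dvdp_gcdr.
Qed.

Lemma monic_X_prime_poly : prime_poly 'X.
Proof.
move=> a b [c E].
have : root (a * b) 0 by rewrite E rootE hornerM hornerX mul0r.
rewrite rootM => /orP[] /factor_theorem[d ->]; [left|right]; exists d; by rewrite subr0 mulrC.
Qed.

(** ['Phi_n] is the minimal polynomial of a primitive root of unity, at which one of the two factors
    must vanish. *)
Lemma cyclotomic_prime_poly n : (0 < n)%N -> prime_poly 'Phi_n.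
Proof.
move=> n0 a b [c E]; have [w pw] := C_prim_root_exists n0.
have [p [Ep pm dv]] := minCpolyP w.
have EP : p = pZtoQ 'Phi_n.
  apply: (map_inj_poly (fmorph_inj (ratr : rat -> algC)) (rmorph0 _)).
  rewrite -Ep (minCpoly_cyclotomic pw) -(Cintr_Cyclotomic pw) -map_poly_comp.
  by apply: eq_map_poly => z /=; rewrite ratr_int.
have : root (pQtoC (pZtoQ a) * pQtoC (pZtoQ b)) w.
  by rewrite -!rmorphM E dv EP rmorphM; apply: dvdp_mulr.
by rewrite rootM !dv EP => /orP[] /(dvd_rat_dvd_int (Cyclotomic_monic n)); [left|right].
Qed.

(** The roots of a factor of degree [k < q] all have [q]-th power [A]. Their product [b] is
    rational, being a quotient of coefficients up to sign, and [b^q = A^k]; as [k] is prime to [q],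
    this makes [A] a [q]-th power. *)
Lemma radical_irreducible q (A : int) : prime q -> (forall b : rat, b ^+ q != A%:~R) ->
  irreducible_poly ('X^q - (A%:~R)%:P : {poly rat}).
Proof.
move=> pq nA; have q0 := prime_gt0 pq.
have szp : size ('X^q - (A%:~R)%:P : {poly rat}) = q.+1 by rewrite size_XnsubC.
have A0 : A%:~R != 0 :> rat by have := nA 0; rewrite expr0n gtn_eqF // eq_sym.
split; first by rewrite szp ltnS.
move=> g sg dg; have p0 : 'X^q - (A%:~R)%:P != 0 :> {poly rat} by rewrite -size_poly_gt0 szp.
have g0 : g != 0 by apply: contraNneq p0 => E; move: dg; rewrite E dvd0p.
rewrite -dvdp_size_eqp //; apply: contraT => szn.
pose k := (size g).-1.
have kq : (0 < k < q)%N.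
  have := dvdp_leq p0 dg; rewrite szp /k; move: szn sg; rewrite szp.
  have : (0 < size g)%N by rewrite size_poly_gt0.
  by case: (size g) => [|[|m]] //= _ /eqP h _ h2; lia.
have [r Er] := closed_field_poly_normal (pQtoC g).
have sr : size r = k.
  have := size_map_poly (ratr : {rmorphism rat -> algC}) g; rewrite Er size_scale ?lead_coef_eq0 ?map_poly_eq0 //.
  by rewrite size_prod_XsubC /k => <-.
have rz z : z \in r -> z ^+ q = (ratr (A%:~R) : algC).
  move=> zr; have : root (pQtoC ('X^q - (A%:~R)%:P)) z.
    have /dvdpP[c ->] : pQtoC g %| pQtoC ('X^q - (A%:~R)%:P) by rewrite dvdp_map.
    by rewrite rootM Er rootZ ?lead_coef_eq0 ?map_poly_eq0 // root_prod_XsubC zr orbT.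
  by rewrite rmorphB /= map_polyXn map_polyC /= rootE !hornerE subr_eq0 => /eqP.
have [b Eb] : exists b : rat, ratr b = \prod_(z <- r) z :> algC.
  exists ((-1) ^+ k * g`_0 / lead_coef g).
  have E0 : ratr g`_0 = lead_coef (pQtoC g) * \prod_(z <- r) (- z) :> algC.
    have := congr1 (fun h : {poly algC} => h`_0) Er; rewrite coef_map /= => ->.
    rewrite coefZ; congr (_ * _); rewrite -horner_coef0 horner_prod.
    by apply: eq_bigr => z _; rewrite hornerXsubC sub0r.
  have prodN : \prod_(z <- r) (- z) = (-1) ^+ k * \prod_(z <- r) z.
    rewrite -sr; elim: (r) => [|z t IH]; first by rewrite !big_nil mulr1.
    by rewrite !big_cons IH /= exprS; ring.
  have lg : lead_coef (pQtoC g) = ratr (lead_coef g) by rewrite lead_coef_map.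
  have l0 : ratr (lead_coef g) != 0 :> algC by rewrite fmorph_eq0 lead_coef_eq0.
  rewrite !rmorphM rmorphXn rmorphN1 fmorphV /= E0 prodN lg.
  have sq : (-1) ^+ k * (-1) ^+ k = 1 :> algC by rewrite -exprMn mulrNN mulr1 expr1n.
  move: ((-1) ^+ k) (ratr (lead_coef g)) (\prod_(z <- r) z) l0 sq => e l P l0 sq.
  by rewrite -[RHS]mul1r -sq; field.
have Ebq : b ^+ q = A%:~R ^+ k.
  apply: (fmorph_inj (ratr : rat -> algC)); rewrite !rmorphXn /= Eb -prodrXl.
  by rewrite (eq_big_seq (fun=> ratr A%:~R)) // big_const_seq count_predT iter_mulr_1 sr.
have cop : coprime k q by rewrite coprime_sym prime_coprime // gtnNdvd //; case/andP: kq.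
have [k0 _] := andP kq; case: (egcdnP q k0) => s t Est _; rewrite (eqP cop) in Est.
case/eqP: (nA (b ^+ s / A%:~R ^+ t)).
rewrite expr_div_n -!exprM mulnC exprM Ebq -exprM mulnC Est exprD expr1 mulrAC mulfV ?mul1r //.
by rewrite expf_neq0.
Qed.

Lemma cyclotomic_prime q : prime q -> ('X - 1) * 'Phi_q = 'X^q - 1 :> {poly int}.
Proof.
move=> pq; have P1 : 'Phi_1 = 'X - 1 :> {poly int}.
  by have := prod_Cyclotomic (ltn0Sn 0); rewrite big_cons big_nil mulr1 expr1.
rewrite -(prod_Cyclotomic (prime_gt0 pq)) (perm_big [:: 1%N; q]) /=.
  by rewrite !big_cons big_nil mulr1 P1.
apply: uniq_perm; rewrite ?divisors_uniq //=; first by rewrite inE neq_ltn prime_gt1.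
move=> d; rewrite -dvdn_divisors ?prime_gt0 // !inE.
apply/idP/idP => [dq|/orP[/eqP->|/eqP->]]; [|exact: dvd1n|exact: dvdnn].
by have /primeP[_ /(_ d dq)] := pq.
Qed.

(** Differentiate [('X - 1) 'Phi_q = 'X^q - 1], multiply by ['X], and subtract [q] times the
    original equation. *)
Lemma cyclotomic_bezout q : prime q ->
  q%:R = ('X - q%:R * ('X - 1)) * 'Phi_q + 'X * ('X - 1) * ('Phi_q)^`() :> {poly int}.
Proof.
move=> pq; have E := cyclotomic_prime pq; have := congr1 (@deriv int) E.
have d1 : (1 : {poly int})^`() = 0 by rewrite -polyC1 derivC.
rewrite derivM !derivB derivX derivXn d1 !subr0 mul1r => E'.
have Eq : 'X^q = 'X * ('X^(q.-1)) :> {poly int} by rewrite -exprS prednK // prime_gt0.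
transitivity ('X * ('Phi_q + ('X - 1) * ('Phi_q)^`()) - q%:R * (('X - 1) * 'Phi_q)); last by ring.
by rewrite E' E Eq -[_ *+ q]mulr_natl; ring.
Qed.

(** For [f = 'X^q - A], the product of ['X] with the derivative minus [q f] is [q A]; the factor [s]
    corrects the sign of [A]. *)
Lemma radical_bezout q (A : int) : (0 < q)%N -> exists u v : {poly int},
  (q * `|A|)%N%:R = u * ('X^q - A%:P) + v * ('X^q - A%:P)^`().
Proof.
move=> q0; pose s : {poly int} := (sgz A)%:P.
exists (- (q%:R * s)), (s * 'X).
rewrite derivB derivXn derivC subr0 -[_ *+ q]mulr_natl.
have -> : (q * `|A|)%N%:R = q%:R * s * A%:P :> {poly int}.
  have -> : (q * `|A|)%N%:R = q%:R * (Posz (absz A))%:P :> {poly int} by rewrite natrM -[Posz _]natz polyC_natr.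
  by rewrite /s -mulrA -polyCM -abszEsg.
have Eq : 'X^q = 'X * ('X^(q.-1)) :> {poly int} by rewrite -exprS prednK.
by rewrite Eq; ring.
Qed.

End PrimePolynomials.

(** * Lower densities of weighted primes *)

Section Densities.
Variable R : realType.
Implicit Types (r s : nat -> R) (c d x : R).

(** Weights may have either sign, which allows densities to be subtracted as well as added. *)
Definition density_ge r c := forall eps, 0 < eps -> exists x0, forall x, x0 <= x -> (c - eps) * x <= ln x * sum_primes r x.

Lemma ln_little_o (K eps : R) : 0 <= K -> 0 < eps -> exists x0, 1 <= x0 /\ forall x, x0 <= x -> K * ln x <= eps * x.
Proof.
move=> K0 e0; have h : (2^-1 : R) < 1 by lra.
have [x0 [x01 H]] := powR_little_o (K * 2) h e0.
exists x0; split => // x xx; apply: le_trans (H x xx).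
have i2 : 0 < (2^-1 : R) by rewrite invr_gt0.
have x1 : 1 <= x by apply: le_trans xx.
have := ln_le_powR i2 x1; rewrite invrK => hl.
by rewrite -mulrA; apply: ler_wpM2l => //; apply: le_trans hl _; rewrite mulrC.
Qed.

Lemma sum_primesD r s x : sum_primes (fun p => r p + s p) x = sum_primes r x + sum_primes s x.
Proof. by rewrite /sum_primes /sumR /sumN -big_split /=; apply: eq_bigr => n _; case: ifP; rewrite ?addr0. Qed.

Lemma sum_primesZ c r x : sum_primes (fun p => c * r p) x = c * sum_primes r x.
Proof. by rewrite /sum_primes /sumR /sumN mulr_sumr; apply: eq_bigr => n _; case: ifP; rewrite ?mulr0. Qed.

Lemma sum_primes_le r s x : (forall p, prime p -> r p <= s p) -> sum_primes r x <= sum_primes s x.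
Proof. by move=> h; apply: ler_sum => n _; case: ifP => // /h. Qed.

Lemma sum_primes_small (B : nat) x : sum_primes (fun p => (p <= B)%N%:R) x <= B%:R.
Proof.
rewrite /sum_primes /sumR /sumN.
apply: le_trans (_ : \sum_(1 <= n < (Num.truncn x).+1) (n <= B)%N%:R <= _).
  by apply: ler_sum => n _; case: ifP.
rewrite -natr_sum ler_nat; apply: leq_trans (_ : \sum_(1 <= n < B.+1) 1 <= _)%N; last first.
  by rewrite sum_nat_const_nat subn1 muln1.
rewrite big_mkcond /= [X in (_ <= X)%N](_ : _ = \sum_(1 <= n < B.+1) (n <= B)%N)%N; last first.
  by apply: eq_big_nat => n /andP[_]; rewrite ltnS => ->.
have [h|h] := leqP (Num.truncn x) B.
  rewrite [X in (_ <= X)%N](@big_cat_nat _ _ _ (Num.truncn x).+1) //= leq_addr //.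
rewrite (@big_cat_nat _ _ _ B.+1) //=; last by rewrite ltnS ltnW.
rewrite [X in (_ + X)%N]big_nat_cond [X in (_ + X)%N]big1 ?addn0 // => n /andP[/andP[hn _] _].
by rewrite leqNgt hn.
Qed.

(** The primes up to [B] contribute at most [K B] in all, and [ln x] times that is negligible
    against [x]. *)
Lemma density_dom r s c (K : R) (B : nat) : 0 <= K -> density_ge r c ->
  (forall p, prime p -> r p <= s p + K * (p <= B)%N%:R) -> density_ge s c.
Proof.
move=> K0 hr hs eps e0; have e2 : 0 < eps / 2 by lra.
have [x1 H1] := hr _ e2; have [x2 [x21 H2]] := ln_little_o (mulr_ge0 K0 (ler0n R B)) e2.
exists (Num.max x1 x2) => x; rewrite ge_max => /andP[h1 h2].
have lx : 0 <= ln x by rewrite ln_ge0 // (le_trans x21).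
have := H1 x h1; have := H2 x h2 => g2 g1.
have h : sum_primes r x <= sum_primes s x + K * B%:R.
  apply: le_trans (sum_primes_le _ hs) _; rewrite sum_primesD sum_primesZ lerD2l ler_wpM2l //.
  exact: sum_primes_small.
have := ler_wpM2l lx h; rewrite mulrDr => h'.
by clear -g1 g2 h'; lra.
Qed.

Lemma density_add r s c d : density_ge r c -> density_ge s d -> density_ge (fun p => r p + s p) (c + d).
Proof.
move=> hr hs eps e0; have e2 : 0 < eps / 2 by lra.
have [x1 H1] := hr _ e2; have [x2 H2] := hs _ e2.
exists (Num.max x1 x2) => x; rewrite ge_max => /andP[h1 h2].
rewrite sum_primesD mulrDr; have := H1 x h1; have := H2 x h2; lra.
Qed.

Lemma density_scale r k c : 0 < k -> density_ge (fun p => k * r p) c -> density_ge r (c / k).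
Proof.
move=> k0 h eps e0; have [x0 H] := h (k * eps) (mulr_gt0 k0 e0).
exists x0 => x /H; rewrite sum_primesZ mulrCA -ler_pdivrMl // => h'.
by apply: le_trans h'; rewrite le_eqVlt; apply/orP; left; apply/eqP; field; rewrite gt_eqF.
Qed.

(* The weight [-1] turns the upper bound for the number of primes into a lower bound. *)
Lemma density_neg1 : density_ge (fun=> -1) (-1).
Proof.
have d2 : 2%:R = 0 * 'X + 2%:R * ('X : {poly int})^`() by rewrite derivX mul0r add0r mulr1.
have sX : (1 < size ('X : {poly int}))%N by rewrite size_polyX.
have mX : ('X : {poly int}) \is monic by apply: monicX.
pose O := {poly %/ ('X : {poly int})}.
have [L] := qpoly_lattice mX sX monic_X_prime_poly.
have ixn := order_index_natr L.
have inv := monogenic_prime_inverse (@qpoly_surj ('X : {poly int})) (qpoly_ker mX sX) mX d2.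
have hpsi := @prime_ideal_theorem R O _ 2 L isT (qpoly_domain mX sX monic_X_prime_poly) inv.
(* [D = 2] removes the ideals over 2, so the prime 2 is put back by hand. *)
pose Lam m : R := ideal_mangoldt R O 2 m + (m == 2%N)%:R * ln 2.
have l2 : 0 <= ln 2 :> R by rewrite ln_ge0 // ler1n.
have Lam0 m : 0 <= Lam m by rewrite addr_ge0 ?mulr_ge0 // (ideal_mangoldt_ge0 R 2 ixn).
move=> eps e0; have [||x0 H] := @prime_count_upper R Lam Lam0 _ _ eps e0.
- move=> p pp; rewrite /Lam; have [->|p2] := eqVneq p 2%N.
    by rewrite mul1r lerDr (ideal_mangoldt_ge0 R 2 ixn).
  rewrite mul0r addr0 (ideal_mangoldt_prime R mX sX monic_X_prime_poly d2) //.
  apply: ler_peMl; first by rewrite ln_ge0 // ler1n prime_gt0.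
  by apply: (@ideal_count_linear R _ 2 mX sX monic_X_prime_poly p); rewrite ?size_polyX // dvdn_prime2.
- move=> eps' e'0; have e2 : 0 < eps' / 2 by lra.
  have [x1 H1] := hpsi _ e2.
  exists (Num.max x1 (Num.max 0 (ln 2 * 2 / eps'))) => x; rewrite !ge_max => /andP[h1 /andP[h2 h3]].
  have E : sumR Lam x = sumR (ideal_mangoldt R O 2) x + sumR (fun m => (m == 2%N)%:R * ln 2) x.
    by rewrite /sumR /sumN -big_split.
  have b : 0 <= sumR (fun m => (m == 2%N)%:R * ln 2 : R) x <= ln 2.
    rewrite /sumR /sumN -mulr_suml -natr_sum mulr_ge0 //= ler_piMl // lern1.
    have [h|h] := boolP (2%N \in index_iota 1 (Num.truncn x).+1).
      by rewrite (bigD1_seq 2%N h (iota_uniq _ _)) /= big1 // => i /negbTE ->.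
    rewrite big_seq big1 // => i hi; case: eqP => // E2; by rewrite -E2 hi in h.
  have h4 : ln 2 <= eps' / 2 * x.
    by move: h3; rewrite ler_pdivrMr // mulrC => h3; lra.
  have := H1 x h1; rewrite E; move: b; move: (sumR _ x) (sumR _ x) => u w /andP[b1 b2].
  by rewrite !ler_norml => /andP[c1 c2]; apply/andP; split; lra.
exists x0 => x /H h.
have -> : sum_primes (fun=> -1) x = - sum_primes (fun=> 1 : R) x.
  by rewrite /sum_primes /sumR /sumN -sumrN; apply: eq_bigr => n _; case: ifP; rewrite ?oppr0.
by rewrite mulrN; lra.
Qed.


Lemma root_count_size (p : nat) (f : {poly int}) : f \is monic -> (root_count p f <= (size f).-1)%N.
Proof.
move=> fm; have sz : size (map_poly (fun z : int => z%:~R : 'F_p) f) = size f.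
  by rewrite size_map_poly_id0 // (monicP fm) rmorph1 oner_neq0.
have s0 : (0 < size f)%N by rewrite size_poly_gt0 monic_neq0.
rewrite /root_count cardE -ltnS prednK // -sz; apply: max_poly_roots; rewrite ?enum_uniq //.
  by rewrite -size_poly_gt0 sz.
by apply/allP => t; rewrite mem_enum inE.
Qed.

Lemma fermat_Fp (p : nat) (t : 'F_p) : prime p -> t != 0 -> t ^+ p.-1 = 1.
Proof.
move=> pp t0; apply: (mulfI t0); rewrite mulr1 -exprS prednK ?prime_gt0 //.
by have := expf_card t; rewrite card_Fp.
Qed.

Lemma coprime_root1 (F : fieldType) (t : F) i j : (0 < i)%N -> coprime i j -> t ^+ i = 1 -> t ^+ j = 1 -> t = 1.
Proof.
move=> i0 cij ti tj; case: (egcdnP j i0) => u w E _; rewrite (eqP cij) in E.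
have : t ^+ (u * i) = t ^+ (w * j + 1) by rewrite E.
by rewrite exprD expr1 mulnC exprM ti expr1n mulnC exprM tj expr1n mul1r.
Qed.

(** For [p > q] a root [t] satisfies [t^q = 1] and [t^(p-1) = 1]. If [q] does not divide [p - 1]
    then [t = 1], where the identity of [cyclotomic_bezout] reads [q = 0] modulo [p]. *)
Lemma root_count_cyclotomic (p q : nat) : prime p -> prime q ->
  (root_count p 'Phi_q <= q.-1 * (q %| p.-1) + q.-1 * (p <= q))%N.
Proof.
move=> pp pq; have szq : (root_count p 'Phi_q <= q.-1)%N.
  by have := root_count_size p (Cyclotomic_monic q); rewrite size_Cyclotomic totient_prime.
have [pq'|qp] := leqP p q; first by rewrite muln1 (leq_trans szq) // leq_addl.
have [dv|ndv] := boolP (q %| p.-1)%N; first by rewrite muln1 (leq_trans szq) // leq_addr.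
rewrite /= !muln0 addn0 leqn0; apply/eqP/eq_card0 => t; rewrite inE /=; apply/negbTE/negP => rt.
have q0 : q%:R != 0 :> 'F_p by rewrite -(dvdn_pcharf (pchar_Fp pp)) dvdn_prime2 // gtn_eqF.
have E := congr1 (fun f => (map_poly (fun z : int => z%:~R : 'F_p) f).[t]) (cyclotomic_prime pq).
move: E; rewrite /= rmorphM rmorphB rmorphB /= rmorph1 map_polyX map_polyXn !hornerE (eqP rt) mulr0.
move=> /esym/eqP; rewrite subr_eq0 => /eqP tq.
have t0 : t != 0 by apply: contra_eq_neq tq => ->; rewrite expr0n gtn_eqF ?prime_gt0 // eq_sym oner_neq0.
have t1 : t = 1.
  apply: (coprime_root1 (prime_gt0 pq) _ tq (fermat_Fp pp t0)).
  by rewrite prime_coprime.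
have E := congr1 (fun f => (map_poly (fun z : int => z%:~R : 'F_p) f).[t]) (cyclotomic_bezout pq).
move: E; rewrite /= rmorphD !rmorphM rmorph_nat hornerD !hornerM (eqP rt) mulr0 add0r t1.
have -> : (map_poly (fun z : int => z%:~R : 'F_p) ('X - 1)).[1] = 0.
  by rewrite rmorphB /= rmorph1 map_polyX !hornerE subrr.
by rewrite mulr0 mul0r -polyC_natr hornerC => /eqP; rewrite (negbTE q0).
Qed.

(** The roots of ['Phi_q] number at least 1 on average, but at most [q - 1] at a prime 1 modulo [q]
    and none at the others above [q]. *)
Lemma density_cyclotomic q : prime q -> density_ge (fun p => (q %| p.-1)%N%:R) ((q.-1)%:R^-1).
Proof.
move=> pq; have q1 := prime_gt1 pq.
have q10 : 0 < (q.-1)%:R :> R by rewrite ltr0n -subn1 subn_gt0.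
rewrite -[_^-1]mul1r; apply: density_scale => //.
apply: (density_dom (r := fun p => (root_count p 'Phi_q)%:R) (B := q) (K := (q.-1)%:R)) => //; last first.
  move=> p pp; rewrite -!natrM -natrD ler_nat; exact: root_count_cyclotomic.
have sz : (1 < size 'Phi_q)%N by rewrite size_Cyclotomic totient_prime // ltnS -subn1 subn_gt0.
exact: (root_count_lower (Cyclotomic_monic q) sz (cyclotomic_prime_poly (prime_gt0 pq)) (cyclotomic_bezout pq) q1).
Qed.

End Densities.

(** * Density of the primes whose index is divisible by q *)

Section Hits.
Implicit Types (a b : rat) (p q : nat).

Definition hit a q p : bool := (nu p a == 0) && (q %| p.-1 %/ ordp p a)%N.

(** A prime above this bound divides neither the numerator nor the denominator. *)
Definition height a := (`|numq a| + `|denq a|)%N.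

Lemma absz_Fp_neq0 p (z : int) : prime p -> z != 0 -> (`|z| < p)%N -> z%:~R != 0 :> 'F_p.
Proof. by move=> pp z0 h; rewrite intr_Fp_eq0 // gtnNdvd // absz_gt0. Qed.

Section LargePrime.
Variables (a : rat) (p : nat).
Hypotheses (a0 : a != 0) (pp : prime p) (hp : (height a < p)%N).

Lemma num_Fp : (numq a)%:~R != 0 :> 'F_p.
Proof. by apply: absz_Fp_neq0; rewrite ?numq_eq0 //; move: hp; rewrite /height; lia. Qed.

Lemma den_Fp : (denq a)%:~R != 0 :> 'F_p.
Proof. by apply: absz_Fp_neq0; rewrite ?denq_neq0 //; move: hp; rewrite /height; lia. Qed.

Lemma nu_large : nu p a = 0.
Proof.
have h (z : int) : z%:~R != 0 :> 'F_p -> logn p `|z|%N = 0%N.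
  by rewrite intr_Fp_eq0 // -prime_coprime // => /logn_coprime.
by rewrite /nu !h ?subrr ?num_Fp ?den_Fp.
Qed.

Lemma modp_neq0 : modp_rat p a != 0.
Proof. by rewrite /modp_rat mulf_neq0 ?invr_eq0 ?num_Fp ?den_Fp. Qed.

Lemma ordp_dvd k : modp_rat p a ^+ k = 1 -> (ordp p a %| k)%N.
Proof.
move=> h; rewrite /ordp order_dvdn -val_eqE FinRing.val_unitX FinRing.val_unit1.
by rewrite insubdK ?h // unitfE modp_neq0.
Qed.

Lemma ordp_dvd_pred : (ordp p a %| p.-1)%N.
Proof. by apply: ordp_dvd; apply: fermat_Fp => //; apply: modp_neq0. Qed.

(** If [p - 1 = m q] then [a^m = t^(p-1) = 1] modulo [p], so the order of [a] divides [m]. *)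
Lemma hit_of_root q (t : 'F_p) : prime q -> (q %| p.-1)%N -> modp_rat p a = t ^+ q -> hit a q p.
Proof.
move=> pq /dvdnP[m Em] Et; rewrite /hit nu_large eqxx /=.
have t0 : t != 0 by apply: contraNneq modp_neq0 => t0; rewrite Et t0 expr0n gtn_eqF // prime_gt0.
have /dvdnP[c Ec] : (ordp p a %| m)%N.
  by apply: ordp_dvd; rewrite Et -exprM mulnC -Em fermat_Fp.
have p1 := prime_gt1 pp.
have o0 : (0 < ordp p a)%N by apply: dvdn_gt0 ordp_dvd_pred; rewrite -subn1 subn_gt0.
by rewrite Em Ec mulnAC mulnK // dvdn_mull.
Qed.

End LargePrime.

Lemma hit_power a b q p : a != 0 -> a = b ^+ q -> prime q -> prime p -> (height a + height b < p)%N ->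
  (q %| p.-1)%N -> hit a q p.
Proof.
move=> a0 Ea pq pp hp dv; have ha : (height a < p)%N by apply: leq_ltn_trans hp; apply: leq_addr.
have hb : (height b < p)%N by apply: leq_ltn_trans hp; apply: leq_addl.
have b0 : b != 0 by apply: contraNneq a0 => E; rewrite Ea E expr0n gtn_eqF // prime_gt0.
apply: (hit_of_root a0 pp ha (t := modp_rat p b)) => //.
have E : numq a * denq b ^+ q = numq b ^+ q * denq a.
  apply: (@intr_inj rat); rewrite !rmorphM !rmorphXn /=.
  have da : (denq a)%:~R != 0 :> rat by rewrite intr_eq0 denq_neq0.
  have db : (denq b)%:~R ^+ q != 0 :> rat by rewrite expf_neq0 // intr_eq0 denq_neq0.
  by apply/eqP; rewrite -eqr_div // -expr_div_n !divq_num_den Ea.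
have Ep := congr1 (fun z : int => z%:~R : 'F_p) E; rewrite /= !rmorphM !rmorphXn /= in Ep.
have da := den_Fp a0 pp ha; have db := den_Fp b0 pp hb.
rewrite /modp_rat expr_div_n; apply/eqP; rewrite eqr_div ?expf_neq0 //; apply/eqP.
by rewrite Ep.
Qed.

(* An integer with the same [q]-th power residue behaviour as [a]. *)
Definition radicand a q : int := numq a * denq a ^+ q.-1.

Lemma radicand_power a b q : prime q -> b ^+ q = (radicand a q)%:~R -> a = (b / (denq a)%:~R) ^+ q.
Proof.
move=> pq E; have d0 : (denq a)%:~R != 0 :> rat by rewrite intr_eq0 denq_neq0.
rewrite expr_div_n E rmorphM rmorphXn /= -{1}(divq_num_den a).
have -> : (denq a)%:~R ^+ q = (denq a)%:~R * (denq a)%:~R ^+ q.-1 :> rat by rewrite -exprS prednK // prime_gt0.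
by move: (_ ^+ q.-1) (expf_neq0 q.-1 d0) => e e0; field; rewrite ?d0 ?e0.
Qed.

(** If [q] divides [p - 1], a root forces [hit], and there are at most [q] of them. Otherwise the
    [q]-th power map is injective modulo [p], which leaves at most one root. *)
Lemma root_count_radical a q p : a != 0 -> prime q -> prime p -> (height a < p)%N ->
  (root_count p ('X^q - (radicand a q)%:P) <= q * hit a q p + (1 - (q %| p.-1)))%N.
Proof.
move=> a0 pq pp ha; have q0 := prime_gt0 pq.
have d0 := den_Fp a0 pp ha; have n0 := num_Fp a0 pp ha.
have rootE' (t : 'F_p) : root (map_poly (fun z : int => z%:~R) ('X^q - (radicand a q)%:P)) t =
    (t ^+ q == (radicand a q)%:~R).
  by rewrite rmorphB /= map_polyXn map_polyC /= rootE !hornerE subr_eq0.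
have A0 : (radicand a q)%:~R != 0 :> 'F_p by rewrite rmorphM rmorphXn /= mulf_neq0 ?expf_neq0.
have [dv|ndv] := boolP (q %| p.-1)%N.
  rewrite subnn addn0 /root_count.
  have [->//|/card_gt0P[t]] := posnP #|[pred t : 'F_p | root (map_poly (fun z : int => z%:~R) ('X^q - (radicand a q)%:P)) t]|.
  rewrite inE /= rootE' => /eqP Et.
  have -> : hit a q p.
    apply: (hit_of_root a0 pp ha (t := t / (denq a)%:~R)) => //.
    rewrite expr_div_n Et rmorphM rmorphXn /= /modp_rat.
    have -> : (denq a)%:~R ^+ q = (denq a)%:~R * (denq a)%:~R ^+ q.-1 :> 'F_p by rewrite -exprS prednK.
    by move: (_ ^+ q.-1) (expf_neq0 q.-1 d0) => e e0; field; rewrite ?d0 ?e0.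
  rewrite muln1; have mon : ('X^q - (radicand a q)%:P : {poly int}) \is monic by apply: monicXnsubC.
  by have := root_count_size p mon; rewrite size_XnsubC.
rewrite subn0 -[X in (X <= _)%N]add0n leq_add // /root_count; apply/card_le1P => t; rewrite inE rootE' => /eqP Et s.
rewrite !inE rootE'; apply/idP/idP => [/eqP Es|/eqP ->]; last by rewrite Et.
have t0 : t != 0 by apply: contraNneq A0 => E; rewrite -Et E expr0n gtn_eqF.
have s0 : s != 0 by apply: contraNneq A0 => E; rewrite -Es E expr0n gtn_eqF.
have : s / t = 1.
  apply: (coprime_root1 q0 (_ : coprime q p.-1)); first by rewrite prime_coprime.
    by rewrite expr_div_n Et Es divff.
  by rewrite expr_div_n !fermat_Fp // divr1.
by move=> /(congr1 (fun z => z * t)); rewrite divfK // mul1r => ->.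
Qed.

Variable R : realType.

Lemma density_hit_power a b q : prime q -> a != 0 -> a = b ^+ q ->
  density_ge (fun p => (hit a q p)%:R : R) (q.-1)%:R^-1.
Proof.
move=> pq a0 Ea; have := @density_cyclotomic R q pq.
move=> h; apply: (density_dom (B := height a + height b) ler01 h) => p pp.
rewrite mul1r -natrD ler_nat; case: (leqP p) => hp; first by rewrite addn1 (leq_trans (leq_b1 _)).
by rewrite addn0; case: (boolP (q %| p.-1)%N) => // dv; rewrite (hit_power a0 Ea).
Qed.

(** Three densities are added: 1 for the roots, [-1] for all primes, and [1/(q-1)] for the primes 1
    modulo [q]. By [root_count_radical] the sum of these weights is at most [q] times [hit] beyond
    [height a]. *)
Lemma density_hit a q : prime q -> a != 0 -> (forall b, a != b ^+ q) ->
  density_ge (fun p => (hit a q p)%:R : R) (q * q.-1)%:R^-1.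
Proof.
move=> pq a0 nA; have q0 := prime_gt0 pq; have q1 := prime_gt1 pq.
have nA' (b : rat) : b ^+ q != (radicand a q)%:~R.
  by apply/eqP => /(radicand_power pq) E; have := nA (b / (denq a)%:~R); rewrite -E eqxx.
have mon : ('X^q - (radicand a q)%:P : {poly int}) \is monic by apply: monicXnsubC.
have sz : (1 < size ('X^q - (radicand a q)%:P : {poly int})%R)%N by rewrite size_XnsubC.
have [u [v Euv]] := radical_bezout (radicand a q) q0.
have D1 : (1 < q * `|radicand a q|)%N.
  have : (0 < `|radicand a q|)%N by rewrite absz_gt0 mulf_neq0 ?numq_eq0 ?expf_neq0 ?denq_neq0.
  by move: q1; nia.
have irr : irreducible_poly (map_poly (intr : int -> rat) ('X^q - (radicand a q)%:P)).
  by rewrite rmorphB /= map_polyXn map_polyC; apply: radical_irreducible.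
have h1 : density_ge (fun p => (root_count p ('X^q - (radicand a q)%:P))%:R : R) 1 := @root_count_lower R _ _ _ _ mon sz (irreducible_prime_poly mon irr) Euv D1.
have h2 := density_add (density_add h1 (@density_neg1 R)) (@density_cyclotomic R q pq).
have -> : (q * q.-1)%:R^-1 = (1 + -1 + q.-1%:R^-1) / q%:R :> R.
  by rewrite natrM invfM subrr add0r mulrC.
apply: density_scale; first by rewrite ltr0n.
apply: (density_dom (B := height a) (K := (q + 1)%:R) _ h2) => // p pp.
have m1 : (q %| p.-1)%N%:R <= 1 :> R by rewrite lern1 leq_b1.
case: (leqP p) => hp.
  rewrite mulr1 natrD; have r1 : (root_count p ('X^q - (radicand a q)%:P))%:R <= q%:R :> R.
    by rewrite ler_nat; have := root_count_size p mon; rewrite size_XnsubC.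
  have r2 : 0 <= q%:R * (hit a q p)%:R :> R by rewrite mulr_ge0.
  by clear -m1 r1 r2; lra.
have := root_count_radical a0 pq pp hp; rewrite -(ler_nat R) natrD natrM natrB ?leq_b1 //.
by rewrite mulr0 addr0 => r1; clear -r1; lra.
Qed.

End Hits.

(** * The mean of [omega] of the index *)

Section MeanIndex.
Variables (R : realType) (a : rat).
Hypothesis a0 : a != 0.
Implicit Types (x : R).

Lemma sum_primes_ord (r : nat -> R) x : 0 <= x ->
  sum_primes r x = \sum_(p < (Num.truncn x).+1 | prime p && ((p : nat)%:R <= x)) r p.
Proof.
move=> x0; rewrite /sum_primes /sumR /sumN -(big_mkord (fun p : nat => prime p && (p%:R <= x)) r).
rewrite [RHS]big_mkcond [RHS]big_ltn //= add0r; apply: eq_big_nat => p /andP[_ hp].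
have -> : p%:R <= x.
  by apply: le_trans (_ : (Num.truncn x)%:R <= _); [rewrite ler_nat -ltnS|rewrite truncn_le].
by rewrite andbT.
Qed.

Lemma primepi_sum x : 0 <= x -> (primepi x)%:R = sum_primes (fun=> 1) x :> R.
Proof.
move=> x0; rewrite sum_primes_ord // sumr_const /primepi; congr (_%:R).
by rewrite cardsE.
Qed.

Definition index_sum x : R :=
  \sum_(p < (Num.truncn x).+1 | [&& prime p, (p : nat)%:R <= x & nu p a == 0]) (omega_index a p)%:R.

(** For a given [x] only finitely many [n] occur, so the partial sums of the series are eventually
    constant. *)
Lemma mean_DomE x : mean_Dom a x = index_sum x / (primepi x)%:R.
Proof.
pose N0 := (\max_(p < (Num.truncn x).+1) omega_index a p).+1.
have key N : (N0 <= N)%N -> \sum_(0 <= n < N) n%:R * Dom a n x = index_sum x / (primepi x)%:R.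
  move=> hN; rewrite /Dom /index_sum mulr_suml.
  transitivity (\sum_(0 <= n < N) \sum_(p < (Num.truncn x).+1 | [&& prime p, (p : nat)%:R <= x & nu p a == 0])
      (omega_index a p == n)%:R * (n%:R / (primepi x)%:R) : R).
    apply: eq_bigr => n _; rewrite -mulr_suml mulrCA; congr (_ * _).
    rewrite -sum1_card natr_sum big_mkcond [RHS]big_mkcond /=; apply: eq_bigr => p _.
    by rewrite inE; case: (prime p) => //=; case: (_ <= _) => //=; case: (_ == _) => //=; case: (_ == _).
  rewrite exchange_big /=; apply: eq_bigr => p _.
  have hp : omega_index a p \in index_iota 0 N.
    by rewrite mem_index_iota /=; apply: leq_trans hN; rewrite ltnS; apply: (leq_bigmax p).
  rewrite (bigD1_seq _ hp (iota_uniq _ _)) /= eqxx mul1r big1 ?addr0 // => n nn.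
  by rewrite eq_sym (negbTE nn) mul0r.
rewrite /mean_Dom; apply: lim_near_cst => //.
by exists N0 => // N /= hN; apply: key.
Qed.

(** Primes up to [height a] are left out because there the reduction of [a] may fail to be a unit,
    and [ordp] then takes a default value. *)
Definition big_hit (S : seq nat) (p : nat) : R := \sum_(q <- S) (hit a q p && (height a < p)%N)%:R.

Lemma big_hit_le S p : uniq S -> all prime S -> prime p -> big_hit S p <= (nu p a == 0)%:R * (omega_index a p)%:R.
Proof.
move=> uS /allP pS pp; rewrite /big_hit -natr_sum -natrM ler_nat.
have [hp|hp] := leqP p (height a).
  by rewrite big1 // => q _; rewrite andbF.
rewrite (nu_large a0 pp hp) eqxx mul1n /omega_index /omega.
have m0 : (0 < p.-1 %/ ordp p a)%N.
  have o := ordp_dvd_pred a0 pp hp; have p1 := prime_gt1 pp.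
  have q0 : (0 < p.-1)%N by rewrite -subn1 subn_gt0.
  by rewrite divn_gt0 ?(dvdn_gt0 q0 o) // dvdn_leq.
have -> : (\sum_(q <- S) (hit a q p && true) = size [seq q <- S | hit a q p])%N.
  by rewrite -sum1_size big_filter [RHS]big_mkcond; apply: eq_bigr => q _; rewrite andbT; case: (hit a q p).
apply: uniq_leq_size; first exact: filter_uniq.
move=> q; rewrite mem_filter => /andP[/andP[_ dv] qS].
by rewrite mem_primes m0 dv pS.
Qed.

Lemma index_sum_ge S x : uniq S -> all prime S -> 0 <= x -> sum_primes (big_hit S) x <= index_sum x.
Proof.
move=> uS pS x0; rewrite sum_primes_ord // /index_sum big_mkcond [X in _ <= X]big_mkcond /=.
apply: ler_sum => p _; case: (boolP (prime p)) => //= pp; case: (boolP ((p : nat)%:R <= x)) => //= _.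
by apply: le_trans (big_hit_le uS pS pp) _; case: (nu p a == 0); rewrite ?mul1r ?mul0r.
Qed.

Lemma density_big_hit S (d : nat -> R) : all prime S ->
  (forall q, prime q -> density_ge (fun p => (hit a q p)%:R : R) (d q)) ->
  density_ge (big_hit S) (\sum_(q <- S) d q).
Proof.
move=> pS hd; elim: S pS => [_|q S IH /= /andP[pq pS]].
  move=> eps e0; exists 0 => x x0; rewrite big_nil sub0r.
  have -> : sum_primes (big_hit [::]) x = 0.
    by rewrite /sum_primes /sumR /sumN big1 // => n _; rewrite /big_hit big_nil; case: ifP.
  by rewrite mulr0 mulNr oppr_le0 mulr_ge0 // ltW.
rewrite big_cons.
have hq : density_ge (fun p => (hit a q p && (height a < p)%N)%:R : R) (d q).
  apply: (density_dom (B := height a) ler01 (hd q pq)) => p _; rewrite mul1r -natrD ler_nat.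
  by rewrite ltnNge; case: (hit a q p); case: (p <= height a)%N.
have h := density_add hq (IH pS).
apply: (density_dom (B := 0) (lexx 0) h) => p _.
by rewrite mul0r addr0 /big_hit big_cons.
Qed.

Lemma mean_Dom_eventually S (d : nat -> R) (eps : R) : uniq S -> all prime S -> 0 < eps ->
  (forall q, 0 <= d q) ->
  (forall q, prime q -> density_ge (fun p => (hit a q p)%:R : R) (d q)) ->
  exists x0, forall x, x0 <= x -> \sum_(q <- S) d q - eps <= mean_Dom a x.
Proof.
move=> uS pS e0 d0 hd; set T := \sum_(q <- S) d q.
have T0 : 0 <= T by apply: sumr_ge0.
(* Ensures [(T - eps) (1 + e1) <= T - e1], which compares the upper bound for the primes with the
   lower bound for the hits. *)
pose e1 := Num.min 1 (eps / (T + 1 + 1)).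
have den : 0 < T + 1 + 1 by lra.
have e10 : 0 < e1 by rewrite lt_min ltr01 divr_gt0.
have e11 : e1 * (T + 1 + 1) <= eps.
  by rewrite -ler_pdivlMr // /e1 ge_min lexx orbT.
have [x1 H1] := density_big_hit pS hd e10.
have [x2 H2] := @density_neg1 R _ e10.
exists (Num.max (Num.max x1 x2) 3) => x; rewrite !ge_max => /andP[/andP[h1 h2] h3].
have x0 : 0 < x by lra.
have l0 : 0 < ln x by rewrite ln_gt0 //; lra.
rewrite mean_DomE; have g1 := H1 x h1; have g2 := H2 x h2.
have -> : (primepi x)%:R = sum_primes (fun=> 1) x :> R by rewrite primepi_sum // ltW.
have E : sum_primes (fun=> -1) x = - sum_primes (fun=> 1 : R) x.
  by rewrite -[in RHS]mulN1r -sum_primesZ; rewrite /sum_primes /sumR /sumN; apply: eq_bigr => n _; rewrite mulr1.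
rewrite E in g2; have g3 := index_sum_ge uS pS (ltW x0).
have pi0 : 0 < sum_primes (fun=> 1 : R) x.
  rewrite -primepi_sum ?ltr0n ?(ltW x0) //; apply/card_gt0P.
  have t2 : (2 < (Num.truncn x).+1)%N by rewrite ltnS truncn_ge_nat ?(ltW x0) //; lra.
  exists (Ordinal t2); rewrite inE /=; lra.
rewrite ler_pdivlMr //; have [c|c] := leP (T - eps) 0.
  apply: (@le_trans _ _ 0); first by rewrite mulr_le0_ge0 // ltW.
  by rewrite /index_sum sumr_ge0.
rewrite -(ler_pM2l l0).
apply: le_trans (_ : ln x * sum_primes (big_hit S) x <= _); last by rewrite ler_pM2l.
apply: le_trans g1; set P := sum_primes _ _ in g2 pi0 *.
have g4 : ln x * P <= (1 + e1) * x by lra.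
have ee : 0 < eps * e1 by rewrite mulr_gt0.
rewrite mulrCA -/T; apply: le_trans (ler_wpM2l (ltW c) g4) _; rewrite mulrA ler_pM2r //; lra.
Qed.

Lemma liminf_mean_Dom S (d : nat -> R) : uniq S -> all prime S ->
  (forall q, 0 <= d q) ->
  (forall q, prime q -> density_ge (fun p => (hit a q p)%:R : R) (d q)) ->
  ((\sum_(q <- S) d q)%:E <= limf_einf (fun x : R => (mean_Dom a x)%:E) +oo%R)%E.
Proof.
move=> uS pS d0 hd; apply/lee_addgt0Pr => eps e0.
have [x0 H] := mean_Dom_eventually uS pS e0 d0 hd.
rewrite -leeBlDr // -EFinB limf_einfE.
apply: (@le_trans _ _ (ereal_inf [set (mean_Dom a x)%:E | x in [set y | x0 < y]%classic]%classic)).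
  apply: le_ereal_inf_tmp => _ [x /= hx <-]; rewrite lee_fin; apply: H; exact: ltW.
apply: ereal_sup_ubound; exists [set y | x0 < y]%classic => //.
by exists x0; split => //; exact: num_real.
Qed.

End MeanIndex.

(** * Derivatives at 1 *)

Section DerivativesAtOne.
Variable R : realType.
Implicit Types (h : nat) (z : R).

(** All factors are 1 at 1, so the derivative of the product is the sum of the derivatives. *)
Lemma is_derive_prod_at1 (r : seq nat) (P : pred nat) (F : nat -> R -> R) (D : nat -> R) :
  (forall q, q \in r -> P q -> is_derive (1 : R) (1 : R) (F q) (D q) /\ F q 1 = 1) ->
  is_derive (1 : R) (1 : R) (fun z => \prod_(q <- r | P q) F q z) (\sum_(q <- r | P q) D q).
Proof.
elim: r => [_|q r IH H].
  rewrite big_nil; have -> : (fun z => \prod_(q <- [::] | P q) F q z) = cst 1 by apply/funext => z; rewrite big_nil.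
  exact: is_derive_cst.
have {}IH := IH (fun p hp => H p (mem_behead (s := q :: r) hp)).
have V : \prod_(p <- r | P p) F p 1 = 1.
  rewrite big_seq_cond big1 // => p /andP[pr Pp].
  by have [] := H p (mem_behead (s := q :: r) pr) Pp.
rewrite big_cons; case: (boolP (P q)) => Pq; last first.
  by under eq_fun do rewrite big_cons (negbTE Pq).
under eq_fun do rewrite big_cons Pq.
have [h1 h2] := H q (mem_head _ _) Pq.
have := @is_deriveM _ _ _ _ _ _ _ _ h1 IH.
move=> h; apply: is_derive_eq h _.
by rewrite V h2 !scale1r addrC.
Qed.

Lemma is_derive_H_factor (q : nat) : prime q ->
  is_derive (1 : R) (1 : R) (fun z : R => (q%:R * (q%:R + z - 2)) / (q%:R ^+ 2 - q%:R + z - 1)) q%:R^-1.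
Proof.
move=> pq; have q2 : 2 <= q%:R :> R by rewrite ler_nat prime_gt1.
set u : R := q%:R in q2 *.
have c0 : u ^+ 2 - u + 1 - 1 != 0 :> R by rewrite gt_eqF //; nra.
have h1 : is_derive (1 : R) (1 : R) (fun z : R => u * (u + z - 2)) u.
  apply: is_derive_eq; rewrite ?scaler0 ?addr0 ?add0r ?subr0 ?scale1r; rewrite /GRing.scale /= ?mulr1 //.
have h2 : is_derive (1 : R) (1 : R) (fun z : R => u ^+ 2 - u + z - 1) 1.
  apply: is_derive_eq; rewrite ?oppr0 ?addr0 ?add0r ?subr0 //.
have h := @is_deriveM _ _ _ _ _ _ _ _ h1 (@is_deriveV R (fun z : R => u ^+ 2 - u + z - 1) _ _ _ c0 h2).
apply: is_derive_eq h _.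
rewrite /GRing.scale /=; field; rewrite ?gt_eqF //; try nra; lra.
Qed.

Lemma derive1_H_om h : derive1 (H_om (R := R) h) 1 = \sum_(q <- primes h | q != 2%N) q%:R^-1.
Proof.
rewrite derive1E; apply: derive_val; apply: is_derive_prod_at1 => q.
rewrite mem_primes => /and3P[pq _ _] _; split; first exact: is_derive_H_factor.
have q2 : 2 <= q%:R :> R by rewrite ler_nat prime_gt1.
by field; rewrite gt_eqF //; nra.
Qed.

Lemma derive1_two_z : derive1 (fun z : R => 2 * z / (z + 1)) 1 = 2^-1.
Proof.
rewrite derive1E; apply: derive_val.
have c0 : (1 : R) + 1 != 0 by rewrite gt_eqF //; lra.
have h1 : is_derive (1 : R) (1 : R) (fun z : R => 2 * z) 2.
  by apply: is_derive_eq; rewrite ?scaler0 ?addr0 ?add0r /GRing.scale /= ?mulr1.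
have h2 : is_derive (1 : R) (1 : R) (fun z : R => z + 1) 1.
  by apply: is_derive_eq; rewrite addr0.
have h := @is_deriveM _ _ _ _ _ _ _ _ h1 (@is_deriveV R (fun z : R => z + 1) _ _ _ c0 h2).
apply: is_derive_eq h _.
by rewrite /GRing.scale /=; field.
Qed.

(** Each factor vanishes at 1, so two of them already make a double zero. *)
Lemma is_derive_prod_zeros (r : seq nat) (P : pred nat) (G : nat -> R -> R) :
  (forall q, q \in r -> P q -> (exists D, is_derive (1 : R) (1 : R) (G q) D) /\ G q 1 = 0) ->
  exists2 D, is_derive (1 : R) (1 : R) (fun z => \prod_(q <- r | P q) G q z) D &
    ((0 < count P r)%N -> \prod_(q <- r | P q) G q 1 = 0) /\ ((1 < count P r)%N -> D = 0).
Proof.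
elim: r => [_|q r IH H].
  exists 0; last by [].
  have -> : (fun z => \prod_(q <- [::] | P q) G q z) = cst 1 by apply/funext => z; rewrite big_nil.
  exact: is_derive_cst.
have [D hD [v0 D0]] := IH (fun p hp => H p (mem_behead (s := q :: r) hp)).
rewrite /= big_cons; case: (boolP (P q)) => Pq; last first.
  by exists D => //; under eq_fun do rewrite big_cons (negbTE Pq).
have [[E hE] q0] := H q (mem_head _ _) Pq.
have h := @is_deriveM _ _ _ _ _ _ _ _ hE hD.
eexists; first by under eq_fun do rewrite big_cons Pq; exact: h.
rewrite q0 mul0r; split => // c; rewrite scale0r add0r v0 ?scale0r //.
Qed.

Lemma is_derive_zero_quotient (g : R -> R) (E : R) : is_derive (1 : R) (1 : R) g E -> g 1 != 0 ->
  exists D, is_derive (1 : R) (1 : R) (fun z => (z - 1) / g z) D.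
Proof.
move=> hg g0.
have h1 : is_derive (1 : R) (1 : R) (fun z : R => z - 1) 1.
  by apply: is_derive_eq; rewrite oppr0 addr0.
have h := @is_deriveM _ _ _ _ _ _ _ _ h1 (@is_deriveV R g _ _ _ g0 hg).
by eexists; exact: h.
Qed.

(* For odd [h] the primes 2 and some [r] dividing [b0] contribute two factors of [f_om] that
   vanish at 1. *)
Lemma is_derive_f_om h (b0 : int) : odd h -> odd `|b0|%N -> (1 < `|b0|)%N ->
  is_derive (1 : R) (1 : R) (f_om h b0) 0.
Proof.
move=> oh ob b1; set b := `|b0|%N in ob b1 *.
have ge2 q : prime q -> 2 <= q%:R :> R by move=> pq; rewrite ler_nat prime_gt1.
have [|D hD [DA D0]] := @is_derive_prod_zeros (primes (2 * b)) (fun q => ~~ (q %| h)%N)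
    (fun q z => (z - 1) / (q%:R ^+ 2 - q%:R + z - 1)).
  move=> q; rewrite mem_primes => /and3P[/ge2 q2 _ _] _; rewrite subrr mul0r; split => //.
  apply: (is_derive_zero_quotient (g := fun z : R => q%:R ^+ 2 - q%:R + z - 1) (E := 1)).
    by apply: is_derive_eq; rewrite ?oppr0 ?addr0 ?add0r ?subr0.
  by rewrite gt_eqF //; nra.
have [|E hE [EB _]] := @is_derive_prod_zeros (primes (gcdn b h)) predT
    (fun q z => (z - 1) / (q%:R + z - 2)).
  move=> q; rewrite mem_primes => /and3P[/ge2 q2 _ _] _; rewrite subrr mul0r; split => //.
  apply: (is_derive_zero_quotient (g := fun z : R => q%:R + z - 2) (E := 1)).
    by apply: is_derive_eq; rewrite ?oppr0 ?addr0 ?add0r ?subr0.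
  by rewrite gt_eqF //; lra.
have h2 : ~~ (2 %| h)%N by rewrite dvdn2 negbK.
have bp : (0 < b)%N by apply: leq_trans b1.
have m2 : 2%N \in primes (2 * b) by rewrite mem_primes dvdn_mulr // muln_gt0 bp.
have mA : (0 < count (fun q => ~~ (q %| h)%N) (primes (2 * b)))%N.
  by rewrite -has_count; apply/hasP; exists 2%N.
apply: is_derive_eq (@is_deriveM _ _ _ _ _ _ _ _ hD hE) _.
rewrite DA // scale0r add0r.
have pr := pdiv_prime b1; have dr := pdiv_dvd b; set r := pdiv b in pr dr.
have r2 : r != 2%N by apply: contraTneq dr => ->; rewrite dvdn2 ob.
have [rh|rh] := boolP (r %| h)%N.
  rewrite EB ?scale0r // -has_count; apply/hasP; exists r => //.
  by rewrite mem_primes pr gcdn_gt0 bp /= dvdn_gcd dr.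
rewrite D0 ?scaler0 // -size_filter.
apply: (uniq_leq_size (s1 := [:: 2%N; r])); first by rewrite /= inE eq_sym r2.
move=> q; rewrite !inE mem_filter => /orP[] /eqP ->; first by rewrite h2 m2.
by rewrite rh mem_primes pr muln_gt0 bp /= dvdn_mull.
Qed.

Lemma derive1_F_om_even (a : rat) h b0 : ~~ odd h ->
  derive1 (F_om (R := R) a h b0) 1 = (0 < a)%R%:R / 2.
Proof.
move=> /negbTE oh; case: (boolP (0 < a)) => ha.
  have -> : F_om (R := R) a h b0 = (fun z : R => 2 * z / (z + 1)) by apply/funext => z; rewrite /F_om oh ha.
  by rewrite derive1_two_z mul1r.
have -> : F_om (R := R) a h b0 = cst 1 by apply/funext => z; rewrite /F_om oh (negbTE ha).
by rewrite derive1_cst mul0r.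
Qed.

(** In the branch with [f_om] the congruence modulo 4 makes [b0] odd, and with [b0 != 1] and
    [0 < b0] this gives the prime divisor that [is_derive_f_om] uses. *)
Lemma derive1_F_om_odd (a : rat) h (b0 : int) : odd h -> b0 != 1 -> 0 < b0 ->
  derive1 (F_om (R := R) a h b0) 1 = 0.
Proof.
move=> oh b1 bp; set C := (((if (a < 0)%R then - b0 else b0) %% 4)%Z == 1).
case: (boolP C) => hC; last first.
  have -> : F_om (R := R) a h b0 = cst 1 by apply/funext => z; rewrite /F_om oh -/C (negbTE hC).
  by rewrite derive1_cst.
have -> : F_om (R := R) a h b0 = cst 1 + f_om h b0 by apply/funext => z; rewrite /F_om oh -/C hC.
have ob : odd `|b0|%N.
  move: hC; rewrite /C; case: ifP => _ /eqP; lia.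
have b2 : (1 < `|b0|)%N by lia.
have hf := is_derive_f_om oh ob b2.
by rewrite derive1E; apply: derive_val; apply: is_derive_eq; rewrite addr0.
Qed.

End DerivativesAtOne.

(** * Assembly of the lower bound *)

Section Assembly.
Variable R : realType.
Implicit Types (h n : nat).

Lemma sumR_primes_le (F G : nat -> R) (c : R) (p0 : nat) n : (p0 < n)%N ->
  prime p0 -> (forall q, prime q -> F q + (q == p0)%:R * c <= G q) ->
  \sum_(q <- [seq q <- iota 0 n | prime q]) F q + c <= \sum_(q <- [seq q <- iota 0 n | prime q]) G q.
Proof.
move=> hn pp H; set S := [seq q <- iota 0 n | prime q].
have -> : c = \sum_(q <- S) (q == p0)%:R * c.
  rewrite (bigD1_seq p0) ?filter_uniq ?iota_uniq //= ?mem_filter ?pp ?mem_iota //.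
  by rewrite eqxx mul1r big1 ?addr0 // => q /negbTE ->; rewrite mul0r.
rewrite -big_split /=; rewrite !big_seq; apply: ler_sum => q; rewrite mem_filter => /andP[pq _].
exact: H.
Qed.

Lemma sum_primes_factors h n : (0 < h)%N -> (h < n)%N ->
  \sum_(q <- primes h | q != 2%N) q%:R^-1
  = \sum_(q <- [seq q <- iota 0 n | prime q]) ((q \in primes h) && (q != 2%N))%:R * q%:R^-1 :> R.
Proof.
move=> h0 hn; set S := [seq q <- iota 0 n | prime q].
transitivity (\sum_(q <- S | (q \in primes h) && (q != 2%N)) q%:R^-1 : R); last first.
  rewrite big_mkcond /=; apply: eq_bigr => q _.
  by case: (_ && _); rewrite ?mul1r ?mul0r.
rewrite -[LHS]big_filter -[RHS]big_filter; apply: perm_big; apply: uniq_perm.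
- by rewrite filter_uniq ?primes_uniq.
- by rewrite !filter_uniq ?iota_uniq.
move=> q; rewrite !mem_filter mem_iota /=; case: (boolP (q \in primes h)); rewrite ?andbF //= => hq.
move: hq; rewrite mem_primes => /and3P[-> _ dv]; rewrite andbT /=.
by rewrite (leq_ltn_trans (dvdn_leq h0 dv) hn) andbT.
Qed.

(** Partial sums increase, so a bound for large [n] bounds them all and yields convergence of the
    series together with the estimate. *)
Lemma sum_primes_recip_le (L : R) (n0 : nat) :
  (forall n, (n0 <= n)%N -> \sum_(q <- [seq q <- iota 0 n | prime q]) (q * q.-1)%:R^-1 <= L) ->
  sum_primes_recip R <= L.
Proof.
move=> H; have E n : \sum_(q <- [seq q <- iota 0 n | prime q]) (q * q.-1)%:R^-1
    = \sum_(0 <= q < n) (if prime q then ((q * q.-1)%:R : R)^-1 else 0).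
  by rewrite big_filter big_mkcond /= /index_iota subn0.
rewrite /sum_primes_recip; set u := fun n => \sum_(0 <= q < n) _.
have u1 : {homo u : n m / (n <= m)%N >-> n <= m}.
  apply: homo_leq => [x //|x y z|n]; first exact: le_trans.
  by rewrite /u big_nat_recr //= lerDl; case: ifP.
apply: limr_le.
  apply: nondecreasing_is_cvgn => //; exists L => _ [n _ <-].
  apply: le_trans (u1 n (maxn n n0) (leq_maxl _ _)) _.
  by rewrite /u -E; apply: H; rewrite leq_maxr.
by exists n0 => // n /= hn; rewrite -[X in X <= _]/(u n) /u -E; exact: H.
Qed.

(** An odd exponent absorbs the sign of [a]. *)
Lemma odd_pow_pm (a a0 : rat) h q : a = a0 ^+ h \/ a = - a0 ^+ h -> odd q -> (q %| h)%N ->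
  exists b, a = b ^+ q.
Proof.
move=> ha oq /dvdnP[k hk]; rewrite hk exprM in ha; case: ha => ->; first by exists (a0 ^+ k).
by exists (- a0 ^+ k); rewrite exprNn -signr_odd oq expr1 mulN1r.
Qed.

Definition hit_density (a : rat) (q : nat) : R :=
  if `[< exists b : rat, a = b ^+ q >] then q.-1%:R^-1 else (q * q.-1)%:R^-1.

Lemma density_hit_density a q : a != 0 -> prime q ->
  density_ge (fun p => (hit a q p)%:R : R) (hit_density a q).
Proof.
move=> a0 pq; rewrite /hit_density; case: asboolP => [[b hb]|nb].
  exact: density_hit_power hb.
by apply: density_hit => // b; apply/eqP => hb; apply: nb; exists b.
Qed.

Lemma recip_pred q : prime q -> (q.-1%:R^-1 : R) = (q * q.-1)%:R^-1 + q%:R^-1.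
Proof.
case: q => [//|[//|q]] _; rewrite natrM /= -[q.+2]addn1 natrD.
have : 0 < q.+1%:R :> R by [].
by set u := q.+1%:R => u0; field; rewrite !gt_eqF //; lra.
Qed.

Lemma hit_density_ge a q (e : bool) : prime q -> (e -> exists b : rat, a = b ^+ q) ->
  (q * q.-1)%:R^-1 + e%:R * q%:R^-1 <= hit_density a q.
Proof.
move=> pq he; rewrite /hit_density; case: asboolP => [_|nb].
  by rewrite recip_pred // lerD2l; case: e {he}; rewrite ?mul1r // mul0r.
by case: e he => he; [case: nb; exact: he|rewrite mul0r addr0].
Qed.

(** [b0 = 1] would make [a0] the square of [c0], against [not_perfect_power]; so for odd [h] the
    derivative is zero. *)
Lemma derive1_F_om_bound (a a0 c0 : rat) h b0 : 0 < a0 -> not_perfect_power a0 -> a0 = b0%:~R * c0 ^+ 2 ->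
  derive1 (F_om (R := R) a h b0) 1 = (~~ odd h && (0 < a))%:R * 2^-1.
Proof.
move=> ha0 np hbc; case: (boolP (odd h)) => oh; last by rewrite derive1_F_om_even.
rewrite derive1_F_om_odd ?mul0r //.
  apply/eqP => b1; move: hbc; rewrite b1 mul1r => hbc.
  by have := np c0 2%N isT; rewrite hbc eqxx.
have c2 : 0 <= c0 ^+ 2 by exact: sqr_ge0.
rewrite ltNge; apply/negP => b0n.
have : b0%:~R <= 0 :> rat by rewrite lerz0.
by move=> h1; move: ha0; rewrite hbc ltNge mulr_le0_ge0.
Qed.

End Assembly.

Theorem theorem8p2 (R : realType) (a : rat)
  (ha : a \notin [:: -1; 0; 1])
  (h : nat) (a0 : rat) (b0 : int) (c0 : rat)
  (hh : (0 < h)%N) (ha0 : 0 < a0) (ha0np : not_perfect_power a0)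
  (hdec : a = a0 ^+ h \/ a = - a0 ^+ h)
  (hb0 : squarefree_int b0) (hbc : a0 = b0%:~R * c0 ^+ 2) :
  ((derive1 (F_om (R:=R) a h b0) 1 + derive1 (H_om (R:=R) h) 1
    + sum_primes_recip R)%:E
   <= limf_einf (fun x : R => (mean_Dom a x)%:E) +oo%R)%E.
Proof.
have an0 : a != 0 by apply: contraNneq ha => ->; rewrite !inE eqxx orbT.
have dge0 q : 0 <= hit_density R a q by rewrite /hit_density; case: asboolP.
pose S n := [seq q <- iota 0 n | prime q].
(* Marks the primes at which the excess [1/q] is counted; [he] shows that [a] is a [q]-th power
   there. *)
pose e q := ((q \in primes h) && (q != 2%N)) || ((q == 2%N) && (~~ odd h && (0 < a))).
have he q : prime q -> e q -> exists b : rat, a = b ^+ q.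
  move=> pq /orP[/andP[]|/and3P[/eqP -> oh ap]].
    rewrite mem_primes => /and3P[_ _ dv] q2; apply: odd_pow_pm hdec _ dv.
    by case: (even_prime pq) => // q2'; rewrite q2' in q2.
  have /dvdnP[k hk] : (2 %| h)%N by rewrite dvdn2.
  exists (a0 ^+ k); rewrite -exprM -hk; case: hdec => // ea.
  by move: ap; rewrite ea oppr_gt0 ltNge exprn_ge0 // ltW.
rewrite (derive1_F_om_bound R a h ha0 ha0np hbc) derive1_H_om.
set c := _ * 2^-1; set H := \sum_(_ <- _ | _) _.
(* [H] collects the excess over the odd marked primes, and [c] is the excess at 2, added by
   [sumR_primes_le] as a single extra term. *)
have key n : (maxn h 2 < n)%N ->
    c + H + \sum_(q <- S n) (q * q.-1)%:R^-1 <= \sum_(q <- S n) hit_density R a q.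
  rewrite gtn_max => /andP[hn n2]; rewrite /H (sum_primes_factors R hh hn) -addrA addrC -big_split /=.
  apply: sumR_primes_le n2 _ _ => // q pq.
  apply: le_trans (hit_density_ge R pq (he q pq)); rewrite addrAC addrC lerD2l /e /c mulrA -natrM.
  case: (eqVneq q 2%N) => [->|q2]; last by rewrite mul0n !andbT orbF mul0r addr0.
  by rewrite !andbF orFb andTb mul0r add0r mul1n.
have low n : (maxn h 2 < n)%N ->
    ((c + H + \sum_(q <- S n) (q * q.-1)%:R^-1)%:E <= limf_einf (fun x : R => (mean_Dom a x)%:E) +oo%R)%E.
  move=> hn; apply: (le_trans (y := (\sum_(q <- S n) hit_density R a q)%:E)); first by rewrite lee_fin key.
  apply: liminf_mean_Dom => //.
  - by rewrite filter_uniq ?iota_uniq.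
  - exact: filter_all.
  - by move=> q pq; apply: density_hit_density.
(* For a finite limit inferior the partial sums are bounded by it and pass to the series; the value
   minus infinity is excluded by [low] itself. *)
move: low; case: (limf_einf _ _) => [l| |] low; last 2 first.
- exact: leey.
- by have := low _ (ltnSn _); rewrite leeNy_eq.
rewrite lee_fin -lerBrDl; apply: (sum_primes_recip_le (n0 := (maxn h 2).+1)) => n hn.
by rewrite lerBrDl -lee_fin; apply: low.
Qed.
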